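(* Let $d\in\mathbb{N}$. There is a constant $N=N(d)$, depending only on $d$, such that for all $\delta\in(0,1/2)$, all $(1,\delta)$-equidistributed sequences, all measurable and bounded $V:\mathbb{R}^d\to\mathbb{R}$, all $L\in\mathbb{N}$, all $b\ge 0$ and all $\phi\in\mathrm{Ran}(\chi_{(-\infty,b]}(H_L))$ we have $$\lVert\phi\rVert_{L^2(W_\delta(L))}^2\ \ge\ C_{\mathrm{sfuc}}\,\lVert\phi\rVert_{L^2(\Lambda_L)}^2,\qquad\text{where}\quad C_{\mathrm{sfuc}}=C_{\mathrm{sfuc}}(d,\delta,b,\lVert V\rVert_\infty):=\delta^{N\bigl(1+\lVert V\rVert_\infty^{2/3}+\sqrt{b}\bigr)}.$$
   Context: For $L>0$, $\Lambda_L=(-L/2,L/2)^d\subset\mathbb{R}^d$, and $\Delta_L$ is the Laplace operator on $L^2(\Lambda_L)$ with Dirichlet, Neumann or periodic boundary conditions (the result holds for each of these three choices). For measurable bounded $V:\mathbb{R}^d\to\mathbb{R}$, $V_L$ is the restriction of $V$ to $\Lambda_L$ and $H_L=-\Delta_L+V_L$ on $L^2(\Lambda_L)$, a self-adjoint operator with purely discrete spectrum; $\chi_{(-\infty,b]}(H_L)$ is its spectral projector. $B(x,r)$ is the Euclidean ball with center $x$ and radius $r$. For $G,\delta>0$, a sequence $z_j\in\mathbb{R}^d$, $j\in(G\mathbb{Z})^d$, is called $(G,\delta)$-equidistributed if $B(z_j,\delta)\subset\Lambda_G+j$ for all $j\in(G\mathbb{Z})^d$. Corresponding to such a sequence, for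 $L\in G\mathbb{N}$, $W_\delta(L)=\bigcup_{j\in(G\mathbb{Z})^d}B(z_j,\delta)\cap\Lambda_L$. In the claim $G=1$. *)

(* Defs.v *)
From HB Require Import structures.
From mathcomp Require Import all_boot all_order all_algebra.
From mathcomp Require Import all_classical all_reals all_analysis.
From mathcomp Require Import complex.

Set Implicit Arguments.
Unset Strict Implicit.
Unset Printing Implicit Defensive.
Import Order.TTheory GRing.Theory Num.Theory.
Import numFieldNormedType.Exports.

Local Open Scope classical_set_scope.
Local Open Scope ring_scope.

(* R^n carries the product sigma-algebra of n copies of the Borel sigma-algebra
   of R; it coincides with the Borel sigma-algebra of R^n. *)
Definition rV_coord {R : realType} {n : nat} (i : 'I_n) (x : 'rV[R]_n) :
  measurableTypeR R := x 0 i.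

Section measurable_rV.
Context {R : realType} {n : nat}.

Let rV_set0 : g_sigma_preimage (@rV_coord R n) set0.
Proof. exact: sigma_algebra0. Qed.

Let rV_setC A : g_sigma_preimage (@rV_coord R n) A ->
  g_sigma_preimage (@rV_coord R n) (~` A).
Proof. exact: sigma_algebraC. Qed.

Let rV_bigcup (F : _^nat) : (forall i, g_sigma_preimage (@rV_coord R n) (F i)) ->
  g_sigma_preimage (@rV_coord R n) (\bigcup_i (F i)).
Proof. exact: sigma_algebra_bigcup. Qed.

HB.instance Definition _ := @isMeasurable.Build default_measure_display
  'rV[R]_n (g_sigma_preimage (@rV_coord R n)) rV_set0 rV_setC rV_bigcup.

End measurable_rV.

Lemma measurable_fun_rVP {R : realType} {n : nat} d (T : measurableType d)
    (f : T -> 'rV[R]_n) :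
  (forall i, measurable_fun [set: T] (@rV_coord R n i \o f)) ->
  measurable_fun [set: T] f.
Proof.
move=> mf _ A mA; rewrite setTI.
suff : <<s \big[setU/set0]_(i < n)
    preimage_set_system [set: 'rV[R]_n] (rV_coord i) measurable >> `<=`
  [set B | measurable (f @^-1` B)] by apply.
apply: smallest_sub.
  split => /=.
  - by rewrite preimage_set0; exact: measurable0.
  - by move=> B mB; rewrite setTD preimage_setC; exact: measurableC.
  - by move=> F mF; rewrite preimage_bigcup; exact: bigcupT_measurable.
rewrite -bigcup_seq; apply: bigcup_sub => i _ B [C mC <-] /=.
by rewrite setTI -comp_preimage -[X in measurable X]setTI; exact: mf.
Qed.

Definition rV_cons {R : realType} {n : nat} (p : measurableTypeR R * 'rV[R]_n) :
  'rV[R]_n.+1 := row_mx (p.1%:M : 'rV[R]_1) p.2.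

Lemma measurable_coord {R : realType} {n : nat} (i : 'I_n) :
  measurable_fun [set: 'rV[R]_n] (@rV_coord R n i).
Proof.
move=> _ Y mY; apply: sub_sigma_algebra.
rewrite -bigcup_seq; exists i; first by rewrite /= mem_index_enum.
by exists Y.
Qed.

Lemma measurable_rV_cons {R : realType} {n : nat} :
  measurable_fun [set: measurableTypeR R * 'rV[R]_n] (@rV_cons R n).
Proof.
apply: measurable_fun_rVP => i.
case: (split_ordP (i : 'I_(1 + n))) => j ->.
  rewrite (_ : _ \o _ = fst); first exact: measurable_fst.
  apply/funext => p; apply: etrans (row_mxEl _ _ _ _) _.
  by rewrite (ord1 j) mxE eqxx mulr1n.
rewrite (_ : _ \o _ = rV_coord j \o snd).
  exact: (measurableT_comp (measurable_coord j) measurable_snd).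
by apply/funext => p; exact: row_mxEr.
Qed.

Section lebesgue_cons.
Context {R : realType} {n : nat}.
Variable m : {sigma_finite_measure set 'rV[R]_n -> \bar R}.

Let prod : {measure set (measurableTypeR R * 'rV[R]_n)%type -> \bar R} :=
  (@lebesgue_measure R \x m)%E.

Definition lebesgue_cons : set 'rV[R]_n.+1 -> \bar R :=
  pushforward prod rV_cons.

Let lebesgue_cons0 : lebesgue_cons set0 = 0%E.
Proof. by rewrite /lebesgue_cons /pushforward preimage_set0 measure0. Qed.

Let lebesgue_cons_ge0 A : (0 <= lebesgue_cons A)%E.
Proof. exact: (measure_ge0 prod). Qed.

Let lebesgue_cons_sigma_additive : semi_sigma_additive lebesgue_cons.
Proof.
move=> F mF tF mUF; rewrite /lebesgue_cons /pushforward preimage_bigcup.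
apply: measure_semi_sigma_additive.
- by move=> k; rewrite -[X in measurable X]setTI; exact: measurable_rV_cons.
- apply/trivIsetP => /= i j _ _ ij; rewrite -preimage_setI.
  by move/trivIsetP : tF => /(_ _ _ _ _ ij) ->//; rewrite preimage_set0.
- rewrite -preimage_bigcup -[X in measurable X]setTI.
  exact: measurable_rV_cons.
Qed.

HB.instance Definition _ := isMeasure.Build _ _ _ lebesgue_cons
  lebesgue_cons0 lebesgue_cons_ge0 lebesgue_cons_sigma_additive.

Let lebesgue_cons_sigma_finite : sigma_finite setT lebesgue_cons.
Proof.
have /sigma_finiteP[F [FT ndF Foo]] := sigma_finiteT (@lebesgue_measure R).
have /sigma_finiteP[G [GT ndG Goo]] := sigma_finiteT m.
pose tl (x : 'rV[R]_n.+1) : 'rV[R]_n := \row_j x 0 (rshift 1 j).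
pose uncons (x : 'rV[R]_n.+1) : measurableTypeR R * 'rV[R]_n :=
  (rV_coord ord0 x, tl x).
have unconsK p : uncons (rV_cons p) = p.
  case: p => t x; congr pair; last first.
    by apply/rowP => j; rewrite mxE; exact: row_mxEr.
  rewrite /rV_coord (_ : ord0 = lshift n (ord0 : 'I_1)); last exact/val_inj.
  by apply: etrans (row_mxEl _ _ _ _) _; rewrite mxE eqxx mulr1n.
have muncons : measurable_fun setT uncons.
  apply/measurable_fun_pairP; split; first exact: measurable_coord.
  apply: measurable_fun_rVP => i.
  rewrite (_ : _ \o _ = rV_coord (rshift 1 i)); first exact: measurable_coord.
  by apply/funext => x; rewrite /rV_coord /= mxE.
have FGT : \bigcup_k (F k `*` G k) = setT.
  rewrite -setXTT FT GT predeqE => -[x y]; split.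
    by move=> [k _ []/= ? ?]; split; exists k.
  move=> [/= [k _ Fkx] [l _ Gly]]; exists (maxn k l) => //; split.
  - by move: x Fkx; exact/subsetPset/ndF/leq_maxl.
  - by move: y Gly; exact/subsetPset/ndG/leq_maxr.
exists (fun k => uncons @^-1` (F k `*` G k)).
  by rewrite -preimage_bigcup FGT preimage_setT.
move=> k; have [mF Fk] := Foo k; have [mG Gk] := Goo k; split.
  by rewrite -[X in measurable X]setTI; apply: muncons => //; exact: measurableX.
rewrite /lebesgue_cons /pushforward -comp_preimage.
rewrite (_ : uncons \o rV_cons = id); last exact/funext.
rewrite preimage_id (_ : prod _ = lebesgue_measure (F k) * m (G k))%E.
  by rewrite lte_mul_pinfty// ge0_fin_numE.
exact: product_measure1E.
Qed.

HB.instance Definition _ := Measure_isSigmaFinite.Build _ _ _ lebesgue_cons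
  lebesgue_cons_sigma_finite.

End lebesgue_cons.

(* Lebesgue measure on R^n, as an iterated product measure. *)
Fixpoint lebesgue_rV (R : realType) (n : nat) :
    {sigma_finite_measure set 'rV[R]_n -> \bar R} :=
  if n is n'.+1 then lebesgue_cons (lebesgue_rV R n') else \d_(0 : 'rV[R]_0).

Lemma lebesgue_rV_box (R : realType) (n : nat) (a b : 'I_n -> R) :
  (forall i, a i <= b i) ->
  lebesgue_rV R n [set x | forall i, a i < x 0 i < b i] =
  (\prod_(i < n) (b i - a i))%:E.
Proof.
elim: n a b => [|n IH] a b ab.
  rewrite big_ord0 /= diracE mem_set//=.
  by case.
pose B := [set x : 'rV[R]_n |
  forall i, a (lift ord0 i) < x 0 i < b (lift ord0 i)].
have mB : measurable B.
  rewrite (_ : B = \bigcap_(i in [set: 'I_n])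
      (rV_coord i @^-1` `]a (lift ord0 i), b (lift ord0 i)[)).
    apply: fin_bigcap_measurable => // i _.
    by rewrite -[X in measurable X]setTI; exact: measurable_coord.
  apply/seteqP; split => x /= Bx i; first by rewrite /= in_itv/= => _; exact: Bx.
  by have := Bx i Logic.I; rewrite /= in_itv.
rewrite big_ord_recl EFinM -IH//=.
transitivity ((@lebesgue_measure R \x lebesgue_rV R n)%E
    (`]a ord0, b ord0[%classic `*` B)).
  rewrite /lebesgue_cons /pushforward /=; congr (product_measure1 _ _ _).
  have hd (p : measurableTypeR R * 'rV[R]_n) : rV_cons p 0 ord0 = p.1 :> R.
    transitivity (rV_cons p 0 (lshift n (ord0 : 'I_1))).
      by congr (rV_cons p _ _); exact: val_inj.
    by apply: etrans (row_mxEl _ _ _ _) _; rewrite mxE eqxx mulr1n.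
  have tl (p : measurableTypeR R * 'rV[R]_n) k : rV_cons p 0 (lift ord0 k) = p.2 0 k :> R.
    transitivity (rV_cons p 0 (rshift 1 k)).
      by congr (rV_cons p _ _); exact: val_inj.
    exact: row_mxEr.
  apply/seteqP; split => -[t x] /=.
    move=> H; split; first by have := H ord0; rewrite hd in_itv.
    by move=> i; have := H (lift ord0 i); rewrite tl.
  move=> [+ Bx] i; rewrite in_itv/= => Ht.
  by case: (unliftP ord0 i) => [k|] ->; rewrite ?tl ?hd//; exact: Bx.
rewrite product_measure1E//; congr (_ * _)%E.
apply: etrans (@lebesgue_measure_itv R `]a ord0, b ord0[) _ => /=.
by rewrite lte_fin; case: ltgtP (ab ord0) => // -> _; rewrite subrr.
Qed.

(* Complex-valued functions on a measurable set D of R^d. Elements of L^2(D)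
   are represented by functions on R^d, considered up to almost everywhere
   equality on D. *)
Section L2.
Context {R : realType} {d : nat}.
Local Notation mu := (lebesgue_rV R d).
Implicit Types (D : set 'rV[R]_d) (u v : 'rV[R]_d -> R[i]).

Definition normL2sq D u : \bar R :=
  (\int[mu]_(x in D) (complex.Re (u x) ^+ 2 + complex.Im (u x) ^+ 2)%:E)%E.

Definition L2 D u :=
  [/\ measurable_fun D (fun x => complex.Re (u x)),
      measurable_fun D (fun x => complex.Im (u x)) &
      (normL2sq D u < +oo)%E].

Definition cintegral D u : R[i] :=
  Complex (\int[mu]_(x in D) complex.Re (u x))
          (\int[mu]_(x in D) complex.Im (u x)).

Definition inner D u v : R[i] := cintegral D (fun x => u x * conjc (v x)).

Definition eqL2 D u v := u = v %[ae mu in D].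

End L2.

Section smooth_functions.
Context {R : realType} {d : nat}.

Definition unit_vec (i : 'I_d) : 'rV[R]_d := delta_mx 0 i.

Fixpoint Ck (k : nat) (f : 'rV[R]_d -> R) : Prop :=
  if k is k'.+1 then
    forall i, (forall x, derivable f x (unit_vec i)) /\
              Ck k' (fun x => 'D_(unit_vec i) f x)
  else continuous f.

Definition smooth (f : 'rV[R]_d -> R[i]) := forall k,
  Ck k (fun x => complex.Re (f x)) /\ Ck k (fun x => complex.Im (f x)).

Definition partial (i : 'I_d) (f : 'rV[R]_d -> R[i]) (x : 'rV[R]_d) : R[i] :=
  Complex ('D_(unit_vec i) (fun y => complex.Re (f y)) x)
          ('D_(unit_vec i) (fun y => complex.Im (f y)) x).

Definition support_closure (f : 'rV[R]_d -> R[i]) :=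
  closure [set x | f x != 0].

Definition test_function (D : set 'rV[R]_d) (f : 'rV[R]_d -> R[i]) :=
  [/\ smooth f, compact (support_closure f) & support_closure f `<=` D].

Definition smooth_periodic (L : R) (f : 'rV[R]_d -> R[i]) :=
  smooth f /\ forall i x, f (x + L *: unit_vec i) = f x.

End smooth_functions.

Section geometry.
Context {R : realType} {d : nat}.

Definition euclid_ball (c : 'rV[R]_d) (r : R) : set 'rV[R]_d :=
  [set x | Num.sqrt (\sum_(i < d) (x 0 i - c 0 i) ^+ 2) < r].

Definition cube (L : R) : set 'rV[R]_d :=
  [set x | forall i, - (L / 2) < x 0 i < L / 2].

(* The point j of the lattice (G Z)^d is written G k with k in Z^d, and a
   sequence indexed by (G Z)^d is indexed by k. *)
Definition lattice_point (G : R) (k : 'rV[int]_d) : 'rV[R]_d :=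
  \row_i (G * (k 0 i)%:~R).

Definition equidistributed (G delta : R) (z : 'rV[int]_d -> 'rV[R]_d) :=
  forall k, euclid_ball (z k) delta `<=`
    [set x | cube G (x - lattice_point G k)].

Definition equi_set (delta : R) (z : 'rV[int]_d -> 'rV[R]_d) (L : R) :
    set 'rV[R]_d :=
  (\bigcup_k euclid_ball (z k) delta) `&` cube L.

End geometry.

Section sobolev.
Context {R : realType} {d : nat}.
Implicit Types (D : set 'rV[R]_d) (u f : 'rV[R]_d -> R[i]).

Definition weak_partial D (i : 'I_d) u f :=
  forall theta, test_function D theta ->
  cintegral D (fun x => u x * partial i theta x) =
  - cintegral D (fun x => f x * theta x).

(* u is in H^1(D) and g is its weak gradient. *)
Definition H1 D u (g : 'I_d -> 'rV[R]_d -> R[i]) :=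
  L2 D u /\ forall i, L2 D (g i) /\ weak_partial D i u (g i).

(* For u in H^1(D) with weak gradient g: u is in the H^1(D)-closure of S. *)
Definition H1_closure D (S : set ('rV[R]_d -> R[i])) u
    (g : 'I_d -> 'rV[R]_d -> R[i]) :=
  forall e : R, 0 < e -> exists2 theta, S theta &
  (normL2sq D (fun x => u x - theta x)%R
   + \sum_(i < d) normL2sq D (fun x => g i x - partial i theta x)%R < e%:E)%E.

End sobolev.

Variant boundary_condition := Dirichlet | Neumann | Periodic.

Section schrodinger.
Context {R : realType} {d : nat}.
Local Notation mu := (lebesgue_rV R d).
Implicit Types (L : R) (u v w f : 'rV[R]_d -> R[i]) (V : 'rV[R]_d -> R).

(* The domain of the quadratic form of -Delta_L, namely H^1_0, H^1 or
   H^1_per of the cube, as a set of pairs (function, weak gradient). *)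
Definition form_domain (bc : boundary_condition) L u
    (g : 'I_d -> 'rV[R]_d -> R[i]) :=
  H1 (cube L) u g /\
  match bc with
  | Dirichlet => H1_closure (cube L) (test_function (cube L)) u g
  | Neumann => True
  | Periodic => H1_closure (cube L) (smooth_periodic L) u g
  end.

(* Unbounded operators on L^2 are given by their graphs. The graph of
   -Delta_L is that of the self-adjoint operator associated with the form
   (u, v) |-> \int grad u . conj (grad v). *)
Definition neg_laplacian (bc : boundary_condition) L u f :=
  L2 (cube L) f /\
  exists2 g, form_domain bc L u g &
  forall v h, form_domain bc L v h ->
    \sum_(i < d) inner (cube L) (g i) (h i) = inner (cube L) f v.

Definition schrodinger (bc : boundary_condition) L V u f :=
  L2 (cube L) f /\
  exists2 w, neg_laplacian bc L u w &
    eqL2 (cube L) f (fun x => w x + (V x)%:C%C * u x).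

End schrodinger.

Section spectral.
Context {R : realType} {d : nat}.
Implicit Types (D : set 'rV[R]_d) (u v f : 'rV[R]_d -> R[i]).
Implicit Types (A : ('rV[R]_d -> R[i]) -> ('rV[R]_d -> R[i]) -> Prop).

Definition orthogonal_projection D
    (P : ('rV[R]_d -> R[i]) -> ('rV[R]_d -> R[i])) :=
  [/\ forall u, L2 D u -> L2 D (P u),
      forall (c : R[i]) u v, L2 D u -> L2 D v ->
        eqL2 D (P (fun x => c * u x + v x)) (fun x => c * P u x + P v x),
      forall u, L2 D u -> eqL2 D (P (P u)) (P u) &
      forall u v, L2 D u -> L2 D v -> inner D (P u) v = inner D u (P v)].

(* E is the spectral measure of A: a projection-valued measure such that
   A = \int lambda dE(lambda), with domain the set of u for which
   \int lambda^2 d<E(lambda) u, u> is finite. The scalar measure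
   B |-> <E(B) u, u> = ||E(B) u||^2 is called m; that it is a measure for every
   u is the countable additivity of E, and the values of the forms <E(B) u, u>
   and <A u, u> determine E(B) and A by polarization. *)
Definition spectral_measure D A
    (E : set R -> ('rV[R]_d -> R[i]) -> ('rV[R]_d -> R[i])) :=
  [/\ forall B, measurable B -> orthogonal_projection D (E B),
      forall u, L2 D u -> eqL2 D (E setT u) u &
      forall u, L2 D u ->
        exists m : {measure set (measurableTypeR R) -> \bar R},
        [/\ forall B, measurable B -> m B = normL2sq D (E B u),
            (exists f, A u f) <-> (\int[m]_x (x ^+ 2)%:E < +oo)%E &
            forall f, A u f -> inner D f u = (\int[m]_x x)%:C%C]].

(* u belongs to the range of the spectral projector chi_B(A). *)
Definition ran_spectral_projector D A (B : set R) u :=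
  L2 D u /\ exists E, spectral_measure D A E /\
  exists2 v, L2 D v & eqL2 D u (E B v).

End spectral.

Section statement.
Context {R : realType} {d : nat}.
Local Notation mu := (lebesgue_rV R d).
Implicit Types V : 'rV[R]_d -> R.

(* The sigma-algebra on R^d is not completed: Lebesgue measurable functions are
   those equal almost everywhere to a Borel function. *)
Definition lebesgue_measurable V :=
  exists2 V', measurable_fun setT V' & V = V' %[ae mu].

Definition sup_norm V : R := fine ('N[mu]_+oo%E[EFin \o V])%E.

(* C_sfuc(d, delta, b, K), where N is N(d) and K stands for ||V||_oo. *)
Definition C_sfuc (N delta b K : R) : R :=
  delta `^ (N * (1 + K `^ (2 / 3) + Num.sqrt b)).

End statement.

(* Main.v *)
Require Import Defs.
From mathcomp Require Import all_boot all_order all_algebra.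
From mathcomp Require Import all_classical all_reals all_analysis.
From mathcomp Require Import complex ring lra zify measurable_realfun ess_sup_inf.

(* For [phi] in the spectral subspace and [K] large enough that [A + K] is
   nonnegative on it ([A] the Schrodinger operator), the ghost-dimension
   extension
     F (t, x) = sum_m t^(2m+1) / (2m+1)! * ((A + K)^m phi) x
   solves (d/dt)^2 F + Laplacian F = (V + K) F, vanishes at t = 0 and has normal
   derivative [phi] there.  A Carleman estimate with a weight that is a function
   of the distance to a pole is used twice in every unit cell: with the pole
   (- delta, z_j) it bounds F near (0, z_j) by its normal derivative on the ball
   B (z_j, delta), and with the pole (delta / 8, z_j) it transports this bound
   to the whole cell.  The functions are extended to all of space by reflection
   (Dirichlet, Neumann) or periodicity, so that summing over the cells needs no
   boundary terms; the error terms far from the cell are absorbed because the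
   Carleman parameter is taken proportional to 1 + |V|^(2/3) + sqrt b.
   The elements of the spectral subspace are only known to lie in the form
   domain, so the estimate is applied to truncations of [F] whose coefficients
   (A + K)^m phi are replaced by trigonometric sums satisfying the boundary
   conditions, approximating them in graph norm. *)

Set Implicit Arguments.
Unset Strict Implicit.
Unset Printing Implicit Defensive.
Import Order.TTheory GRing.Theory Num.Theory.
Import numFieldNormedType.Exports.
Local Open Scope classical_set_scope.
Local Open Scope ring_scope.

(** * Integration on boxes and the divergence formula *)

(** The exponents of the constant come from two balances. The Carleman gain is of order [al ^+ 3]
    and the potential costs the square of [2 * K], so absorption requires [al] of order [K^(2/3)].
    The extension grows at most like [expR (t * sqrt (b + K))] over the bounded height of the slabs
    and is damped by [expR (- al / 4)], whence [sqrt b]; the remaining [sqrt K] is dominated by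
    [1 + K^(2/3)]. The power of [delta] is the ratio of the weights at the scales [delta] and 1. Two
    poles are used because the two possible positions have opposite defects. From a pole below the
    hyperplane the inner cutoff region misses the half-space, but the boundary term has the bad sign
    and must be paid on the ball. From a pole above it the boundary term has the good sign, but [F]
    must be known near the pole. The shift by [K] makes every [(A + K)^m phi] pair nonnegatively
    with [phi], so the first term of the series bounds [F] from below for any truncation. The
    spectral measure is known only through its scalar measures, so invariance of the subspace under
    [A] and the norm bound for [A + K] are derived from additivity of mass and positivity of
    forms. *)

Section box.
Context {R : realType} {n : nat}.
Local Notation mu := (lebesgue_rV R n).
Implicit Types (a b : 'I_n -> R) (f : 'rV[R]_n -> R).

Definition obox a b : set 'rV[R]_n := [set x | forall i, a i < x 0 i < b i].

Lemma measurable_obox a b : measurable (obox a b).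
Proof.
rewrite (_ : obox a b = \bigcap_(i in [set: 'I_n])
    (rV_coord i @^-1` `]a i, b i[)).
  apply: fin_bigcap_measurable => // i _.
  by rewrite -[X in measurable X]setTI; exact: measurable_coord.
apply/seteqP; split => x /= Bx i; first by rewrite /= in_itv/= => _; exact: Bx.
by have := Bx i Logic.I; rewrite /= in_itv.
Qed.

(** The sigma-algebra is generated by the coordinates, so an open set is written as a countable
    union of boxes with rational centre and radius. *)
Lemma open_measurable_rV (U : set 'rV[R]_n) : open U -> measurable U.
Proof.
move=> oU.
pose B (p : 'rV[rat]_n * rat) : set 'rV[R]_n :=
  obox (fun i => ratr (p.1 0 i - p.2)) (fun i => ratr (p.1 0 i + p.2)).
pose I := [set p | B p `<=` U].
rewrite (_ : U = \bigcup_(p in I) B p).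
  rewrite bigcup_mkcond; apply: countable_bigcupT_measurable => [|p].
    exact: countableP.
  by case: ifPn => // _; exact: measurable_obox.
apply/seteqP; split => [x Ux|x [p Ip]]; last exact: Ip.
have /nbhs_ballP[e /= e0 xeU] : nbhs x U by exact: open_nbhs_nbhs.
have [r r0 re] : exists2 r : rat, 0 < r & ratr r < e / 2 :> R.
  have [r] := rat_in_itvoo (divr_gt0 e0 (ltr0n _ 2)).
  by rewrite in_itv/= => /andP[r0 re]; exists r => //; rewrite -(@ltr0q R).
have H i : exists q : rat, `|x 0 i - ratr q| < ratr r.
  have [q] : exists q : rat, ratr q \in `]x 0 i - ratr r, x 0 i + ratr r[.
    by apply: rat_in_itvoo; rewrite ltrD2l gt0_cp// ltr0q.
  by rewrite in_itv/= => qx; exists q; rewrite distrC ltr_distl.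
have [q qP] := choice H.
exists (\row_i q i, r); last first.
  move=> i; rewrite mxE rmorphB rmorphD/=.
  by have := qP i; rewrite ltr_distl.
move=> y By; apply: xeU; split => // i j; rewrite (ord1 i).
rewrite /ball/=.
have := By j; rewrite mxE rmorphB rmorphD/= -ltr_distl => yq.
rewrite (_ : x 0 j - y 0 j = (x 0 j - ratr (q j)) - (y 0 j - ratr (q j))); last by ring.
by rewrite (le_lt_trans (ler_normB _ _))// (lt_trans (ltrD (qP j) yq))//; lra.
Qed.

Lemma continuous_measurable_rV f : continuous f -> measurable_fun setT f.
Proof.
move=> /continuousP cf; apply: (measurability _ (measurable_realfun.RGenOpens.measurableE R)).
move=> _ [_ [a [b ->] <-]]; rewrite setTI.
by apply: open_measurable_rV; apply: cf; exact: interval_open.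
Qed.

Lemma lebesgue_obox_lty a b : (mu (obox a b) < +oo)%E.
Proof.
apply: (@le_lt_trans _ _ (mu (obox a (fun i => Num.max (a i) (b i))))).
  apply: le_measure; rewrite ?inE; try exact: measurable_obox.
  by move=> x H i; have /andP[-> /=] := H i; rewrite lt_max => ->; rewrite orbT.
rewrite lebesgue_rV_box ?ltry// => i; by rewrite le_max lexx.
Qed.

Lemma continuous_bounded_obox f a b : continuous f ->
  exists M, forall x, obox a b x -> `|f x| <= M.
Proof.
move=> cf.
have cK : compact [set x : 'rV[R]_n | forall i, x ord0 i \in `[a i, b i]].
  apply: (@rV_compact _ n (fun i => `[a i, b i]%classic)) => i.
  exact: segment_compact.
have := @compact_bounded _ _ _ (continuous_compact (continuous_subspaceT cf) cK).
move=> [M [_ HM]]; exists (M + 1) => x Bx; apply: (HM (M + 1)); first lra.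
exists x => // i; have /andP[? ?] := Bx i.
by rewrite in_itv/= !ltW.
Qed.

(* The real integral is only used on functions that are measurable and bounded
   on a set of finite measure. *)
Definition bmf (D : set 'rV[R]_n) f :=
  measurable_fun setT f /\ exists M, forall x, D x -> `|f x| <= M.

Lemma bmf_continuous f a b : continuous f -> bmf (obox a b) f.
Proof.
by move=> cf; split; [exact: continuous_measurable_rV|exact: continuous_bounded_obox].
Qed.

Lemma bmf_integrable D f : measurable D -> (mu D < +oo)%E -> bmf D f ->
  mu.-integrable D (EFin \o f).
Proof.
move=> mD Doo [mf [M fM]]; apply: measurable_bounded_integrable => //.
  exact: measurable_funTS.
exists M; split; first exact: num_real.
by move=> x Mx y Dy /=; rewrite (le_trans (fM _ Dy))// ltW.
Qed.

Lemma bmf_obox_integrable f a b : bmf (obox a b) f ->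
  mu.-integrable (obox a b) (EFin \o f).
Proof.
by apply: bmf_integrable; [exact: measurable_obox|exact: lebesgue_obox_lty].
Qed.

Lemma bmfD D f g : bmf D f -> bmf D g -> bmf D (fun x => f x + g x).
Proof.
move=> [mf [M fM]] [mg [N gN]]; split; first exact: measurable_funD.
exists (M + N) => x Dx; rewrite (le_trans (ler_normD _ _))// lerD//.
  exact: fM.
exact: gN.
Qed.

Lemma bmfM D f g : bmf D f -> bmf D g -> bmf D (fun x => f x * g x).
Proof.
move=> [mf [M fM]] [mg [N gN]]; split; first exact: measurable_funM.
by exists (M * N) => x Dx; rewrite normrM ler_pM//; [exact: fM|exact: gN].
Qed.

Lemma bmf_cst D (c : R) : bmf D (fun=> c).
Proof. by split; [exact: measurable_cst|exists `|c|]. Qed.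

Lemma bmfZ D (c : R) f : bmf D f -> bmf D (fun x => c * f x).
Proof. by apply: bmfM; exact: bmf_cst. Qed.

Lemma bmf_sum D I (s : seq I) (P : pred I) (f : I -> 'rV[R]_n -> R) :
  (forall i, bmf D (f i)) -> bmf D (fun x => \sum_(i <- s | P i) f i x).
Proof.
move=> bf; elim: s => [|i s IH].
  rewrite (_ : (fun x => _) = cst 0); first exact: bmf_cst.
  by apply/funext => x; rewrite big_nil.
case Pi : (P i).
  rewrite (_ : (fun x => _) = (fun x => f i x + \sum_(i <- s | P i) f i x)).
    exact: bmfD.
  by apply/funext => x; rewrite big_cons Pi.
rewrite (_ : (fun x => _) = (fun x => \sum_(i <- s | P i) f i x))//.
by apply/funext => x; rewrite big_cons Pi.
Qed.

Lemma bmf_indic D A : measurable A -> bmf D (\1_A : _ -> R).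
Proof.
move=> mA; split; first exact: measurable_indic.
by exists 1 => x _; rewrite indicE; case: (_ \in _); rewrite ?normr1 ?normr0.
Qed.

Variables (a b : 'I_n -> R).
Local Notation Q := (obox a b).

Let mQ : measurable Q. Proof. exact: measurable_obox. Qed.
Let iQ f : bmf Q f -> mu.-integrable Q (EFin \o f).
Proof. exact: bmf_obox_integrable. Qed.

Definition bint f : R := (\int[mu]_(x in Q) f x)%R.

Lemma bintD f g : bmf Q f -> bmf Q g ->
  bint (fun x => f x + g x) = bint f + bint g.
Proof. by move=> bf bg; apply: RintegralD => //; exact: iQ. Qed.

Lemma bintB f g : bmf Q f -> bmf Q g ->
  bint (fun x => f x - g x) = bint f - bint g.
Proof. by move=> bf bg; apply: RintegralB => //; exact: iQ. Qed.

Lemma bintZ (c : R) f : bmf Q f -> bint (fun x => c * f x) = c * bint f.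
Proof. by move=> bf; apply: RintegralZl => //; exact: iQ. Qed.

Lemma bintN f : bmf Q f -> bint (fun x => - f x) = - bint f.
Proof.
move=> bf; rewrite -mulN1r -bintZ//; congr bint.
by apply/funext => x; rewrite mulN1r.
Qed.

Lemma le_bint f g : bmf Q f -> bmf Q g -> (forall x, Q x -> f x <= g x) ->
  bint f <= bint g.
Proof. by move=> bf bg fg; apply: le_Rintegral => //; exact: iQ. Qed.

Lemma bint_ge0 f : (forall x, Q x -> 0 <= f x) -> 0 <= bint f.
Proof. by move=> fg; exact: Rintegral_ge0. Qed.

Lemma eq_bint f g : (forall x, Q x -> f x = g x) -> bint f = bint g.
Proof. by move=> fg; apply: eq_Rintegral => x; rewrite inE => /fg. Qed.

Lemma bint0 : bint (fun=> 0) = 0.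
Proof. by rewrite /bint Rintegral_cst// mul0r. Qed.

Lemma bint_sum I (s : seq I) (P : pred I) (f : I -> 'rV[R]_n -> R) :
  (forall i, bmf Q (f i)) ->
  bint (fun x => \sum_(i <- s | P i) f i x) = \sum_(i <- s | P i) bint (f i).
Proof.
move=> bf; elim: s => [|i s IH].
  by rewrite big_nil -[RHS]bint0; apply: eq_bint => x _; rewrite big_nil.
rewrite big_cons; case: ifPn => Pi; last first.
  by rewrite -IH; apply: eq_bint => x _; rewrite big_cons (negbTE Pi).
rewrite -IH -bintD//; last exact: bmf_sum.
by apply: eq_bint => x _; rewrite big_cons Pi.
Qed.

Lemma bint_EFin f : bmf Q f -> ((bint f)%:E = \int[mu]_(x in Q) (f x)%:E)%E.
Proof.
move=> bf; rewrite /bint /Rintegral fineK//; apply: integrable_fin_num => //.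
exact: iQ.
Qed.

End box.

Lemma lebesgue_itvoo_lty {R : realType} (u v : R) :
  (@lebesgue_measure R `]u, v[ < +oo)%E.
Proof.
rewrite lebesgue_measure_itv/=; case: ifPn => // _; by rewrite -EFinB ltry.
Qed.

(** * Integration slice by slice along the first coordinate *)

Section fubini_box.
Context {R : realType} {n : nat}.
Variables (a b : 'I_n.+1 -> R).
Local Notation a' := (fun i => a (lift ord0 i)).
Local Notation b' := (fun i => b (lift ord0 i)).
Local Notation mu1 := (@lebesgue_measure R).
Implicit Types (f : 'rV[R]_n.+1 -> R).

Lemma rV_cons0 (p : measurableTypeR R * 'rV[R]_n) : rV_cons p 0 ord0 = p.1 :> R.
Proof.
transitivity (rV_cons p 0 (lshift n (ord0 : 'I_1))).
  by congr (rV_cons p _ _); exact: val_inj.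
by apply: etrans (row_mxEl _ _ _ _) _; rewrite mxE eqxx mulr1n.
Qed.

Lemma rV_consS (p : measurableTypeR R * 'rV[R]_n) i :
  rV_cons p 0 (lift ord0 i) = p.2 0 i :> R.
Proof.
transitivity (rV_cons p 0 (rshift 1 i)); last exact: row_mxEr.
by congr (rV_cons p _ _); exact: val_inj.
Qed.

Lemma obox_cons t x : obox a b (rV_cons (t, x)) <->
  (t \in `]a ord0, b ord0[) /\ obox a' b' x.
Proof.
split=> [H|[]].
  split=> [|i]; first by have := H ord0; rewrite rV_cons0 in_itv.
  by have := H (lift ord0 i); rewrite rV_consS.
rewrite in_itv/= => t01 H i; case: (unliftP ord0 i) => [j|] ->.
  by rewrite rV_consS; exact: H.
by rewrite rV_cons0.
Qed.

Local Notation mp := (mu1 \x lebesgue_rV R n)%E.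

Lemma ge0_integral_lebesgue_cons (f : 'rV[R]_n.+1 -> \bar R) :
  measurable_fun [set: 'rV[R]_n.+1] f -> (forall x, 0 <= f x)%E ->
  (\int[lebesgue_rV R n.+1]_x f x = \int[mp]_p f (rV_cons p))%E.
Proof.
move=> mf f0.
have mc : measurable_fun setT (@rV_cons R n) by exact: measurable_rV_cons.
by rewrite (@ge0_integral_pushforward _ _ _ _ _ _ mc mp setT f).
Qed.

Lemma integrable_lebesgue_cons (f : 'rV[R]_n.+1 -> \bar R) :
  measurable_fun [set: 'rV[R]_n.+1] f ->
  (lebesgue_rV R n.+1).-integrable setT f -> mp.-integrable setT (f \o @rV_cons R n).
Proof.
move=> mf /integrableP[_ foo]; apply/integrableP; split.
  by apply: measurableT_comp => //; exact: measurable_rV_cons.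
rewrite -(@ge0_integral_lebesgue_cons (fun x => `|f x|%E))//.
exact: measurableT_comp.
Qed.

Lemma integral_lebesgue_cons (f : 'rV[R]_n.+1 -> \bar R) :
  measurable_fun [set: 'rV[R]_n.+1] f ->
  (lebesgue_rV R n.+1).-integrable setT f ->
  (\int[lebesgue_rV R n.+1]_x f x = \int[mp]_p f (rV_cons p))%E.
Proof.
move=> mf foo.
have mc : measurable_fun setT (@rV_cons R n) by exact: measurable_rV_cons.
rewrite (@integral_pushforward _ _ _ _ _ _ mc mp setT f)//.
by rewrite preimage_setT; exact: integrable_lebesgue_cons.
Qed.

Let pr (f : 'rV[R]_n.+1 -> R) : 'rV[R]_n.+1 -> \bar R := (EFin \o f) \_ (obox a b).

Let pr_integrable f : bmf (obox a b) f -> (lebesgue_rV R n.+1).-integrable setT (pr f).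
Proof.
move=> bf; apply/(integrable_mkcond _ (measurable_obox a b)).
exact: bmf_obox_integrable.
Qed.

Let mpr f : bmf (obox a b) f -> measurable_fun [set: 'rV[R]_n.+1] (pr f).
Proof. by move=> /pr_integrable/integrableP[]. Qed.

Let bintE f : bmf (obox a b) f -> ((bint a b f)%:E = \int[mp]_p (pr f) (rV_cons p))%E.
Proof.
move=> bf; rewrite bint_EFin// integral_mkcond integral_lebesgue_cons//.
  exact: mpr.
exact: pr_integrable.
Qed.

Let prE f t x : pr f (rV_cons (t, x)) =
  (if t \in `]a ord0, b ord0[ then ((fun x => (f (rV_cons (t, x)))%:E) \_ (obox a' b')) x else 0)%E.
Proof.
rewrite /pr !patchE; case: ifPn => [/set_mem/obox_cons[-> H]|].
  by rewrite mem_set.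
move=> /negP H; case: ifPn => // tab; case: ifPn => // /set_mem xab.
by exfalso; apply: H; apply/mem_set/obox_cons.
Qed.

Lemma measurable_rV_cons2 t : measurable_fun setT (fun x : 'rV[R]_n => rV_cons (t, x)).
Proof.
apply: (measurableT_comp (@measurable_rV_cons R n)).
exact: measurable_pair1.
Qed.

Lemma measurable_rV_cons1 x :
  measurable_fun setT (fun t : measurableTypeR R => @rV_cons R n (t, x)).
Proof.
apply: (measurableT_comp (@measurable_rV_cons R n)).
exact: measurable_pair2.
Qed.

Lemma bmf_rV_cons f t : bmf (obox a b) f -> t \in `]a ord0, b ord0[ ->
  bmf (obox a' b') (fun x => f (rV_cons (t, x))).
Proof.
move=> [mf [M fM]] tab; split.
  by apply: (measurableT_comp mf); exact: measurable_rV_cons2.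
by exists M => x xab; apply: fM; apply/obox_cons.
Qed.

Lemma fubini_box12 f : bmf (obox a b) f ->
  ((bint a b f)%:E = \int[mu1]_(t in `]a ord0, b ord0[)
    (bint a' b' (fun x => f (rV_cons (t, x))))%:E)%E.
Proof.
move=> bf; rewrite bintE// -integral12_prod_meas1; last first.
  by apply: integrable_lebesgue_cons; [exact: mpr|exact: pr_integrable].
rewrite [RHS]integral_mkcond; apply: eq_integral => t _.
rewrite patchE /fubini_F; case: ifPn => [/set_mem/= tab|].
  rewrite bint_EFin; last exact: bmf_rV_cons.
  rewrite [RHS]integral_mkcond; apply: eq_integral => x _ /=.
  by rewrite prE tab.
move=> /negP H; rewrite integral0_eq// => x _ /=; rewrite prE.
by case: ifPn => // tab; exfalso; apply: H; apply/mem_set.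
Qed.

Lemma bmf_rV_cons_itv f x : bmf (obox a b) f -> obox a' b' x ->
  mu1.-integrable `]a ord0, b ord0[ (fun t => (f (rV_cons (t, x)))%:E).
Proof.
move=> [mf [M fM]] xab; apply: measurable_bounded_integrable => //.
- exact: lebesgue_itvoo_lty.
- by apply: measurable_funTS; apply: (measurableT_comp mf); exact: measurable_rV_cons1.
- exists M; split; first exact: num_real.
  move=> y My t tab /=; rewrite (le_trans (fM _ _))//; last exact: ltW.
  exact/obox_cons.
Qed.

(** Here the first coordinate is integrated first, so that the one-dimensional fundamental theorem
    applies to it; [fubini_box12] leaves it for last, which suits inductions on the dimension. *)
Lemma fubini_box21 f : bmf (obox a b) f ->
  bint a b f = bint a' b' (fun x => \int[mu1]_(t in `]a ord0, b ord0[) f (rV_cons (t, x))).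
Proof.
move=> bf.
have ib : mp.-integrable setT (pr f \o @rV_cons R n).
  by apply: integrable_lebesgue_cons; [exact: mpr|exact: pr_integrable].
rewrite -[LHS]/(fine (bint a b f)%:E) (bintE bf) -integral21_prod_meas1//.
rewrite /bint /Rintegral [in RHS]integral_mkcond; congr fine.
apply: eq_integral => x _; rewrite /fubini_G patchE; case: ifPn => [/set_mem xab|].
  rewrite fineK; last by apply: integrable_fin_num => //; exact: bmf_rV_cons_itv.
  rewrite [in RHS]integral_mkcond; apply: eq_integral => t _ /=.
  by rewrite prE !patchE !mem_setE mem_set.
move=> /negP H; rewrite integral0_eq// => t _ /=; rewrite prE.
case: ifPn => // tab; rewrite patchE; case: ifPn => // xab.
Qed.

End fubini_box.

(** * Integration by parts on boxes *)

Section ftc_box.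
Context {R : realType}.
Local Notation mu1 := (@lebesgue_measure R).

Lemma is_derive_continuous (F f : R -> R) : (forall x : R, is_derive x (1 : R) F (f x)) -> continuous F.
Proof.
move=> dF x; apply: differentiable_continuous; apply/derivable1_diffP.
by have [] := dF x.
Qed.

Lemma ftc_itv (F f : R -> R) (u v : R) : u <= v -> continuous f ->
  (forall x : R, is_derive x (1 : R) F (f x)) ->
  \int[mu1]_(x in `]u, v[) f x = F v - F u.
Proof.
move=> uv cf dF; have cF := is_derive_continuous dF.
move: uv; rewrite le_eqVlt => /predU1P[->|uv].
  rewrite subrr (_ : `]v, v[%classic = set0) ?Rintegral_set0//.
  by apply/seteqP; split => x //=; rewrite in_itv/= => /andP[/lt_trans/[apply]]; rewrite ltxx.
have mfo : measurable_fun `]u, v[ f.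
  by apply: measurable_funTS; exact: continuous_measurable_fun.
have icc : mu1.-integrable `[u, v] (EFin \o f).
  apply: continuous_compact_integrable; first exact: segment_compact.
  exact: continuous_subspaceT.
rewrite (@Rintegral_itv_obnd_cbnd _ u (BLeft v)); last first.
  by apply: integrableS icc => //; exact: subset_itv_oo_cc.
rewrite (@Rintegral_itv_bndo_bndc _ (BLeft u) v); last first.
  by apply: integrableS icc => //; exact: subset_itv_co_cc.
rewrite /Rintegral (@continuous_FTC2 _ f F)//.
- exact: continuous_subspaceT.
- split; first by move=> x _; have [] := dF x.
  + by apply: cvg_at_right_filter; exact: cF.
  + by apply: cvg_at_left_filter; exact: cF.
- by move=> x _; rewrite derive1E; have [_ ->] := dF x.
Qed.

(** A directional derivative depends only on the restriction to a line; this transports derivatives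
    between [R], slices and the whole space. *)
Lemma is_derive_line (V V' W : normedModType R) (f : V -> W) (g : V' -> W) a v a' v' d :
  (forall h : R, f (h *: v + a) = g (h *: v' + a')) ->
  is_derive a v f d -> is_derive a' v' g d.
Proof.
move=> fg [df fd].
have E : (fun h : R => h^-1 *: ((f \o shift a) (h *: v) - f a)) =
         (fun h : R => h^-1 *: ((g \o shift a') (h *: v') - g a')).
  apply/funext => h /=; rewrite fg; congr (_ *: (_ - _)).
  by have := fg 0; rewrite !scale0r !add0r.
by split; [move: df; rewrite /derivable E|rewrite -fd /derive E].
Qed.

Lemma rV_cons_line0 n (h t : R) (x : 'rV[R]_n) :
  rV_cons (h *: 1 + t, x) = h *: unit_vec ord0 + rV_cons (t, x).
Proof.
apply/rowP => i; rewrite [RHS]mxE; case: (unliftP ord0 i) => [j|] ->.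
  by rewrite !rV_consS/= !mxE/= mulr0 add0r.
by rewrite !rV_cons0/= !mxE/=.
Qed.

Lemma rV_cons_lineS n (h t : R) (x : 'rV[R]_n) (j : 'I_n) :
  rV_cons (t, h *: unit_vec j + x) = h *: unit_vec (lift ord0 j) + rV_cons (t, x).
Proof.
apply/rowP => i; rewrite [RHS]mxE; case: (unliftP ord0 i) => [k|] ->.
  by rewrite !rV_consS/= !mxE/= (inj_eq lift_inj).
by rewrite !rV_cons0/= !mxE/= mulr0 add0r.
Qed.

Lemma is_derive_slice0 n (w : 'rV[R]_n.+1 -> R) (t : R) x d :
  is_derive (rV_cons (t, x)) (unit_vec ord0) w d ->
  is_derive t (1 : R) (fun s : R => w (rV_cons (s, x))) d.
Proof. by apply: is_derive_line => h; rewrite -rV_cons_line0. Qed.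

Lemma is_derive_sliceS n (w : 'rV[R]_n.+1 -> R) (t : R) x j d :
  is_derive (rV_cons (t, x)) (unit_vec (lift ord0 j)) w d ->
  is_derive x (unit_vec j) (fun y => w (rV_cons (t, y))) d.
Proof. by apply: is_derive_line => h; rewrite -rV_cons_lineS. Qed.

Lemma continuous_rV (T : topologicalType) n (f : T -> 'rV[R]_n) :
  (forall i, continuous (fun x => f x 0 i)) -> continuous f.
Proof.
move=> cf x; apply/cvg_ballP => e e0.
have H : \forall y \near x, forall j, ball (f x 0 j) e (f y 0 j).
  by apply: filter_forall => j; exact: (cvg_ball (cf j x)).
by apply: filterS H => y H; split => // i j; rewrite (ord1 i).
Qed.

Lemma continuous_slice1 n (x : 'rV[R]_n) : continuous (fun t : R => rV_cons (t, x)).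
Proof.
apply: continuous_rV => i; case: (unliftP ord0 i) => [k|] ->.
  by under eq_fun do rewrite rV_consS; exact: cst_continuous.
by under eq_fun do rewrite rV_cons0.
Qed.

Lemma continuous_slice2 n (t : R) : continuous (fun x : 'rV[R]_n => rV_cons (t, x)).
Proof.
apply: continuous_rV => i; case: (unliftP ord0 i) => [k|] ->.
  by under eq_fun do rewrite rV_consS; exact: coord_continuous.
by under eq_fun do rewrite rV_cons0; exact: cst_continuous.
Qed.

Lemma ftc_box0 n (a b : 'I_n.+1 -> R) (w w1 : 'rV[R]_n.+1 -> R) :
  a ord0 <= b ord0 -> continuous w1 ->
  (forall x, is_derive x (unit_vec ord0) w (w1 x)) ->
  bint a b w1 = bint (fun i => a (lift ord0 i)) (fun i => b (lift ord0 i))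
    (fun x => w (rV_cons (b ord0, x)) - w (rV_cons (a ord0, x))).
Proof.
move=> ab cw1 dw; rewrite fubini_box21; last exact: bmf_continuous.
apply: eq_bint => x _; apply: (@ftc_itv (fun t => w (rV_cons (t, x)))) => //; last first.
  by move=> t; apply: is_derive_slice0.
by move=> t; apply: continuous_comp; [exact: continuous_slice1|exact: cw1].
Qed.

(** The hypothesis only compares the values at facing points of two opposite faces, so it covers
    functions vanishing on the faces as well as periodic ones. *)
Lemma ftc_box n (i : 'I_n) (a b : 'I_n -> R) (w w1 : 'rV[R]_n -> R) :
  (forall j, a j <= b j) -> continuous w1 ->
  (forall x, is_derive x (unit_vec i) w (w1 x)) ->
  (forall x y : 'rV[R]_n, (forall j, j != i -> x 0 j = y 0 j /\ a j < x 0 j < b j) ->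
    x 0 i = a i -> y 0 i = b i -> w x = w y) ->
  bint a b w1 = 0.
Proof.
elim: n i a b w w1 => [|n IH] i a b w w1 ab cw1 dw wab; first by case: i {wab dw}.
case: (unliftP ord0 i) => [j|] Ei; subst i.
  have bw1 : bmf (obox a b) w1 by exact: bmf_continuous.
  suff : ((bint a b w1)%:E = 0)%E by case.
  rewrite fubini_box12// integral0_eq// => t /= tab; congr EFin.
  apply: (IH j _ _ (fun x => w (rV_cons (t, x)))) => //.
  - by move=> x; apply: continuous_comp; [exact: continuous_slice2|exact: cw1].
  - by move=> x; apply: is_derive_sliceS.
  - move=> x y xy xa yb; apply: wab; rewrite ?rV_consS//.
    move=> k; case: (unliftP ord0 k) => [l|] ->; rewrite ?rV_consS ?rV_cons0.
      by rewrite (inj_eq lift_inj) => /xy.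
    by move: tab; rewrite in_itv/=.
rewrite (ftc_box0 (ab _) cw1 dw) -[RHS](bint0 (fun i => a (lift ord0 i)) (fun i => b (lift ord0 i))).
apply: eq_bint => x xab; apply/eqP; rewrite subr_eq0 eq_sym; apply/eqP.
apply: wab; rewrite ?rV_cons0// => k; case: (unliftP ord0 k) => [l|] ->//.
by rewrite !rV_consS/= => _; split => //; exact: xab.
Qed.

End ftc_box.

(** * Functions of class C1 and C2 *)

Section continuity.
Context {R : realType} {T : topologicalType}.
Implicit Types f g : T -> R.

Lemma contD f g : continuous f -> continuous g -> continuous (fun x => f x + g x).
Proof. by move=> cf cg x; apply: cvgD; [exact: cf|exact: cg]. Qed.

Lemma contB f g : continuous f -> continuous g -> continuous (fun x => f x - g x).
Proof. by move=> cf cg x; apply: cvgB; [exact: cf|exact: cg]. Qed.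

Lemma contM f g : continuous f -> continuous g -> continuous (fun x => f x * g x).
Proof. by move=> cf cg x; apply: cvgM; [exact: cf|exact: cg]. Qed.

Lemma cont_cst (c : R) : continuous (fun _ : T => c).
Proof. exact: cst_continuous. Qed.

Lemma contN f : continuous f -> continuous (fun x => - f x).
Proof. by move=> cf x; apply: cvgN; exact: cf. Qed.

Lemma contX k f : continuous f -> continuous (fun x => f x ^+ k).
Proof. by move=> cf x; exact: (continuous_comp (cf x) (@exprn_continuous _ _ _)). Qed.

Lemma cont_norm f : continuous f -> continuous (fun x => `|f x|).
Proof. by move=> cf x; apply: cvg_norm; exact: cf. Qed.

Lemma cont_comp1 (phi : R -> R) f : continuous phi -> continuous f ->
  continuous (fun x => phi (f x)).
Proof. by move=> cp cf x; exact: (continuous_comp (cf x) (cp _)). Qed.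

Lemma cont_sum I (s : seq I) (P : pred I) (f : I -> T -> R) :
  (forall k, continuous (f k)) -> continuous (fun x => \sum_(k <- s | P k) f k x).
Proof.
move=> cf; elim: s => [|k s IH].
  rewrite (_ : (fun x => _) = cst 0); first exact: cst_continuous.
  by apply/funext => x; rewrite big_nil.
case Pk : (P k); under eq_fun do rewrite big_cons Pk.
  exact: contD.
exact: IH.
Qed.

End continuity.

Ltac cont_tac := first
  [ match goal with H : continuous ?f |- continuous ?f => exact H end
  | match goal with |- continuous (fun _ => ?c) => exact: cont_cst end
  | lazymatch goal with
    | |- continuous (fun x => @?f x + @?g x) => apply: (@contD _ _ f g); cont_tac
    | |- continuous (fun x => - @?f x) => apply: (@contN _ _ f); cont_tac
    | |- continuous (fun x => @?f x * @?g x) => apply: (@contM _ _ f g); cont_tac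
    | |- continuous (fun x => @?f x ^+ ?k) => apply: (@contX _ _ k f); cont_tac
    | |- continuous (fun x => Num.Def.normr (@?f x)) => apply: (@cont_norm _ _ f); cont_tac
    | |- _ => first [assumption | solve [auto 2] | exact: cont_cst
                    | (apply: cont_sum => ?; cont_tac) | idtac]
    end ].

Lemma cont_slice2 {R : realType} n (f : 'rV[R]_n.+1 -> R) (t : R) :
  continuous f -> continuous (fun x : 'rV[R]_n => f (rV_cons (t, x))).
Proof.
by move=> cf x; apply: continuous_comp; [exact: continuous_slice2|exact: cf].
Qed.

Section C1.
Context {R : realType} {n : nat}.
Local Notation V := 'rV[R]_n.
Implicit Types (f g : V -> R) (G : 'I_n -> V -> R).

Definition C1 f G := [/\ continuous f, forall i, continuous (G i) &
  forall i x, is_derive x (unit_vec i : V) f (G i x)].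

(** Gradient and Hessian are explicit data. Symmetry of the Hessian belongs to them, since for all
    functions built here it can be read off the formulas. *)
Definition C2 f G (H : 'I_n -> 'I_n -> V -> R) :=
  [/\ C1 f G, forall i, C1 (G i) (H i) & forall i j x, H i j x = H j i x].

Lemma C1_eq f G f' G' : C1 f G -> f =1 f' -> (forall i, G i =1 G' i) -> C1 f' G'.
Proof.
move=> C ff' GG'; have -> : f' = f by apply/funext => x; rewrite ff'.
by have -> : G' = G by apply/funext => i; apply/funext => x; rewrite GG'.
Qed.

Lemma C2_eq f G H f' G' H' : C2 f G H -> f =1 f' -> (forall i, G i =1 G' i) ->
  (forall i j, H i j =1 H' i j) -> C2 f' G' H'.
Proof.
move=> C ff' GG' HH'; have -> : f' = f by apply/funext => x; rewrite ff'.
have -> : G' = G by apply/funext => i; apply/funext => x; rewrite GG'.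
by have -> : H' = H by apply/funext => i; apply/funext => j; apply/funext => x; rewrite HH'.
Qed.

Lemma C1_cst (c : R) : C1 (fun=> c) (fun _ _ => 0).
Proof.
split; [exact: cst_continuous|by move=> i; exact: cst_continuous|].
by move=> i x; exact: is_derive_cst.
Qed.

Lemma C1D f G g H : C1 f G -> C1 g H ->
  C1 (fun x => f x + g x) (fun i x => G i x + H i x).
Proof.
move=> [cf cG dG] [cg cH dH]; split.
- exact: contD.
- by move=> i; exact: contD.
- by move=> i x; exact: is_deriveD.
Qed.

Lemma C1M f G g H : C1 f G -> C1 g H ->
  C1 (fun x => f x * g x) (fun i x => G i x * g x + f x * H i x).
Proof.
move=> [cf cG dG] [cg cH dH]; split.
- exact: contM.
- by move=> i; apply: contD; exact: contM.
- move=> i x; have := @is_deriveM _ _ f g x (unit_vec i) _ _ (dG i x) (dH i x).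
  move=> H'; apply: is_derive_eq H' _.
  by rewrite /GRing.scale/= addrC mulrC.
Qed.

Lemma C1Z (c : R) f G : C1 f G -> C1 (fun x => c * f x) (fun i x => c * G i x).
Proof.
move=> Cf; apply: C1_eq (C1M (C1_cst c) Cf) _ _ => // i x.
by rewrite mul0r add0r.
Qed.

Lemma C1N f G : C1 f G -> C1 (fun x => - f x) (fun i x => - G i x).
Proof.
by move=> Cf; apply: C1_eq (C1Z (-1) Cf) _ _ => [|i] x; rewrite mulN1r.
Qed.

Lemma C1B f G g H : C1 f G -> C1 g H ->
  C1 (fun x => f x - g x) (fun i x => G i x - H i x).
Proof. by move=> Cf Cg; apply: C1D => //; exact: C1N. Qed.

Lemma C1_sum I (s : seq I) (P : pred I) (f : I -> V -> R) (G : I -> 'I_n -> V -> R) :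
  (forall k, C1 (f k) (G k)) ->
  C1 (fun x => \sum_(k <- s | P k) f k x) (fun i x => \sum_(k <- s | P k) G k i x).
Proof.
move=> C; elim: s => [|k s IH].
  by apply: C1_eq (C1_cst 0) _ _ => [|i] x; rewrite big_nil.
case Pk : (P k); last by apply: C1_eq IH _ _ => [|i] x; rewrite big_cons Pk.
by apply: C1_eq (C1D (C k) IH) _ _ => [|i] x; rewrite big_cons Pk.
Qed.

Lemma C1_coord (c : R) k : C1 (fun x => x 0 k - c) (fun i _ => (i == k)%:R).
Proof.
split.
- by apply: contB; [exact: coord_continuous|exact: cst_continuous].
- by move=> i; exact: cst_continuous.
- move=> i x.
  apply: (@is_derive_line _ _ _ _ (fun t : R => (i == k)%:R * t + (x 0 k - c)) _ (0 : R) (1 : R)).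
    move=> h; rewrite !mxE eqxx/= [h *: 1]mulr1 addr0 eq_sym; ring.
  apply: is_derive_eq; rewrite addr0; exact: mulr1.
Qed.

Lemma is_derive_comp1 (f : V -> R) (phi : R -> R) x v df dphi :
  is_derive x v f df -> is_derive (f x) (1 : R) phi dphi ->
  is_derive x v (phi \o f) (dphi * df).
Proof.
move=> fd pd.
pose l (h : R) := f (h *: v + x).
have ld : is_derive (0 : R) (1 : R) l df.
  apply: (is_derive_line _ fd) => h.
  by rewrite /l addr0 [h *: 1]mulr1.
apply: (@is_derive_line _ _ _ _ (phi \o l) _ (0 : R) (1 : R)).
  by move=> h; rewrite /l/= addr0 [h *: 1]mulr1.
have l0 : l 0 = f x by rewrite /l scale0r add0r.
rewrite -l0 in pd.
exact: (@is_derive1_comp R phi l 0 dphi df pd ld).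
Qed.

Lemma C1_comp (phi phi1 : R -> R) f G : continuous phi1 ->
  (forall t : R, is_derive t (1 : R) phi (phi1 t)) -> C1 f G ->
  C1 (fun x => phi (f x)) (fun i x => phi1 (f x) * G i x).
Proof.
move=> cp dp [cf cG dG]; split.
- by apply: cont_comp1 cf; exact: (@is_derive_continuous _ _ phi1).
- by move=> i; apply: contM => //; exact: cont_comp1.
- by move=> i x; exact: is_derive_comp1.
Qed.

Lemma C2_cst (c : R) : C2 (fun=> c) (fun _ _ => 0) (fun _ _ _ => 0).
Proof. by split => // [|i]; exact: C1_cst. Qed.

Lemma C2_coord (c : R) k :
  C2 (fun x => x 0 k - c) (fun i _ => (i == k)%:R) (fun _ _ _ => 0).
Proof. by split => // [|i]; [exact: C1_coord|exact: C1_cst]. Qed.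

Lemma C2D f1 G1 H1 f2 G2 H2 : C2 f1 G1 H1 -> C2 f2 G2 H2 ->
  C2 (fun x => f1 x + f2 x) (fun i x => G1 i x + G2 i x)
     (fun i j x => H1 i j x + H2 i j x).
Proof.
move=> [C11 C12 S1] [C21 C22 S2]; split; first exact: C1D.
- by move=> i; exact: C1D.
- by move=> i j x; rewrite S1 S2.
Qed.

Lemma C2M f1 G1 H1 f2 G2 H2 : C2 f1 G1 H1 -> C2 f2 G2 H2 ->
  C2 (fun x => f1 x * f2 x) (fun i x => G1 i x * f2 x + f1 x * G2 i x)
     (fun i j x => H1 i j x * f2 x + G1 i x * G2 j x + G1 j x * G2 i x + f1 x * H2 i j x).
Proof.
move=> [C11 C12 S1] [C21 C22 S2]; split; first exact: C1M.
- move=> i; apply: C1_eq (C1D (C1M (C12 i) C21) (C1M C11 (C22 i))) _ _ => // j x.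
  by rewrite -!addrA.
- by move=> i j x; rewrite S1 S2; ring.
Qed.

Lemma C2Z (c : R) f G H : C2 f G H ->
  C2 (fun x => c * f x) (fun i x => c * G i x) (fun i j x => c * H i j x).
Proof.
move=> [C11 C12 S]; split; first exact: C1Z.
- by move=> i; exact: C1Z.
- by move=> i j x; rewrite S.
Qed.

Lemma C2_sum I (s : seq I) (f : I -> V -> R) (G : I -> 'I_n -> V -> R)
    (H : I -> 'I_n -> 'I_n -> V -> R) :
  (forall k, C2 (f k) (G k) (H k)) ->
  C2 (fun x => \sum_(k <- s) f k x) (fun i x => \sum_(k <- s) G k i x)
     (fun i j x => \sum_(k <- s) H k i j x).
Proof.
move=> C; split; first by apply: C1_sum => k; have [] := C k.
- by move=> i; apply: C1_sum => k; have [_] := C k; exact.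
- by move=> i j x; apply: eq_bigr => k _; have [_ _] := C k; exact.
Qed.

Lemma C2_comp (phi phi1 phi2 : R -> R) f G H : continuous phi2 ->
  (forall t : R, is_derive t (1 : R) phi (phi1 t)) ->
  (forall t : R, is_derive t (1 : R) phi1 (phi2 t)) -> C2 f G H ->
  C2 (fun x => phi (f x)) (fun i x => phi1 (f x) * G i x)
     (fun i j x => phi2 (f x) * G i x * G j x + phi1 (f x) * H i j x).
Proof.
move=> cp d1 d2 [C11 C12 S].
have cp1 : continuous phi1 by exact: is_derive_continuous d2.
split; first exact: C1_comp.
- move=> i; apply: C1_eq (C1M (C1_comp cp d2 C11) (C12 i)) _ _ => // j x.
  by congr (_ + _); rewrite mulrAC.
- by move=> i j x; rewrite S; ring.
Qed.

End C1.

(** * Derivatives along vector fields *)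

Section dalong.
Context {R : realType} {n : nat}.
Local Notation V := 'rV[R]_n.
Implicit Types (Y : 'I_n -> V -> R) (f g : V -> R).

(** A relation rather than a function: the rules for sums and products compose without displaying
    gradients, and [f'] can be prescribed in any pointwise equal form. *)
Definition dalong Y f f' := exists2 G, C1 f G & forall x, f' x = \sum_k Y k x * G k x.

Lemma dalong_C1 Y f G : C1 f G -> dalong Y f (fun x => \sum_k Y k x * G k x).
Proof. by exists G. Qed.

Lemma dalong_eq Y f f' g g' : dalong Y f f' -> f =1 g -> f' =1 g' -> dalong Y g g'.
Proof.
move=> [G C E] fg f'g'; exists G; first exact: C1_eq C fg _.
by move=> x; rewrite -f'g' E.
Qed.

Lemma dalong_cst Y (c : R) : dalong Y (fun=> c) (fun=> 0).
Proof.
exists (fun _ _ => 0); first exact: C1_cst.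
by move=> x; rewrite big1// => k _; rewrite mulr0.
Qed.

Lemma dalongD Y f f' g g' : dalong Y f f' -> dalong Y g g' ->
  dalong Y (fun x => f x + g x) (fun x => f' x + g' x).
Proof.
move=> [G CG E] [H CH E']; exists (fun i x => G i x + H i x); first exact: C1D.
by move=> x; rewrite E E' -big_split; apply: eq_bigr => k _; rewrite mulrDr.
Qed.

Lemma dalongM Y f f' g g' : dalong Y f f' -> dalong Y g g' ->
  dalong Y (fun x => f x * g x) (fun x => f' x * g x + f x * g' x).
Proof.
move=> [G CG E] [H CH E']; exists (fun i x => G i x * g x + f x * H i x); first exact: C1M.
move=> x; rewrite E E' mulr_suml mulr_sumr -big_split; apply: eq_bigr => k _ /=.
ring.
Qed.

Lemma dalongZ Y (c : R) f f' : dalong Y f f' ->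
  dalong Y (fun x => c * f x) (fun x => c * f' x).
Proof.
move=> df; apply: dalong_eq (dalongM (dalong_cst Y c) df) _ _ => // x.
by rewrite mul0r add0r.
Qed.

Lemma dalongB Y f f' g g' : dalong Y f f' -> dalong Y g g' ->
  dalong Y (fun x => f x - g x) (fun x => f' x - g' x).
Proof.
move=> df dg; apply: dalong_eq (dalongD df (dalongZ (-1) dg)) _ _ => x /=; ring.
Qed.

Lemma dalong_sum Y I (s : seq I) (f f' : I -> V -> R) :
  (forall k, dalong Y (f k) (f' k)) ->
  dalong Y (fun x => \sum_(k <- s) f k x) (fun x => \sum_(k <- s) f' k x).
Proof.
move=> df; elim: s => [|k s IH].
  by apply: dalong_eq (dalong_cst Y 0) _ _ => x; rewrite big_nil.
by apply: dalong_eq (dalongD (df k) IH) _ _ => x; rewrite big_cons.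
Qed.

Lemma dalong_continuous Y f f' : dalong Y f f' -> continuous f.
Proof. by move=> [G []]. Qed.

End dalong.

(** * A Carleman inequality on a box *)

Section carleman.
Context {R : realType} {d : nat}.
Local Notation n := d.+1.
Local Notation V := 'rV[R]_n.
Variables (p : V) (a b : 'I_n -> R).
Hypothesis ab : forall i, a i <= b i.
Hypothesis a0 : a ord0 = 0.
Local Notation a' := (fun i => a (lift ord0 i)).
Local Notation b' := (fun i => b (lift ord0 i)).

Definition shiftc (i : 'I_n) (x : V) : R := x 0 i - p 0 i.
Local Notation X := shiftc.
Definition dist2 (x : V) : R := \sum_i X i x ^+ 2.
Local Notation q := dist2.

Definition lateral (x : V) := x 0 ord0 = b ord0 \/
  exists j, x 0 (lift ord0 j) = a' j \/ x 0 (lift ord0 j) = b' j.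
Definition van (w : V -> R) := forall x, lateral x -> w x = 0.

Lemma vanM w g : van w -> van (fun x => w x * g x).
Proof. by move=> vw x /vw ->; rewrite mul0r. Qed.

Lemma vanMl w g : van w -> van (fun x => g x * w x).
Proof. by move=> vw x /vw ->; rewrite mulr0. Qed.

Lemma vanD w g : van w -> van g -> van (fun x => w x + g x).
Proof. by move=> vw vg x lx; rewrite vw// vg// addr0. Qed.

Lemma vanB w g : van w -> van g -> van (fun x => w x - g x).
Proof. by move=> vw vg x lx; rewrite vw// vg// subr0. Qed.

Lemma van_sum I (s : seq I) (w : I -> V -> R) :
  (forall k, van (w k)) -> van (fun x => \sum_(k <- s) w k x).
Proof. by move=> vw x lx; rewrite big1// => k _; exact: vw. Qed.

(** The face where the coordinate [ord0] vanishes is the only one on which [W] survives; the sign is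
    that of its outer normal. *)
Lemma bint_div (k : 'I_n) W G : C1 W G -> van W ->
  bint a b (G k) = - ((k == ord0)%:R * bint a' b' (fun x => W (rV_cons (0, x)))).
Proof.
move=> [cW cG dG] vW; have [->|k0] := eqVneq k ord0.
  rewrite (ftc_box0 (ab _) (cG _) (dG ord0)) mul1r.
  have bW : bmf (obox a' b') (fun x => W (rV_cons (0, x))).
    apply: bmf_continuous; exact: cont_slice2.
  rewrite -bintN//; apply: eq_bint => x _; rewrite a0 vW ?sub0r//.
  by left; rewrite rV_cons0.
rewrite mul0r oppr0 (ftc_box ab (cG k) (dG k))// => x y _.
case: (unliftP ord0 k) k0 => [j|] -> //= _ xa yb.
by rewrite vW ?vW//; right; exists j; [right|left].
Qed.

(** [DY] is the dilation field about the pole and [OY] are the rotation fields: the frame in which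
    [q] times the Laplacian splits into a radial and a spherical part. *)
Definition DY (k : 'I_n) x : R := X k x.
Definition OY i j (k : 'I_n) x : R := X i x * (k == j)%:R - X j x * (k == i)%:R.

Lemma sum_OY i j (G : 'I_n -> V -> R) x :
  \sum_k OY i j k x * G k x = X i x * G j x - X j x * G i x.
Proof.
rewrite /OY; under eq_bigr do rewrite mulrBl.
rewrite sumrB (bigD1 j)//= eqxx mulr1 big1 ?addr0; last first.
  by move=> k /negbTE ->; rewrite mulr0 mul0r.
rewrite (bigD1 i)//= eqxx mulr1 [X in _ - (_ + X)]big1 ?addr0//.
by move=> k /negbTE ->; rewrite mulr0 mul0r.
Qed.

Lemma C1_X i : C1 (X i) (fun k _ => (k == i)%:R).
Proof. exact: C1_coord. Qed.

Lemma cont_X i : continuous (X i). Proof. by have [] := C1_X i. Qed.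

(** The dilation field has divergence [n], and its normal component on the free face is the constant
    [- p 0 ord0]. *)
Lemma bint_dalongD W W' : dalong DY W W' -> van W ->
  bint a b (fun x => W' x + n%:R * W x) =
  p 0 ord0 * bint a' b' (fun x => W (rV_cons (0, x))).
Proof.
move=> [G CG EG] vW.
have CXW k := C1M (C1_X k) CG.
have cont k : continuous (fun x => (k == k)%:R * W x + X k x * G k x).
  by have [_ H _] := CXW k; exact: H.
transitivity (bint a b (fun x => \sum_k ((k == k)%:R * W x + X k x * G k x))).
  apply: eq_bint => x _; rewrite EG big_split/= addrC; congr (_ + _).
  under eq_bigr do rewrite eqxx mul1r.
  by rewrite sumr_const card_ord mulr_natl.
rewrite bint_sum; last by move=> k; exact/bmf_continuous/cont.
under eq_bigr => k _ do rewrite (bint_div k (CXW k) (vanMl _ vW)).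
rewrite (bigD1 ord0)//= big1 ?addr0; last first.
  by move=> k /negbTE ->; rewrite mul0r oppr0.
rewrite mul1r.
have [cW _ _] := CG.
have bW : bmf (obox a' b') (fun x => W (rV_cons (0, x))).
  apply: bmf_continuous; exact: cont_slice2.
rewrite -bintZ// -bintN; last first.
  apply: bmf_continuous; apply: contM; last exact: cont_slice2.
  by apply: cont_slice2; exact: cont_X.
by apply: eq_bint => x _; rewrite /X rV_cons0/= sub0r mulNr opprK.
Qed.

(** Rotation fields are divergence-free, and they have a normal component on the free face only if
    one of their indices is [ord0]. *)
Lemma bint_dalongO i j W W' : dalong (OY i j) W W' -> van W ->
  bint a b W' = (i == ord0)%:R * bint a' b' (fun x => X j (rV_cons (0, x)) * W (rV_cons (0, x)))
    - (j == ord0)%:R * bint a' b' (fun x => X i (rV_cons (0, x)) * W (rV_cons (0, x))).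
Proof.
move=> [G CG EG] vW.
have CXW k := C1M (C1_X k) CG.
have cont k l : continuous (fun x => (l == k)%:R * W x + X k x * G l x).
  by have [_ H _] := CXW k; exact: H.
transitivity (bint a b (fun x => ((j == i)%:R * W x + X i x * G j x)
    - ((i == j)%:R * W x + X j x * G i x))).
  apply: eq_bint => x _; rewrite EG sum_OY eq_sym; ring.
rewrite bintB; [|exact/bmf_continuous/cont|exact/bmf_continuous/cont].
rewrite (bint_div j (CXW i) (vanMl _ vW)) (bint_div i (CXW j) (vanMl _ vW)).
by rewrite opprK addrC.
Qed.

Variables (v : V -> R) (g : 'I_n -> V -> R) (h : 'I_n -> 'I_n -> V -> R).
Hypothesis C2v : C2 v g h.
Hypothesis vanv : van v.
Hypothesis vang : forall i, van (g i).
Hypothesis v0 : forall x, v (rV_cons (0, x)) = 0.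
Variables (al c : R).

(** For the weight [t^(-(al + 1) / 2) * e^(al * c * t / 2)] at [t = q x], [cbeta] is 1 plus the
    radial logarithmic derivative, and [cbeta1] is the radial derivative of [cbeta]. The exponential
    factor is there to make [cbeta1] positive: for a pure power it would vanish and nothing would be
    gained. *)
Definition cbeta x := - al + al * c * q x.
Definition cbeta1 x := 2 * al * c * q x.
Local Notation be := cbeta.
Local Notation be1 := cbeta1.

Let C1v : C1 v g. Proof. by have [] := C2v. Qed.
Let C1g i : C1 (g i) (h i). Proof. by have [] := C2v. Qed.
Let hs i j x : h i j x = h j i x. Proof. by have [_ _] := C2v. Qed.

Let dv x := \sum_k X k x * g k x.
Let ddv x := \sum_k X k x * (g k x + \sum_l X l x * h k l x).
Let om i j x := X i x * g j x - X j x * g i x.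
Let om1 i j k x := ((k == i)%:R * g j x + X i x * h j k x)
                  - ((k == j)%:R * g i x + X j x * h i k x).
Let omm i j x := X i x * om1 i j j x - X j x * om1 i j i x.
Let dom i j x := om i j x + \sum_k X k x * (X i x * h j k x - X j x * h i k x).

Let D_X i : dalong DY (X i) (X i).
Proof.
apply: dalong_eq (dalong_C1 DY (C1_X i)) _ _ => // x.
rewrite (bigD1 i)//= eqxx mulr1 big1 ?addr0// => k /negbTE ->.
by rewrite mulr0.
Qed.

Let D_q : dalong DY q (fun x => 2 * q x).
Proof.
apply: dalong_eq (dalong_sum _ (fun i => dalongM (D_X i) (D_X i))) _ _ => x.
  by apply: eq_bigr => i _; rewrite expr2.
by rewrite /q mulr_sumr; apply: eq_bigr => i _; ring.
Qed.

Let O_q i j : dalong (OY i j) q (fun=> 0).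
Proof.
have H := dalong_sum (index_enum 'I_n) (fun k => dalongM (dalong_C1 (OY i j) (C1_X k)) (dalong_C1 (OY i j) (C1_X k))).
apply: dalong_eq H _ _ => x.
  by apply: eq_bigr => k _; rewrite expr2.
under eq_bigr do rewrite (sum_OY i j (fun k' _ => (k' == _)%:R)).
have E : forall k : 'I_n, (X i x * (j == k)%:R - X j x * (i == k)%:R) * X k x +
   X k x * (X i x * (j == k)%:R - X j x * (i == k)%:R) =
   2 * (X i x * ((j == k)%:R * X k x)) - 2 * (X j x * ((i == k)%:R * X k x)).
  by move=> k; ring.
under eq_bigr do rewrite E.
have S : forall l : 'I_n, \sum_k ((l == k)%:R * X k x) = X l x.
  move=> l; rewrite (bigD1 l)//= eqxx mul1r big1 ?addr0// => k.
  by rewrite eq_sym => /negbTE ->; rewrite mul0r.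
by rewrite sumrB -!mulr_sumr !S; ring.
Qed.

Let D_v : dalong DY v dv. Proof. exact: dalong_C1. Qed.

Let D_dv : dalong DY dv ddv.
Proof.
have H := dalong_sum (index_enum 'I_n) (fun k => dalongM (D_X k) (dalong_C1 DY (C1g k))).
apply: dalong_eq H _ _ => // x; rewrite /ddv.
by apply: eq_bigr => k _; rewrite mulrDr.
Qed.

Let D_om i j : dalong DY (om i j) (dom i j).
Proof.
have H := dalongB (dalongM (D_X i) (dalong_C1 DY (C1g j))) (dalongM (D_X j) (dalong_C1 DY (C1g i))).
apply: dalong_eq H _ _ => // x; rewrite /dom /om /DY.
under [in RHS]eq_bigr do rewrite mulrBr.
rewrite sumrB.
have E : forall (z : R) l, \sum_k X k x * (z * h l k x) = z * \sum_k X k x * h l k x.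
  by move=> z l; rewrite mulr_sumr; apply: eq_bigr => k _; ring.
by rewrite !E; ring.
Qed.

Let O_v i j : dalong (OY i j) v (om i j).
Proof.
apply: dalong_eq (dalong_C1 (OY i j) C1v) _ _ => // x.
by rewrite sum_OY.
Qed.

Let O_om i j : dalong (OY i j) (om i j) (omm i j).
Proof.
have H := dalong_C1 (OY i j) (C1B (C1M (C1_X i) (C1g j)) (C1M (C1_X j) (C1g i))).
by apply: dalong_eq H _ _ => // x; rewrite (sum_OY i j (om1 i j)).
Qed.

Let O_dv i j : dalong (OY i j) dv (dom i j).
Proof.
have H := dalong_sum (index_enum 'I_n) (fun k => dalongM (dalong_C1 (OY i j) (C1_X k)) (dalong_C1 (OY i j) (C1g k))).
apply: dalong_eq H _ _ => // x; rewrite /dom /om.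
under eq_bigr do rewrite (sum_OY i j (fun k' _ => (k' == _)%:R)) sum_OY.
rewrite big_split/=; congr (_ + _); last first.
  by apply: eq_bigr => k _; rewrite (hs j k) (hs i k).
have E : forall k : 'I_n, (X i x * (j == k)%:R - X j x * (i == k)%:R) * g k x =
   X i x * ((j == k)%:R * g k x) - X j x * ((i == k)%:R * g k x).
  by move=> k; ring.
under eq_bigr do rewrite E.
have S : forall l : 'I_n, \sum_k ((l == k)%:R * g k x) = g l x.
  move=> l; rewrite (bigD1 l)//= eqxx mul1r big1 ?addr0// => k.
  by rewrite eq_sym => /negbTE ->; rewrite mul0r.
by rewrite sumrB -!mulr_sumr !S.
Qed.

(* Half the sum of the squared rotation fields is the spherical part of
   [q] times the Laplacian. *)
Let sum_omm x : 2^-1 * \sum_i \sum_j omm i j x =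
  q x * (\sum_i h i i x) - ddv x - (n%:R - 2) * dv x.
Proof.
have E i j : omm i j x = X i x ^+ 2 * h j j x + X j x ^+ 2 * h i i x
    - 2 * (X i x * (X j x * h i j x)) - X i x * g i x - X j x * g j x
    + (j == i)%:R * (2 * (X i x * g i x)).
  rewrite /omm /om1 !eqxx (hs j i) (eq_sym i j); case: eqVneq => [->|_] /=; rewrite ?(mulr1n,mulr0n); ring.
have -> : \sum_i \sum_j omm i j x = \sum_i (X i x ^+ 2 * \sum_j h j j x + q x * h i i x
   - 2 * (X i x * \sum_j X j x * h i j x) - n%:R * (X i x * g i x) - dv x + 2 * (X i x * g i x)).
  apply: eq_bigr => i _; under eq_bigr do rewrite E.
  rewrite big_split/= !sumrB big_split/= -!mulr_sumr -mulr_suml sumr_const card_ord.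
  congr (_ + _); first by rewrite -[g i x *+ _]mulr_natl /q /dv; ring.
  rewrite (bigD1 i)//= eqxx mul1r big1 ?addr0// => j /negbTE ->.
  by rewrite mul0r.
have -> : ddv x = dv x + \sum_i (X i x * \sum_j X j x * h i j x).
  by rewrite /ddv /dv -big_split/=; apply: eq_bigr => i _; rewrite mulrDr.
rewrite big_split/= !sumrB big_split/= -!mulr_sumr -mulr_suml sumr_const card_ord.
rewrite -/(q x) -/(dv x) -mulr_natl.
by field.
Qed.

(** The conjugate of [q] times the Laplacian by the weight: in [D^2 + (n - 2) D] plus the spherical
    part, the radial derivative [D] has been replaced by [D - (be - 1)]. *)
Definition carleman_op x := q x * (\sum_i h i i x) + 2 * dv x + (n%:R - 1 + be x ^+ 2) * v x
  - 2 * be x * (dv x + n%:R / 2 * v x) - be1 x * v x.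

(** The operator [pv], that is [D + n / 2], is antisymmetric. [S] is the symmetric part of the
    conjugated operator, with radial term the square of [pv]; [A] is the antisymmetric part, minus
    the anticommutator of [be] and [pv]. *)
Let S x := ddv x + n%:R * dv x + n%:R ^+ 2 / 4 * v x + 2^-1 * (\sum_i \sum_j omm i j x)
  + (be x ^+ 2 - ((n%:R - 2) / 2) ^+ 2) * v x.
Let pv x := dv x + n%:R / 2 * v x.
Let A x := - (2 * (be x * pv x)) - be1 x * v x.

Let opE x : carleman_op x = S x + A x.
Proof. by rewrite /carleman_op /S /A /pv sum_omm; field. Qed.

Let D_be : dalong DY be be1.
Proof.
apply: dalong_eq (dalongD (dalong_cst DY (- al)) (dalongZ (al * c) D_q)) _ _ => x.
  by [].
by rewrite /be1; ring.
Qed.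

Let D_be1 : dalong DY be1 (fun x => 2 * be1 x).
Proof.
apply: dalong_eq (dalongZ (2 * al * c) D_q) _ _ => x; first by [].
by rewrite /be1; ring.
Qed.

Let O_be i j : dalong (OY i j) be (fun=> 0).
Proof.
apply: dalong_eq (dalongD (dalong_cst _ (- al)) (dalongZ (al * c) (O_q i j))) _ _ => x.
  by [].
by rewrite mulr0 addr0.
Qed.

Let O_be1 i j : dalong (OY i j) be1 (fun=> 0).
Proof.
apply: dalong_eq (dalongZ (2 * al * c) (O_q i j)) _ _ => x; first by [].
by rewrite mulr0.
Qed.

Let D_pv : dalong DY pv (fun x => ddv x + n%:R / 2 * dv x).
Proof. by apply: dalongD => //; exact: dalongZ. Qed.

Let O_pv i j : dalong (OY i j) pv (fun x => dom i j x + n%:R / 2 * om i j x).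
Proof. by apply: dalongD => //; exact: dalongZ. Qed.

Let O_A i j : dalong (OY i j) A
  (fun x => - (2 * (be x * (dom i j x + n%:R / 2 * om i j x))) - be1 x * om i j x).
Proof.
have H := dalongB (dalongZ (-2) (dalongM (O_be i j) (O_pv i j))) (dalongM (O_be1 i j) (O_v i j)).
apply: dalong_eq H _ _ => x; first by rewrite /A; ring.
by ring.
Qed.

(** The radial flux left when [S * A] is written as a divergence: each term is a coefficient times a
    product whose radial derivative occurs in [S * A]. *)
Let Z0 x := - (be x * (pv x * pv x)) - be1 x * (v x * pv x) + be1 x * (v x * v x)
  - (be x * (be x * be x) - ((n%:R - 2) / 2) ^+ 2 * be x) * (v x * v x)
  + be x * (2^-1 * \sum_i \sum_j om i j x * om i j x).
Let Z0' x := - (be1 x * (pv x * pv x) + 2 * be x * (pv x * (ddv x + n%:R / 2 * dv x)))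
  - (2 * be1 x * (v x * pv x) + be1 x * (dv x * pv x + v x * (ddv x + n%:R / 2 * dv x)))
  + (2 * be1 x * (v x * v x) + be1 x * (2 * (v x * dv x)))
  - ((3 * be x ^+ 2 * be1 x - ((n%:R - 2) / 2) ^+ 2 * be1 x) * (v x * v x)
     + (be x ^+ 3 - ((n%:R - 2) / 2) ^+ 2 * be x) * (2 * (v x * dv x)))
  + (be1 x * (2^-1 * \sum_i \sum_j om i j x * om i j x)
     + be x * (\sum_i \sum_j om i j x * dom i j x)).

Let D_Z0 : dalong DY Z0 Z0'.
Proof.
have D1 := dalongM D_be (dalongM D_pv D_pv).
have D2 := dalongM D_be1 (dalongM D_v D_pv).
have D3 := dalongM D_be1 (dalongM D_v D_v).
have D4 := dalongM (dalongB (dalongM D_be (dalongM D_be D_be)) (dalongZ (((n%:R - 2) / 2) ^+ 2) D_be)) (dalongM D_v D_v).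
have D5 := dalongM D_be (dalongZ 2^-1 (dalong_sum (index_enum 'I_n) (fun i => dalong_sum (index_enum 'I_n) (fun j => dalongM (D_om i j) (D_om i j))))).
have H := dalongD (dalongB (dalongD (dalongB (dalongZ (-1) D1) D2) D3) D4) D5.
apply: dalong_eq H _ _ => x; first by rewrite /Z0; ring.
rewrite /Z0'.
have -> : \sum_i \sum_j (dom i j x * om i j x + om i j x * dom i j x) =
    2 * \sum_i \sum_j (om i j x * dom i j x).
  rewrite mulr_sumr; apply: eq_bigr => i _; rewrite mulr_sumr; apply: eq_bigr => j _.
  by ring.
by field.
Qed.

Let W' i j x := omm i j x * A x + om i j x *
  (- (2 * (be x * (dom i j x + n%:R / 2 * om i j x))) - be1 x * om i j x).

Let O_W i j : dalong (OY i j) (fun x => om i j x * A x) (W' i j).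
Proof. exact: dalongM. Qed.

(** The commutator of [S] and [A], computed pointwise: up to the radial and rotational divergences
    only squares remain, with coefficients that are multiples of [be1]. *)
Let SA x : S x * A x = (Z0' x + n%:R * Z0 x) + 2^-1 * (\sum_i \sum_j W' i j x)
  + 2 * be1 x * pv x ^+ 2 + (2 * be x ^+ 2 * be1 x - 2 * be1 x) * v x ^+ 2.
Proof.
have -> : \sum_i \sum_j W' i j x = A x * (\sum_i \sum_j omm i j x)
   - 2 * be x * (\sum_i \sum_j om i j x * dom i j x)
   - (n%:R * be x + be1 x) * (\sum_i \sum_j om i j x * om i j x).
  rewrite !mulr_sumr -!sumrB; apply: eq_bigr => i _.
  rewrite !mulr_sumr -!sumrB; apply: eq_bigr => j _.
  by rewrite /W'; field.
by rewrite /S /A /Z0 /Z0' /pv; field.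
Qed.

(** The pointwise inequality is [4 * S * A <= (S + A)^2], to which the divergence theorem is
    applied. On the free face [v = 0], so the boundary term contains only the normal derivative;
    where [be] is negative, its sign tells on which side of the hyperplane the pole lies. *)
Lemma carleman :
  bint a b (fun x => (8 * be x ^+ 2 * be1 x - 8 * be1 x) * v x ^+ 2
     + 8 * be1 x * (dv x + n%:R / 2 * v x) ^+ 2)
  - 4 * bint a' b' (fun x => p 0 ord0 * be (rV_cons (0, x)) * q (rV_cons (0, x))
      * g ord0 (rV_cons (0, x)) ^+ 2)
  <= bint a b (fun x => carleman_op x ^+ 2).
Proof.
have cq : continuous q by exact: dalong_continuous D_q.
have cbe : continuous be by exact: dalong_continuous D_be.
have cbe1 : continuous be1 by exact: dalong_continuous D_be1.
have cv : continuous v by exact: dalong_continuous D_v.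
have cdv : continuous dv by exact: dalong_continuous D_dv.
have cpv : continuous pv by exact: dalong_continuous D_pv.
have ch i j : continuous (h i j) by have [_ + _] := C1g i.
have cg i : continuous (g i) by have [+ _ _] := C1g i.
have cop : continuous carleman_op.
  apply: contB; last exact: contM.
  apply: contB; last by apply: contM => //; apply: contM => //; exact: cont_cst.
  apply: contD; last by apply: contM => //; apply: contD; [exact: cont_cst|exact: contX].
  apply: contD; last by apply: contM => //; exact: cont_cst.
  by apply: contM => //; apply: cont_sum => k; exact: ch.
have cZ0 : continuous Z0 by exact: dalong_continuous D_Z0.
have cX i : continuous (X i) by exact: cont_X.
have com1 i j k : continuous (om1 i j k).
  by apply: contB; apply: contD; apply: contM => //; exact: cont_cst.
have comm i j : continuous (omm i j) by apply: contB; exact: contM.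
have com i j : continuous (om i j) by apply: contB; exact: contM.
have cdom i j : continuous (dom i j).
  by apply: contD => //; apply: cont_sum => k; apply: contM => //; apply: contB; exact: contM.
have cA : continuous A by exact: dalong_continuous (O_A ord0 ord0).
have cW i j : continuous (W' i j).
  by rewrite /W'; cont_tac.
have vandv : van dv by apply: van_sum => k; exact/vanMl/vang.
have vanom i j : van (om i j) by apply: vanB; exact/vanMl/vang.
have vanZ0 : van Z0.
  move=> x lx; rewrite /Z0 /pv (vandv _ lx) (vanv lx) big1; first by ring.
  by move=> i _; rewrite big1// => j _; rewrite (vanom _ _ _ lx) mul0r.
have IZ := bint_dalongD D_Z0 vanZ0.
have IW i j := bint_dalongO (O_W i j) (vanM _ (vanom i j)).
pose y (x : 'rV[R]_d) := rV_cons (0, x) : V.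
(* Since [v] vanishes on the free face, so do its tangential derivatives there. *)
have g0 x i : g i (y x) = (i == ord0)%:R * g ord0 (y x).
  have [->|i0] := eqVneq i ord0; first by rewrite mul1r.
  case: (unliftP ord0 i) i0 => [j|] -> //= _; rewrite mul0r.
  have [_ _ dg] := C1v.
  have := is_derive_sliceS (dg (lift ord0 j) (y x)).
  rewrite (_ : (fun _ => _) = cst 0); last by apply/funext => z; rewrite v0.
  by move=> [_ <-]; rewrite derive_cst.
have sumX (f : 'I_n -> R) : \sum_i (i == ord0)%:R * f i = f ord0.
  by rewrite (bigD1 ord0)//= mul1r big1 ?addr0// => i /negbTE ->; rewrite mul0r.
have dv0 x : dv (y x) = X ord0 (y x) * g ord0 (y x).
  rewrite /dv -[RHS](sumX (fun i => X i (y x) * g ord0 (y x))).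
  by apply: eq_bigr => i _; rewrite g0; ring.
have pv0 x : pv (y x) = X ord0 (y x) * g ord0 (y x).
  by rewrite /pv dv0 v0 mulr0 addr0.
have om0 x i j : om i j (y x) = (X i (y x) * (j == ord0)%:R
    - X j (y x) * (i == ord0)%:R) * g ord0 (y x).
  by rewrite /om (g0 x i) (g0 x j); ring.
have om00 x : 2^-1 * (\sum_i \sum_j om i j (y x) * om i j (y x)) =
    (q (y x) - X ord0 (y x) ^+ 2) * g ord0 (y x) ^+ 2.
  have E i j : om i j (y x) * om i j (y x) = ((j == ord0)%:R * (X i (y x) ^+ 2)
     + (i == ord0)%:R * (X j (y x) ^+ 2) -
     (i == ord0)%:R * ((j == ord0)%:R * (2 * X i (y x) * X j (y x)))) * g ord0 (y x) ^+ 2.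
    by rewrite om0; case: (i == _); case: (j == _) => /=; ring.
  have -> : \sum_i \sum_j om i j (y x) * om i j (y x) = \sum_i (X i (y x) ^+ 2
      + (i == ord0)%:R * (q (y x) - 2 * X i (y x) * X ord0 (y x))) * g ord0 (y x) ^+ 2.
    apply: eq_bigr => i _; under eq_bigr do rewrite E.
    rewrite -mulr_suml; congr (_ * _); rewrite sumrB big_split/= (sumX (fun=> _)).
    rewrite -!mulr_sumr (sumX (fun j => 2 * X i (y x) * X j (y x))).
    by rewrite /q; ring.
  rewrite -mulr_suml big_split/= -/(q _).
  by rewrite (sumX (fun i => q (y x) - 2 * X i (y x) * X ord0 (y x))); field.
have bc' (f : V -> R) : continuous f -> bmf (obox a' b') (fun x => f (y x)).
  by move=> cf; apply: bmf_continuous; exact: cont_slice2.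
have bd : p 0 ord0 * bint a' b' (fun x => Z0 (y x)) + 2^-1 * \sum_i \sum_j bint a b (W' i j)
    = - bint a' b' (fun x => p 0 ord0 * be (y x) * q (y x) * g ord0 (y x) ^+ 2).
  have cXW k i j : continuous (fun x => X k x * (om i j x * A x)).
    by apply: contM => //; exact: contM.
  pose T i j x := (i == ord0)%:R * (X j x * (om i j x * A x))
     - (j == ord0)%:R * (X i x * (om i j x * A x)).
  have cT i j : continuous (T i j).
    by apply: contB; apply: contM => //; exact: cont_cst.
  have -> : \sum_i \sum_j bint a b (W' i j) = bint a' b' (fun x => \sum_i \sum_j T i j (y x)).
    rewrite bint_sum; last by move=> i; apply: bmf_sum => j; exact: bc'.
    apply: eq_bigr => i _; rewrite bint_sum; last by move=> j; exact: bc'.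
    apply: eq_bigr => j _.
    have B1 := bc' _ (cXW i i j); have B2 := bc' _ (cXW j i j).
    by rewrite IW /T bintB ?bintZ//; exact: bmfZ.
  have bT : bmf (obox a' b') (fun x => \sum_i \sum_j T i j (y x)).
    by apply: bmf_sum => i; apply: bmf_sum => j; exact: bc'.
  rewrite -bintZ; last exact: bc'.
  rewrite -bintZ// -bintD; [|by apply: bmfZ; exact: bc'|exact: bmfZ].
  rewrite -bintN; last first.
    have := bc' (fun x => p 0 ord0 * be x * q x * g ord0 x ^+ 2); apply.
    apply: contM; last exact: contX.
    by apply: contM => //; apply: contM => //; exact: cont_cst.
  apply: eq_bint => x _.
  have -> : \sum_i \sum_j T i j (y x) = - 2 * (q (y x) - X ord0 (y x) ^+ 2) * g ord0 (y x) * A (y x).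
    have -> : \sum_i \sum_j T i j (y x) = \sum_i ((i == ord0)%:R *
       (- (q (y x) - X ord0 (y x) ^+ 2) * g ord0 (y x) * A (y x)) +
       (- (X i (y x) ^+ 2 - (i == ord0)%:R * X i (y x) ^+ 2)) * g ord0 (y x) * A (y x)).
      apply: eq_bigr => i _; rewrite sumrB (sumX (fun j => X i (y x) * (om i j (y x) * A (y x)))).
      have [->|i0] := eqVneq i ord0; last first.
        rewrite !mul0r big1 ?add0r; last by move=> j _; rewrite mul0r.
        by rewrite om0 (negbTE i0) eqxx/=; ring.
      have E j : (ord0 == ord0 :> 'I_n)%:R * (X j (y x) * (om ord0 j (y x) * A (y x))) =
         ((j == ord0)%:R * X j (y x) ^+ 2 - X j (y x) ^+ 2) * (g ord0 (y x) * A (y x)).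
        rewrite om0 eqxx; have [->|] := eqVneq j ord0; first by rewrite /=; ring.
        by move=> _ /=; ring.
      under eq_bigr do rewrite E.
      rewrite -mulr_suml sumrB (sumX (fun j => X j (y x) ^+ 2)) -/(q _) om0 eqxx/=; ring.
    rewrite big_split/= (sumX (fun=> _)) -!mulr_suml sumrN sumrB (sumX (fun i => X i (y x) ^+ 2)).
    by rewrite -/(q _); ring.
  have X0 : p 0 ord0 = - X ord0 (y x) by rewrite /shiftc rV_cons0/=; ring.
  by rewrite /Z0 om00 /A pv0 v0 X0; field.
have bc (f : V -> R) : continuous f -> bmf (obox a b) f by exact: bmf_continuous.
have cS : continuous S.
  have -> : S = fun x => carleman_op x - A x by apply/funext => x; rewrite opE addrK.
  exact: contB.
pose T x := 2 * be1 x * pv x ^+ 2 + (2 * be x ^+ 2 * be1 x - 2 * be1 x) * v x ^+ 2.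
have cT : continuous T by rewrite /T; cont_tac.
have cZ0' : continuous Z0'.
  have -> : Z0' = fun x => S x * A x - T x - 2^-1 * (\sum_i \sum_j W' i j x) - n%:R * Z0 x.
    by apply/funext => x; rewrite SA /T; ring.
  by cont_tac.
have ESA : bint a b (fun x => S x * A x) = bint a b T
   - bint a' b' (fun x => p 0 ord0 * be (y x) * q (y x) * g ord0 (y x) ^+ 2).
  rewrite -bd -IZ.
  have -> : \sum_i \sum_j bint a b (W' i j) = bint a b (fun x => \sum_i \sum_j W' i j x).
    rewrite bint_sum; last by move=> i; apply: bmf_sum => j; exact: bc.
    by apply: eq_bigr => i _; rewrite bint_sum// => j; exact: bc.
  have b1 : bmf (obox a b) T by exact: bc.
  have b2 : bmf (obox a b) (fun x => Z0' x + n%:R * Z0 x) by apply: bc; cont_tac.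
  have b3 : bmf (obox a b) (fun x => \sum_i \sum_j W' i j x) by apply: bc; cont_tac.
  rewrite -bintZ// -bintD//; last exact: bmfZ.
  rewrite -bintD//; last by apply: bmfD => //; exact: bmfZ.
  by apply: eq_bint => x _; rewrite SA /T; ring.
rewrite (_ : bint a b _ = 4 * bint a b T); last first.
  by rewrite -bintZ; [apply: eq_bint => x _; rewrite /T /pv; ring|exact: bc].
rewrite -mulrBr -ESA -bintZ; last by apply: bc; exact: contM.
apply: le_bint.
- by apply: bc; apply: contM; [exact: cont_cst|exact: contM].
- by apply: bc; exact: contX.
- by move=> x _; rewrite opE -subr_ge0 (_ : _ - _ = (S x - A x) ^+ 2) ?sqr_ge0//; ring.
Qed.

End carleman.

(** * Cutoff functions *)

Section onedim.
Context {R : realType}.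
Implicit Types (f g h : R -> R) (t : R).

Lemma is_derive1M f g t df dg : is_derive t (1 : R) f df -> is_derive t (1 : R) g dg ->
  is_derive t (1 : R) (fun x => f x * g x) (df * g t + f t * dg).
Proof.
move=> Hf Hg; have := @is_deriveM _ _ f g t 1 _ _ Hf Hg.
by move=> H; apply: is_derive_eq H _; rewrite /GRing.scale/= addrC mulrC.
Qed.

Lemma is_derive1D f g t df dg : is_derive t (1 : R) f df -> is_derive t (1 : R) g dg ->
  is_derive t (1 : R) (fun x => f x + g x) (df + dg).
Proof. by move=> Hf Hg; exact: is_deriveD. Qed.

Lemma is_derive1B f g t df dg : is_derive t (1 : R) f df -> is_derive t (1 : R) g dg ->
  is_derive t (1 : R) (fun x => f x - g x) (df - dg).
Proof. by move=> Hf Hg; exact: is_deriveB. Qed.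

Lemma is_derive1Z (k : R) f t df : is_derive t (1 : R) f df ->
  is_derive t (1 : R) (fun x => k * f x) (k * df).
Proof. by move=> Hf; exact: is_deriveZ. Qed.

Lemma is_derive1_affine f t k l df : is_derive (k * t + l) (1 : R) f df ->
  is_derive t (1 : R) (fun x => f (k * x + l)) (k * df).
Proof.
move=> Hf; rewrite mulrC.
apply: (@is_derive1_comp _ f (fun x => k * x + l)) => //.
apply: is_derive_eq; rewrite addr0; exact: mulr1.
Qed.

Lemma is_derive_near f g t df : (\forall x \near t, f x = g x) ->
  is_derive t (1 : R) f df -> is_derive t (1 : R) g df.
Proof. by move=> fg; apply: near_eq_is_derive. Qed.

Lemma cont_id : continuous (fun t : R => t). Proof. by move=> t; exact: cvg_id. Qed.

Lemma is_derive1_id t : is_derive t (1 : R) (fun x => x) 1.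
Proof. exact: is_derive_id. Qed.

Lemma is_derive1X k t : is_derive t (1 : R) (fun x => x ^+ k.+1) (k.+1%:R * t ^+ k).
Proof.
elim: k => [|k IH]; first by rewrite expr0 mul1r; exact: is_derive1_id.
rewrite (_ : (fun x => _) = (fun x => x * x ^+ k.+1)).
  have H := is_derive1M (is_derive1_id t) IH; apply: is_derive_eq H _.
  by rewrite -[in RHS]natr1 !exprS; ring.
by apply/funext => x; rewrite exprS.
Qed.

Definition posp (k : nat) t : R := Num.max 0 t ^+ k.

Lemma continuous_posp k : continuous (posp k).
Proof.
apply: contX => x; apply: continuous_max; first exact: cst_continuous.
exact: cont_id.
Qed.

Lemma is_derive_posp k t :
  is_derive t (1 : R) (posp k.+2) (k.+2%:R * posp k.+1 t).
Proof.
have [t0|t0|->] := ltgtP t 0.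
- apply: (@is_derive_near (cst 0)).
    near=> x; rewrite /posp max_l; first by rewrite expr0n.
    by apply/ltW; near: x; exact: lt_nbhsl.
  apply: is_derive_eq; rewrite /posp max_l ?ltW// expr0n mulr0//.
- apply: (@is_derive_near (fun x => x ^+ k.+2)).
    near=> x; rewrite /posp max_r//.
    by apply/ltW; near: x; exact: lt_nbhsr.
  by rewrite /posp max_r ?ltW//; exact: is_derive1X.
- have H : (fun h : R => h^-1 *: ((posp k.+2 \o shift 0) (h *: (1 : R)) - posp k.+2 0)) @ 0^' --> (0 : R).
    apply: (@cvg_trans _ (posp k.+1 h @[h --> 0^'])).
      apply: near_eq_cvg; near=> h.
      rewrite /= addr0 [h *: 1]mulr1 /posp [X in _ - X ^+ _]max_l// expr0n subr0.
      have h0 : h != 0 by near: h; exact: nbhs_dnbhs_neq.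
      case: (leP h 0) => h1; first by rewrite !expr0n/= scaler0.
      by rewrite [in RHS]exprS /GRing.scale/= mulrA mulVf// mul1r.
    have : posp k.+1 h @[h --> 0^'] --> posp k.+1 0.
      by apply/continuous_withinNx; exact: continuous_posp.
    by rewrite /posp max_l// expr0n.
  have -> : k.+2%:R * posp k.+1 0 = 0 by rewrite /posp max_l// expr0n mulr0.
  split; first by apply/cvg_ex; exists 0.
  by apply/cvg_lim.
Unshelve. all: by end_near. Qed.

(* The cubic B-spline step: 0 on [-oo, 0] and 1 on [3, +oo]. *)
Definition bstep (k : nat) (c : R) t := c * (posp k t - 3 * posp k (t - 1)
  + 3 * posp k (t - 2) - posp k (t - 3)).
Definition step0 := bstep 3 6^-1.
Definition step1 := bstep 2 2^-1.
Definition step2 := bstep 1 1.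

Lemma is_derive_bstep k (c c' : R) t : c' = c * k.+2%:R ->
  is_derive t (1 : R) (bstep k.+2 c) (bstep k.+1 c' t).
Proof.
move=> ->.
have P u : is_derive t (1 : R) (fun x => posp k.+2 (x - u)) (k.+2%:R * posp k.+1 (t - u)).
  have := @is_derive1_affine (posp k.+2) t 1 (- u) _ (is_derive_posp k _).
  rewrite !mul1r => H; apply: is_derive_near H.
  by near=> x; rewrite mul1r.
have P0 : is_derive t (1 : R) (posp k.+2) (k.+2%:R * posp k.+1 t) by exact: is_derive_posp.
have := is_derive1Z c (is_derive1B (is_derive1D (is_derive1B P0 (is_derive1Z 3 (P 1)))
  (is_derive1Z 3 (P 2))) (P 3)).
by move=> H; apply: is_derive_eq H _; rewrite /bstep; ring.
Unshelve. all: by end_near. Qed.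

Lemma continuous_bstep k c : continuous (bstep k c).
Proof.
have P u : continuous (fun x => posp k (x - u)).
  apply: cont_comp1; first exact: continuous_posp.
  by apply: contB; [exact: cont_id|exact: cont_cst].
have P0 : continuous (posp k) by exact: continuous_posp.
apply: contM; first exact: cont_cst.
apply: contB => //; apply: contD; last by apply: contM => //; exact: cont_cst.
by apply: contB => //; apply: contM => //; exact: cont_cst.
Qed.

Lemma bstep_le0 k c t : t <= 0 -> bstep k.+1 c t = 0.
Proof.
move=> t0; have E u : u <= 0 -> posp k.+1 u = 0 by move=> u0; rewrite /posp max_l// expr0n.
by rewrite /bstep !E; [ring|lra..].
Qed.

Lemma step0_ge3 t : 3 <= t -> step0 t = 1.
Proof. by move=> t3; rewrite /step0 /bstep /posp !max_r; [field|lra..]. Qed.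

Lemma step1_ge3 t : 3 <= t -> step1 t = 0.
Proof. by move=> t3; rewrite /step1 /bstep /posp !max_r; [field|lra..]. Qed.

Lemma step2_ge3 t : 3 <= t -> step2 t = 0.
Proof. by move=> t3; rewrite /step2 /bstep /posp !max_r; [field|lra..]. Qed.

Lemma bstep_bound k' (k := k'.+1) c t : 0 <= c -> t <= 3 ->
  `|bstep k c t| <= 8 * c * 3 ^+ k.
Proof.
move=> c0 t3.
have P u : 0 <= u -> `|posp k (t - u)| <= 3 ^+ k.
  move=> u0; rewrite /posp normrX ler_pXn2r ?nnegrE//.
  by rewrite ger0_norm ?le_max ?lexx// ge_max; apply/andP; split; lra.
have P0 : `|posp k t| <= 3 ^+ k by rewrite -[t]subr0 P.
rewrite /bstep normrM ger0_norm// mulrAC mulrC ler_wpM2r//.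
have := P 1 ler01; have := P 2 (ler0n _ 2); have := P 3 (ler0n _ 3).
rewrite !ler_norml; move: P0; rewrite !ler_norml; move=> *; lra.
Qed.

Lemma step_bounds t : [/\ `|step0 t| <= 36, `|step1 t| <= 36 & `|step2 t| <= 36].
Proof.
have [t3|t3] := leP t 3; last first.
  by rewrite step0_ge3 ?step1_ge3 ?step2_ge3 ?normr0 ?normr1; [split; lra|lra..].
split; (apply: le_trans (bstep_bound _ _ t3) _; lra).
Qed.

Lemma continuous_is_derive f (df t : R) : is_derive t (1 : R) f df -> {for t, continuous f}.
Proof.
by move=> [Df _]; apply: differentiable_continuous; exact/derivable1_diffP.
Qed.

(** The Carleman weight is singular at 0, but it is always multiplied by cutoffs vanishing below
    [q0]; derivatives thus have to be computed for positive arguments only. *)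
Lemma is_derive_cut (f f1 : R -> R) (q0 : R) : 0 < q0 ->
  (forall t, t <= q0 -> f t = 0 /\ f1 t = 0) ->
  (forall t, 0 < t -> is_derive t (1 : R) f (f1 t)) ->
  forall t, is_derive t (1 : R) f (f1 t).
Proof.
move=> q00 f0 df t; have [t0|t0] := ltP 0 t; first exact: df.
have tq : t < q0 by exact: le_lt_trans q00.
have [_ ->] := f0 _ (ltW tq).
apply: (@is_derive_near (cst (0 : R))).
near=> x; have [//|->] := f0 x _ => //.
by apply/ltW; near: x; exact: lt_nbhsl.
Unshelve. all: by end_near. Qed.

Lemma continuous_cut (f : R -> R) (q0 : R) : 0 < q0 ->
  (forall t, t <= q0 -> f t = 0) ->
  (forall t, 0 < t -> {for t, continuous f}) -> continuous f.
Proof.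
move=> q00 f0 cf t; have [t0|t0] := ltP 0 t; first exact: cf.
have tq : t < q0 by exact: le_lt_trans q00.
apply: (@cvg_trans _ (cst (0 : R) @ t)).
  apply: near_eq_cvg; near=> x; rewrite /= f0//.
  by apply/ltW; near: x; exact: lt_nbhsl.
have -> : f t = 0 by apply: f0; exact: ltW.
by have := @cst_continuous R R (0 : R) t; apply.
Unshelve. all: by end_near. Qed.

End onedim.

Section cutoff.
Context {R : realType}.
Variables (q0 q1 q2 q3 : R).
Hypothesis q00 : 0 < q0.
Hypothesis q01 : q0 < q1.
Hypothesis q12 : q1 < q2.
Hypothesis q23 : q2 < q3.

Let k1 := 3 / (q1 - q0).
Let l1 := - (k1 * q0).
Let k2 := 3 / (q3 - q2).
Let l2 := - (k2 * q2).

(** A rise on [[q0, q1]] times a fall on [[q2, q3]]. The 3 in [k1] and [k2] rescales these intervals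
    to [[0, 3]], where the spline step moves. *)
Definition eta0 t : R := step0 (k1 * t + l1) * (1 - step0 (k2 * t + l2)).
Definition eta1 t : R := k1 * step1 (k1 * t + l1) * (1 - step0 (k2 * t + l2))
  - step0 (k1 * t + l1) * (k2 * step1 (k2 * t + l2)).
Definition eta2 t : R := k1 ^+ 2 * step2 (k1 * t + l1) * (1 - step0 (k2 * t + l2))
  - 2 * (k1 * step1 (k1 * t + l1)) * (k2 * step1 (k2 * t + l2))
  - step0 (k1 * t + l1) * (k2 ^+ 2 * step2 (k2 * t + l2)).

Let k10 : 0 < k1. Proof. by rewrite divr_gt0// subr_gt0. Qed.
Let k20 : 0 < k2. Proof. by rewrite divr_gt0// subr_gt0. Qed.

Let d0 k l t : is_derive t (1 : R) (fun t => step0 (k * t + l)) (k * step1 (k * t + l)).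
Proof. by apply: is_derive1_affine; apply: is_derive_bstep; field. Qed.

Let d1 k l t : is_derive t (1 : R) (fun t => step1 (k * t + l)) (k * step2 (k * t + l)).
Proof. by apply: is_derive1_affine; apply: is_derive_bstep; field. Qed.

Lemma is_derive_eta0 t : is_derive t (1 : R) eta0 (eta1 t).
Proof.
have H := is_derive1M (d0 k1 l1 t) (is_derive1B (is_derive_cst (1 : R) t (1 : R)) (d0 k2 l2 t)).
by apply: is_derive_eq H _; rewrite /eta1 /=; ring.
Qed.

Lemma is_derive_eta1 t : is_derive t (1 : R) eta1 (eta2 t).
Proof.
have H := is_derive1B (is_derive1M (is_derive1Z k1 (d1 k1 l1 t)) (is_derive1B (is_derive_cst (1 : R) t (1 : R)) (d0 k2 l2 t)))
  (is_derive1M (d0 k1 l1 t) (is_derive1Z k2 (d1 k2 l2 t))).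
by apply: is_derive_eq H _; rewrite /eta2 /=; ring.
Qed.

Lemma continuous_eta2 : continuous eta2.
Proof.
have A k l : continuous (fun t : R => k * t + l).
  by apply: contD; [apply: contM; [exact: cont_cst|exact: cont_id]|exact: cont_cst].
have S0 k l : continuous (fun t : R => step0 (k * t + l)).
  by apply: cont_comp1 => //; exact: continuous_bstep.
have S1 k l : continuous (fun t : R => step1 (k * t + l)).
  by apply: cont_comp1 => //; exact: continuous_bstep.
have S2 k l : continuous (fun t : R => step2 (k * t + l)).
  by apply: cont_comp1 => //; exact: continuous_bstep.
by rewrite /eta2; cont_tac.
Qed.

Lemma eta_le t : t <= q0 -> [/\ eta0 t = 0, eta1 t = 0 & eta2 t = 0].
Proof.
move=> tq; have H : k1 * t + l1 <= 0 by rewrite /l1 -mulrBr pmulr_rle0// subr_le0.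
by rewrite /eta0 /eta1 /eta2 /step0 /step1 /step2 !(bstep_le0 _ _ H); split; ring.
Qed.

Lemma eta_ge t : q3 <= t -> [/\ eta0 t = 0, eta1 t = 0 & eta2 t = 0].
Proof.
move=> tq; have H : 3 <= k2 * t + l2.
  by rewrite /l2 -mulrBr /k2 mulrAC ler_pdivlMr ?subr_gt0// ler_pM2l// lerB.
by rewrite /eta0 /eta1 /eta2 (step0_ge3 H) (step1_ge3 H) (step2_ge3 H); split; ring.
Qed.

Lemma eta_mid t : q1 <= t <= q2 -> [/\ eta0 t = 1, eta1 t = 0 & eta2 t = 0].
Proof.
move=> /andP[t1 t2]; have H : 3 <= k1 * t + l1.
  by rewrite /l1 -mulrBr /k1 mulrAC ler_pdivlMr ?subr_gt0// ler_pM2l// lerB.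
have H2 : k2 * t + l2 <= 0 by rewrite /l2 -mulrBr pmulr_rle0// subr_le0.
rewrite /eta0 /eta1 /eta2 (step0_ge3 H) (step1_ge3 H) (step2_ge3 H).
by rewrite /step0 /step1 /step2 !(bstep_le0 _ _ H2); split; ring.
Qed.

(* [r] controls the relative widths of the two transition shells. *)
Lemma eta_bounds (r t : R) : q1 <= r * (q1 - q0) -> q3 <= r * (q3 - q2) -> 0 <= t <= q3 ->
  [/\ `|eta0 t| <= 36 * 37, `|t * eta1 t| <= 36 * 37 * 6 * r &
      `|t ^+ 2 * eta2 t| <= 36 * 37 * 36 * r ^+ 2].
Proof.
move=> r1 r2 /andP[t0 t3].
have [s1 s2 s3] := step_bounds (k1 * t + l1).
have [u1 u2 u3] := step_bounds (k2 * t + l2).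
have q1r : k1 * q1 <= 3 * r by rewrite /k1 mulrAC ler_pdivrMr ?subr_gt0// -mulrA ler_pM2l.
have q3r : k2 * q3 <= 3 * r by rewrite /k2 mulrAC ler_pdivrMr ?subr_gt0// -mulrA ler_pM2l.
have r0 : 0 <= r by have := mulr_ge0 (ltW k10) (ltW (lt_trans q00 q01)); lra.
(* The rising step is constant beyond [q1], so its derivatives count only where [t <= q1]; for the
   falling step the bound [t <= q3] is enough. *)
have H1 : (step1 (k1 * t + l1) = 0 /\ step2 (k1 * t + l1) = 0) \/ k1 * t <= 3 * r.
  have [tq|tq] := leP t q1; first by right; rewrite (le_trans _ q1r)// ler_pM2l.
  left; have H : 3 <= k1 * t + l1.
    by rewrite /l1 -mulrBr /k1 mulrAC ler_pdivlMr ?subr_gt0// ler_pM2l// lerB// ltW.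
  by rewrite (step1_ge3 H) (step2_ge3 H).
have k2t : k2 * t <= 3 * r by rewrite (le_trans _ q3r)// ler_pM2l.
have k1t0 : 0 <= k1 * t by rewrite mulr_ge0// ltW.
have k2t0 : 0 <= k2 * t by rewrite mulr_ge0// ltW.
have bM (x y M N : R) : `|x| <= M -> `|y| <= N -> `|x * y| <= M * N.
  by move=> ? ?; rewrite normrM ler_pM.
have A1 : `|k1 * t * step1 (k1 * t + l1)| <= 3 * r * 36.
  case: H1 => [[-> _]|H]; first by rewrite mulr0 normr0; lra.
  by apply: bM => //; rewrite ger0_norm.
have A2 : `|(k1 * t) ^+ 2 * step2 (k1 * t + l1)| <= (3 * r) ^+ 2 * 36.
  case: H1 => [[_ ->]|H]; first by rewrite mulr0 normr0 mulr_ge0// sqr_ge0.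
  by apply: bM => //; rewrite normrX ger0_norm// ler_pXn2r ?nnegrE// mulr_ge0.
have B1 : `|k2 * t * step1 (k2 * t + l2)| <= 3 * r * 36 by apply: bM => //; rewrite ger0_norm.
have B2 : `|(k2 * t) ^+ 2 * step2 (k2 * t + l2)| <= (3 * r) ^+ 2 * 36.
  by apply: bM => //; rewrite normrX ger0_norm// ler_pXn2r ?nnegrE// mulr_ge0.
have C : `|1 - step0 (k2 * t + l2)| <= 37.
  by rewrite (le_trans (ler_normB _ _))// normr1; lra.
split.
- by apply: bM.
- rewrite (_ : t * eta1 t = (k1 * t * step1 (k1 * t + l1)) * (1 - step0 (k2 * t + l2))
    - step0 (k1 * t + l1) * (k2 * t * step1 (k2 * t + l2))); last by rewrite /eta1; ring.
  apply: le_trans (ler_normB _ _) _.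
  have := bM _ _ _ _ A1 C; have := bM _ _ _ _ s1 B1; lra.
- rewrite (_ : t ^+ 2 * eta2 t = ((k1 * t) ^+ 2 * step2 (k1 * t + l1)) * (1 - step0 (k2 * t + l2))
    - 2 * ((k1 * t * step1 (k1 * t + l1)) * (k2 * t * step1 (k2 * t + l2)))
    - step0 (k1 * t + l1) * ((k2 * t) ^+ 2 * step2 (k2 * t + l2))); last by rewrite /eta2; ring.
  apply: le_trans (ler_normB _ _) _; apply: le_trans (lerD (ler_normB _ _) (lexx _)) _.
  rewrite [X in _ + X + _]normrM (ger0_norm (ler0n R 2)).
  have := bM _ _ _ _ A2 C; have := bM _ _ _ _ s1 B2; have := bM _ _ _ _ A1 B1; nra.
Qed.

Variables (al c : R).
Let om t : R := expR (- ((al + 1) / 2) * ln t + al * c / 2 * t).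
Let be t : R := - al + al * c * t.

Definition weight := om.
Definition chi0 t := om t * eta0 t.
Definition chi1 t := om t * ((be t - 1) / (2 * t) * eta0 t + eta1 t).
Definition chi2 t := om t * (((be t - 1) ^+ 2 / (4 * t ^+ 2) + al * c / (2 * t) - (be t - 1) / (2 * t ^+ 2)) * eta0 t
  + (be t - 1) / t * eta1 t + eta2 t).
(** Up to a factor 4, the coefficient of the radial derivative of [F] in the commutator of the
    operator with the cutoff. It serves as the cutoff of the Caccioppoli inequality that removes
    this derivative. *)
Definition zeta0 t := om t * (t * eta1 t).
Definition zeta1 t := om t * ((be t + 1) / 2 * eta1 t + t * eta2 t).

Let is_derive_om (t : R) : 0 < t -> is_derive t (1 : R) om (om t * ((be t - 1) / (2 * t))).
Proof.
move=> t0.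
have H := is_derive1D (is_derive1Z (- ((al + 1) / 2)) (is_derive1_ln t0))
  (is_derive1Z (al * c / 2) (is_derive1_id t)).
have := is_derive1_comp (is_derive_expR _) H.
by move=> H'; apply: is_derive_eq H' _; rewrite /om /be; field; lra.
Qed.

Let is_derive_be t : is_derive t (1 : R) be (al * c).
Proof.
have H := is_derive1D (is_derive_cst (- al) t (1 : R)) (is_derive1Z (al * c) (is_derive1_id t)).
by apply: is_derive_eq H _; rewrite mulr1 add0r.
Qed.

Let is_derive_inv (t : R) : 0 < t -> is_derive t (1 : R) (fun t => t^-1) (- t ^- 2).
Proof.
move=> t0; have t1 : t != 0 by rewrite gt_eqF.
have H := @is_deriveV _ id t 1 1 t1 (is_derive_id _ _).
by apply: is_derive_eq H _; rewrite /GRing.scale/= mulr1.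
Qed.

Lemma is_derive_chi0 t : is_derive t (1 : R) chi0 (chi1 t).
Proof.
move: t; apply: (is_derive_cut q00) => t.
  by move=> /eta_le[e0 e1 e2]; rewrite /chi0 /chi1 e0 e1; split; ring.
move=> t0; have H := is_derive1M (is_derive_om t0) (is_derive_eta0 t).
by apply: is_derive_eq H _; rewrite /chi1; ring.
Qed.

Lemma is_derive_chi1 t : is_derive t (1 : R) chi1 (chi2 t).
Proof.
move: t; apply: (is_derive_cut q00) => t.
  by move=> /eta_le[e0 e1 e2]; rewrite /chi1 /chi2 e0 e1 e2; split; ring.
move=> t0; have H := is_derive1M (is_derive_om t0) (is_derive1D (is_derive1M
  (is_derive1M (is_derive1B (is_derive_be t) (is_derive_cst (1 : R) t (1 : R))) (is_derive1Z 2^-1 (is_derive_inv t0)))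
  (is_derive_eta0 t)) (is_derive_eta1 t)).
rewrite (_ : chi1 = fun x => om x * ((be x - 1) * (2^-1 * x^-1) * eta0 x + eta1 x)); last first.
  by apply/funext => x; rewrite /chi1 invfM.
by apply: is_derive_eq H _; rewrite /chi2/=; field; lra.
Qed.

Lemma is_derive_zeta0 t : is_derive t (1 : R) zeta0 (zeta1 t).
Proof.
move: t; apply: (is_derive_cut q00) => t.
  by move=> /eta_le[e0 e1 e2]; rewrite /zeta0 /zeta1 e1 e2; split; ring.
move=> t0; have H := is_derive1M (is_derive_om t0) (is_derive1M (is_derive1_id t) (is_derive_eta1 t)).
by apply: is_derive_eq H _; rewrite /zeta1/=; field; lra.
Qed.

Let cont_om t : 0 < t -> {for t, continuous om}.
Proof. by move=> /is_derive_om; exact: continuous_is_derive. Qed.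

Lemma continuous_chi2 : continuous chi2.
Proof.
apply: (continuous_cut q00) => t.
  by move=> /eta_le[e0 e1 e2]; rewrite /chi2 e0 e1 e2; ring.
move=> t0.
have cbe : be x @[x --> t] --> be t by exact: continuous_is_derive (is_derive_be t).
have c0 : eta0 x @[x --> t] --> eta0 t by exact: (continuous_is_derive (is_derive_eta0 t)).
have c1 : eta1 x @[x --> t] --> eta1 t by exact: (continuous_is_derive (is_derive_eta1 t)).
have c2 : eta2 x @[x --> t] --> eta2 t by exact: continuous_eta2.
have ci : x^-1 @[x --> t] --> t^-1 by apply: cvgV => //; rewrite gt_eqF.
apply: cvgM; first exact: cont_om.
apply: cvgD => //; apply: cvgD; last first.
  by apply: cvgM => //; apply: cvgM => //; apply: cvgB => //; exact: cvg_cst.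
have cb1 : (be x - 1) @[x --> t] --> be t - 1 by apply: cvgB => //; exact: cvg_cst.
have E k (z : R) : 0 < z -> (z * x ^+ k)^-1 @[x --> t] --> (z * t ^+ k)^-1.
  move=> z0; apply: cvgV; first by rewrite gt_eqF// mulr_gt0// exprn_gt0.
  by apply: cvgM; [exact: cvg_cst|exact: exprn_continuous].
apply: cvgM => //; apply: cvgB; last by apply: cvgM => //; exact: E.
apply: cvgD; first by apply: cvgM; [apply: cvgM|exact: E].
apply: cvgM; first exact: cvg_cst.
exact: (E 1%N).
Qed.

Lemma continuous_weight_eta1 : continuous (fun t => om t * eta1 t).
Proof.
apply: (continuous_cut q00) => t.
  by move=> /eta_le[e0 e1 e2]; rewrite e1 mulr0.
move=> t0; apply: cvgM; first exact: cont_om.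
exact: (continuous_is_derive (is_derive_eta1 t)).
Qed.

Lemma continuous_weight_eta2 : continuous (fun t => om t * eta2 t).
Proof.
apply: (continuous_cut q00) => t.
  by move=> /eta_le[e0 e1 e2]; rewrite e2 mulr0.
by move=> t0; apply: cvgM; [exact: cont_om|exact: continuous_eta2].
Qed.

Lemma continuous_zeta1 : continuous zeta1.
Proof.
apply: (continuous_cut q00) => t.
  by move=> /eta_le[e0 e1 e2]; rewrite /zeta1 e1 e2; ring.
move=> t0.
have cbe : be x @[x --> t] --> be t by exact: continuous_is_derive (is_derive_be t).
have c1 : eta1 x @[x --> t] --> eta1 t by exact: (continuous_is_derive (is_derive_eta1 t)).
have c2 : eta2 x @[x --> t] --> eta2 t by exact: continuous_eta2.
apply: cvgM; first exact: cont_om.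
apply: cvgD; last by apply: cvgM.
apply: cvgM => //; apply: cvgM; last exact: cvg_cst.
by apply: cvgD => //; exact: cvg_cst.
Qed.

End cutoff.

(** * Local estimate with a cutoff *)

Section weight.
Context {R : realType}.
Implicit Types s t u w al c : R.

(** The tangent inequality [ln y <= y - 1] at [y = s / t]. *)
Lemma ln_sub_ge s t : 0 < s -> 0 < t -> (t - s) / t <= ln t - ln s.
Proof.
move=> s0 t0; have := le_ln1Dx (x := s / t - 1).
rewrite [1 + _]addrC subrK ln_div ?posrE// => H.
have -> : (t - s) / t = - (s / t - 1) by field; lra.
by rewrite lerNl opprB; apply: H; have := divr_gt0 s0 t0; lra.
Qed.

Lemma weight_gt0 al c t : 0 < weight al c t. Proof. exact: expR_gt0. Qed.

Lemma weight_decr al c s t : 0 <= al -> 0 < s -> s <= t -> c * t <= 2^-1 ->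
  weight al c t <= weight al c s.
Proof.
move=> al0 s0 st ct; rewrite /weight ler_expR.
have t0 : 0 < t by exact: lt_le_trans st.
have L := ln_sub_ge s0 t0.
have C : c * (t - s) <= (t - s) / t.
  rewrite mulrC ler_wpM2l ?subr_ge0// -[t^-1]mul1r ler_pdivlMr//; lra.
have : 0 <= (t - s) / t by rewrite divr_ge0 ?subr_ge0// ltW.
nra.
Qed.

Lemma weight_decr_mul al c s t : 0 <= al -> 0 < s -> s <= t -> c * t <= 2^-1 ->
  t * weight al c t ^+ 2 <= s * weight al c s ^+ 2.
Proof.
move=> al0 s0 st ct; have t0 : 0 < t by exact: lt_le_trans st.
rewrite -[X in X * _ <= _]lnK ?posrE// -[X in _ <= X * _]lnK ?posrE//.
rewrite /weight -!expRM_natl -!expRD ler_expR.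
have L := ln_sub_ge s0 t0.
have C : c * (t - s) <= (t - s) / t.
  rewrite mulrC ler_wpM2l ?subr_ge0// -[t^-1]mul1r ler_pdivlMr//; lra.
nra.
Qed.

(** The exponential factor of the weight increases and is dropped, so the ratio is that of the
    powers. With [u] of the order of the squared small scale, this produces the power of [delta]. *)
Lemma weight_ratio_inner al c u w : 0 <= al -> 0 <= c -> 0 < u -> u <= w ->
  weight al c u ^+ 2 <= expR ((al + 1) * ln (w / u)) * weight al c w ^+ 2.
Proof.
move=> al0 c0 u0 uw; have w0 : 0 < w by exact: lt_le_trans uw.
rewrite /weight -!expRM_natl -expRD ler_expR ln_div ?posrE//.
have : 0 <= al * c * (w - u) by rewrite mulr_ge0 ?subr_ge0// mulr_ge0.
nra.
Qed.

(** The power decays at the rate [(u - w) / u] by the tangent inequality, and [c * u <= 2^-1] lets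
    the exponential factor give back at most half of it. *)
Lemma weight_ratio_outer al c u w : 0 <= al -> c * u <= 2^-1 -> 0 < w -> w <= u ->
  weight al c u ^+ 2 <= expR (- (al * ((u - w) / (2 * u)))) * weight al c w ^+ 2.
Proof.
move=> al0 cu w0 wu; have u0 : 0 < u by exact: lt_le_trans wu.
rewrite /weight -!expRM_natl -expRD ler_expR.
have L := ln_sub_ge w0 u0.
have E : (u - w) / (2 * u) = (u - w) / u / 2 by rewrite invfM mulrA mulrAC.
have C : c * (u - w) <= (u - w) / u / 2.
  rewrite mulrC -mulrA ler_wpM2l ?subr_ge0// mulrC ler_pdivlMr//.
have : 0 <= (u - w) / u by rewrite divr_ge0 ?subr_ge0// ltW.
rewrite E; nra.
Qed.

End weight.

Section local.
Context {R : realType} {d : nat}.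
Local Notation n := d.+1.
Local Notation V := 'rV[R]_n.
Variables (p : V) (a b : 'I_n -> R).
Hypothesis ab : forall i, a i <= b i.
Hypothesis a0 : a ord0 = 0.
Local Notation a' := (fun i => a (lift ord0 i)).
Local Notation b' := (fun i => b (lift ord0 i)).
Local Notation X := (shiftc p).
Local Notation q := (dist2 p).
Variables (F : V -> R) (G : 'I_n -> V -> R) (H : 'I_n -> 'I_n -> V -> R).
Hypothesis C2F : C2 F G H.
Hypothesis F0 : forall x, F (rV_cons (0, x)) = 0.

Definition lapl (x : V) := \sum_i H i i x.
Let DF (x : V) := \sum_k X k x * G k x.

Lemma C2_dist2 : C2 q (fun i x => 2 * X i x) (fun i j x => 2 * (i == j)%:R).
Proof.
have C := C2_sum (index_enum 'I_n) (fun k => C2M (C2_coord (p 0 k) k) (C2_coord (p 0 k) k)).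
apply: C2_eq C _ _ _ => [x|i x|i j x].
- by apply: eq_bigr => k _; rewrite expr2.
- rewrite (bigD1 i)//= eqxx big1 ?addr0; first by rewrite /shiftc /=; ring.
  by move=> k; rewrite eq_sym => /negbTE ->; rewrite mul0r mulr0 addr0.
- rewrite (bigD1 i)//= eqxx big1 ?addr0; first by rewrite (eq_sym j) /=; ring.
  by move=> k; rewrite eq_sym => /negbTE ->; rewrite !(mul0r,mulr0,addr0).
Qed.

Lemma dist2_ge0 x : 0 <= q x.
Proof. by apply: sumr_ge0 => i _; exact: sqr_ge0. Qed.

Lemma sum_shiftc x : \sum_k X k x * X k x = q x.
Proof. by apply: eq_bigr => k _; rewrite expr2. Qed.

Lemma continuous_dist2 : continuous q. Proof. by have [[]] := C2_dist2. Qed.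

(** The Cauchy-Schwarz inequality, by Lagrange's identity. *)
Lemma sqr_radial x : DF x ^+ 2 <= q x * \sum_k G k x ^+ 2.
Proof.
rewrite -subr_ge0.
have -> : q x * (\sum_k G k x ^+ 2) - DF x ^+ 2 =
    2^-1 * \sum_i \sum_j (X i x * G j x - X j x * G i x) ^+ 2.
  have -> : \sum_i \sum_j (X i x * G j x - X j x * G i x) ^+ 2 =
      \sum_i (X i x ^+ 2 * (\sum_k G k x ^+ 2) + q x * G i x ^+ 2
        - 2 * (X i x * G i x) * DF x).
    apply: eq_bigr => i _; rewrite /q /DF !mulr_sumr mulr_suml -!big_split/= -sumrB.
    by apply: eq_bigr => j _; ring.
  rewrite sumrB big_split/= -!mulr_suml -!mulr_sumr -/(q x) -/(DF x).
  by field.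
by rewrite mulr_ge0// sumr_ge0// => i _; rewrite sumr_ge0// => j _; exact: sqr_ge0.
Qed.

(** The divergence of [ze^2 * F * grad F] has integral 0, its flux through the free face vanishing
    with [F]. Subtracting it twice from the left integrand leaves minus the square of
    [ze * grad F + 4 * ze1 * F * X], plus the terms of the right side. *)
Lemma caccioppoli (ze ze1 : R -> R) :
  continuous ze1 -> (forall t : R, is_derive t (1 : R) ze (ze1 t)) ->
  van a b (fun x => ze (q x)) ->
  bint a b (fun x => ze (q x) ^+ 2 * \sum_k G k x ^+ 2) <=
  bint a b (fun x => 16 * (q x * ze1 (q x) ^+ 2) * F x ^+ 2
    + 2 * ze (q x) ^+ 2 * `|F x| * `|lapl x|).
Proof.
move=> cze1 dze vze; have [CF CG _] := C2F; have [Cq _ _] := C2_dist2.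
have Cz := C1_comp cze1 dze Cq.
have CW k := C1M (C1M (C1M Cz Cz) CF) (CG k).
have cq := continuous_dist2.
have cze : continuous ze by exact: is_derive_continuous dze.
have czq : continuous (fun x => ze (q x)) by exact: cont_comp1.
have cz1q : continuous (fun x => ze1 (q x)) by exact: cont_comp1.
have [cF cG _] := CF.
have cH i j : continuous (H i j) by have [_ + _] := CG i.
have cl : continuous lapl by apply: cont_sum => i.
have cX i : continuous (X i) by exact: cont_X.
pose DW x := 4 * (ze (q x) * ze1 (q x) * F x * DF x) + ze (q x) ^+ 2 * (\sum_k G k x ^+ 2)
   + ze (q x) ^+ 2 * F x * lapl x.
have cDF : continuous DF by apply: cont_sum => k; exact: contM.
have cG2 : continuous (fun x => \sum_k G k x ^+ 2) by apply: cont_sum => k; exact: contX.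
have bc (f : V -> R) : continuous f -> bmf (obox a b) f by exact: bmf_continuous.
have cDW : continuous DW by rewrite /DW; cont_tac.
have IW : bint a b DW = 0.
  pose W1 k x := (((ze1 (q x) * (2 * X k x)) * ze (q x) + ze (q x) * (ze1 (q x) * (2 * X k x))) * F x
     + (ze (q x) * ze (q x)) * G k x) * G k x + (ze (q x) * ze (q x)) * F x * H k k x.
  have cW1 k : continuous (W1 k) by rewrite /W1; cont_tac.
  rewrite (@eq_bint _ _ a b DW (fun x => \sum_k W1 k x)); last first.
    move=> x _; rewrite /DW /lapl /DF !mulr_sumr -!big_split/=; apply: eq_bigr => k _.
    by rewrite /W1; ring.
  rewrite bint_sum; last by move=> k; exact: bc.
  rewrite big1// => k _.
  have vW : van a b (fun x => ze (q x) * ze (q x) * F x * G k x).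
    by apply: vanM; apply: vanM; exact: vanM.
  rewrite (bint_div ab a0 k (CW k) vW) -[RHS]oppr0; congr (- _).
  rewrite (@eq_bint _ _ a' b' _ (fun=> 0)) ?bint0 ?mulr0// => x _.
  by rewrite F0; ring.
have cl1 : continuous (fun x => ze (q x) ^+ 2 * \sum_k G k x ^+ 2) by cont_tac.
have -> : bint a b (fun x => ze (q x) ^+ 2 * \sum_k G k x ^+ 2) =
    bint a b (fun x => ze (q x) ^+ 2 * (\sum_k G k x ^+ 2) - 2 * DW x).
  rewrite bintB ?bintZ ?IW ?mulr0 ?subr0//; try exact: bc.
  by apply: bmfZ; exact: bc.
apply: le_bint; [by apply: bc; cont_tac|by apply: bc; cont_tac|] => x _.
have S : 0 <= \sum_k (ze (q x) * G k x + 4 * ze1 (q x) * F x * X k x) ^+ 2.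
  by apply: sumr_ge0 => k _; exact: sqr_ge0.
have E : \sum_k (ze (q x) * G k x + 4 * ze1 (q x) * F x * X k x) ^+ 2 =
    ze (q x) ^+ 2 * (\sum_k G k x ^+ 2) + 8 * (ze (q x) * ze1 (q x) * F x * DF x)
    + 16 * (q x * ze1 (q x) ^+ 2) * F x ^+ 2.
  set z := ze (q x); set z1 := ze1 (q x); rewrite -(sum_shiftc x) /DF mulr_suml !mulr_sumr !mulr_suml -!big_split/=; apply: eq_bigr => k _.
  by ring.
have N : - (ze (q x) ^+ 2 * F x * lapl x) <= ze (q x) ^+ 2 * `|F x| * `|lapl x|.
  rewrite -[_ * F x * _]mulrA -[_ * `|F x| * _]mulrA -mulrN ler_wpM2l ?sqr_ge0//.
  by rewrite -normrM (le_trans (ler_norm _))// normrN.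
rewrite /DW; lra.
Qed.

Variables (q0 q1 q2 q3 : R).
Hypothesis q00 : 0 < q0.
Hypothesis q01 : q0 < q1.
Hypothesis q12 : q1 < q2.
Hypothesis q23 : q2 < q3.
Variables al : R.
(** With this value [c * q <= 1 / 2] on the support of the cutoff, hence [be <= - al / 2] there. *)
Let c : R := (2 * q3)^-1.
Local Notation eta0 := (eta0 q0 q1 q2 q3).
Local Notation eta1 := (eta1 q0 q1 q2 q3).
Local Notation eta2 := (eta2 q0 q1 q2 q3).
Local Notation om := (weight al c).
Local Notation chi0 := (chi0 q0 q1 q2 q3 al c).
Local Notation chi1 := (chi1 q0 q1 q2 q3 al c).
Local Notation chi2 := (chi2 q0 q1 q2 q3 al c).
Local Notation zeta0 := (zeta0 q0 q1 q2 q3 al c).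
Local Notation zeta1 := (zeta1 q0 q1 q2 q3 al c).

Let v x := chi0 (q x) * F x.
Let vG i x := chi1 (q x) * (2 * X i x) * F x + chi0 (q x) * G i x.
Let vH i j x := (chi2 (q x) * (2 * X i x) * (2 * X j x) + chi1 (q x) * (2 * (i == j)%:R)) * F x
  + chi1 (q x) * (2 * X i x) * G j x + chi1 (q x) * (2 * X j x) * G i x + chi0 (q x) * H i j x.

Let C2v : C2 v vG vH.
Proof.
apply: C2M => //; apply: C2_comp; last exact: C2_dist2.
- exact: continuous_chi2.
- exact: is_derive_chi0.
- exact: is_derive_chi1.
Qed.

(** The conjugation cancels all derivatives of the weight. What accompanies the Laplacian of [F]
    comes from derivatives of [eta0], supported in the two transition shells. *)
Let op_cut x : carleman_op p v vG vH al c x = om (q x) *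
  (q x * eta0 (q x) * lapl x + 4 * q x * eta1 (q x) * DF x
   + (4 * q x ^+ 2 * eta2 (q x) + 2 * n%:R * q x * eta1 (q x)) * F x).
Proof.
have E1 : \sum_k X k x * vG k x = 2 * q x * chi1 (q x) * F x + chi0 (q x) * DF x.
  rewrite -[in 2 * q x](sum_shiftc x) /DF !mulr_sumr !mulr_suml -big_split/=.
  by apply: eq_bigr => k _; rewrite /vG; ring.
have E2 : \sum_k vH k k x = (4 * q x * chi2 (q x) + 2 * n%:R * chi1 (q x)) * F x
    + 4 * chi1 (q x) * DF x + chi0 (q x) * lapl x.
  have -> : (4 * q x * chi2 (q x) + 2 * n%:R * chi1 (q x)) * F x =
     \sum_k ((4 * (X k x * X k x) * chi2 (q x) + 2 * chi1 (q x)) * F x).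
    rewrite -mulr_suml; congr (_ * _); rewrite big_split/= -mulr_suml -mulr_sumr sum_shiftc.
    by rewrite sumr_const card_ord -mulr_natl; ring.
  rewrite /DF /lapl !mulr_sumr -!big_split/=.
  by apply: eq_bigr => k _; rewrite /vH eqxx/=; ring.
rewrite /carleman_op E1 E2 /v /cbeta /cbeta1.
have [qq|qq] := leP (q x) q0.
  have [e0 e1 e2] : [/\ eta0 (q x) = 0, eta1 (q x) = 0 & eta2 (q x) = 0] by exact: eta_le.
  by rewrite /chi0 /chi1 /chi2 e0 e1 e2; ring.
have qx0 : q x != 0 by rewrite gt_eqF// (lt_trans q00).
by rewrite /chi0 /chi1 /chi2 -/(om (q x)); field.
Qed.

Variables (ka : R) (e : V -> R) (r M qb : R).
Hypothesis ka0 : 0 <= ka.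
Hypothesis ce : continuous e.
Hypothesis e0 : forall x, 0 <= e x.
Hypothesis Fe : forall x, `|lapl x| <= ka * `|F x| + e x.
Hypothesis lat : forall x, lateral a b x -> q3 <= q x.
Hypothesis al3 : 3 <= al.
Hypothesis alka : 12 * q3 ^+ 2 * ka ^+ 2 <= al ^+ 3.
Hypothesis r1 : 1 <= r.
Hypothesis rq1 : q1 <= r * (q1 - q0).
Hypothesis rq3 : q3 <= r * (q3 - q2).
Hypothesis ME : M = 36 * 37 * 36 * r ^+ 2.
Hypothesis q1b : q1 <= qb.
Hypothesis qb2 : qb <= q2.

Let q30 : 0 < q3. Proof. exact: (lt_trans q00 (lt_trans q01 (lt_trans q12 q23))). Qed.
Let M0 : 0 <= M. Proof. by rewrite ME mulr_ge0// sqr_ge0. Qed.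

Let eta_M t : 0 <= t <= q3 ->
  [/\ eta0 t ^+ 2 <= M ^+ 2, (t * eta1 t) ^+ 2 <= M ^+ 2 & (t ^+ 2 * eta2 t) ^+ 2 <= M ^+ 2].
Proof.
move=> t03; have [b0 b1 b2] := eta_bounds q00 q01 q23 rq1 rq3 t03.
have B (x : R) : `|x| <= M -> x ^+ 2 <= M ^+ 2.
  by move=> xM; rewrite -(real_normK (num_real x)) ler_pXn2r ?nnegrE.
have rr : r <= r ^+ 2 by rewrite -[leLHS]mulr1 expr2 ler_wpM2l// (le_trans ler01).
have r1' := r1; split; apply: B.
- by apply: le_trans b0 _; rewrite ME; lra.
- by apply: le_trans b1 _; rewrite ME; lra.
- by apply: le_trans b2 _; rewrite ME; lra.
Qed.

Definition shell (lo hi : R) : set V := [set x : V | (lo <= q x <= hi)%R].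

Lemma measurable_shell lo hi : measurable (shell lo hi).
Proof.
have /(_ measurableT `[lo, hi]%classic) := continuous_measurable_rV continuous_dist2.
rewrite setTI => /(_ (measurable_itv _)).
by congr measurable; apply/seteqP; split => x; rewrite /shell/= in_itv.
Qed.

Lemma indic_shell lo hi x : \1_(shell lo hi) x = ((lo <= q x <= hi)%R)%:R :> R.
Proof. by rewrite indicE; congr (nat_of_bool _)%:R; apply/idP/idP => [/set_mem|] // HH; exact/mem_set. Qed.

Let be x := cbeta p al c x.
Let c0 : 0 < c. Proof. by rewrite invr_gt0 mulr_gt0. Qed.
Let cq t : t <= q3 -> c * t <= 2^-1.
Proof.
by move=> t3; rewrite /c invfM -mulrA ger_pMr// mulrC ler_pdivrMr ?mul1r.
Qed.

Let al0 : 0 <= al. Proof. by rewrite (le_trans _ al3). Qed.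
Let om_q0 t : q0 <= t -> t <= q3 -> om t <= om q0.
Proof. by move=> tq t3; apply: weight_decr => //; exact: cq. Qed.
Let sq_mono (x y : R) : 0 <= x -> x <= y -> x ^+ 2 <= y ^+ 2.
Proof. by move=> x0 xy; rewrite ler_pXn2r ?nnegrE// (le_trans x0). Qed.

(** Here [s] is the squared inner radius of the shell concerned. The quotient [q3 / s] comes from
    bounding [q * zeta1^2], the last term from the second-order part of the commutator. *)
Definition cst_cut s := M ^+ 2 * (32 + 48 * q3 + 3072 * (q3 / s) + 3 * (4 + 2 * n%:R) ^+ 2).
Definition cst_src := M ^+ 2 * (6 * q3 ^+ 2 + 48 * q3).
(** The positive part records that a pole in the upper half-space has a boundary term of favourable
    sign, which is then discarded. *)
Definition cst_bd := 4 * Num.max 0 (- p 0 ord0) * q3 * M ^+ 2.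
Local Notation K1 := cst_cut.
Local Notation K2 := cst_src.

(* The terms of order zero produced by the two cutoffs, once the radial
   derivative has been absorbed. *)
Definition cut_rhs x := om (q x) ^+ 2 * (6 * (q x * eta0 (q x)) ^+ 2 + 48 * q3 * (q x * eta1 (q x)) ^+ 2) * e x ^+ 2
  + (om (q x) ^+ 2 * (48 * q3 * (2 * ka + 1) * (q x * eta1 (q x)) ^+ 2
       + 3 * (4 * (q x ^+ 2 * eta2 (q x)) + 2 * n%:R * (q x * eta1 (q x))) ^+ 2)
     + 768 * q3 * (q x * zeta1 (q x) ^+ 2)) * F x ^+ 2.

Let ineq_al : q3 * ka <= al ^+ 2 / 3.
Proof.
have A3 := al3; have AK := alka.
rewrite -ler_sqr ?nnegrE ?divr_ge0 ?sqr_ge0 ?mulr_ge0 ?(ltW q30)//.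
have A4 : 3 * al ^+ 3 <= al * al ^+ 3 by rewrite ler_wpM2r// exprn_ge0// (le_trans _ A3).
have -> : (al ^+ 2 / 3) ^+ 2 = al * al ^+ 3 / 9 by field.
by rewrite exprMn; have := exprn_ge0 3 (le_trans (ler0n _ 3) A3); lra.
Qed.

Let eta_out t : t < q0 \/ q3 < t -> [/\ eta0 t = 0, eta1 t = 0 & eta2 t = 0].
Proof. by move=> [/ltW|/ltW]; [exact: eta_le|exact: eta_ge]. Qed.

Lemma sq_lin_le (x y m k l : R) : 0 <= k -> 0 <= l -> x ^+ 2 <= m -> y ^+ 2 <= m ->
  (k * x + l * y) ^+ 2 <= (k + l) ^+ 2 * m.
Proof.
move=> k0 l0 xm ym; apply: (@le_trans _ _ ((k + l) * (k * x ^+ 2 + l * y ^+ 2))).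
  rewrite -subr_ge0 (_ : _ - _ = k * l * (x - y) ^+ 2); last by ring.
  by rewrite mulr_ge0 ?sqr_ge0 ?mulr_ge0.
rewrite [in leRHS]expr2 -mulrA ler_wpM2l ?addr_ge0// mulrDl.
by apply: lerD; rewrite ler_wpM2l.
Qed.

Let zeta_bound s t : 0 < s -> s <= t -> t <= q3 ->
  t * zeta1 t ^+ 2 <= om t ^+ 2 * (4 * al ^+ 2 * M ^+ 2 / s).
Proof.
move=> s0 tq t3; have t0 : 0 < t by exact: lt_le_trans tq.
have /eta_M[_ m1 m2] : 0 <= t <= q3 by rewrite t3 ltW.
set A := t * eta1 t in m1; set B := t ^+ 2 * eta2 t in m2.
pose ga := (- al + al * c * t + 1) / 2.
have -> : t * zeta1 t ^+ 2 = om t ^+ 2 * ((ga * A + B) ^+ 2 / t).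
  by rewrite /zeta1 -/(om t) /A /B /ga; field; lra.
rewrite ler_wpM2l ?sqr_ge0// ler_pdivrMr//.
apply: (@le_trans _ _ (4 * al ^+ 2 * M ^+ 2)); last first.
  by rewrite -[leRHS]mulrA ler_peMr ?mulr_ge0 ?sqr_ge0// mulrC ler_pdivlMr ?mul1r.
have A3 := al3; have CT := cq t3; have C0 := c0.
have ct0 : 0 <= c * t by rewrite mulr_ge0// ltW.
have g2 : ga ^+ 2 <= al ^+ 2.
  rewrite -(real_normK (num_real ga)); apply: sq_mono; first exact: normr_ge0.
  rewrite ler_norml /ga; have H1 : al * (c * t) <= al * 2^-1 by rewrite ler_wpM2l// (le_trans _ A3).
  have H2 : 0 <= al * (c * t) by rewrite mulr_ge0// (le_trans _ A3).
  by rewrite -mulrA; apply/andP; split; lra.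
have ABn : (ga * A + B) ^+ 2 <= 2 * (ga ^+ 2 * A ^+ 2) + 2 * B ^+ 2.
  rewrite -subr_ge0 (_ : _ - _ = (ga * A - B) ^+ 2) ?sqr_ge0//; ring.
have gA : ga ^+ 2 * A ^+ 2 <= al ^+ 2 * M ^+ 2 by rewrite ler_pM ?sqr_ge0.
have : M ^+ 2 <= al ^+ 2 * M ^+ 2.
  by rewrite -[leLHS]mul1r ler_wpM2r ?sqr_ge0// exprn_ege1// (le_trans _ A3)// ler1n.
lra.
Qed.

(** The weight decreases on the support, so in each shell it is replaced by its value on the inner
    edge; between the shells the derivatives of the cutoff vanish and only the source [e]
    remains. *)
Lemma cut_rhs_le x : cut_rhs x <= al ^+ 2 * (K1 q0 * om q0 ^+ 2 * (\1_(shell q0 q1) x * F x ^+ 2)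
    + K1 q2 * om q2 ^+ 2 * (\1_(shell q2 q3) x * F x ^+ 2))
  + om q0 ^+ 2 * K2 * (\1_(shell q0 q3) x * e x ^+ 2).
Proof.
have Q0 := q00; have Q3 := q30; have A3 := al3; have KA := ka0.
have K10 s : 0 < s -> 0 <= K1 s.
  move=> s0.
  exact: (mulr_ge0 (sqr_ge0 _) (addr_ge0 (addr_ge0 (addr_ge0 (ler0n _ 32) (mulr_ge0 (ler0n _ 48) (ltW Q3)))
    (mulr_ge0 (ler0n _ 3072) (divr_ge0 (ltW Q3) (ltW s0)))) (mulr_ge0 (ler0n _ 3) (sqr_ge0 _)))).
have Q2 : 0 < q2 by exact: (lt_trans q00 (lt_trans q01 q12)).
have K20 : 0 <= K2.
  by rewrite mulr_ge0 ?sqr_ge0// addr_ge0// mulr_ge0 ?sqr_ge0 ?(ltW Q3).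
have I0 lo hi (w : R) : 0 <= \1_(shell lo hi) x * w ^+ 2.
  by rewrite mulr_ge0 ?sqr_ge0// indic_shell.
have R0 : 0 <= al ^+ 2 * (K1 q0 * om q0 ^+ 2 * (\1_(shell q0 q1) x * F x ^+ 2)
    + K1 q2 * om q2 ^+ 2 * (\1_(shell q2 q3) x * F x ^+ 2)).
  apply: mulr_ge0; first exact: sqr_ge0.
  by apply: addr_ge0; (apply: mulr_ge0; [apply: mulr_ge0; [exact: K10|exact: sqr_ge0]|exact: I0]).
have R1 : 0 <= om q0 ^+ 2 * K2 * (\1_(shell q0 q3) x * e x ^+ 2).
  by apply: mulr_ge0; [apply: mulr_ge0; [exact: sqr_ge0|exact: K20]|exact: I0].
have [out|inn] : (q x < q0 \/ q3 < q x) \/ q0 <= q x <= q3.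
  by case: (ltP (q x) q0) => ?; [left; left|case: (ltP q3 (q x)) => ?; [left; right|right]].
  have [z0 z1 z2] := eta_out out.
  apply: (@le_trans _ _ 0); last exact: addr_ge0.
  by rewrite /cut_rhs /zeta1 z0 z1 z2 !(mulr0,mul0r,addr0,expr0n).
have [qx0 qx3] := andP inn.
have qxp : 0 <= q x by exact: dist2_ge0.
have /eta_M[m0 m1 m2] : 0 <= q x <= q3 by rewrite qxp.
have w0 : 0 <= om (q x) ^+ 2 by exact: sqr_ge0.
have wq0 : om (q x) ^+ 2 <= om q0 ^+ 2 by apply: sq_mono; [exact/ltW/weight_gt0|exact: om_q0].
rewrite /cut_rhs addrC; apply: lerD; last first.
  have Hp : 0 <= 6 * (q x * eta0 (q x)) ^+ 2 + 48 * q3 * (q x * eta1 (q x)) ^+ 2.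
    exact: (addr_ge0 (mulr_ge0 (ler0n _ 6) (sqr_ge0 _)) (mulr_ge0 (mulr_ge0 (ler0n _ 48) (ltW Q3)) (sqr_ge0 _))).
  have Hs : 6 * (q x * eta0 (q x)) ^+ 2 + 48 * q3 * (q x * eta1 (q x)) ^+ 2 <= K2.
    rewrite /K2 [leRHS]mulrDr; apply: lerD; last first.
      by rewrite [leRHS]mulrC; apply: ler_wpM2l m1; exact: (mulr_ge0 (ler0n _ 48) (ltW Q3)).
    rewrite (_ : M ^+ 2 * (6 * q3 ^+ 2) = 6 * (M ^+ 2 * q3 ^+ 2)); last by ring.
    apply: (ler_wpM2l (ler0n _ 6)).
    rewrite exprMn [leRHS]mulrC; apply: (ler_pM (sqr_ge0 _) (sqr_ge0 _) _ m0).
    exact: sq_mono.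
  rewrite indic_shell inn mul1r; apply: ler_wpM2r; first exact: sqr_ge0.
  exact: ler_pM.
have [mid|] := boolP (q1 <= q x <= q2).
  have [z0 z1 z2] := eta_mid q01 q23 mid.
  rewrite (_ : (_ + _) * F x ^+ 2 = 0); first exact: R0.
  by rewrite /zeta1 z1 z2 !(mulr0,mul0r,addr0,expr0n).
have T1 : (q x * eta1 (q x)) ^+ 2 * (48 * q3 * (2 * ka + 1)) <= al ^+ 2 * (M ^+ 2 * (32 + 48 * q3)).
  have A1 : 1 <= al ^+ 2 by rewrite exprn_ege1// (le_trans _ A3)// ler1n.
  have := ineq_al => IA; apply: (@le_trans _ _ (M ^+ 2 * (32 * al ^+ 2 + 48 * q3))).
    by apply: ler_pM => //; [exact: sqr_ge0|rewrite mulr_ge0 ?mulr_ge0 ?(ltW Q3)//; lra|lra].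
  rewrite (_ : al ^+ 2 * (M ^+ 2 * _) = M ^+ 2 * (al ^+ 2 * (32 + 48 * q3))); last by ring.
  apply: ler_wpM2l; first exact: sqr_ge0.
  by have := ler_wpM2r (ltW Q3) A1; lra.
have T2 : 3 * (4 * (q x ^+ 2 * eta2 (q x)) + 2 * n%:R * (q x * eta1 (q x))) ^+ 2 <=
    al ^+ 2 * (M ^+ 2 * (3 * (4 + 2 * n%:R) ^+ 2)).
  have A1 : 1 <= al ^+ 2 by rewrite exprn_ege1// (le_trans _ A3)// ler1n.
  have H1 : 0 <= 2 * n%:R :> R by rewrite mulr_ge0.
  have := sq_lin_le (ler0n _ 4) H1 m2 m1 => H2.
  apply: (@le_trans _ _ (3 * ((4 + 2 * n%:R) ^+ 2 * M ^+ 2))); first by rewrite ler_wpM2l.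
  rewrite -[leLHS]mul1r; apply: ler_pM => //; first by rewrite !mulr_ge0 ?sqr_ge0.
  by rewrite (_ : M ^+ 2 * (3 * _) = 3 * ((4 + 2 * n%:R) ^+ 2 * M ^+ 2)) //; ring.
have T3 s : 0 < s -> s <= q x ->
    768 * q3 * (q x * zeta1 (q x) ^+ 2) <= om (q x) ^+ 2 * (al ^+ 2 * (M ^+ 2 * (3072 * (q3 / s)))).
  move=> s0 sx; have := zeta_bound s0 sx qx3 => ZB.
  apply: (@le_trans _ _ (768 * q3 * (om (q x) ^+ 2 * (4 * al ^+ 2 * M ^+ 2 / s)))).
    exact: (ler_wpM2l (mulr_ge0 (ler0n _ 768) (ltW Q3)) ZB).
  by rewrite le_eqVlt; apply/orP; left; apply/eqP; field; lra.
have TT s : 0 < s -> s <= q x -> (om (q x) ^+ 2 * (48 * q3 * (2 * ka + 1) * (q x * eta1 (q x)) ^+ 2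
       + 3 * (4 * (q x ^+ 2 * eta2 (q x)) + 2 * n%:R * (q x * eta1 (q x))) ^+ 2)
     + 768 * q3 * (q x * zeta1 (q x) ^+ 2)) * F x ^+ 2 <= al ^+ 2 * (K1 s * om (q x) ^+ 2 * F x ^+ 2).
  move=> s0 sx; rewrite (_ : al ^+ 2 * (K1 s * om (q x) ^+ 2 * F x ^+ 2) =
     om (q x) ^+ 2 * (al ^+ 2 * K1 s) * F x ^+ 2); last by ring.
  apply: (ler_wpM2r (sqr_ge0 _)).
  have -> : al ^+ 2 * K1 s = al ^+ 2 * (M ^+ 2 * (32 + 48 * q3)) + al ^+ 2 * (M ^+ 2 * (3 * (4 + 2 * n%:R) ^+ 2))
     + al ^+ 2 * (M ^+ 2 * (3072 * (q3 / s))) by rewrite /K1; ring.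
  rewrite [in leRHS]mulrDr; apply: lerD; last exact: T3.
  by rewrite ler_wpM2l// lerD// mulrC.
move=> nmid; have mono s (m : R) : 0 < s -> om (q x) ^+ 2 <= m ->
    al ^+ 2 * (K1 s * om (q x) ^+ 2 * F x ^+ 2) <= al ^+ 2 * (K1 s * m * F x ^+ 2).
  move=> s0 wm; apply: (ler_wpM2l (sqr_ge0 _)); apply: (ler_wpM2r (sqr_ge0 _)).
  by apply: ler_wpM2l => //; exact: K10.
move: nmid; rewrite negb_and -!ltNge => /orP[lt1|lt2].
  apply: le_trans (TT _ q00 qx0) _; apply: le_trans (mono _ _ q00 wq0) _.
  apply: (ler_wpM2l (sqr_ge0 _)).
  have -> : \1_(shell q0 q1) x = 1 :> R by rewrite indic_shell qx0 ltW.
  rewrite mul1r -[leLHS]addr0; apply: lerD => //.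
  exact: (mulr_ge0 (mulr_ge0 (K10 _ Q2) (sqr_ge0 _)) (I0 _ _ _)).
have wq2 : om (q x) ^+ 2 <= om q2 ^+ 2.
  apply: sq_mono; first exact/ltW/weight_gt0.
  by apply: weight_decr => //; [exact: ltW|exact: cq].
apply: le_trans (TT _ Q2 (ltW lt2)) _; apply: le_trans (mono _ _ Q2 wq2) _.
apply: (ler_wpM2l (sqr_ge0 _)).
have -> : \1_(shell q2 q3) x = 1 :> R by rewrite indic_shell qx3 ltW.
rewrite mul1r -[leLHS]add0r; apply: lerD => //.
exact: (mulr_ge0 (mulr_ge0 (K10 _ q00) (sqr_ge0 _)) (I0 _ _ _)).
Qed.

Lemma continuous_cut_rhs : continuous cut_rhs.
Proof.
have dchi0 : forall t : R, is_derive t (1 : R) chi0 (chi1 t) by exact: is_derive_chi0.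
have cchi0 : continuous chi0 := is_derive_continuous dchi0.
have cq' : continuous q := continuous_dist2.
have [[cF _ _] _ _] := C2F.
have cz1 : continuous (fun x => zeta1 (q x)) by apply: cont_comp1 => //; exact: continuous_zeta1.
have cc0 : continuous (fun x => chi0 (q x)) by exact: cont_comp1.
have we1 : continuous (fun x => om (q x) * eta1 (q x)).
  by apply: (@cont_comp1 _ _ (fun t => om t * eta1 t)) => //; exact: continuous_weight_eta1.
have we2 : continuous (fun x => om (q x) * eta2 (q x)).
  by apply: (@cont_comp1 _ _ (fun t => om t * eta2 t)) => //; exact: continuous_weight_eta2.
rewrite (_ : cut_rhs = fun x => (6 * (q x * chi0 (q x)) ^+ 2
     + 48 * q3 * (q x * (om (q x) * eta1 (q x))) ^+ 2) * e x ^+ 2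
  + (48 * q3 * (2 * ka + 1) * (q x * (om (q x) * eta1 (q x))) ^+ 2
     + 3 * (4 * (q x ^+ 2 * (om (q x) * eta2 (q x))) + 2 * n%:R * (q x * (om (q x) * eta1 (q x)))) ^+ 2
     + 768 * q3 * (q x * zeta1 (q x) ^+ 2)) * F x ^+ 2); first by cont_tac.
by apply/funext => x; rewrite /cut_rhs /chi0 -/(om (q x)); ring.
Qed.

Let al_ge1 : 1 <= al. Proof. exact: le_trans (ler1n _ 3) al3. Qed.
Let al2_ge1 : 1 <= al ^+ 2.
Proof. by rewrite exprn_ege1// (le_trans _ al3)// ler1n. Qed.

Let bmf_shell lo hi (f : V -> R) : continuous f ->
  bmf (obox a b) (fun x => \1_(shell lo hi) x * f x ^+ 2).
Proof.
move=> cf; apply: bmfM; first by apply: bmf_indic; exact: measurable_shell.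
by apply: bmf_continuous; exact: contX.
Qed.

Let bmf_shell0 lo hi (f : V -> R) : continuous f ->
  bmf (obox a' b') (fun x => \1_(shell lo hi) (rV_cons (0, x)) * f (rV_cons (0, x)) ^+ 2).
Proof.
move=> cf; apply: bmfM; last first.
  by apply: bmf_continuous; apply: contX; exact: cont_slice2.
split; last first.
  by exists 1 => x _; rewrite indic_shell; case: (_ <= _ <= _); rewrite ?normr1 ?normr0.
apply: (measurableT_comp (measurable_indic (measurable_shell lo hi))).
exact: measurable_rV_cons2.
Qed.

Local Ltac only_section := clear -ab a0 C2F F0 q00 q01 q12 q23 C2v op_cut ka0 ce e0 Fe lat al3 alka r1 rq1 rq3 ME
  q1b qb2 q30 M0 eta_M be c0 cq al0 om_q0 sq_mono ineq_al eta_out zeta_bound al_ge1 al2_ge1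
  bmf_shell bmf_shell0 DF v vG vH c.

(** Half of the Carleman gain pays for the Laplacian through the differential inequality [Fe]; the
    radial derivative in the commutator is traded for zeroth-order terms by [caccioppoli]. All that
    is left is collected in [cut_rhs]. *)
Lemma local_bulk : al ^+ 3 * c * bint a b (fun x => q x * (chi0 (q x) * F x) ^+ 2)
   - 4 * bint a' b' (fun x => p 0 ord0 * cbeta p al c (rV_cons (0, x)) * q (rV_cons (0, x))
      * (chi0 (q (rV_cons (0, x))) * G ord0 (rV_cons (0, x))) ^+ 2)
  <= bint a b cut_rhs.
Proof.
have vanc (f : R -> R) : (forall t, q3 <= t -> f t = 0) -> van a b (fun x => f (q x)).
  by move=> f0 x /lat /f0.
have vchi0 : van a b (fun x => chi0 (q x)).
  by apply: vanc => t /(eta_ge q0 q1 q23)[z0 z1 z2]; rewrite /chi0 z0 mulr0.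
have vchi1 : van a b (fun x => chi1 (q x)).
  by apply: vanc => t /(eta_ge q0 q1 q23)[z0 z1 z2]; rewrite /chi1 z0 z1 mulr0 addr0 mulr0.
have vzeta0 : van a b (fun x => zeta0 (q x)).
  by apply: vanc => t /(eta_ge q0 q1 q23)[z0 z1 z2]; rewrite /zeta0 z1 !mulr0.
have vanv : van a b v by exact: vanM.
have vang i : van a b (vG i) by apply: vanD; apply: vanM => //; exact: vanM.
have v0 x : v (rV_cons (0, x)) = 0 by rewrite /v F0 mulr0.
have CA := @carleman R d p a b ab a0 v vG vH C2v vanv vang v0 al c.
have czeta1 : continuous zeta1 by exact: continuous_zeta1.
have dzeta0 : forall t : R, is_derive t (1 : R) zeta0 (zeta1 t) by exact: is_derive_zeta0.
have dchi0 : forall t : R, is_derive t (1 : R) chi0 (chi1 t) by exact: is_derive_chi0.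
have dchi1 : forall t : R, is_derive t (1 : R) chi1 (chi2 t) by exact: is_derive_chi1.
have CC := caccioppoli czeta1 dzeta0 vzeta0.
have A3 := al3; have KA := ka0; have Q3 := q30; have C0 := c0.
have [CF CG _] := C2F; have [Cv _ _] := C2v.
have cq' : continuous q := continuous_dist2.
have [cF cG _] := CF; have [cv _ _] := Cv.
have cH i j : continuous (H i j) by have [_ + _] := CG i.
have cl : continuous lapl by apply: cont_sum => i.
have cX i : continuous (X i) by exact: cont_X.
have cDF : continuous DF by apply: cont_sum => k; exact: contM.
have cG2 : continuous (fun x => \sum_k G k x ^+ 2) by apply: cont_sum => k; exact: contX.
have bc (f : V -> R) : continuous f -> bmf (obox a b) f by exact: bmf_continuous.
have cchi1 : continuous chi1 := is_derive_continuous dchi1.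
have cchi0 : continuous chi0 := is_derive_continuous dchi0.
have czeta0 : continuous zeta0 := is_derive_continuous dzeta0.
have cc0 : continuous (fun x => chi0 (q x)) by exact: cont_comp1.
have cc1 : continuous (fun x => chi1 (q x)) by exact: cont_comp1.
have cz0 : continuous (fun x => zeta0 (q x)) by exact: cont_comp1.
have cz1 : continuous (fun x => zeta1 (q x)) by exact: cont_comp1.
have bc' (f : V -> R) : continuous f -> bmf (obox a' b') (fun x => f (rV_cons (0, x))).
  by move=> cf; apply: bmf_continuous; exact: cont_slice2.
have cvG i : continuous (vG i) by rewrite /vG; cont_tac.
have we1 : continuous (fun x => om (q x) * eta1 (q x)).
  by apply: (@cont_comp1 _ _ (fun t => om t * eta1 t)) => //; exact: continuous_weight_eta1.
have we2 : continuous (fun x => om (q x) * eta2 (q x)).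
  by apply: (@cont_comp1 _ _ (fun t => om t * eta2 t)) => //; exact: continuous_weight_eta2.
pose T x := 6 * (q x * chi0 (q x)) ^+ 2 * e x ^+ 2
   + 3 * (4 * q x ^+ 2 * (om (q x) * eta2 (q x)) + 2 * n%:R * q x * (om (q x) * eta1 (q x))) ^+ 2 * F x ^+ 2.
pose W x := 16 * (q x * zeta1 (q x) ^+ 2) * F x ^+ 2
   + zeta0 (q x) ^+ 2 * ((2 * ka + 1) * F x ^+ 2 + e x ^+ 2).
have cT : continuous T by rewrite /T; cont_tac.
have cW : continuous W by rewrite /W; cont_tac.
have cutE : bint a b cut_rhs = bint a b T + 48 * q3 * bint a b W.
  rewrite -bintZ; last exact: bc.
  rewrite -bintD; [|exact: bc|by apply: bmfZ; exact: bc].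
  by apply: eq_bint => x _; rewrite /cut_rhs /T /W /chi0 /zeta0 -/(om (q x)); ring.
have zgt t : q3 < t -> chi0 t = 0 /\ zeta0 t = 0.
  by move=> /ltW/(eta_ge q0 q1 q23)[z0 z1 z2]; rewrite /chi0 /zeta0 z0 z1 !mulr0.
have S3 : bint a b (fun x => zeta0 (q x) ^+ 2 * \sum_k G k x ^+ 2) <= bint a b W.
  apply: le_trans CC _; apply: le_bint; [by apply: bc; cont_tac|exact: bc|] => x _.
  rewrite lerD2l (_ : 2 * _ ^+ 2 * _ * _ = zeta0 (q x) ^+ 2 * (2 * (`|F x| * `|lapl x|))); last by ring.
  apply: ler_wpM2l; first exact: sqr_ge0.
  have N := normr_ge0 (F x); have EF : F x ^+ 2 = `|F x| ^+ 2 by rewrite real_normK ?num_real.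
  have e0' := e0 x; have := ler_wpM2l N (Fe x).
  have : 0 <= (`|F x| - e x) ^+ 2 by exact: sqr_ge0.
  by rewrite EF; move: N e0' KA; only_section; nra.
have S2 : bint a b (fun x => carleman_op p v vG vH al c x ^+ 2) <=
   al ^+ 3 * c * bint a b (fun x => q x * v x ^+ 2) + 48 * q3 * bint a b (fun x => zeta0 (q x) ^+ 2 * \sum_k G k x ^+ 2)
   + bint a b T.
  have B1 : bmf (obox a b) (fun x => q x * v x ^+ 2) by apply: bc; cont_tac.
  have B2 : bmf (obox a b) (fun x => zeta0 (q x) ^+ 2 * \sum_k G k x ^+ 2) by apply: bc; cont_tac.
  rewrite -bintZ// -bintZ// -bintD; [|exact: bmfZ|exact: bmfZ].
  rewrite -bintD; [|by apply: bmfD; exact: bmfZ|exact: bc].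
  have cop : continuous (carleman_op p v vG vH al c).
    rewrite (_ : carleman_op _ _ _ _ _ _ = fun x => q x * chi0 (q x) * lapl x + 4 * q x * (om (q x) * eta1 (q x)) * DF x
     + (4 * q x ^+ 2 * (om (q x) * eta2 (q x)) + 2 * n%:R * q x * (om (q x) * eta1 (q x))) * F x).
      by cont_tac.
    by apply/funext => x; rewrite op_cut /chi0 -/(om (q x)); ring.
  apply: le_bint; [by apply: bc; exact: contX|by apply: bmfD; [apply: bmfD; exact: bmfZ|exact: bc]|] => x _.
  have -> : carleman_op p v vG vH al c x = q x * chi0 (q x) * lapl x + 4 * zeta0 (q x) * DF x
     + (4 * q x ^+ 2 * (om (q x) * eta2 (q x)) + 2 * n%:R * q x * (om (q x) * eta1 (q x))) * F x.
    by rewrite op_cut /chi0 /zeta0 -/(om (q x)); ring.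
  set Y := (4 * q x ^+ 2 * _ + _).
  have sq3 (u1 u2 u3 : R) : (u1 + u2 + u3) ^+ 2 <= 3 * u1 ^+ 2 + 3 * u2 ^+ 2 + 3 * u3 ^+ 2.
    rewrite -subr_ge0 (_ : _ - _ = (u1 - u2) ^+ 2 + (u2 - u3) ^+ 2 + (u1 - u3) ^+ 2).
      by rewrite !addr_ge0 ?sqr_ge0.
    by ring.
  apply: le_trans (sq3 _ _ _) _.
  have qx0 := dist2_ge0 x.
  have L2 : lapl x ^+ 2 <= 2 * ka ^+ 2 * F x ^+ 2 + 2 * e x ^+ 2.
    rewrite -(real_normK (num_real (lapl x))) -(real_normK (num_real (F x))).
    apply: (@le_trans _ _ ((ka * `|F x| + e x) ^+ 2)).
      by apply: sq_mono => //; exact: normr_ge0.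
    rewrite -subr_ge0 (_ : _ - _ = (ka * `|F x| - e x) ^+ 2) ?sqr_ge0//; ring.
  have I1 : 3 * (q x * chi0 (q x) * lapl x) ^+ 2 <= al ^+ 3 * c * (q x * v x ^+ 2)
      + 6 * (q x * chi0 (q x)) ^+ 2 * e x ^+ 2.
    have [qx3|/zgt[E _]] := leP (q x) q3; last first.
      by rewrite /v E !(mulr0,mul0r,expr0n)/= !(mulr0,mul0r,addr0).
    (* Here the cubic gain absorbs the potential; the condition [alka] is the origin of the power
       2/3 of the norm. *)
    have K : 6 * ka ^+ 2 * q x <= al ^+ 3 * c.
      rewrite /c ler_pdivlMr; last exact: mulr_gt0.
      apply: le_trans alka; rewrite (_ : 6 * ka ^+ 2 * q x * (2 * q3) = 12 * ka ^+ 2 * q3 * q x); last by ring.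
      rewrite (_ : 12 * q3 ^+ 2 * ka ^+ 2 = 12 * ka ^+ 2 * q3 * q3); last by ring.
      by apply: ler_wpM2l => //; exact: (mulr_ge0 (mulr_ge0 (ler0n _ 12) (sqr_ge0 _)) (ltW Q3)).
    have H1 := ler_wpM2l (sqr_ge0 (q x * chi0 (q x))) L2.
    have H2 := ler_wpM2r (mulr_ge0 qx0 (sqr_ge0 (chi0 (q x) * F x))) K.
    rewrite /v exprMn.
    rewrite (_ : 6 * ka ^+ 2 * q x * (q x * (chi0 (q x) * F x) ^+ 2) =
       3 * ((q x * chi0 (q x)) ^+ 2 * (2 * ka ^+ 2 * F x ^+ 2))) in H2; last by ring.
    by rewrite mulrDr in H1; move: H1 H2; only_section; lra.
  have I2 : 3 * (4 * zeta0 (q x) * DF x) ^+ 2 <= 48 * q3 * (zeta0 (q x) ^+ 2 * \sum_k G k x ^+ 2).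
    have [qx3|/zgt[_ E]] := leP (q x) q3; last first.
      by rewrite E !(mulr0,mul0r,expr0n)/= ?(mulr0,mul0r).
    have GG : 0 <= \sum_k G k x ^+ 2 by apply: sumr_ge0 => k _; exact: sqr_ge0.
    have H1 := le_trans (sqr_radial x) (ler_wpM2r GG qx3).
    have H2 := ler_wpM2l (sqr_ge0 (zeta0 (q x))) H1.
    rewrite (_ : 3 * _ = 48 * (zeta0 (q x) ^+ 2 * DF x ^+ 2)); last by ring.
    rewrite (_ : 48 * q3 * _ = 48 * (zeta0 (q x) ^+ 2 * (q3 * \sum_k G k x ^+ 2))); last by ring.
    exact: (ler_wpM2l (ler0n _ 48)).
  by move: I1 I2; rewrite /T -/Y (exprMn 2 Y); clearbody Y; only_section; lra.
(* On the support [be^2 >= al^2 / 4], so [8 * be^2 - 8 >= al^2] once [al >= 3]; the factor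
   [be1 = 2 * al * c * q] completes the cube. *)
have bulk : 2 * (al ^+ 3 * c) * bint a b (fun x => q x * v x ^+ 2) <=
   bint a b (fun x => (8 * cbeta p al c x ^+ 2 * cbeta1 p al c x - 8 * cbeta1 p al c x) * v x ^+ 2
     + 8 * cbeta1 p al c x * ((\sum_k X k x * vG k x) + n%:R / 2 * v x) ^+ 2).
  rewrite -bintZ; last by apply: bc; cont_tac.
  have cb : continuous (cbeta p al c) by rewrite /cbeta; cont_tac.
  have cb1 : continuous (cbeta1 p al c) by rewrite /cbeta1; cont_tac.
  have cdv : continuous (fun x => \sum_k X k x * vG k x) by apply: cont_sum => k; exact: contM.
  apply: le_bint; [by apply: bc; cont_tac|by apply: bc; cont_tac|] => x _.
  have qx0 := dist2_ge0 x.
  have b10 : 0 <= cbeta1 p al c x.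
    exact: (mulr_ge0 (mulr_ge0 (mulr_ge0 (ler0n _ 2) al0) (ltW C0)) qx0).
  have R0 : 0 <= 8 * cbeta1 p al c x * ((\sum_k X k x * vG k x) + n%:R / 2 * v x) ^+ 2.
    exact: (mulr_ge0 (mulr_ge0 (ler0n _ 8) b10) (sqr_ge0 _)).
  have [qx3|/zgt[E _]] := leP (q x) q3; last first.
    by move: R0; rewrite /v E !(mulr0,mul0r,expr0n)/= !(mulr0,mul0r,add0r).
  rewrite -[leLHS]addr0; apply: lerD => //.
  rewrite mulrA; apply: ler_wpM2r; first exact: sqr_ge0.
  have CQ := cq qx3.
  have B2 : al ^+ 2 / 4 <= cbeta p al c x ^+ 2.
    have H0 : al / 2 <= al * (1 - c * q x) by apply: ler_wpM2l => //; move: CQ; only_section; lra.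
    have -> : cbeta p al c x ^+ 2 = (al * (1 - c * q x)) ^+ 2 by rewrite /cbeta; ring.
    have -> : al ^+ 2 / 4 = (al / 2) ^+ 2 by field.
    by apply: sq_mono => //; move: A3; only_section; lra.
  have A2 : 9 <= al ^+ 2 by have := ler_pM (ler0n _ 3) (ler0n _ 3) A3 A3; rewrite -expr2; only_section; lra.
  have B3 : al ^+ 2 <= 8 * cbeta p al c x ^+ 2 - 8 by move: A2 B2; only_section; lra.
  have := ler_wpM2r b10 B3.
  by rewrite mulrBl /cbeta1; only_section; lra.
have bdE : bint a' b' (fun x => p 0 ord0 * cbeta p al c (rV_cons (0, x)) * q (rV_cons (0, x)) * vG ord0 (rV_cons (0, x)) ^+ 2)
   = bint a' b' (fun x => p 0 ord0 * cbeta p al c (rV_cons (0, x)) * q (rV_cons (0, x))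
      * (chi0 (q (rV_cons (0, x))) * G ord0 (rV_cons (0, x))) ^+ 2).
  by apply: eq_bint => x _; rewrite /vG F0 mulr0 add0r.
rewrite bdE in CA; rewrite cutE -/v.
have : 48 * q3 * bint a b (fun x => zeta0 (q x) ^+ 2 * \sum_k G k x ^+ 2) <= 48 * q3 * bint a b W.
  exact: (ler_wpM2l (mulr_ge0 (ler0n _ 48) (ltW Q3)) S3).
have := le_trans CA S2; by have := bulk; only_section; lra.
Qed.

(** Dividing the weighted inequality by the weight at [qb] gives an interpolation: the data near the
    pole and on the face are amplified by a power of [qb / q0], while the outer shell is damped
    exponentially in [al]. *)
Lemma local_estimate :
  qb / (2 * q3) * bint a b (fun x => \1_(shell q1 qb) x * F x ^+ 2) <=
  expR ((al + 1) * ln (qb / q0)) *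
     ((cst_cut q0 + cst_src) * (bint a b (fun x => \1_(shell q0 q1) x * F x ^+ 2)
      + bint a b (fun x => \1_(shell q0 q3) x * e x ^+ 2))
      + cst_bd * bint a' b' (fun x => \1_(shell q0 q3) (rV_cons (0, x)) * G ord0 (rV_cons (0, x)) ^+ 2))
   + expR (- (al * ((q2 - qb) / (2 * q2)))) * (cst_cut q2 * bint a b (fun x => \1_(shell q2 q3) x * F x ^+ 2)).
Proof.
have Q0 := q00; have Q3 := q30; have A3 := al3; have C0 := c0; have A2 := al2_ge1.
have Q1 : 0 < q1 by exact: lt_trans q00 q01.
have [CF CG _] := C2F; have [cF cG _] := CF.
have cH i j : continuous (H i j) by have [_ + _] := CG i.
have cl : continuous lapl by apply: cont_sum => i.
have dchi0 : forall t : R, is_derive t (1 : R) chi0 (chi1 t) by exact: is_derive_chi0.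
have cchi0 : continuous chi0 := is_derive_continuous dchi0.
have cq' : continuous q := continuous_dist2.
have cc0 : continuous (fun x => chi0 (q x)) by exact: cont_comp1.
set Pm := Num.max 0 (- p 0 ord0).
have Pm0 : 0 <= Pm by rewrite le_max lexx.
pose Iin := bint a b (fun x => \1_(shell q0 q1) x * F x ^+ 2).
pose Iout := bint a b (fun x => \1_(shell q2 q3) x * F x ^+ 2).
pose Ie := bint a b (fun x => \1_(shell q0 q3) x * e x ^+ 2).
pose Ib := bint a' b' (fun x => \1_(shell q0 q3) (rV_cons (0, x)) * G ord0 (rV_cons (0, x)) ^+ 2).
pose Imid := bint a b (fun x => \1_(shell q1 qb) x * F x ^+ 2).
have ind0 lo hi x : 0 <= \1_(shell lo hi) x :> R by rewrite indic_shell.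
have pin : 0 <= Iin by apply: bint_ge0 => x _; exact: (mulr_ge0 (ind0 _ _ _) (sqr_ge0 _)).
have pout : 0 <= Iout by apply: bint_ge0 => x _; exact: (mulr_ge0 (ind0 _ _ _) (sqr_ge0 _)).
have pe : 0 <= Ie by apply: bint_ge0 => x _; exact: (mulr_ge0 (ind0 _ _ _) (sqr_ge0 _)).
have pb : 0 <= Ib by apply: bint_ge0 => x _; exact: (mulr_ge0 (ind0 _ _ _) (sqr_ge0 _)).
have pmid : 0 <= Imid by apply: bint_ge0 => x _; exact: (mulr_ge0 (ind0 _ _ _) (sqr_ge0 _)).
have L1 : qb * om qb ^+ 2 * Imid <= bint a b (fun x => q x * (chi0 (q x) * F x) ^+ 2).
  rewrite -bintZ; last exact: bmf_shell.
  apply: le_bint; [by apply: bmfZ; exact: bmf_shell|by apply: bmf_continuous; cont_tac|] => x _.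
  have qx0 := dist2_ge0 x; rewrite indic_shell; case: (boolP (_ <= _ <= _)) => [mid|_]; last first.
    by rewrite mul0r mulr0; exact: (mulr_ge0 qx0 (sqr_ge0 _)).
  have [m1 m2] := andP mid.
  have q1x : q1 <= q x <= q2 by rewrite m1 (le_trans m2).
  have [z0 _ _] := eta_mid q01 q23 q1x.
  rewrite mul1r /chi0 z0 mulr1 exprMn [leRHS]mulrA; apply: (ler_wpM2r (sqr_ge0 _)).
  apply: weight_decr_mul => //; [exact: (lt_le_trans Q1)|].
  by apply: cq; apply: (le_trans qb2); exact: ltW.
have L2 : bint a b cut_rhs <= al ^+ 2 * (K1 q0 * om q0 ^+ 2 * Iin + K1 q2 * om q2 ^+ 2 * Iout) + om q0 ^+ 2 * K2 * Ie.
  have s1 : bmf (obox a b) (fun x => \1_(shell q0 q1) x * F x ^+ 2) by exact: bmf_shell.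
  have s2 : bmf (obox a b) (fun x => \1_(shell q2 q3) x * F x ^+ 2) by exact: bmf_shell.
  have s3 : bmf (obox a b) (fun x => \1_(shell q0 q3) x * e x ^+ 2) by exact: bmf_shell.
  have s4 := bmfD (bmfZ (K1 q0 * om q0 ^+ 2) s1) (bmfZ (K1 q2 * om q2 ^+ 2) s2).
  rewrite /Iin /Iout /Ie -(bintZ _ s1) -(bintZ _ s2) -(bintZ _ s3).
  rewrite -(bintD (bmfZ _ s1) (bmfZ _ s2)) -(bintZ _ s4).
  rewrite -(bintD (bmfZ _ s4) (bmfZ _ s3)).
  apply: (le_bint _ _ (fun x _ => cut_rhs_le x)).
    by apply: bmf_continuous; exact: continuous_cut_rhs.
  exact: (bmfD (bmfZ _ s4) (bmfZ _ s3)).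
have L3 : bint a' b' (fun x => p 0 ord0 * cbeta p al c (rV_cons (0, x)) * q (rV_cons (0, x))
      * (chi0 (q (rV_cons (0, x))) * G ord0 (rV_cons (0, x))) ^+ 2) <= Pm * al * q3 * M ^+ 2 * om q0 ^+ 2 * Ib.
  have s1 : bmf (obox a' b') (fun x => \1_(shell q0 q3) (rV_cons (0, x)) * G ord0 (rV_cons (0, x)) ^+ 2).
    exact: bmf_shell0.
  rewrite -bintZ//; apply: le_bint => //.
  - pose g x := p 0 ord0 * cbeta p al c x * q x * (chi0 (q x) * G ord0 x) ^+ 2.
    have cg : continuous g by rewrite /g /cbeta; cont_tac.
    by apply: (@bmf_continuous _ _ (fun x => g (rV_cons (0, x)))); exact: cont_slice2.
  - exact: bmfZ.
  move=> x' _; set x := rV_cons _; rewrite indic_shell.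
  case: (boolP (_ <= _ <= _)) => [/andP[x0 x3]|out]; last first.
    have [z0 _ _] : [/\ eta0 (q x) = 0, eta1 (q x) = 0 & eta2 (q x) = 0].
      apply: eta_out; move: out; rewrite negb_and -!ltNge => /orP[]; [by left|by right].
    by rewrite /chi0 z0 !(mulr0,mul0r,expr0n)/= ?(mulr0,mul0r).
  have qx0 := dist2_ge0 x; rewrite mul1r.
  have /eta_M[m0 _ _] : 0 <= q x <= q3 by rewrite qx0.
  have B1 : p 0 ord0 * cbeta p al c x <= Pm * al.
    have CQ := cq x3; have cp : 0 <= c * q x by rewrite mulr_ge0// ltW.
    have A := al0.
    have -> : p 0 ord0 * cbeta p al c x = (- p 0 ord0) * (al * (1 - c * q x)) by rewrite /cbeta; ring.
    apply: (@le_trans _ _ (Pm * (al * (1 - c * q x)))).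
      apply: ler_wpM2r; first by apply: mulr_ge0 => //; lra.
      by rewrite /Pm le_max lexx orbT.
    apply: ler_wpM2l => //; rewrite -[leRHS]mulr1; apply: ler_wpM2l => //; lra.
  have B2 : chi0 (q x) ^+ 2 <= om q0 ^+ 2 * M ^+ 2.
    rewrite /chi0 exprMn; apply: (ler_pM (sqr_ge0 _) (sqr_ge0 _) _ m0).
    by apply: sq_mono; [exact/ltW/weight_gt0|exact: om_q0].
  rewrite exprMn [leLHS]mulrA; apply: (ler_wpM2r (sqr_ge0 _)).
  apply: (@le_trans _ _ (Pm * al * q x * chi0 (q x) ^+ 2)).
    exact: (ler_wpM2r (sqr_ge0 _) (ler_wpM2r qx0 B1)).
  have PA : 0 <= Pm * al by exact: mulr_ge0.
  rewrite -[leRHS]mulrA [M ^+ 2 * _]mulrC; apply: (ler_pM (mulr_ge0 PA qx0) (sqr_ge0 _) _ B2).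
  exact: ler_wpM2l.
have R1 : om q0 ^+ 2 <= expR ((al + 1) * ln (qb / q0)) * om qb ^+ 2.
  apply: weight_ratio_inner => //; first exact: ltW.
  exact: le_trans (ltW q01) q1b.
have R2 : om q2 ^+ 2 <= expR (- (al * ((q2 - qb) / (2 * q2)))) * om qb ^+ 2.
  apply: weight_ratio_outer => //; first by apply: cq; exact: ltW.
  exact: lt_le_trans Q1 q1b.
rewrite -/Imid -/Iin -/Ie -/Ib -/Iout.
set r1' := expR _ in R1 *; set r2' := expR _ in R2 *.
set ob2 := om qb ^+ 2 in R1 R2 L1 *.
have obp : 0 < ob2 by rewrite exprn_gt0// weight_gt0.
have LB := local_bulk; rewrite -/Pm in LB L3.
have Q12 : 0 < al ^+ 2 * ob2 by rewrite mulr_gt0// (lt_le_trans ltr01).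
have K10 s : 0 < s -> 0 <= K1 s.
  move=> s0.
  exact: (mulr_ge0 (sqr_ge0 _) (addr_ge0 (addr_ge0 (addr_ge0 (ler0n _ 32) (mulr_ge0 (ler0n _ 48) (ltW Q3)))
    (mulr_ge0 (ler0n _ 3072) (divr_ge0 (ltW Q3) (ltW s0)))) (mulr_ge0 (ler0n _ 3) (sqr_ge0 _)))).
have Q2 : 0 < q2 by exact: (lt_trans q00 (lt_trans q01 q12)).
have K20 : 0 <= K2.
  exact: (mulr_ge0 (sqr_ge0 _) (addr_ge0 (mulr_ge0 (ler0n _ 6) (sqr_ge0 _)) (mulr_ge0 (ler0n _ 48) (ltW Q3)))).
have K30 : 0 <= cst_bd by exact: (mulr_ge0 (mulr_ge0 (mulr_ge0 (ler0n _ 4) Pm0) (ltW Q3)) (sqr_ge0 _)).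
have [k10 k12] : 0 <= K1 q0 /\ 0 <= K1 q2 by split; exact: K10.
have r10 : 0 <= r1' by exact: expR_ge0.
have r20 : 0 <= r2' by exact: expR_ge0.
rewrite -(ler_pM2l Q12).
have al3c : 0 <= al ^+ 3 * c by exact: (mulr_ge0 (exprn_ge0 _ al0) (ltW C0)).
have H0 := ler_wpM2l al3c L1.
set S := bint a b (fun x => q x * _) in LB H0; set S' := bint a' b' _ in L3 LB.
set S'' := bint a b cut_rhs in LB L2.
set o0 := om q0 ^+ 2 in L2 L3 R1; set o2 := om q2 ^+ 2 in L2 R2.
have o00 : 0 <= o0 by exact: sqr_ge0.
have E3 : cst_bd = 4 * Pm * q3 * M ^+ 2 by [].
set K3 := cst_bd in K30 E3 *; set k1 := K1 q0 in L2 k10 *; set k2 := K1 q2 in L2 k12 *.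
set ks := K2 in L2 K20 *.
have qb0 : 0 <= qb by exact: (le_trans (ltW Q1)).
(* One of the three powers of [al] is given up, so that the factor [al^2] of the cutoff errors
   cancels. *)
apply: (@le_trans _ _ (al ^+ 3 * c * (qb * ob2 * Imid))).
  rewrite [leLHS](_ : _ = al ^+ 2 * (c * qb * ob2 * Imid)); last by rewrite /c; field; rewrite gt_eqF.
  rewrite [leRHS](_ : _ = al * (al ^+ 2 * (c * qb * ob2 * Imid))); last by ring.
  have P : 0 <= al ^+ 2 * (c * qb * ob2 * Imid).
    exact: (mulr_ge0 (sqr_ge0 _) (mulr_ge0 (mulr_ge0 (mulr_ge0 (ltW C0) qb0) (ltW obp)) pmid)).
  by rewrite ler_peMl.
apply: (@le_trans _ _ (al ^+ 2 * (k1 * o0 * Iin + k2 * o2 * Iout) + o0 * ks * Ie + al * K3 * o0 * Ib)).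
  by move: E3 LB L2 L3 H0; clearbody K3 => ->; only_section; lra.
have H3 : o0 * ks * Ie <= al ^+ 2 * (ks * (o0 * Ie)).
  rewrite (_ : o0 * ks * Ie = ks * (o0 * Ie)); last by ring.
  by apply: ler_peMl => //; exact: (mulr_ge0 K20 (mulr_ge0 o00 pe)).
have H4 : al * K3 * o0 * Ib <= al ^+ 2 * (K3 * (o0 * Ib)).
  rewrite (_ : al * K3 * o0 * Ib = al * (K3 * (o0 * Ib))); last by ring.
  rewrite expr2 -[leRHS]mulrA; apply: ler_wpM2l => //; apply: ler_peMl; last exact: al_ge1.
  exact: (mulr_ge0 K30 (mulr_ge0 o00 pb)).
have W1 : k1 * (o0 * Iin) <= k1 * (r1' * ob2 * Iin) by apply: ler_wpM2l => //; exact: ler_wpM2r.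
have W2 : ks * (o0 * Ie) <= ks * (r1' * ob2 * Ie) by apply: ler_wpM2l => //; exact: ler_wpM2r.
have W3 : K3 * (o0 * Ib) <= K3 * (r1' * ob2 * Ib) by apply: ler_wpM2l => //; exact: ler_wpM2r.
have W4 : k2 * (o2 * Iout) <= k2 * (r2' * ob2 * Iout) by apply: ler_wpM2l => //; exact: ler_wpM2r.
have P1 : 0 <= ks * (r1' * ob2 * Iin).
  exact: (mulr_ge0 K20 (mulr_ge0 (mulr_ge0 r10 (ltW obp)) pin)).
have P2 : 0 <= k1 * (r1' * ob2 * Ie).
  exact: (mulr_ge0 k10 (mulr_ge0 (mulr_ge0 r10 (ltW obp)) pe)).
clearbody K3 k1 k2 ks o0 o2 ob2 r1' r2'.
apply: (@le_trans _ _ (al ^+ 2 * (k1 * (o0 * Iin) + k2 * (o2 * Iout) + ks * (o0 * Ie) + K3 * (o0 * Ib)))).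
  by move: H3 H4; only_section; lra.
by rewrite -[leRHS]mulrA; apply: (ler_wpM2l (sqr_ge0 _)); move: W1 W2 W3 W4 P1 P2; only_section; lra.
Qed.

End local.

(** * Two Carleman steps in a unit cell *)

Section two_steps.
Context {R : realType} {d : nat}.
Local Notation n := d.+1.
Local Notation V := 'rV[R]_n.
Hypothesis d_gt0 : (0 < d)%N.
Local Notation D := (d%:R : R).
Variables (z : 'rV[R]_d) (delta : R).
Hypothesis delta0 : 0 < delta.
Hypothesis delta2 : delta < 2^-1.

(** Half-width [4 d] and height [4 d + 1] put all faces but the bottom at squared distance at least
    [(4 d)^2 >= 16 d] from both poles, so the largest cutoff, of squared radius [16 d], vanishes on
    them. *)
Definition slab_lo (z : 'rV[R]_d) (i : 'I_n) : R := rV_cons (0, z - const_mx (4 * D)) 0 i.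
Definition slab_hi (z : 'rV[R]_d) (i : 'I_n) : R := rV_cons (4 * D + 1, z + const_mx (4 * D)) 0 i.
Local Notation a := (slab_lo z).
Local Notation b := (slab_hi z).
Local Notation a' := (fun i => a (lift ord0 i)).
Local Notation b' := (fun i => b (lift ord0 i)).

Lemma slab_lo0 : a ord0 = 0. Proof. exact: rV_cons0. Qed.
Lemma slab_hi0 : b ord0 = 4 * D + 1. Proof. exact: rV_cons0. Qed.
Lemma slab_loS i : a (lift ord0 i) = z 0 i - 4 * D.
Proof. by rewrite /slab_lo rV_consS !mxE. Qed.
Lemma slab_hiS i : b (lift ord0 i) = z 0 i + 4 * D.
Proof. by rewrite /slab_hi rV_consS !mxE. Qed.

Let D1 : 1 <= D. Proof. by rewrite ler1n. Qed.

Lemma slab_le i : a i <= b i.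
Proof.
have := D1; case: (unliftP ord0 i) => [j|] ->; rewrite ?slab_loS ?slab_hiS ?slab_lo0 ?slab_hi0; lra.
Qed.

Lemma dist2_pole s (x : V) :
  dist2 (rV_cons (s, z)) x = (x 0 ord0 - s) ^+ 2 + \sum_j (x 0 (lift ord0 j) - z 0 j) ^+ 2.
Proof.
rewrite /dist2 big_ord_recl /shiftc rV_cons0; congr (_ + _).
by apply: eq_bigr => j _; rewrite rV_consS.
Qed.

Lemma lateral_dist2 s x : lateral a b x -> s <= 1 -> 16 * D <= dist2 (rV_cons (s, z)) x.
Proof.
move=> lx s1; have D1' := D1; rewrite dist2_pole.
have S0 : 0 <= \sum_j (x 0 (lift ord0 j) - z 0 j) ^+ 2.
  by apply: sumr_ge0 => j _; exact: sqr_ge0.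
have D16 : 16 * D <= (4 * D) ^+ 2.
  by rewrite exprMn (_ : 4 ^+ 2 = 16) ?ler_wpM2l ?ler_eXnr//; ring.
case: lx => [->|[j lj]].
  rewrite slab_hi0; apply: le_trans D16 _; rewrite -[leLHS]addr0; apply: lerD => //.
  by rewrite ler_pXn2r ?nnegrE//; lra.
apply: le_trans D16 _; rewrite (bigD1 j)//= addrCA -[leLHS]addr0; apply: lerD; last first.
  by apply: addr_ge0; [exact: sqr_ge0|apply: sumr_ge0 => k _; exact: sqr_ge0].
by case: lj => ->; rewrite ?slab_loS ?slab_hiS le_eqVlt; apply/orP; left; apply/eqP; ring.
Qed.

Lemma euclid_ballP (x : 'rV[R]_d) :
  euclid_ball z delta x <-> \sum_i (x 0 i - z 0 i) ^+ 2 < delta ^+ 2.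
Proof.
rewrite /euclid_ball/= -[X in _ <-> _ < X]sqr_sqrtr ?sqr_ge0// sqrtr_sqr gtr0_norm//.
have S0 : 0 <= \sum_i (x 0 i - z 0 i) ^+ 2 by apply: sumr_ge0 => j _; exact: sqr_ge0.
by rewrite -[X in _ <-> X < _]sqr_sqrtr// ltr_pXn2r ?nnegrE ?sqrtr_ge0 ?ltW.
Qed.

Lemma measurable_euclid_ball : measurable (euclid_ball z delta).
Proof.
have cq : continuous (fun x : 'rV[R]_d => \sum_i (x 0 i - z 0 i) ^+ 2).
  apply: cont_sum => i; apply: contX; apply: contB; last exact: cont_cst.
  exact: coord_continuous.
have /(_ measurableT `]-oo, (delta ^+ 2)[%classic) := continuous_measurable_rV cq.
rewrite setTI => /(_ (measurable_itv _)).
congr measurable; apply/seteqP; split => x; rewrite /= in_itv/=.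
  by move/euclid_ballP.
by move=> h; apply/euclid_ballP.
Qed.

Variables (F : V -> R) (G : 'I_n -> V -> R) (H : 'I_n -> 'I_n -> V -> R).
Hypothesis C2F : C2 F G H.
Hypothesis F0 : forall x, F (rV_cons (0, x)) = 0.
Variables (ka : R) (e : V -> R).
Hypothesis ka0 : 0 <= ka.
Hypothesis ce : continuous e.
Hypothesis e0 : forall x, 0 <= e x.
Hypothesis Fe : forall x, `|lapl H x| <= ka * `|F x| + e x.
Variable M : R.
Hypothesis ME : M = 36 * 37 * 36 * 10 ^+ 2.

(** A common bound for the constants of both steps. The largest term is [3072 * q3 / q0] of the
    second one, which is [3072 * 2048 * d] once multiplied by [delta^2]; [2600^2] leaves room for
    the others. In [M] the ratio is 10, because the tightest shell satisfies
    [19 / 10 <= 10 * (2 / 10)]. *)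
Definition two_step_cst := M ^+ 2 * (2600 ^+ 2 * D ^+ 2 + 3 * (4 + 2 * n%:R) ^+ 2).
Local Notation k := two_step_cst.

Let Ie := bint a b (fun x => e x ^+ 2).
Let Iout := bint a b (fun x => F x ^+ 2).
Let Ib := bint a' b' (fun x => \1_(euclid_ball z delta) x * G ord0 (rV_cons (0, x)) ^+ 2).
Local Notation p1 := (rV_cons (- delta, z)).
Local Notation p2 := (rV_cons (delta / 8, z)).
Let I1 := bint a b (fun x => \1_(shell p1 (delta ^+ 2 / 2) (8 / 5 * delta ^+ 2)) x * F x ^+ 2).
Let I2 := bint a b (fun x => \1_(shell p2 (delta ^+ 2 / 64) (4 * D)) x * F x ^+ 2).

Let cF : continuous F. Proof. by have [[]] := C2F. Qed.
Let cG i : continuous (G i). Proof. by have [[_]] := C2F. Qed.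

Let bmfi S (f : V -> R) : measurable S -> continuous f -> bmf (obox a b) (fun x => \1_S x * f x ^+ 2).
Proof.
move=> mS cf; apply: bmfM; first exact: bmf_indic.
by apply: bmf_continuous; exact: contX.
Qed.

Let bint_sub S S' (f : V -> R) : measurable S -> measurable S' -> continuous f ->
  (forall x, obox a b x -> S x -> S' x) ->
  bint a b (fun x => \1_S x * f x ^+ 2) <= bint a b (fun x => \1_S' x * f x ^+ 2).
Proof.
move=> mS mS' cf SS'; apply: le_bint; [exact: bmfi|exact: bmfi|] => x Qx.
apply: (ler_wpM2r (sqr_ge0 _)); rewrite !indicE ler_nat.
by case: (boolP (x \in S)) => // /set_mem/(SS' _ Qx)/mem_set ->.
Qed.

Let bint_all S (f : V -> R) : measurable S -> continuous f ->
  bint a b (fun x => \1_S x * f x ^+ 2) <= bint a b (fun x => f x ^+ 2).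
Proof.
move=> mS cf; apply: le_bint; [exact: bmfi|by apply: bmf_continuous; exact: contX|] => x Qx.
by rewrite -[leRHS]mul1r; apply: (ler_wpM2r (sqr_ge0 _)); rewrite indicE; case: (_ \in _).
Qed.

Let k_ge0 : 0 <= k.
Proof.
exact: (mulr_ge0 (sqr_ge0 _) (addr_ge0 (mulr_ge0 (sqr_ge0 _) (sqr_ge0 _))
  (mulr_ge0 (ler0n _ 3) (sqr_ge0 _)))).
Qed.

Let DD : D <= D ^+ 2. Proof. by rewrite ler_eXnr. Qed.
Let de2 : delta ^+ 2 <= 4^-1.
Proof.
rewrite (_ : 4^-1 = 2^-1 ^+ 2); last by field.
by have := delta2; rewrite ler_pXn2r ?nnegrE ?ltW// => /ltW.
Qed.
Let de20 : 0 < delta ^+ 2. Proof. exact: exprn_gt0. Qed.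

Definition cell : set V :=
  [set x : V | x 0 ord0 <= 1 /\ forall j, `|x 0 (lift ord0 j) - z 0 j| <= 3 / 2].

Lemma measurable_cell : measurable cell.
Proof.
have mc i (f : R -> R) (c : R) : continuous f -> measurable [set x : V | f (x 0 i) <= c].
  move=> cf; have cfx : continuous (fun x : V => f (x 0 i)).
    by apply: cont_comp1 => //; exact: coord_continuous.
  have /(_ measurableT `]-oo, c]%classic) := continuous_measurable_rV cfx.
  rewrite setTI => /(_ (measurable_itv _)).
  by congr measurable; apply/seteqP; split => x; rewrite /= in_itv.
rewrite (_ : cell = [set x : V | x 0 ord0 <= 1] `&`
    \bigcap_(j in [set: 'I_d]) [set x : V | `|x 0 (lift ord0 j) - z 0 j| <= 3 / 2]).
  apply: measurableI; first by apply: (mc ord0 id) => t; exact: cvg_id.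
  apply: fin_bigcap_measurable => // j _.
  apply: (mc (lift ord0 j) (fun t => `|t - z 0 j|)).
  apply: cont_norm; apply: contB; last exact: cont_cst.
  by move=> t; exact: cvg_id.
by apply/seteqP; split => x [x1 x2]; split => // j; [move=> _|]; exact: x2.
Qed.

(** The junction of the two steps. A point of the half-space within [delta / 8] of the second pole
    has height at most [delta / 4], so its squared distance to the first pole lies between [delta^2]
    and [101 / 64 * delta^2], which is below [8 / 5 * delta^2]. *)
Let near_pole x : obox a b x -> dist2 p2 x <= delta ^+ 2 / 64 ->
  shell p1 (delta ^+ 2 / 2) (8 / 5 * delta ^+ 2) x.
Proof.
move=> /(_ ord0); rewrite slab_lo0 => /andP[x0 _].
have d0 := delta0; have d2 := de2; have d20 := de20.
have S0 : 0 <= \sum_j (x 0 (lift ord0 j) - z 0 j) ^+ 2.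
  by apply: sumr_ge0 => j _; exact: sqr_ge0.
rewrite /shell/= !dist2_pole; set t := x 0 ord0 in x0 *; set S := \sum_j _ in S0 * => h.
have t1 : t <= delta / 4 by rewrite leNgt; apply/negP => h1; nra.
by apply/andP; split; nra.
Qed.

Local Ltac only_section := clear -d_gt0 delta0 delta2 D1 C2F F0 ka0 ce e0 Fe ME
  Ie Iout Ib I1 I2 cF cG bmfi bint_sub bint_all k_ge0 DD de2 de20 near_pole;
  have ? := delta0; have ? := delta2; have ? := de2; have ? := de20; have ? := D1; have ? := DD.

(** The pole lies at depth [delta], so points of the half-space are at squared distance greater than
    [delta^2 / 2]: the inner transition shell is empty and no interior data enters. *)
Lemma first_step al : 3 <= al -> 12 * (16 * D) ^+ 2 * ka ^+ 2 <= al ^+ 3 ->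
  I1 <= 3 * k * (expR ((al + 1) * 6) * (Ie + Ib) + expR (- (al / 34)) * Iout).
Proof.
move=> al3 alka; have d0 := delta0; have d2 := de2; have d20 := de20; have D1' := D1.
have DD' := DD; have q23 : 17 / 10 * delta ^+ 2 < 19 / 10 * delta ^+ 2 by lra.
have q12 : delta ^+ 2 / 2 < 17 / 10 * delta ^+ 2 by lra.
have q01 : delta ^+ 2 / 4 < delta ^+ 2 / 2 by lra.
have q00 : 0 < delta ^+ 2 / 4 by lra.
have q3D : 19 / 10 * delta ^+ 2 <= 16 * D by lra.
have lat x : lateral a b x -> 19 / 10 * delta ^+ 2 <= dist2 p1 x.
  move=> /lateral_dist2 => /(_ (- delta)) L; apply: le_trans q3D (L _); lra.
have alka' : 12 * (19 / 10 * delta ^+ 2) ^+ 2 * ka ^+ 2 <= al ^+ 3.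
  apply: le_trans alka; apply: (ler_wpM2r (sqr_ge0 _)); apply: (ler_wpM2l (ler0n _ 12)).
  by rewrite ler_pXn2r ?nnegrE//; lra.
have := local_estimate slab_le slab_lo0 C2F F0 q00 q01 q12 q23 ka0 ce e0 Fe lat al3 alka'
  (_ : 1 <= 10) _ _ ME (_ : _ <= 8 / 5 * delta ^+ 2) _.
move=> /(_ (ler1n _ 10)) LE.
have {}LE := LE ltac:(only_section; lra) ltac:(only_section; lra) ltac:(only_section; lra) ltac:(only_section; lra).
move: LE; rewrite -/I1.
have -> : bint a b (fun x => \1_(shell p1 (delta ^+ 2 / 4) (delta ^+ 2 / 2)) x * F x ^+ 2) = 0.
  rewrite -(bint0 a b); apply: eq_bint => x Qx; rewrite indic_shell.
  have := Qx ord0; rewrite slab_lo0 => /andP[x0 _].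
  have S0 : 0 <= \sum_j (x 0 (lift ord0 j) - z 0 j) ^+ 2.
    by apply: sumr_ge0 => j _; exact: sqr_ge0.
  have : delta ^+ 2 / 2 < dist2 p1 x by rewrite dist2_pole; nra.
  by rewrite ltNge => /negbTE ->; rewrite andbF mul0r.
set J1 := bint a b (fun x => \1__ x * e x ^+ 2); set J2 := bint a' b' _; set J3 := bint a b _.
have J1e : J1 <= Ie by apply: bint_all => //; exact: measurable_shell.
have J3e : J3 <= Iout by apply: bint_all => //; exact: measurable_shell.
have J1p : 0 <= Ie by apply: bint_ge0 => x _; exact: sqr_ge0.
have J3p : 0 <= Iout by apply: bint_ge0 => x _; exact: sqr_ge0.
have mb : bmf (obox a' b') (fun x => G ord0 (rV_cons (0, x)) ^+ 2).
  by apply: bmf_continuous; apply: contX; exact: cont_slice2.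
have J2p : 0 <= J2.
  by apply: bint_ge0 => x _; rewrite indic_shell; exact: (mulr_ge0 (ler0n _ _) (sqr_ge0 _)).
(* On the face, [delta^2 + |x - z|^2 <= 19 / 10 * delta^2] puts [x] inside the ball of radius
   [delta]. *)
have J2e : J2 <= Ib.
  apply: le_bint.
  - apply: bmfM => //; split; last first.
      by exists 1 => x _; rewrite indic_shell; case: (_ <= _ <= _); rewrite ?normr1 ?normr0.
    apply: (measurableT_comp (measurable_indic (measurable_shell _ _ _))).
    exact: measurable_rV_cons2.
  - by apply: bmfM => //; apply: bmf_indic; exact: measurable_euclid_ball.
  move=> x _; apply: (ler_wpM2r (sqr_ge0 _)); rewrite indic_shell indicE ler_nat.
  case: (boolP (_ <= _ <= _)) => // /andP[_]; rewrite dist2_pole rV_cons0 => h.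
  have -> // : x \in euclid_ball z delta.
  apply/mem_set/euclid_ballP; under eq_bigr do rewrite -(rV_consS (0, x)).
  by move: h d0 => /=; only_section; nra.
have L1 : (al + 1) * ln (8 / 5 * delta ^+ 2 / (delta ^+ 2 / 4)) <= (al + 1) * 6.
  apply: ler_wpM2l; first by move: al3; only_section; lra.
  rewrite (_ : _ / _ = 1 + 27 / 5); last by only_section; field; lra.
  by apply: le_trans (le_ln1Dx _) _; only_section; lra.
(* The small margin between [8 / 5] and [17 / 10] fixes the decay rate [1 / 34], for which
   [two_steps] compensates by a larger parameter. *)
have L2 : - (al * ((17 / 10 * delta ^+ 2 - 8 / 5 * delta ^+ 2) / (2 * (17 / 10 * delta ^+ 2)))) = - (al / 34).
  by only_section; field; lra.
rewrite L2; rewrite -ler_expR in L1.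
have E1 : 8 / 5 * delta ^+ 2 / (2 * (19 / 10 * delta ^+ 2)) = 8 / 19 by only_section; field; lra.
rewrite E1 add0r.
have C1 : cst_cut (d := d) (19 / 10 * delta ^+ 2) M (delta ^+ 2 / 4) + cst_src (19 / 10 * delta ^+ 2) M <= k.
  rewrite /cst_cut /cst_src /two_step_cst -mulrDr; apply: (ler_wpM2l (sqr_ge0 _)).
  have -> : 19 / 10 * delta ^+ 2 / (delta ^+ 2 / 4) = 38 / 5 by only_section; field; lra.
  have : (19 / 10 * delta ^+ 2) ^+ 2 <= 1 by only_section; rewrite expr_le1//; lra.
  have := sqr_ge0 (4 + 2 * n%:R : R).
  by only_section; lra.
have C2 : cst_cut (d := d) (19 / 10 * delta ^+ 2) M (17 / 10 * delta ^+ 2) <= k.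
  rewrite /cst_cut /two_step_cst; apply: (ler_wpM2l (sqr_ge0 _)).
  have -> : 19 / 10 * delta ^+ 2 / (17 / 10 * delta ^+ 2) = 19 / 17 by only_section; field; lra.
  have := sqr_ge0 (4 + 2 * n%:R : R).
  by only_section; lra.
have C3 : cst_bd p1 (19 / 10 * delta ^+ 2) M <= k.
  rewrite /cst_bd rV_cons0 /= opprK (max_idPr (ltW d0)) /two_step_cst [leLHS]mulrC; apply: (ler_wpM2l (sqr_ge0 _)).
  have := sqr_ge0 (4 + 2 * n%:R : R); have : delta * delta ^+ 2 <= 1 * 4^-1 by apply: ler_pM => //; [exact: ltW|exact: ltW|have := delta2; only_section; lra].
  by only_section; lra.
have J1p' : 0 <= J1.
  by apply: bint_ge0 => x _; rewrite indic_shell; exact: (mulr_ge0 (ler0n _ _) (sqr_ge0 _)).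
have J3p' : 0 <= J3.
  by apply: bint_ge0 => x _; rewrite indic_shell; exact: (mulr_ge0 (ler0n _ _) (sqr_ge0 _)).
set cc := cst_cut _ _ _ + _ in C1 *; set c2 := cst_cut _ _ _ in C2 *; set c3 := cst_bd _ _ _ in C3 *.
set E := expR _ in L1 *; set E' := expR ((al + 1) * 6) in L1 *; set E'' := expR _.
have K0 := k_ge0.
have B1 : cc * J1 + c3 * J2 <= k * (Ie + Ib).
  rewrite mulrDr; apply: lerD.
    by apply: (le_trans (ler_wpM2r J1p' C1)); exact: ler_wpM2l.
  by apply: (le_trans (ler_wpM2r J2p C3)); exact: ler_wpM2l.
have B2 : c2 * J3 <= k * Iout.
  by apply: (le_trans (ler_wpM2r J3p' C2)); exact: ler_wpM2l.
have B3 := ler_wpM2l (expR_ge0 _ : 0 <= E) B1.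
have B4 := ler_wpM2l (expR_ge0 _ : 0 <= E'') B2.
have B5 : 0 <= k * (Ie + Ib) := mulr_ge0 K0 (addr_ge0 J1p (le_trans J2p J2e)).
have B6 := ler_wpM2r B5 L1.
have B7 : 0 <= E' * (k * (Ie + Ib)) by exact: (mulr_ge0 (expR_ge0 _) B5).
have B8 : 0 <= E'' * (k * Iout) by apply: mulr_ge0; [exact: expR_ge0|exact: mulr_ge0].
by move: B3 B4 B6 B7 B8; only_section; lra.
Qed.

(** The pole lies above the hyperplane, so [cst_bd] is 0; in exchange [F] is needed in the inner
    shell, where the first step provides it. The division by [delta ^+ 2] comes from [q3 / q0]. *)
Lemma second_step al : 3 <= al -> 12 * (16 * D) ^+ 2 * ka ^+ 2 <= al ^+ 3 ->
  I2 <= 8 * k * (expR ((al + 1) * ln (512 * D / delta ^+ 2)) / delta ^+ 2 * (I1 + Ie)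
    + expR (- (al / 4)) * Iout).
Proof.
move=> al3 alka; have d0 := delta0; have d2 := de2; have d20 := de20; have D1' := D1.
have DD' := DD; have q23 : 8 * D < 16 * D by lra.
have q12 : delta ^+ 2 / 64 < 8 * D by lra.
have q01 : delta ^+ 2 / 128 < delta ^+ 2 / 64 by lra.
have q00 : 0 < delta ^+ 2 / 128 by lra.
have lat x : lateral a b x -> 16 * D <= dist2 p2 x.
  move=> /lateral_dist2 => /(_ (delta / 8)); apply; have := delta2; lra.
have := local_estimate slab_le slab_lo0 C2F F0 q00 q01 q12 q23 ka0 ce e0 Fe lat al3 alka
  (_ : 1 <= 10) _ _ ME (_ : _ <= 4 * D) _.
move=> /(_ (ler1n _ 10)) LE.
have {}LE := LE ltac:(only_section; lra) ltac:(only_section; lra) ltac:(only_section; lra) ltac:(only_section; lra).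
move: LE; rewrite -/I2.
have -> : cst_bd p2 (16 * D) M = 0.
  rewrite /cst_bd rV_cons0 /= max_l ?mulr0 ?mul0r//; lra.
rewrite mul0r addr0.
set J0 := bint a b _; set J1 := bint a b (fun x => \1__ x * e x ^+ 2); set J3 := bint a b _.
have J1e : J1 <= Ie by apply: bint_all => //; exact: measurable_shell.
have J3e : J3 <= Iout by apply: bint_all => //; exact: measurable_shell.
have J0e : J0 <= I1.
  apply: bint_sub => //; [exact: measurable_shell|exact: measurable_shell|] => x Qx.
  by rewrite [X in X -> _]/= => /andP[_ h]; exact: near_pole.
have J0p' : 0 <= J0.
  by apply: bint_ge0 => x _; rewrite indic_shell; exact: (mulr_ge0 (ler0n _ _) (sqr_ge0 _)).
have J1p' : 0 <= J1.
  by apply: bint_ge0 => x _; rewrite indic_shell; exact: (mulr_ge0 (ler0n _ _) (sqr_ge0 _)).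
have J3p' : 0 <= J3.
  by apply: bint_ge0 => x _; rewrite indic_shell; exact: (mulr_ge0 (ler0n _ _) (sqr_ge0 _)).
have -> : 4 * D / (delta ^+ 2 / 128) = 512 * D / delta ^+ 2 by only_section; field; lra.
have -> : al * ((8 * D - 4 * D) / (2 * (8 * D))) = al / 4 by only_section; field; lra.
have -> : 4 * D / (2 * (16 * D)) = 8^-1 by only_section; field; lra.
have C1 : cst_cut (d := d) (16 * D) M (delta ^+ 2 / 128) + cst_src (16 * D) M <= k / delta ^+ 2.
  rewrite ler_pdivlMr// /cst_cut /cst_src /two_step_cst -mulrDr -[leLHS]mulrA; apply: (ler_wpM2l (sqr_ge0 _)).
  have -> : (32 + 48 * (16 * D) + 3072 * (16 * D / (delta ^+ 2 / 128)) + 3 * (4 + 2 * n%:R) ^+ 2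
     + (6 * (16 * D) ^+ 2 + 48 * (16 * D))) * delta ^+ 2 = 3072 * 2048 * D
     + (32 + 1536 * D + 1536 * D ^+ 2 + 3 * (4 + 2 * n%:R) ^+ 2) * delta ^+ 2 by only_section; field; lra.
  have S4 := sqr_ge0 (4 + 2 * n%:R : R).
  have : (32 + 1536 * D + 1536 * D ^+ 2 + 3 * (4 + 2 * n%:R) ^+ 2) * delta ^+ 2 <=
     (32 + 1536 * D + 1536 * D ^+ 2 + 3 * (4 + 2 * n%:R) ^+ 2) * 1 by apply: ler_wpM2l; move: S4; only_section; lra.
  by move: S4; only_section; lra.
have C2 : cst_cut (d := d) (16 * D) M (8 * D) <= k.
  rewrite /cst_cut /two_step_cst; apply: (ler_wpM2l (sqr_ge0 _)).
  have -> : 16 * D / (8 * D) = 2 by only_section; field; lra.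
  have := sqr_ge0 (4 + 2 * n%:R : R).
  by only_section; lra.
set cc := cst_cut _ _ _ + _ in C1 *; set c2 := cst_cut _ _ _ in C2 *.
set E := expR _; set E'' := expR _.
have K0 := k_ge0.
have K1 : 0 <= k / delta ^+ 2 by rewrite divr_ge0// ltW.
have B1 : cc * (J0 + J1) <= k / delta ^+ 2 * (I1 + Ie).
  apply: le_trans (ler_wpM2r _ C1) _; first exact: addr_ge0.
  by apply: ler_wpM2l => //; exact: lerD.
have B2 : c2 * J3 <= k * Iout.
  by apply: (le_trans (ler_wpM2r J3p' C2)); exact: ler_wpM2l.
have B3 := ler_wpM2l (expR_ge0 _ : 0 <= E) B1.
have B4 := ler_wpM2l (expR_ge0 _ : 0 <= E'') B2.
rewrite (_ : E / delta ^+ 2 * (I1 + Ie) = E * (delta ^-2 * (I1 + Ie))); last by rewrite mulrA.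
rewrite -mulrA [_ * (I1 + Ie)]mulrC in B3.
rewrite [_ / delta ^+ 2]mulrC in B3.
by move: B3 B4; only_section; lra.
Qed.

(* The exponent of the first step is tuned so that its remainder, amplified by
   the constant of the second step, is no larger than that of the second. *)
Lemma two_steps al : 3 <= al -> 12 * (16 * D) ^+ 2 * ka ^+ 2 <= al ^+ 3 -> 1 <= k ->
  bint a b (fun x => \1_cell x * F x ^+ 2)
   <= 50 * k ^+ 2 * (expR (1000 * (ln (512 * D) + 1) * (al * - ln delta)) * (Ie + Ib)
      + expR (- (al / 4)) * Iout).
Proof.
move=> al3 alka k1; have d0 := delta0; have d2 := delta2; have D1' := D1.
have P1 : 512 * D \is Num.pos by rewrite posrE; lra.
have P2 : (delta ^+ 2)^-1 \is Num.pos by rewrite posrE invr_gt0 exprn_gt0.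
have mu0 : 0 <= ln (512 * D) by apply: ln_ge0; lra.
have lnE : ln (512 * D / delta ^+ 2) = ln (512 * D) + 2 * - ln delta.
  rewrite (lnM P1 P2) lnV ?posrE ?exprn_gt0// lnXn//.
  by rewrite mulrN (mulr_natl _ 2).
have dE : (delta ^+ 2)^-1 = expR (2 * - ln delta).
  by rewrite mulrN expRN expRM_natl lnK ?posrE.
have S2 := second_step al3 alka; rewrite lnE dE -expRD in S2.
move: (ln (512 * D)) mu0 S2 {lnE P1} => mu mu0 S2.
set la := - ln delta in S2 *.
(* From [ln delta <= delta - 1]. Together with [al >= 3] it lets every term of the exponents be
   absorbed into multiples of [al * la] and [al * la * mu]. *)
have la2 : 2^-1 <= la.
  by have := le_ln1Dx (x := delta - 1); rewrite [1 + _]addrC subrK /la => /(_ _); lra.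
set X := (al + 1) * (mu + 2 * la) + 2 * la in S2.
pose Pr := al * la.
have al0 : 0 <= al by lra.
have la1 : 0 <= 2 * la - 1 by lra.
have al3' : 0 <= al - 3 by lra.
have h1 : al * mu <= 2 * (Pr * mu) by have := mulr_ge0 (mulr_ge0 al0 mu0) la1; rewrite /Pr; lra.
have h2 : la <= Pr / 3 by have := mulr_ge0 al3' (_ : 0 <= la); rewrite /Pr => /(_ _); lra.
have h3 : al <= 2 * Pr by have := mulr_ge0 al0 la1; rewrite /Pr; lra.
have h4 : 3 * mu <= al * mu by have := mulr_ge0 al3' mu0; lra.
have XE : X = al * mu + 2 * Pr + mu + 4 * la by rewrite /X /Pr; ring.
have Pm : 0 <= Pr * mu by apply: mulr_ge0 => //; lra.
have X0 : 0 <= X by rewrite XE; move: h1 h2 h3 h4 Pm mu0 la2; rewrite /Pr; only_section; lra.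
pose al1 := 34 * (X + al / 4).
have al1l : al <= al1 by rewrite /al1; lra.
have F1 : 3 <= al1 by lra.
have F2 : 12 * (16 * D) ^+ 2 * ka ^+ 2 <= al1 ^+ 3.
  by apply: le_trans alka _; rewrite ler_pXn2r ?nnegrE//; lra.
have S1 := first_step F1 F2.
have e1 : expR X * expR (- (al1 / 34)) = expR (- (al / 4)).
  by rewrite -expRD; congr expR; rewrite /al1; field.
have Ie0 : 0 <= Ie by apply: bint_ge0 => x _; exact: sqr_ge0.
have Io0 : 0 <= Iout by apply: bint_ge0 => x _; exact: sqr_ge0.
have Ib0 : 0 <= Ib.
  by apply: bint_ge0 => x _; rewrite indicE; exact: (mulr_ge0 (ler0n _ _) (sqr_ge0 _)).
have I10 : 0 <= I1.
  by apply: bint_ge0 => x _; rewrite indicE; exact: (mulr_ge0 (ler0n _ _) (sqr_ge0 _)).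
have split : bint a b (fun x => \1_cell x * F x ^+ 2) <= I1 + I2.
  rewrite -bintD; [|by apply: bmfi => //; exact: measurable_shell|by apply: bmfi => //; exact: measurable_shell].
  apply: le_bint; [by apply: bmfi => //; exact: measurable_cell| |].
    by apply: bmfD; apply: bmfi => //; exact: measurable_shell.
  move=> x Qx; rewrite -mulrDl; apply: (ler_wpM2r (sqr_ge0 _)).
  rewrite indicE; case: (boolP (x \in cell)) => [/set_mem[x1 xj]|_]; last first.
    by rewrite !indicE; exact: (addr_ge0 (ler0n _ _) (ler0n _ _)).
  have [near|far] := leP (dist2 p2 x) (delta ^+ 2 / 64).
    rewrite [X in _ <= X + _]indicE mem_set; last exact: near_pole.
    by rewrite -[leLHS]addr0; apply: lerD => //; rewrite indicE; exact: ler0n.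
  rewrite [X in _ <= _ + X]indicE mem_set; last first.
    (* In the cell the squared distance to the second pole is at most [1 + 9 / 4 * d], which is
       below [4 * d]. *)
    rewrite /shell/= (ltW far) dist2_pole/=.
    have := Qx ord0; rewrite slab_lo0 => /andP[x0 _].
    have : \sum_j (x 0 (lift ord0 j) - z 0 j) ^+ 2 <= \sum_(j < d) (9 / 4 : R).
      apply: ler_sum => j _; have := xj j; rewrite ler_norml; only_section => /andP[]; nra.
    by rewrite sumr_const card_ord -mulr_natl; move: x0 x1; only_section; nra.
  by rewrite -[leLHS]add0r; apply: lerD => //; rewrite indicE; exact: ler0n.
have Xe : X + (al1 + 1) * 6 <= 1000 * (mu + 1) * (al * la).
  by rewrite -/Pr /al1 XE; lra.
apply: le_trans split _.
set A := expR X in S2 e1; set B := expR ((al1 + 1) * 6) in S1; set e2 := expR (- (al / 4)) in S2 e1 *.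
have A1 : 1 <= A by rewrite -[leLHS]expR0 ler_expR.
have B1 : 1 <= B by rewrite -[leLHS]expR0 ler_expR; move: F1; only_section; lra.
set Y := Ie + Ib in S1 *; have Y0 : 0 <= Y by exact: addr_ge0.
apply: (@le_trans _ _ (50 * k ^+ 2 * (A * B * Y + e2 * Iout))); last first.
  apply: ler_wpM2l; first exact: (mulr_ge0 (ler0n _ 50) (sqr_ge0 _)).
  rewrite lerD2r; apply: (ler_wpM2r Y0).
  by rewrite -expRD ler_expR.
set e3 := expR (- (al1 / 34)) in S1 e1.
have e20 : 0 <= e2 := expR_ge0 _; have e30 : 0 <= e3 := expR_ge0 _.
have K0 := k_ge0; move: k K0 k1 S1 S2 => kk K0 k1 S1 S2.
have A0 : 0 <= A := le_trans ler01 A1.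
have kA : 0 <= kk * A by exact: mulr_ge0.
have kA1 : 1 <= kk * A by rewrite -[leLHS]mulr1; apply: ler_pM.
have u1 : I1 <= kk * A * I1 by rewrite -[leLHS]mul1r; apply: ler_wpM2r.
have u2 : kk * A * I1 <= 3 * kk ^+ 2 * (A * B * Y + e2 * Iout).
  apply: le_trans (ler_wpM2l kA S1) _; rewrite -e1 le_eqVlt; apply/orP; left; apply/eqP; ring.
have kk2 : kk <= kk ^+ 2 by rewrite expr2 -[leLHS]mulr1; exact: ler_wpM2l.
have u3 : kk * (A * Ie) <= kk ^+ 2 * (A * B * Y).
  apply: ler_pM => //; first exact: mulr_ge0.
  apply: ler_pM => //; last by rewrite /Y lerDl.
  by rewrite -[leLHS]mulr1; exact: ler_wpM2l.
have u4 : kk * (e2 * Iout) <= kk ^+ 2 * (e2 * Iout) by apply: ler_wpM2r => //; exact: mulr_ge0.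
have u5 : 0 <= kk ^+ 2 * (A * B * Y).
  by apply: mulr_ge0; [exact: sqr_ge0|apply: mulr_ge0 => //; apply: mulr_ge0 => //; exact: le_trans ler01 B1].
have u6 : 0 <= kk ^+ 2 * (e2 * Iout) by apply: mulr_ge0; [exact: sqr_ge0|exact: mulr_ge0].
have u7 : kk * A * I1 = kk * (A * I1) by rewrite mulrA.
by move: S2 u1 u2 u3 u4 u5 u6 u7; only_section; lra.
Qed.

End two_steps.

(** * Square integrable functions *)

Section square_integrable.
Context {R : realType} {dT : measure_display} {T : measurableType dT}.
Variables (mu : {measure set T -> \bar R}) (D : set T).
Hypothesis mD : measurable D.
Implicit Types f g h : T -> R.

Definition sqi f := measurable_fun D f /\ mu.-integrable D (EFin \o (fun x => f x ^+ 2)).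
Definition ip f g : R := \int[mu]_(x in D) (f x * g x).
Definition nsq f : R := \int[mu]_(x in D) (f x ^+ 2).

Lemma sqiP f : sqi f <-> measurable_fun D f /\ (\int[mu]_(x in D) (f x ^+ 2)%:E < +oo)%E.
Proof.
split=> -[mf H]; split => //.
  case/integrableP: H => _; congr (_ < _)%E; apply: eq_integral => x _ /=.
  by rewrite ger0_norm// sqr_ge0.
apply/integrableP; split.
  by apply/measurable_EFinP; exact: measurable_funX.
move: H; congr (_ < _)%E; apply: eq_integral => x _ /=.
by rewrite ger0_norm// sqr_ge0.
Qed.

Lemma sqi_le f g : measurable_fun D f -> (forall x, D x -> `|f x| <= `|g x|) -> sqi g -> sqi f.
Proof.
move=> mf fg [mg ig]; split => //; apply: le_integrable ig => //.
  by apply/measurable_EFinP; exact: measurable_funX.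
move=> x Dx /=; rewrite lee_fin !normrX ler_pXn2r ?nnegrE//; exact: fg.
Qed.

Lemma sqi_int f g : sqi f -> sqi g -> mu.-integrable D (EFin \o (fun x => f x * g x)).
Proof.
move=> [mf if2] [mg ig2].
apply: (le_integrable mD _ _ (integrableD mD if2 ig2)).
  by apply/measurable_EFinP; exact: measurable_funM.
move=> x Dx /=; rewrite lee_fin normrM [leRHS]ger0_norm ?addr_ge0 ?sqr_ge0//.
have := sqr_ge0 (`|f x| - `|g x|).
by rewrite -(real_normK (num_real (f x))) -(real_normK (num_real (g x))); nra.
Qed.

Lemma sqiD f g : sqi f -> sqi g -> sqi (fun x => f x + g x).
Proof.
move=> sf sg; have [mf if2] := sf; have [mg ig2] := sg; split; first exact: measurable_funD.
have I := integrableD mD (integrableD mD if2 ig2) (integrableZl mD 2 (sqi_int sf sg)).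
apply: eq_integrable I => // x _ /=; rewrite -EFinM -!EFinD; congr _%:E; ring.
Qed.

Lemma sqiZ (c : R) f : sqi f -> sqi (fun x => c * f x).
Proof.
move=> [mf if2]; split; first exact: measurable_funM.
apply: eq_integrable (integrableZl mD (c ^+ 2) if2) => // x _ /=.
by rewrite -EFinM exprMn.
Qed.

Lemma sqiN f : sqi f -> sqi (fun x => - f x).
Proof. by move=> /(sqiZ (-1)); congr sqi; apply/funext => x; rewrite mulN1r. Qed.

Lemma sqiB f g : sqi f -> sqi g -> sqi (fun x => f x - g x).
Proof. by move=> sf /sqiN; exact: sqiD. Qed.

Lemma sqi0 : sqi (fun=> 0).
Proof.
apply/sqiP; split; first exact: measurable_cst.
by under eq_integral do rewrite expr0n/=; rewrite integral0.
Qed.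

Lemma sqi_bounded f (M : R) : (mu D < +oo)%E -> measurable_fun D f ->
  (forall x, D x -> `|f x| <= M) -> sqi f.
Proof.
move=> Doo mf fM; split => //; apply: measurable_bounded_integrable => //.
  exact: measurable_funX.
exists (M ^+ 2); split; first exact: num_real.
move=> N MN x Dx; apply: le_trans (ltW MN).
by rewrite normrX ler_pXn2r ?nnegrE// ?(le_trans _ (fM _ Dx))// fM.
Qed.

Lemma sqi_sum I (s : seq I) (f : I -> T -> R) :
  (forall i, sqi (f i)) -> sqi (fun x => \sum_(i <- s) f i x).
Proof.
move=> sf; elim: s => [|i s IH].
  by rewrite (_ : (fun _ => _) = fun=> 0); [exact: sqi0|apply/funext => x; rewrite big_nil].
rewrite (_ : (fun _ => _) = fun x => f i x + \sum_(j <- s) f j x); first exact: sqiD.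
by apply/funext => x; rewrite big_cons.
Qed.

Lemma ipC f g : ip f g = ip g f.
Proof. by apply: eq_Rintegral => x _; rewrite mulrC. Qed.

Lemma ipDl f g h : sqi f -> sqi g -> sqi h -> ip (fun x => f x + g x) h = ip f h + ip g h.
Proof.
move=> sf sg sh; rewrite /ip; under eq_Rintegral do rewrite mulrDl.
by apply: RintegralD => //; exact: sqi_int.
Qed.

Lemma ipZl (c : R) f h : sqi f -> sqi h -> ip (fun x => c * f x) h = c * ip f h.
Proof.
move=> sf sh; rewrite /ip; under eq_Rintegral do rewrite -mulrA.
by apply: RintegralZl => //; exact: sqi_int.
Qed.

Lemma ipBl f g h : sqi f -> sqi g -> sqi h -> ip (fun x => f x - g x) h = ip f h - ip g h.
Proof.
move=> sf sg sh; rewrite -mulN1r -ipZl// -ipDl//; last exact: sqiZ.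
by congr ip; apply/funext => x; rewrite mulN1r.
Qed.

Lemma ipDr f g h : sqi f -> sqi g -> sqi h -> ip h (fun x => f x + g x) = ip h f + ip h g.
Proof. by move=> sf sg sh; rewrite ipC ipDl// !(ipC h). Qed.

Lemma ipZr (c : R) f h : sqi f -> sqi h -> ip h (fun x => c * f x) = c * ip h f.
Proof. by move=> sf sh; rewrite ipC ipZl// (ipC h). Qed.

Lemma ipBr f g h : sqi f -> sqi g -> sqi h -> ip h (fun x => f x - g x) = ip h f - ip h g.
Proof. by move=> sf sg sh; rewrite ipC ipBl// !(ipC h). Qed.

Lemma ip_nsq f : ip f f = nsq f.
Proof. by apply: eq_Rintegral => x _; rewrite expr2. Qed.

Lemma nsq_ge0 f : 0 <= nsq f.
Proof. by apply: Rintegral_ge0 => x _; exact: sqr_ge0. Qed.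

Lemma nsqZ (c : R) f : sqi f -> nsq (fun x => c * f x) = c ^+ 2 * nsq f.
Proof. by move=> sf; rewrite -!ip_nsq ipZl ?ipZr//; [rewrite mulrA expr2|exact: sqiZ]. Qed.

Lemma nsqN f : nsq (fun x => - f x) = nsq f.
Proof. by apply: eq_Rintegral => x _; rewrite sqrrN. Qed.

Lemma nsqD f g : sqi f -> sqi g -> nsq (fun x => f x + g x) = nsq f + 2 * ip f g + nsq g.
Proof.
move=> sf sg; rewrite -!ip_nsq ipDl ?ipDr//; last exact: sqiD.
rewrite (ipC g f); ring.
Qed.

Lemma nsqB f g : sqi f -> sqi g -> nsq (fun x => f x - g x) = nsq f - 2 * ip f g + nsq g.
Proof.
move=> sf sg; rewrite nsqD ?nsqN//; last exact: sqiN.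
have -> : ip f (fun x => - g x) = - ip f g.
  by rewrite -mulN1r -ipZr//; congr ip; apply/funext => x; rewrite mulN1r.
by rewrite mulrN.
Qed.

Lemma nsqD_le f g : sqi f -> sqi g -> nsq (fun x => f x + g x) <= 2 * nsq f + 2 * nsq g.
Proof.
move=> sf sg; have := nsq_ge0 (fun x => f x - g x); rewrite nsqB ?nsqD//; lra.
Qed.

Lemma nsqB_le f g h : sqi f -> sqi g -> sqi h ->
  nsq (fun x => f x - h x) <= 2 * nsq (fun x => f x - g x) + 2 * nsq (fun x => g x - h x).
Proof.
move=> sf sg sh; rewrite (_ : (fun x => f x - h x) = fun x => (f x - g x) + (g x - h x)).
  by apply: nsqD_le; exact: sqiB.
by apply/funext => x; ring.
Qed.

Lemma ip_CS f g : sqi f -> sqi g -> ip f g ^+ 2 <= nsq f * nsq g.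
Proof.
move=> sf sg.
have P (t : R) : 0 <= nsq f - 2 * t * ip f g + t ^+ 2 * nsq g.
  have := nsq_ge0 (fun x => f x - t * g x); rewrite nsqB//; last exact: sqiZ.
  by rewrite ipZr// nsqZ// mulrA.
have g0 := nsq_ge0 g; have f0 := nsq_ge0 f.
have [gp|] := ltP 0 (nsq g).
  have := P (ip f g / nsq g).
  have -> : nsq f - 2 * (ip f g / nsq g) * ip f g + (ip f g / nsq g) ^+ 2 * nsq g
     = (nsq f * nsq g - ip f g ^+ 2) / nsq g by field; rewrite gt_eqF.
  by rewrite pmulr_lge0 ?invr_gt0// subr_ge0.
move=> g00; have g1 : nsq g = 0 by apply/le_anti; rewrite g00.
have [->|fg0] := eqVneq (ip f g) 0; first by rewrite expr0n/= g1 mulr0.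
have := P ((nsq f + 1) / (2 * ip f g)).
have -> : nsq f - 2 * ((nsq f + 1) / (2 * ip f g)) * ip f g
   + ((nsq f + 1) / (2 * ip f g)) ^+ 2 * nsq g = -1 by rewrite g1; field.
by rewrite lerNr oppr0 ler10.
Qed.

Lemma eq_nsq f g : (forall x, D x -> f x = g x) -> nsq f = nsq g.
Proof. by move=> fg; apply: eq_Rintegral => x; rewrite inE => /fg ->. Qed.

Lemma le_nsq f g : sqi f -> sqi g -> (forall x, D x -> `|f x| <= `|g x|) -> nsq f <= nsq g.
Proof.
move=> [_ sf] [_ sg] fg; apply: le_Rintegral => // x Dx.
rewrite -(real_normK (num_real (f x))) -(real_normK (num_real (g x))).
by rewrite ler_pXn2r ?nnegrE//; exact: fg.
Qed.

Lemma sqi_dominated (f_ : nat -> T -> R) f g :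
  (forall k, measurable_fun D (f_ k)) -> sqi g ->
  (forall k x, D x -> `|f_ k x| <= g x) ->
  (forall x, D x -> f_ ^~ x @ \oo --> f x) ->
  sqi f /\ forall eps, 0 < eps -> \forall k \near \oo, nsq (fun x => f x - f_ k x) < eps.
Proof.
move=> mf_ sg f_g f_f.
have mf : measurable_fun D f by exact: measurable_fun_cvg mf_ f_f.
have fg x : D x -> `|f x| <= g x.
  move=> Dx; have /cvg_norm c := f_f _ Dx.
  rewrite -(cvg_lim _ c)//; apply: limr_le; first by apply/cvg_ex; eexists; exact: c.
  by apply: nearW => k; exact: f_g.
have g0 x : D x -> 0 <= g x by move=> /fg; apply: le_trans.
have sf : sqi f by apply: sqi_le sg => // x Dx; rewrite (le_trans (fg _ Dx))// ler_norm.
split => // eps eps0.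
pose h k x := (f x - f_ k x) ^+ 2.
have [_ sg2] := sg.
have [] := @dominated_convergence _ _ _ mu D mD (fun k => EFin \o h k) (fun=> 0%E)
   (fun x => (4%:E * (EFin \o (fun x => g x ^+ 2)%R) x)%E).
- by move=> k; apply/measurable_EFinP; apply: measurable_funX; exact: measurable_funB.
- exact: measurable_cst.
- apply: aeW => x Dx; apply: cvg_EFin; first exact: nearW.
  have c : (f x - f_ k x) @[k --> \oo] --> f x - f x by apply: cvgB; [exact: cvg_cst|exact: f_f].
  rewrite (_ : 0%R = (f x - f x) * (f x - f x) :> R); last by rewrite subrr mulr0.
  exact: (cvgM c c).
- exact: integrableZl.
- apply: aeW => x k Dx /=; rewrite -EFinM lee_fin ger0_norm ?sqr_ge0//.
  have -> : 4 * g x ^+ 2 = (2 * g x) ^+ 2 by ring.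
  rewrite /h -[leLHS](real_normK (num_real _)) ler_pXn2r ?nnegrE ?mulr_ge0 ?g0//.
  by rewrite (le_trans (ler_normB _ _))//; have := fg _ Dx; have := f_g k _ Dx; lra.
move=> _ _; rewrite integral0 => C.
have : (fun k => nsq (fun x => f x - f_ k x)) @ \oo --> (0 : R) by exact: (fine_cvg C).
move=> /cvgrPdist_lt/(_ _ eps0); apply: filterS => k.
by rewrite sub0r normrN ger0_norm// nsq_ge0.
Qed.

Definition approx (S : set (T -> R)) f :=
  forall eps, 0 < eps -> exists2 s, S s & nsq (fun x => f x - s x) < eps.

Variable S : set (T -> R).
Hypothesis sqiS : forall s, S s -> sqi s.
Hypothesis SD : forall s t, S s -> S t -> S (fun x => s x + t x).
Hypothesis SZ : forall (c : R) s, S s -> S (fun x => c * s x).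

Lemma approx_self s : S s -> approx S s.
Proof.
move=> Ss eps e0; exists s => //; rewrite (@eq_nsq _ (fun=> 0)) => [|x _]; last by rewrite subrr.
by rewrite /nsq; under eq_Rintegral do rewrite expr0n/=; rewrite Rintegral_cst// mul0r.
Qed.

Lemma approx_trans f : sqi f ->
  (forall eps, 0 < eps -> exists g, [/\ sqi g, approx S g & nsq (fun x => f x - g x) < eps]) ->
  approx S f.
Proof.
move=> sf A eps e0; have [|g [sg Ag fg]] := A (eps / 4); first by rewrite divr_gt0.
have [|s Ss gs] := Ag (eps / 4); first by rewrite divr_gt0.
exists s => //; apply: le_lt_trans (nsqB_le sf sg (sqiS Ss)) _; lra.
Qed.

Lemma approxD f g : sqi f -> sqi g -> approx S f -> approx S g -> approx S (fun x => f x + g x).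
Proof.
move=> sf sg Af Ag eps e0; have [|s Ss fs] := Af (eps / 4); first by rewrite divr_gt0.
have [|t St gt] := Ag (eps / 4); first by rewrite divr_gt0.
exists (fun x => s x + t x); first exact: SD.
rewrite (@eq_nsq _ (fun x => (f x - s x) + (g x - t x))) => [|x _]; last by ring.
have := nsqD_le (sqiB sf (sqiS Ss)) (sqiB sg (sqiS St)); lra.
Qed.

Lemma approxZ (c : R) f : sqi f -> approx S f -> approx S (fun x => c * f x).
Proof.
move=> sf Af eps e0; have c0 : 0 < c ^+ 2 + 1 by rewrite ltr_wpDl ?sqr_ge0.
have [|s Ss fs] := Af (eps / (c ^+ 2 + 1)); first by rewrite divr_gt0.
exists (fun x => c * s x); first exact: SZ.
rewrite (@eq_nsq _ (fun x => c * (f x - s x))) => [|x _]; last by ring.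
rewrite nsqZ; last by apply: sqiB => //; exact: sqiS.
move: fs; rewrite ltr_pdivlMr// mulrDr mulr1 mulrC => fs.
by have := nsq_ge0 (fun x => f x - s x); lra.
Qed.

Lemma approx_dominated (f_ : nat -> T -> R) f g :
  (forall k, sqi (f_ k)) -> (forall k, approx S (f_ k)) -> sqi g ->
  (forall k x, D x -> `|f_ k x| <= g x) ->
  (forall x, D x -> f_ ^~ x @ \oo --> f x) ->
  sqi f /\ approx S f.
Proof.
move=> sf_ Af_ sg f_g f_f.
have [||//|//|sf A] := @sqi_dominated f_ f g; [by move=> k; have [] := sf_ k|exact: sg|].
split => //; apply: approx_trans => // eps /A[k _ /(_ k (leqnn k)) H].
by exists (f_ k).
Qed.

End square_integrable.

(** * Approximation by trigonometric polynomials *)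

Section trigonometric_approximation.
Context {R : realType}.
Implicit Types (t y w A B L : R) (f g : R -> R).

Definition trig w A B t : R := A * cos (w * t) + B * sin (w * t).

(** The walls are at [- L / 2] and [L / 2]. The boundary condition becomes a symmetry of functions
    on the whole line, so a trigonometric sum that satisfies it is its own reflected or periodic
    extension. *)
Definition wall_symmetric bc L f := match bc with
  | Dirichlet => forall y, f (L - y) = - f y /\ f (- L - y) = - f y
  | Neumann => forall y, f (L - y) = f y /\ f (- L - y) = f y
  | Periodic => forall y, f (y + L) = f y
  end.

Definition mode bc L w A B := wall_symmetric bc L (trig w A B).

(** The number [m] of modes is a parameter so that the spans belonging to different coordinates can
    be padded to a common length. *)
Definition mode_span bc L (m : nat) g := exists w A B : nat -> R,
  (forall k, mode bc L (w k) (A k) (B k)) /\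
  forall y, g y = \sum_(k < m) trig (w k) (A k) (B k) y.

Lemma trig0 w t : trig w 0 0 t = 0. Proof. by rewrite /trig !mul0r addr0. Qed.

Lemma mode0 bc L : mode bc L 0 0 0.
Proof. by case: bc => y; rewrite !trig0 ?oppr0. Qed.

Lemma mode_span_le bc L m m' g : (m <= m')%N -> mode_span bc L m g -> mode_span bc L m' g.
Proof.
move=> mm' [w [A [B [mo gE]]]].
exists (fun k => if (k < m)%N then w k else 0), (fun k => if (k < m)%N then A k else 0),
  (fun k => if (k < m)%N then B k else 0); split.
  by move=> k; case: ifP => // _; exact: mode0.
move=> y; rewrite gE -(subnKC mm') big_split_ord/= [X in _ = _ + X]big1 ?addr0.
  by apply: eq_bigr => k _ /=; rewrite ltn_ord.
by move=> k _ /=; rewrite ltnNge leq_addr/= trig0.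
Qed.

Definition cos_sum f := exists (m : nat) (a : nat -> R) (k : nat -> nat),
  forall t, f t = \sum_(j < m) a j * cos ((k j)%:R * t).

Lemma cos_sumD f g : cos_sum f -> cos_sum g -> cos_sum (fun t => f t + g t).
Proof.
move=> [m [a [k fE]]] [m' [a' [k' gE]]].
exists (m + m')%N, (fun j => if (j < m)%N then a j else a' (j - m)%N),
  (fun j => if (j < m)%N then k j else k' (j - m)%N) => t.
rewrite big_split_ord/= fE gE; congr (_ + _); apply: eq_bigr => j _ /=; first by rewrite ltn_ord.
by rewrite ltnNge leq_addr/= addKn.
Qed.

Lemma cos_sum_cst (c : R) : cos_sum (fun=> c).
Proof.
exists 1%N, (fun=> c), (fun=> 0%N) => t.
by rewrite big_ord_recl big_ord0 addr0 mul0r cos0 mulr1.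
Qed.

Lemma cos_sumM f : cos_sum f -> cos_sum (fun t => f t * cos t).
Proof.
move=> [m [a [k fE]]].
rewrite (_ : (fun t => _) = fun t => (\sum_(j < m) (a j / 2) * cos ((k j).+1%:R * t))
   + \sum_(j < m) (a j / 2) * cos ((if k j == 0%N then 1%N else (k j).-1)%:R * t)).
  apply: cos_sumD; first by exists m, (fun j => a j / 2), (fun j => (k j).+1).
  by exists m, (fun j => a j / 2), (fun j => if k j == 0%N then 1%N else (k j).-1).
apply/funext => t; rewrite fE mulr_suml -big_split/=; apply: eq_bigr => j _.
rewrite -mulrDr.
have -> : cos ((if k j == 0%N then 1%N else (k j).-1)%:R * t) = cos ((k j)%:R * t - t).
  case: (k j) => [|i] /=; first by rewrite mul1r mul0r sub0r cosN.
  by congr cos; rewrite -natr1; ring.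
have -> : (k j).+1%:R * t = (k j)%:R * t + t by rewrite -natr1; ring.
by rewrite cosD cosB; field.
Qed.

Lemma cos_sum_poly (p : {poly R}) : cos_sum (fun t => p.[cos t]).
Proof.
elim/poly_ind: p => [|p c IH].
  by rewrite (_ : (fun _ => _) = fun=> 0); [exact: cos_sum_cst|apply/funext => t; rewrite horner0].
rewrite (_ : (fun _ => _) = fun t => p.[cos t] * cos t + c).
  by apply: cos_sumD; [exact: cos_sumM|exact: cos_sum_cst].
by apply/funext => t; rewrite hornerMXaddC.
Qed.

Lemma bernoulli_ge (u : R) n : 0 <= u -> 1 + n%:R * u <= (1 + u) ^+ n.
Proof.
move=> u0; elim: n => [|n IH]; first by rewrite mul0r addr0 expr0.
rewrite exprS -natr1; apply: (@le_trans _ _ ((1 + u) * (1 + n%:R * u))).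
  by have := mulr_ge0 (ler0n R n) (sqr_ge0 u); lra.
by rewrite ler_wpM2l// addr_ge0.
Qed.

Lemma bernoulli_le (u : R) n : 0 <= u <= 1 -> 1 - n%:R * u <= (1 - u) ^+ n.
Proof.
move=> /andP[u0 u1]; elim: n => [|n IH]; first by rewrite mul0r subr0 expr0.
rewrite exprS -natr1; apply: (@le_trans _ _ ((1 - u) * (1 - n%:R * u))).
  by have := mulr_ge0 (ler0n R n) (sqr_ge0 u); lra.
by rewrite ler_wpM2l// subr_ge0.
Qed.

(* [bump n] tends to the indicator function of [0, 1/2[ on [0, 1]. *)
Definition bump (n : nat) : {poly R} := (1 - 'X^(n + n)) ^+ (n * 4 ^ n).

Lemma horner_bump n (x : R) : (bump n).[x] = (1 - x ^+ (n + n)) ^+ (n * 4 ^ n).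
Proof. by rewrite /bump horner_exp !hornerE. Qed.

Lemma bump_itv n (x : R) : 0 <= x <= 1 -> 0 <= (bump n).[x] <= 1.
Proof.
move=> /andP[x0 x1]; rewrite horner_bump.
have : 0 <= x ^+ (n + n) <= 1 by rewrite exprn_ge0//= exprn_ile1.
move=> /andP[t0 t1]; rewrite exprn_ge0 ?subr_ge0//= exprn_ile1 ?subr_ge0//; lra.
Qed.

Lemma bump_cvg (x : R) : 0 <= x <= 1 -> (bump n).[x] @[n --> \oo] --> (((x < 2^-1)%R)%:R : R).
Proof.
move=> x01; have [x0 x1] := andP x01.
(* The exponent [n * 4^n] is chosen for this identity: its right side tends to 0 for [x < 1 / 2] and
   to infinity otherwise, and Bernoulli's inequalities convert this into the limits 1 and 0. *)
have tE n : (n * 4 ^ n)%:R * x ^+ (n + n) = n%:R * (2 * x) ^+ n * (2 * x) ^+ n.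
  rewrite natrM natrX exprD exprMn -!mulrA; congr (_ * _).
  by rewrite (_ : 4 = 2 * 2) ?exprMn; ring.
have t01 n : 0 <= x ^+ (n + n) <= 1 by rewrite exprn_ge0//= exprn_ile1.
have [xl|xg] := ltP x 2^-1; last first.
  apply: (@squeeze_cvgr _ _ _ _ (cst 0) (@harmonic R)); [|exact: cvg_cst|exact: cvg_harmonic].
  apply: nearW => n /=; have /andP[-> _] := bump_itv n x01; rewrite /= horner_bump.
  have [t0 t1] := andP (t01 n); set t := x ^+ (n + n) in t0 t1 *; set N := (n * 4 ^ n)%N.
  rewrite -[leRHS]mul1r ler_pdivlMr//.
  have H1 : n.+1%:R <= (1 + t) ^+ N.
    apply: le_trans (bernoulli_ge N t0); rewrite /t /N tE -natr1 addrC lerD2l.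
    rewrite -mulrA ler_peMr//; rewrite -[leLHS]mulr1 ler_pM//; apply: exprn_ege1; lra.
  apply: (@le_trans _ _ ((1 - t) ^+ N * (1 + t) ^+ N)).
    by rewrite ler_wpM2l// exprn_ge0// subr_ge0.
  rewrite -exprMn exprn_ile1//; have := sqr_ge0 t; nra.
set s := 2 * x; have s0 : 0 <= s by rewrite /s; lra.
have s1 : s < 1 by rewrite /s; lra.
have sn n : n%:R * s ^+ n <= (1 - s)^-1.
  have [->|sp] := eqVneq s 0.
    by case: n => [|n]; rewrite ?mul0r ?expr0n/= ?mulr0 subr0 invr1.
  have sgt : 0 < s by rewrite lt_neqAle eq_sym sp.
  have u0 : 0 <= s^-1 - 1 by rewrite subr_ge0 invf_ge1// ltW.
  have := bernoulli_ge n u0; rewrite [1 + (_ - 1)]addrC subrK exprVn => H.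
  rewrite -[leRHS]mul1r ler_pdivlMr ?subr_gt0//.
  have H2 : (1 + n%:R * (s^-1 - 1)) * s ^+ n <= 1 by rewrite -ler_pdivlMr ?exprn_gt0// mul1r.
  have H3 : 0 <= s ^+ n by rewrite exprn_ge0.
  have H4 : n%:R * s ^+ n * (1 - s) = (n%:R * (s^-1 - 1)) * s ^+ n * s by field.
  rewrite H4; apply: le_trans (ltW s1); apply: (ler_piMl s0); lra.
apply: (@squeeze_cvgr _ _ _ _ (fun n => 1 - (1 - s)^-1 * s ^+ n) (cst 1)).
- apply: nearW => n /=; have /andP[_ ->] := bump_itv n x01; rewrite andbT horner_bump.
  apply: le_trans (bernoulli_le _ (t01 n)); rewrite tE lerD2l lerN2.
  by rewrite ler_wpM2r// exprn_ge0.
- rewrite [X in _ --> X](_ : _ = 1 - (1 - s)^-1 * 0); last by rewrite mulr0 subr0.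
  apply: cvgB; first exact: cvg_cst.
  by apply: cvgM; [exact: cvg_cst|apply: cvg_expr; rewrite ger0_norm].
- exact: cvg_cst.
Qed.

Lemma cos_periodn t n : cos (t + (pi *+ 2) *+ n) = cos t.
Proof. exact: (periodicn (@cosD2pi R)). Qed.

(** The bound [2 pi - x] keeps [t] out of the next periodic copy of the arc. *)
Lemma cos_arc (x t : R) : 0 <= x <= pi -> `|t| <= pi *+ 2 - x -> (cos x < cos t) = (`|t| < x).
Proof.
move=> /andP[x0 xpi] tx; have -> : cos t = cos `|t|.
  by have [//|_] := ger0P t; rewrite cosN.
have t0 := normr_ge0 t; move: `|t| t0 tx => {}t t0 tx.
have [tpi|tpi] := leP t pi.
  by rewrite ltr_cos ?in_itv/= ?t0 ?x0.
rewrite [RHS]ltNge (le_trans xpi (ltW tpi))/=.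
have -> : cos t = cos (pi *+ 2 - t) by rewrite -[RHS]cosN opprB -[RHS](cos_periodn _ 1) mulr1n subrK.
apply/negbTE; rewrite -leNgt.
rewrite le_eqVlt ltr_cos ?in_itv/= ?x0 ?xpi//; last by rewrite mulr2n in tx *; lra.
have [->|ne] := eqVneq x (pi *+ 2 - t); first by rewrite eqxx.
by rewrite lt_neqAle ne orbC/= mulr2n in tx *; lra.
Qed.

(** The affine map sends [[-1, 1]] into [[0, 1]] and [c0] to the jump of [bump]; evaluated at a
    cosine, the polynomial approximates the indicator of the arc where the cosine exceeds [c0]. *)
Definition arc_poly (c0 : R) n : {poly R} := bump n \Po ((2^-1 + c0 / 4)%:P - 4^-1 *: 'X).

Lemma horner_arc (c0 c : R) n : (arc_poly c0 n).[c] = (bump n).[2^-1 + (c0 - c) / 4].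
Proof. by rewrite /arc_poly horner_comp; congr horner; rewrite !hornerE; field. Qed.

Lemma arc_itv (c0 c : R) n : -1 <= c0 <= 1 -> -1 <= c <= 1 -> 0 <= (arc_poly c0 n).[c] <= 1.
Proof. by move=> /andP[? ?] /andP[? ?]; rewrite horner_arc; apply: bump_itv; lra. Qed.

Lemma arc_cvg (c0 c : R) : -1 <= c0 <= 1 -> -1 <= c <= 1 ->
  (arc_poly c0 n).[c] @[n --> \oo] --> (((c0 < c)%R)%:R : R).
Proof.
move=> /andP[? ?] /andP[? ?]; under eq_fun do rewrite horner_arc.
have -> : (c0 < c) = (2^-1 + (c0 - c) / 4 < 2^-1) by apply/idP/idP; lra.
by apply: bump_cvg; lra.
Qed.

Section modes.
Variables (bc : boundary_condition) (L : R).
Hypothesis L0 : 0 < L.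
Let pi0 : 0 < pi :> R. Proof. exact: pi_gt0. Qed.

Lemma cos_shift (w ga y : R) : cos (w * (y - ga)) = trig w (cos (w * ga)) (sin (w * ga)) y.
Proof. by rewrite mulrBr cosB /trig mulrC [sin _ * sin _]mulrC. Qed.

Definition arc_freq : R := if bc is Periodic then pi *+ 2 / L else pi / L.

Definition mode_arc (c0 ga : R) n y : R :=
  let P t := (arc_poly c0 n).[cos (arc_freq * (t - ga))] in
  match bc with Dirichlet => P y - P (L - y) | Neumann => P y + P (L - y) | Periodic => P y end.

(** A polynomial in a cosine is a sum of cosines of integer multiples. Adding or subtracting the
    mirror image gives the symmetry about the wall [L / 2], and the period [2 L] transfers it to the
    other wall. *)
Lemma mode_arc_span (c0 ga : R) n : exists m, mode_span bc L m (mode_arc c0 ga n).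
Proof.
have [m [a [k E]]] := cos_sum_poly (arc_poly c0 n); exists m.
have Lne : L != 0 by rewrite gt_eqF.
pose w j : R := (k j)%:R * arc_freq.
have PE t : (arc_poly c0 n).[cos (arc_freq * (t - ga))] =
    \sum_(j < m) trig (w j) (a j * cos (w j * ga)) (a j * sin (w j * ga)) t.
  rewrite E; apply: eq_bigr => j _; rewrite mulrA -/(w j) cos_shift /trig; ring.
have per2 j t : bc <> Periodic -> cos (w j * (t + L + L)) = cos (w j * t).
  move=> bcP; have -> : w j * (t + L + L) = w j * t + (pi *+ 2) *+ k j.
    rewrite /w /arc_freq -[_ *+ k j]mulr_natl -[pi *+ 2]mulr_natl.
    by case: bc bcP => // _; field.
  exact: cos_periodn.
pose h (s : R) j t := a j * (cos (w j * (t - ga)) + s * cos (w j * (L - t - ga))).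
have hE s j : exists A B, forall t, h s j t = trig (w j) A B t.
  exists (a j * (cos (w j * ga) + s * cos (w j * (L - ga)))), (a j * (sin (w j * ga) + s * sin (w j * (L - ga)))) => t.
  rewrite /h (_ : L - t - ga = - (t - (L - ga))); last by ring.
  by rewrite mulrN cosN !cos_shift /trig; ring.
have hsym s j : s ^+ 2 = 1 -> bc <> Periodic -> forall t, h s j (L - t) = s * h s j t /\ h s j (- L - t) = s * h s j t.
  move=> s2 bcP t.
  have H1 : h s j (L - t) = s * h s j t.
    rewrite /h (_ : L - (L - t) = t); last by ring.
    transitivity (a j * (s ^+ 2 * cos (w j * (L - t - ga)) + s * cos (w j * (t - ga)))); last by ring.
    by rewrite s2 mul1r.
  split => //; rewrite -H1 /h.
  rewrite -(per2 j (- L - t - ga))// (_ : - L - t - ga + L + L = L - t - ga); last by ring.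
  rewrite (_ : L - (- L - t) - ga = t - ga + L + L); last by ring.
  by rewrite per2// (_ : L - (L - t) - ga = t - ga) //; ring.
have [bcP|bcP] : bc = Periodic \/ bc <> Periodic by case: bc; [right|right|left].
  exists w, (fun j => a j * cos (w j * ga)), (fun j => a j * sin (w j * ga)); split; last first.
    by move=> y; rewrite /mode_arc bcP PE.
  move=> j; rewrite /mode bcP => y.
  have T t : trig (w j) (a j * cos (w j * ga)) (a j * sin (w j * ga)) t = a j * cos (w j * (t - ga)).
    by rewrite cos_shift /trig; ring.
  rewrite !T; congr (_ * _); have -> : w j * (y + L - ga) = w j * (y - ga) + (pi *+ 2) *+ k j.
    by rewrite /w /arc_freq bcP -[_ *+ k j]mulr_natl; field.
  exact: cos_periodn.
pose s : R := if bc is Dirichlet then -1 else 1.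
have s2 : s ^+ 2 = 1 by rewrite /s; case: bc; rewrite ?sqrrN expr1n.
have [sD sN] : (bc = Dirichlet -> s = -1) /\ (bc = Neumann -> s = 1) by rewrite /s; split => ->.
clearbody s.
have DN : bc = Dirichlet \/ bc = Neumann by case: (bc) bcP; [left|right|].
pose A j := projT1 (cid (hE s j)); pose B j := projT1 (cid (projT2 (cid (hE s j)))).
have AB j : forall t, h s j t = trig (w j) (A j) (B j) t by exact: projT2 (cid (projT2 (cid (hE s j)))).
exists w, A, B; split.
  move=> j; have H := hsym s j s2 bcP.
  have T y : trig (w j) (A j) (B j) y = h s j y by rewrite AB.
  by rewrite /mode; case: DN => E0; rewrite E0 => y; have [H1 H2] := H y;
    rewrite !T H1 H2 ?(sD E0) ?(sN E0) ?mulN1r ?mul1r.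
move=> y; transitivity (\sum_(j < m) h s j y); last by apply: eq_bigr => j _; rewrite AB.
have hP : \sum_(j < m) h s j y = (arc_poly c0 n).[cos (arc_freq * (y - ga))]
   + s * (arc_poly c0 n).[cos (arc_freq * (L - y - ga))].
  rewrite !E mulr_sumr -big_split/=; apply: eq_bigr => j _.
  by rewrite !(mulrA _ arc_freq) -/(w j) /h; ring.
by rewrite hP /mode_arc; case: DN => E0; rewrite [in LHS]E0 ?(sD E0) ?(sN E0) ?mulN1r ?mul1r.
Qed.

Variables al be : R.
Hypothesis al_ge : - (L / 2) <= al.
Hypothesis albe : al <= be.
Hypothesis be_le : be <= L / 2.

Definition mode_bump n := mode_arc (cos (arc_freq * ((be - al) / 2))) ((al + be) / 2) n.

Let cos1 (t : R) : -1 <= cos t <= 1.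
Proof. by rewrite cos_geN1 cos_le1. Qed.

Lemma mode_bump_span n : exists m, mode_span bc L m (mode_bump n).
Proof. exact: mode_arc_span. Qed.

Lemma mode_bump_le n y : `|mode_bump n y| <= 2.
Proof.
rewrite /mode_bump /mode_arc.
have H t := arc_itv n (cos1 (arc_freq * ((be - al) / 2))) (cos1 t).
case: bc.
- by have /andP[? ?] := H (arc_freq * (y - (al + be) / 2)); have /andP[? ?] := H (arc_freq * (L - y - (al + be) / 2));
    rewrite ler_norml; apply/andP; split; lra.
- by have /andP[? ?] := H (arc_freq * (y - (al + be) / 2)); have /andP[? ?] := H (arc_freq * (L - y - (al + be) / 2));
    rewrite ler_norml; apply/andP; split; lra.
by have /andP[? ?] := H (arc_freq * (y - (al + be) / 2)); rewrite ler_norml; apply/andP; split; lra.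
Qed.

Lemma mode_bump_cvg y : - (L / 2) < y < L / 2 ->
  mode_bump n y @[n --> \oo] --> (((al < y < be)%R)%:R : R).
Proof.
move=> /andP[y1 y2]; have al1 := al_ge; have ab1 := albe; have be1 := be_le; have L0' := L0.
set ga := (al + be) / 2; set hw := (be - al) / 2.
have fr0 : 0 < arc_freq by rewrite /arc_freq; case: bc; rewrite divr_gt0// pmulrn_lgt0.
have per : bc = Periodic -> arc_freq * (L / 2) = pi.
  by move=> bcP; rewrite /arc_freq bcP -mulr_natl; field; rewrite gt_eqF.
have non : bc <> Periodic -> arc_freq * L = pi.
  by rewrite /arc_freq; case: bc => // _; field; rewrite gt_eqF.
have x0pi : 0 <= arc_freq * hw <= pi.
  apply/andP; split; first by apply: mulr_ge0; [exact: ltW|rewrite /hw; lra].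
  have [bcP|bcP] : bc = Periodic \/ bc <> Periodic by case: bc; [right|right|left].
    by rewrite -(per bcP) ler_pM2l// /hw; lra.
  by rewrite -(non bcP) ler_pM2l// /hw; lra.
have nrm t : `|arc_freq * t| = arc_freq * `|t| by rewrite normrM gtr0_norm.
have inarc : (`|y - ga| < hw) = (al < y < be).
  by rewrite ltr_norml /ga /hw; apply/idP/idP => /andP[? ?]; apply/andP; split; lra.
have main : `|arc_freq * (y - ga)| <= pi *+ 2 - arc_freq * hw.
  rewrite nrm lerBrDl -mulrDr.
  have yg : hw + `|y - ga| <= L.
    rewrite -lerBrDl ler_norml /hw /ga; apply/andP; split; lra.
  apply: le_trans (_ : arc_freq * L <= _); first by rewrite ler_pM2l.
  have [bcP|bcP] : bc = Periodic \/ bc <> Periodic by case: bc; [right|right|left].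
    by rewrite -(per bcP) -mulr_natl; lra.
  by rewrite (non bcP) mulr2n; have := pi0; lra.
have C1 : (arc_poly (cos (arc_freq * hw)) n).[cos (arc_freq * (y - ga))] @[n --> \oo] --> (((al < y < be)%R)%:R : R).
  rewrite -inarc -(ltr_pM2l fr0) -nrm -(cos_arc x0pi main); exact: arc_cvg (cos1 _) (cos1 _).
(* The mirror image of a point of the open interval lies beyond the wall, hence outside the arc, so
   the reflected term disappears in the limit. *)
have C2 : bc <> Periodic -> (arc_poly (cos (arc_freq * hw)) n).[cos (arc_freq * (L - y - ga))] @[n --> \oo] --> (0 : R).
  move=> bcP; have z0 : 0 < L - y - ga by rewrite /ga; lra.
  have main2 : `|arc_freq * (L - y - ga)| <= pi *+ 2 - arc_freq * hw.
    have E : pi *+ 2 = arc_freq * (L + L) by rewrite mulrDr (non bcP) mulr2n.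
    rewrite nrm (gtr0_norm z0) E -mulrBr ler_pM2l// /hw /ga; lra.
  have -> : (0 : R) = ((cos (arc_freq * hw) < cos (arc_freq * (L - y - ga)))%R)%:R.
    rewrite (cos_arc x0pi main2) nrm gtr0_norm// ltr_pM2l// ltNge (_ : hw <= _) //.
    by rewrite /hw /ga; lra.
  exact: arc_cvg (cos1 _) (cos1 _).
rewrite /mode_bump /mode_arc -/ga -/hw; case: bc C1 C2 => /= C1 C2.
- rewrite -[X in _ --> X]subr0; apply: cvgB => //; exact: C2.
- rewrite -[X in _ --> X]addr0; apply: cvgD => //; exact: C2.
- exact: C1.
Qed.

End modes.

End trigonometric_approximation.

(** * Smooth functions of one variable *)

Section smooth_1d.
Context {R : realType}.
Implicit Types (f g : R -> R) (t y : R).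

Fixpoint smooth1 (k : nat) f : Prop :=
  if k is k'.+1 then
    exists2 f', (forall t, is_derive t (1 : R) f (f' t)) & smooth1 k' f'
  else continuous f.

Lemma smooth1S k f : smooth1 k.+1 f -> smooth1 k f.
Proof.
elim: k f => [|k IH] f [f' df sf]; first exact: is_derive_continuous df.
by exists f' => //; exact: IH.
Qed.

Lemma smooth1_cst k (c : R) : smooth1 k (fun=> c).
Proof.
elim: k c => [|k IH] c; first exact: cst_continuous.
by exists (fun=> 0) => // t; exact: is_derive_cst.
Qed.

Lemma smooth1_id k : smooth1 k (fun t => t).
Proof.
case: k => [|k] /=; first exact: cont_id.
by exists (fun=> 1); [move=> t; exact: is_derive1_id|exact: smooth1_cst].
Qed.

Lemma smooth1D k f g : smooth1 k f -> smooth1 k g -> smooth1 k (fun t => f t + g t).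
Proof.
elim: k f g => [|k IH] f g; first exact: contD.
move=> [f' df sf] [g' dg sg]; exists (fun t => f' t + g' t); last exact: IH.
by move=> t; exact: is_derive1D.
Qed.

Lemma smooth1M k f g : smooth1 k f -> smooth1 k g -> smooth1 k (fun t => f t * g t).
Proof.
elim: k f g => [|k IH] f g; first exact: contM.
move=> sf sg; have [f' df sf'] := sf; have [g' dg sg'] := sg.
exists (fun t => f' t * g t + f t * g' t).
  by move=> t; exact: is_derive1M.
by apply: smooth1D; apply: IH => //; exact: smooth1S.
Qed.

Lemma smooth1_comp k f g : smooth1 k f -> smooth1 k g -> smooth1 k (fun t => f (g t)).
Proof.
elim: k f g => [|k IH] f g.
  by move=> cf cg t; apply: continuous_comp; [exact: cg|exact: cf].
move=> [f' df sf] sg; have [g' dg sg'] := sg.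
exists (fun t => f' (g t) * g' t).
  by move=> t; exact: (@is_derive1_comp _ f g).
by apply: smooth1M => //; apply: IH => //; exact: smooth1S.
Qed.

Lemma is_derive_trig (w A B t : R) : is_derive t (1 : R) (trig w A B) (trig w (w * B) (- (w * A)) t).
Proof.
have dl : is_derive t (1 : R) (fun x => w * x) w.
  by have := is_derive1Z w (is_derive1_id t); rewrite mulr1.
have dc : is_derive t (1 : R) (fun x => cos (w * x)) (- sin (w * t) * w).
  exact: (@is_derive1_comp _ cos (fun x => w * x)).
have ds : is_derive t (1 : R) (fun x => sin (w * x)) (cos (w * t) * w).
  exact: (@is_derive1_comp _ sin (fun x => w * x)).
have H := is_derive1D (is_derive1Z A dc) (is_derive1Z B ds).
by apply: is_derive_eq H _; rewrite /trig; ring.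
Qed.

Lemma smooth1_trig k (w A B : R) : smooth1 k (trig w A B).
Proof.
elim: k A B => [|k IH] A B; first exact: is_derive_continuous (@is_derive_trig w A B).
by exists (trig w (w * B) (- (w * A))) => // t; exact: is_derive_trig.
Qed.

Definition flat (p : {poly R}) y := if 0 < y then p.[y^-1] * expR (- y^-1) else 0.

Lemma flat_le0 p y : y <= 0 -> flat p y = 0.
Proof. by move=> y0; rewrite /flat ltNge y0. Qed.

Lemma expR_ge_pow (u : R) k : 0 <= u -> u ^+ k * expR (- u) <= k`!%:R.
Proof.
move=> u0; rewrite expRN ler_pdivrMr ?expR_gt0//.
case: k => [|k]; first by rewrite expr0 fact0 mul1r -expR0 ler_expR.
rewrite mulrC -ler_pdivrMr ?ltr0n ?fact_gt0//.
by apply: le_trans (expR_ge1Dxn k u0); rewrite lerDr.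
Qed.

Lemma flat_bound p : exists2 C : R, 0 <= C & forall y, `|flat p y| <= C * y ^+ 2.
Proof.
exists (\sum_(k < size p) `|p`_k| * (k.+2)`!%:R).
  by apply: sumr_ge0 => k _; rewrite mulr_ge0.
move=> y; rewrite /flat; case: ifPn => [y0|_]; last first.
  by rewrite normr0 mulr_ge0 ?sqr_ge0// sumr_ge0// => k _; rewrite mulr_ge0.
have u0 : 0 <= y^-1 by rewrite invr_ge0 ltW.
rewrite horner_coef mulr_suml (le_trans (ler_norm_sum _ _ _))// mulr_suml ler_sum// => k _.
rewrite -mulrA normrM -[leRHS]mulrA ler_wpM2l//.
rewrite ger0_norm ?mulr_ge0 ?exprn_ge0 ?expR_ge0//.
have := expR_ge_pow k.+2 u0; rewrite -addn2 exprD mulrAC => H.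
rewrite -ler_pdivrMr ?exprn_gt0//; apply: le_trans H.
by rewrite -exprVn.
Qed.

Lemma is_derive_flat p t : is_derive t (1 : R) (flat p) (flat ((p - p^`()) * 'X^2) t).
Proof.
have [t0|t0|t0] := ltgtP t 0.
- rewrite (flat_le0 _ (ltW t0)).
  apply: (@is_derive_near _ (cst (0 : R))); near=> x.
  by rewrite flat_le0//; apply/ltW; near: x; exact: lt_nbhsl.
- have dV : is_derive t (1 : R) (fun x => x^-1) (- t ^- 2).
    have := @is_deriveV _ (fun x : R => x) t 1 1 (lt0r_neq0 t0) (is_derive1_id t).
    by rewrite /GRing.scale/= mulr1.
  have dp : is_derive t (1 : R) (fun x => p.[x^-1]) (p^`().[t^-1] * - t ^- 2).
    by apply: (@is_derive1_comp _ (horner p) (fun x => x^-1)); exact: is_derive_horner.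
  have de : is_derive t (1 : R) (fun x => expR (- x^-1)) (expR (- t^-1) * - - t ^- 2).
    by apply: (@is_derive1_comp _ expR (fun x => - x^-1)); exact: is_deriveN.
  have H := is_derive1M dp de.
  apply: (@is_derive_near _ (fun x => p.[x^-1] * expR (- x^-1))).
    by near=> x; rewrite /flat ifT//; near: x; exact: lt_nbhsr.
  have E : ((p - p^`()) * 'X^2).[t^-1] = (p.[t^-1] - p^`().[t^-1]) * t^-1 ^+ 2.
    by rewrite hornerM hornerD hornerN hornerXn.
  by apply: is_derive_eq H _; rewrite /flat t0 E exprVn; ring.
rewrite t0 flat_le0//; have [C C0 fC] := flat_bound p.
have f0 : flat p 0 = 0 by rewrite flat_le0.
have cv : h^-1 *: ((flat p \o shift 0) (h *: 1) - flat p 0) @[h --> (0 : R)^'] --> (0 : R).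
  apply/cvgrPdist_lt => e e0; near=> h.
  rewrite sub0r normrN f0 subr0 /= addr0 /GRing.scale/= mulr1 normrM normfV.
  have h0 : h != 0 by near: h; exact: nbhs_dnbhs_neq.
  have hp : 0 < `|h| by rewrite normr_gt0.
  rewrite ltr_pdivrMl//; apply: le_lt_trans (fC h) _.
  rewrite -(real_normK (num_real h)) expr2 mulrA [ltRHS]mulrC ltr_pM2r//.
  apply: (@le_lt_trans _ _ ((C + 1) * `|h|)); first by rewrite ler_wpM2r// lerDl.
  rewrite mulrC -ltr_pdivlMr ?ltr_wpDl//.
  have : ball (0 : R) (e / (C + 1)) h.
    near: h; apply: nbhs_dnbhs; apply: nbhsx_ballx; rewrite divr_gt0// ltr_wpDl//.
  by rewrite /ball/= sub0r normrN.
split; first by apply/cvg_ex; exists 0.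
exact: (cvg_lim _ cv).
Unshelve. all: by end_near. Qed.

Lemma smooth1_flat k p : smooth1 k (flat p).
Proof.
elim: k p => [|k IH] p; first exact: is_derive_continuous (is_derive_flat p).
by exists (flat ((p - p^`()) * 'X^2)) => // t; exact: is_derive_flat.
Qed.

(** * Smooth cutoffs near the walls *)

Section wall_cutoff.
Variables (L : R).
Hypothesis L0 : 0 < L.
Definition wall_dist y := (L / 2) ^+ 2 - y ^+ 2.

(** Nonzero only where [wall_dist > 1 / n], well inside the open interval. The quadratic [wall_dist]
    is a smooth substitute for the distance to the walls. *)
Definition wall_cut (n : nat) y := flat 1 (n%:R * wall_dist y - 1).
Definition wall_cut1 (n : nat) y := flat 'X^2 (n%:R * wall_dist y - 1) * (n%:R * (- (2 * y))).

Let arg_derive n y : is_derive y (1 : R) (fun y => n%:R * wall_dist y - 1) (n%:R * (- (2 * y))).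
Proof.
have H := is_derive1B (is_derive1Z n%:R (is_derive1B (is_derive_cst ((L / 2) ^+ 2 : R) y (1 : R)) (is_derive1X 1 y)))
  (is_derive_cst (1 : R) y (1 : R)).
apply: is_derive_eq H _; rewrite expr1; ring.
Qed.
Lemma is_derive_wall_cut n y : is_derive y (1 : R) (wall_cut n) (wall_cut1 n y).
Proof.
apply: (@is_derive1_comp _ (flat 1) (fun y => n%:R * wall_dist y - 1)) => //.
have := is_derive_flat 1 (n%:R * wall_dist y - 1).
by rewrite derivC subr0 mul1r.
Qed.

Lemma smooth1_wall_cut k n : smooth1 k (wall_cut n).
Proof.
apply: (@smooth1_comp k (flat 1) (fun y => n%:R * wall_dist y - 1)); first exact: smooth1_flat.
apply: smooth1D; last exact: smooth1_cst.
apply: smooth1M; first exact: smooth1_cst.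
rewrite (_ : wall_dist = fun y => (L / 2) ^+ 2 + (-1) * (y * y)).
  apply: smooth1D; first exact: smooth1_cst.
  by apply: smooth1M; [exact: smooth1_cst|apply: smooth1M; exact: smooth1_id].
by apply/funext => y; rewrite /wall_dist; ring.
Qed.

Lemma wall_cut_itv n y : 0 <= wall_cut n y <= 1.
Proof.
rewrite /wall_cut /flat; case: ifPn => [h|_]; last by rewrite lexx ler01.
by rewrite !hornerE expR_ge0/= -[leRHS]expR0 ler_expR oppr_le0 invr_ge0 ltW.
Qed.

Lemma wall_cut_eq0 n y : n%:R * wall_dist y <= 1 -> wall_cut n y = 0 /\ wall_cut1 n y = 0.
Proof. by move=> h; rewrite /wall_cut /wall_cut1 !flat_le0 ?mul0r ?subr_le0. Qed.

Lemma wall_dist_gt0 y : - (L / 2) < y < L / 2 -> 0 < wall_dist y.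
Proof. by move=> /andP[? ?]; rewrite /wall_dist subr_sqr mulr_gt0//; lra. Qed.

Let inv_arg (s : R) : 0 < s -> ((n%:R * s - 1)^-1 : R) @[n --> \oo] --> (0 : R).
Proof.
move=> s0; apply/cvgrPdist_lt => e e0; near=> n.
have H : s^-1 * (e^-1 + 1) < n%:R.
  near: n; exists (Num.truncn (s^-1 * (e^-1 + 1))).+1 => // m /= hm.
  by apply: lt_le_trans (truncnS_gt _) _; rewrite ler_nat.
have H1 : e^-1 < n%:R * s - 1 by rewrite ltrBrDr mulrC -ltr_pdivrMl// mulrC.
have H2 : 0 < n%:R * s - 1 by apply: lt_trans H1; rewrite invr_gt0.
by rewrite sub0r normrN gtr0_norm ?invr_gt0// invf_plt ?posrE.
Unshelve. all: by end_near. Qed.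

Let eventually_pos (s : R) : 0 < s -> \forall n \near \oo, 0 < n%:R * s - 1.
Proof.
move=> s0; near=> n; rewrite subr_gt0 -ltr_pdivrMr// mul1r.
near: n; exists (Num.truncn (s^-1)).+1 => // m /= hm.
by apply: lt_le_trans (truncnS_gt _) _; rewrite ler_nat.
Unshelve. all: by end_near. Qed.

Lemma wall_cut_cvg y : - (L / 2) < y < L / 2 -> wall_cut n y @[n --> \oo] --> (1 : R).
Proof.
move=> /wall_dist_gt0 s0.
apply: (@cvg_trans _ (expR (- (n%:R * wall_dist y - 1)^-1) @[n --> \oo])).
  apply: near_eq_cvg; near=> n.
  rewrite /wall_cut /flat ifT ?hornerE//.
  by near: n; exact: eventually_pos.
have H : expR (- (n%:R * wall_dist y - 1)^-1) @[n --> \oo] --> expR (- 0).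
  apply: continuous_cvg; first exact: continuous_expR.
  by apply: cvgN; exact: inv_arg.
by rewrite oppr0 expR0 in H.
Unshelve. all: by end_near. Qed.

Let cut1E n y : 0 < n%:R * wall_dist y - 1 ->
  `|wall_cut1 n y| * wall_dist y = 2 * `|y| *
   ((n%:R * wall_dist y - 1)^-1 * expR (- (n%:R * wall_dist y - 1)^-1)
    + (n%:R * wall_dist y - 1)^-1 ^+ 2 * expR (- (n%:R * wall_dist y - 1)^-1)).
Proof.
set s := wall_dist y => z0; rewrite /wall_cut1 -/s /flat z0 hornerXn.
set z := n%:R * s - 1 in z0 *.
have zE : n%:R * s = z + 1 by rewrite /z subrK.
rewrite normrM ger0_norm ?mulr_ge0 ?exprn_ge0 ?expR_ge0 ?invr_ge0 ?(ltW z0)//.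
rewrite normrM normrN normrM (ger0_norm (ler0n _ n)) (ger0_norm (ler0n _ 2)).
rewrite (_ : _ * s = (n%:R * s) * (2 * `|y|) * z^-1 ^+ 2 * expR (- z^-1)); last by ring.
by rewrite zE; field; rewrite gt_eqF.
Qed.

(** The derivative of the cutoff grows no faster than the inverse distance to the wall. Multiplied
    by a function vanishing there it is dominated uniformly in [n], and with [wall_cut1_cvg] it
    tends to 0 in [L^2]. *)
Lemma wall_cut1_le n y : - (L / 2) < y < L / 2 -> `|wall_cut1 n y| * wall_dist y <= 3 * L.
Proof.
move=> yL; have s0 := wall_dist_gt0 yL; have [y1 y2] := andP yL.
have [z0|z0] := ltP 0 (n%:R * wall_dist y - 1); last first.
  have [|_ ->] := @wall_cut_eq0 n y; first by rewrite -subr_le0.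
  by rewrite normr0 mul0r mulr_ge0// ltW.
rewrite cut1E//; set u := (_ - 1)^-1; have u0 : 0 <= u by rewrite invr_ge0 ltW.
have := expR_ge_pow 1 u0; have := expR_ge_pow 2 u0.
rewrite expr1 !factS fact0 /= => h2 h1.
have yl : 2 * `|y| <= L by rewrite -ler_pdivlMl// ler_norml; lra.
rewrite [3 * L]mulrC; apply: ler_pM => //.
  by rewrite addr_ge0// mulr_ge0 ?expR_ge0// exprn_ge0.
move: h1 h2; rewrite !(mul1n, muln1); lra.
Qed.

Lemma wall_cut1_cvg y : - (L / 2) < y < L / 2 ->
  `|wall_cut1 n y| * wall_dist y @[n --> \oo] --> (0 : R).
Proof.
move=> /wall_dist_gt0 s0; set s := wall_dist y in s0 *.
pose u (n : nat) : R := (n%:R * s - 1)^-1.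
have cu : u n @[n --> \oo] --> (0 : R) by exact: inv_arg.
apply: (@squeeze_cvgr _ _ _ _ (cst 0) (fun n => 2 * `|y| * (u n + u n * u n))).
- near=> n; rewrite /cst mulr_ge0 ?(ltW s0)//=.
  have z0 : 0 < n%:R * s - 1 by near: n; exact: eventually_pos.
  rewrite cut1E// -/s -/(u n); have u0 : 0 <= u n by rewrite invr_ge0 ltW.
  have e1 : expR (- u n) <= 1 by rewrite -expR0 ler_expR oppr_le0.
  by rewrite ler_wpM2l ?mulr_ge0// lerD//; [rewrite ler_piMr|rewrite -expr2 ler_piMr ?exprn_ge0].
- exact: cvg_cst.
- rewrite -[X in _ --> X](mulr0 (2 * `|y|)).
  apply: cvgM; first exact: cvg_cst.
  rewrite -[X in _ --> X]addr0; apply: cvgD => //.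
  by rewrite -[X in _ --> X](mulr0 0); exact: cvgM.
Unshelve. all: by end_near. Qed.

(** The mean value theorem from the nearer wall; the factor [2 / L] compares the distance to that
    wall with [wall_dist]. *)
Lemma lipschitz_wall (f f1 : R -> R) (C : R) : 0 <= C ->
  (forall t, is_derive t (1 : R) f (f1 t)) -> (forall t, `|f1 t| <= C) ->
  f (L / 2) = 0 -> f (- (L / 2)) = 0 ->
  forall y, - (L / 2) <= y <= L / 2 -> `|f y| <= C * (2 / L) * wall_dist y.
Proof.
move=> C0 df fC fr fl y /andP[y1 y2].
have cf : continuous f := is_derive_continuous df.
have lip a b : a <= b -> `|f b - f a| <= C * (b - a).
  move=> ab; have [|c _ ->] := @MVT_segment _ f f1 a b ab (fun x _ => df x).
    exact: continuous_subspaceT.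
  by rewrite normrM [`|b - a|]ger0_norm ?subr_ge0// ler_wpM2r// subr_ge0.
have wE : wall_dist y = (L / 2 - y) * (L / 2 + y) by rewrite /wall_dist subr_sqr.
have L2 : C * (2 / L) * wall_dist y = C * ((L / 2 - y) * (L / 2 + y) * (2 / L)) by rewrite wE; ring.
rewrite L2; have L0' := L0.
have [yp|yn] := leP 0 y.
  have := lip y (L / 2) y2; rewrite fr sub0r normrN => H; apply: le_trans H _.
  rewrite ler_wpM2l// -mulrA ler_peMr ?subr_ge0//.
  by rewrite mulrA ler_pdivlMr//; lra.
have := lip (- (L / 2)) y y1; rewrite fl subr0 => H; apply: le_trans H _.
rewrite ler_wpM2l// opprK addrC [_ * (L / 2 + y)]mulrC -mulrA ler_peMr//; first lra.
by rewrite mulrA ler_pdivlMr//; lra.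
Qed.

End wall_cutoff.

Lemma trig_le (w A B t : R) : `|trig w A B t| <= `|A| + `|B|.
Proof.
rewrite /trig (le_trans (ler_normD _ _))// lerD// normrM ler_piMr// ler_norml.
  by rewrite cos_geN1 cos_le1.
by rewrite sin_geN1 sin_le1.
Qed.

Lemma mode_dirichlet (L w A B : R) : mode Dirichlet L w A B ->
  trig w A B (L / 2) = 0 /\ trig w A B (- (L / 2)) = 0.
Proof.
move=> mo; have [H1 _] := mo (L / 2); have [_ H2] := mo (- (L / 2)).
move: H1 H2; rewrite (_ : L - L / 2 = L / 2) 1?(_ : - L - - (L / 2) = - (L / 2)); [lra|lra|lra].
Qed.

(** Differentiate the reflection identity at its fixed point. *)
Lemma mode_neumann (L w A B : R) : mode Neumann L w A B ->
  trig w (w * B) (- (w * A)) (L / 2) = 0 /\ trig w (w * B) (- (w * A)) (- (L / 2)) = 0.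
Proof.
move=> mo; have K (c : R) : (forall y, trig w A B (c - y) = trig w A B y) ->
    trig w (w * B) (- (w * A)) (c / 2) = 0.
  move=> H; have d1 := is_derive_trig w A B (c / 2).
  have d2 : is_derive (c / 2) (1 : R) (fun y => trig w A B ((-1) * y + c)) (- 1 * trig w (w * B) (- (w * A)) (c / 2)).
    apply: is_derive1_affine; rewrite (_ : -1 * (c / 2) + c = c / 2); last by field.
    exact: is_derive_trig.
  have E : (fun y => trig w A B (-1 * y + c)) = trig w A B.
    by apply/funext => y; rewrite -[RHS]H; congr trig; ring.
  rewrite E in d2; have [_ e1] := d1; have [_ e2] := d2.
  by move: e2; rewrite e1; lra.
by split; [apply: K => y; case: (mo y)|rewrite -[- (L / 2)]mulNr; apply: K => y; case: (mo y)].
Qed.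

Lemma mode_periodic_derive (L w A B : R) : mode Periodic L w A B -> mode Periodic L w (w * B) (- (w * A)).
Proof.
move=> mo y; have d1 := is_derive_trig w A B y.
have d2 : is_derive y (1 : R) (fun y => trig w A B (1 * y + L)) (1 * trig w (w * B) (- (w * A)) (1 * y + L)).
  by apply: is_derive1_affine; exact: is_derive_trig.
have E : (fun y => trig w A B (1 * y + L)) = trig w A B.
  by apply/funext => x; rewrite -[RHS]mo mul1r.
by rewrite E in d2; have [_ e1] := d1; have [_ e2] := d2; move: e2; rewrite e1 !mul1r.
Qed.

End smooth_1d.

(** * Trigonometric sums *)

Import HBNNSimple.

Section tensors.
Context {R : realType} {d : nat}.
Local Notation V := 'rV[R]_d.
Implicit Types (f : 'I_d -> R -> R) (x : V).

Definition tens f x : R := \prod_i f i (x 0 i).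

Lemma continuous_tens f : (forall i, continuous (f i)) -> continuous (tens f).
Proof.
move=> cf; rewrite /tens; elim: (index_enum _) => [|i s IH].
  by under eq_fun do rewrite big_nil; exact: cst_continuous.
under eq_fun do rewrite big_cons; apply: contM => //.
by apply: (@cont_comp1 _ _ (f i)) => //; exact: coord_continuous.
Qed.

Lemma is_derive_tens f f' (j : 'I_d) x :
  (forall i, i != j -> f' i = f i) -> is_derive (x 0 j) (1 : R) (f j) (f' j (x 0 j)) ->
  is_derive x (unit_vec j) (tens f) (tens f' x).
Proof.
move=> ff' df; pose c := \prod_(i | i != j) f i (x 0 i).
have E : tens f' x = c * f' j (x 0 j).
  rewrite /tens (bigD1 j)//= mulrC; congr (_ * _).
  by apply: eq_bigr => i ij; rewrite ff'.
have D1 := is_derive1Z c df; rewrite E; apply: (is_derive_line _ D1) => h.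
rewrite /tens (bigD1 j)//= mulrC; congr (_ * _).
  by rewrite !mxE !eqxx mulr1 /GRing.scale/= mulr1.
by apply: eq_bigr => i ij; rewrite !mxE (negbTE ij) mulr0 add0r.
Qed.

Lemma Ck_tens k f : (forall i, smooth1 k (f i)) -> Ck k (tens f).
Proof.
elim: k f => [|k IH] f sf; first by apply: continuous_tens => i; exact: sf.
move=> j; have [g dg sg] := sf j.
pose f' i := if i == j then g else f i.
have df x : is_derive x (unit_vec j) (tens f) (tens f' x).
  by apply: is_derive_tens => [i /negbTE ij|]; rewrite /f' ?ij// eqxx.
split; first by move=> x; have [] := df x.
have -> : (fun x => 'D_(unit_vec j) (tens f) x) = tens f'.
  by apply/funext => x; have [_ ->] := df x.
by apply: IH => i; rewrite /f'; case: eqP => // _; exact: smooth1S.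
Qed.

Fixpoint trigd (m : nat) (w A B : R) : R -> R :=
  if m is m'.+1 then trigd m' w (w * B) (- (w * A)) else trig w A B.

Lemma is_derive_trigd m (w A B t : R) : is_derive t (1 : R) (trigd m w A B) (trigd m.+1 w A B t).
Proof. by elim: m A B => [|m IH] A B /=; [exact: is_derive_trig|exact: IH]. Qed.

Lemma trigd2 (w A B t : R) : trigd 2 w A B t = - w ^+ 2 * trig w A B t.
Proof. by rewrite /= /trig; ring. Qed.

Lemma smooth1_trigd k m (w A B : R) : smooth1 k (trigd m w A B).
Proof. by elim: m A B => [|m IH] A B /=; [exact: smooth1_trig|exact: IH]. Qed.

(** The multi-index [m] counts the derivatives taken in each coordinate, so a product mode and all
    its partial derivatives share one form. *)
Definition harmonic_prod (m : 'I_d -> nat) (w A B : 'I_d -> R) : V -> R :=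
  tens (fun i => trigd (m i) (w i) (A i) (B i)).

Lemma is_derive_harmonic m (w A B : 'I_d -> R) j x :
  is_derive x (unit_vec j) (harmonic_prod m w A B)
    (harmonic_prod (fun i => (i == j) + m i)%N w A B x).
Proof.
apply: is_derive_tens => [i /negbTE ->//|].
by rewrite eqxx; exact: is_derive_trigd.
Qed.

Lemma Ck_harmonic k m (w A B : 'I_d -> R) : Ck k (harmonic_prod m w A B).
Proof. by apply: Ck_tens => i; exact: smooth1_trigd. Qed.

Lemma continuous_harmonic m (w A B : 'I_d -> R) : continuous (harmonic_prod m w A B).
Proof. exact: (Ck_harmonic 0). Qed.

Lemma C2_harmonic (w A B : 'I_d -> R) :
  C2 (harmonic_prod (fun=> 0%N) w A B)
     (fun j => harmonic_prod (fun i => (i == j) + 0)%N w A B)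
     (fun j k => harmonic_prod (fun i => (i == k) + ((i == j) + 0))%N w A B).
Proof.
split.
- split; [exact: continuous_harmonic|by move=> i; exact: continuous_harmonic|].
  by move=> i x; exact: is_derive_harmonic.
- move=> i; split; [exact: continuous_harmonic|by move=> j; exact: continuous_harmonic|].
  by move=> j x; exact: is_derive_harmonic.
- by move=> i j x; congr (harmonic_prod _ _ _ _ _); apply/funext => k; rewrite addnCA.
Qed.

Lemma harmonic_hess (w A B : 'I_d -> R) i x :
  harmonic_prod (fun k => (k == i) + ((k == i) + 0))%N w A B x =
  - w i ^+ 2 * harmonic_prod (fun=> 0%N) w A B x.
Proof.
rewrite /harmonic_prod /tens (bigD1 i)//= [in RHS](bigD1 i)//= eqxx trigd2 mulrA; congr (_ * _).
by apply: eq_bigr => k /negbTE ->.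
Qed.

Definition harmonic0 := harmonic_prod (fun=> 0%N).

(** The second function is the Laplacian of the first. Pairing them makes statements in graph norm
    inductive over the modes. *)
Inductive trig_sum (bc : boundary_condition) (L : R) : (V -> R) -> (V -> R) -> Prop :=
| trig_sum0 : trig_sum bc L (fun=> 0) (fun=> 0)
| trig_sum_cons (c : R) (w A B : 'I_d -> R) u l :
    (forall i, mode bc L (w i) (A i) (B i)) -> trig_sum bc L u l ->
    trig_sum bc L (fun x => c * harmonic0 w A B x + u x)
      (fun x => c * (- (\sum_i w i ^+ 2) * harmonic0 w A B x) + l x).

Section trig_sums.
Variables (bc : boundary_condition) (L : R).
Hypothesis L0 : 0 < L.
Local Notation mu := (lebesgue_rV R d).
Local Notation Q := (cube L : set V).
Local Notation TS := (trig_sum bc L).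

Lemma trig_sumD u l u' l' : TS u l -> TS u' l' ->
  TS (fun x => u x + u' x) (fun x => l x + l' x).
Proof.
move=> Tu Tu'; elim: Tu => [|c w A B v k mo _ IH].
  by under eq_fun do rewrite add0r; under [X in TS _ X]eq_fun do rewrite add0r.
under eq_fun do rewrite -addrA; under [X in TS _ X]eq_fun do rewrite -addrA.
exact: trig_sum_cons.
Qed.

Lemma trig_sumZ (a : R) u l : TS u l -> TS (fun x => a * u x) (fun x => a * l x).
Proof.
elim=> [|c w A B v k mo _ IH].
  by under eq_fun do rewrite mulr0; exact: trig_sum0.
under eq_fun do rewrite mulrDr mulrA; under [X in TS _ X]eq_fun do rewrite mulrDr mulrA.
exact: trig_sum_cons.
Qed.

Lemma trig_sum_C2 u l : TS u l -> exists G H, C2 u G H /\ forall x, \sum_i H i i x = l x.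
Proof.
elim=> [|c w A B v k mo _ [G [H [C HE]]]].
  exists (fun _ _ => 0), (fun _ _ _ => 0); split; first exact: C2_cst.
  by move=> x; rewrite big1.
eexists; eexists; split; first exact: C2D (C2Z c (C2_harmonic w A B)) C.
move=> x; rewrite big_split/= HE; congr (_ + _).
rewrite -mulr_sumr; congr (_ * _); rewrite mulNr mulr_suml -sumrN.
by apply: eq_bigr => i _; rewrite harmonic_hess mulNr.
Qed.

Lemma trig_sum_continuous u l : TS u l -> continuous u.
Proof. by move=> /trig_sum_C2[G [H [[[]]]]]. Qed.

Lemma trig_sum_lap_continuous u l : TS u l -> continuous l.
Proof.
elim=> [|c w A B v k mo _ IH]; first exact: cst_continuous.
by apply: contD => //; do 2 (apply: contM; first exact: cst_continuous); exact: continuous_harmonic.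
Qed.

(* The resolvent of the Laplacian acts diagonally. *)
Lemma trig_sum_resolvent u l : TS u l -> exists v k, TS v k /\ forall x, v x - k x = u x.
Proof.
elim=> [|c w A B u' l' mo _ [v [k [Tv vk]]]].
  by exists (fun=> 0), (fun=> 0); split; [exact: trig_sum0|move=> x; rewrite subr0].
have s0 : 0 < 1 + \sum_i w i ^+ 2 by rewrite ltr_wpDr// sumr_ge0// => i _; exact: sqr_ge0.
eexists; eexists; split; first exact: (trig_sum_cons (c / (1 + \sum_i w i ^+ 2)) mo Tv).
by move=> x; rewrite -vk; field; rewrite gt_eqF.
Qed.

Lemma cubeE : Q = obox (fun=> - (L / 2)) (fun=> L / 2).
Proof. by []. Qed.

Lemma measurable_cube : measurable Q.
Proof. by rewrite cubeE; exact: measurable_obox. Qed.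

Lemma cube_lty : (mu Q < +oo)%E.
Proof. by rewrite cubeE; exact: lebesgue_obox_lty. Qed.

Lemma sqi_continuous u : continuous u -> sqi mu Q u.
Proof.
move=> /(bmf_continuous (fun=> - (L / 2)) (fun=> L / 2))[mu' [M uM]].
apply: (sqi_bounded measurable_cube cube_lty) uM; exact: measurable_funTS.
Qed.

Definition trig_sums : set (V -> R) := [set u | exists l, TS u l].

Lemma sqi_trig_sums u : trig_sums u -> sqi mu Q u.
Proof. by move=> [l /trig_sum_continuous]; exact: sqi_continuous. Qed.

Lemma trig_sumsD u v : trig_sums u -> trig_sums v -> trig_sums (fun x => u x + v x).
Proof. by move=> [l Tu] [k Tv]; eexists; exact: trig_sumD Tu Tv. Qed.

Lemma trig_sumsZ (c : R) u : trig_sums u -> trig_sums (fun x => c * u x).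
Proof. by move=> [l Tu]; eexists; exact: trig_sumZ Tu. Qed.

Lemma trig_sums_sum I (s : seq I) (u : I -> V -> R) :
  (forall i, trig_sums (u i)) -> trig_sums (fun x => \sum_(i <- s) u i x).
Proof.
move=> Tu; elim: s => [|i s IH].
  under eq_fun do rewrite big_nil; by eexists; exact: trig_sum0.
by under eq_fun do rewrite big_cons; exact: trig_sumsD.
Qed.

Lemma trig_sums_harmonic (w A B : 'I_d -> R) :
  (forall i, mode bc L (w i) (A i) (B i)) -> trig_sums (harmonic0 w A B).
Proof.
move=> mo; eexists; have := trig_sum_cons 1 mo (trig_sum0 bc L).
by under eq_fun do rewrite mul1r addr0; exact.
Qed.

Lemma trig_sums_tens (g : 'I_d -> R -> R) :
  (forall i, exists m, mode_span bc L m (g i)) -> trig_sums (tens g).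
Proof.
move=> sp; pose m := (\max_(i < d) projT1 (cid (sp i)))%N.
have spm i : mode_span bc L m (g i).
  apply: mode_span_le (projT2 (cid (sp i))); exact: (@leq_bigmax _ (fun i => projT1 (cid (sp i)))).
pose w i := projT1 (cid (spm i)).
pose A i := projT1 (cid (projT2 (cid (spm i)))).
pose B i := projT1 (cid (projT2 (cid (projT2 (cid (spm i)))))).
have H i : (forall k, mode bc L (w i k) (A i k) (B i k)) /\
    forall y, g i y = \sum_(k < m) trig (w i k) (A i k) (B i k) y.
  exact: (projT2 (cid (projT2 (cid (projT2 (cid (spm i))))))).
rewrite (_ : tens g = fun x => \sum_(f : {ffun 'I_d -> 'I_m})
   harmonic0 (fun i => w i (f i)) (fun i => A i (f i)) (fun i => B i (f i)) x).
  by apply: trig_sums_sum => f; apply: trig_sums_harmonic => i; have [] := H i.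
apply/funext => x; rewrite /tens.
under eq_bigr do rewrite (H _).2.
by rewrite bigA_distr_bigA.
Qed.

Local Notation apx := (approx mu Q trig_sums).

Let mD := measurable_cube.

Lemma eq_approx (S : set (V -> R)) u v : (forall x, Q x -> u x = v x) ->
  approx mu Q S u -> approx mu Q S v.
Proof.
move=> uv H eps e0; have [s Ss us] := H _ e0; exists s => //.
rewrite (_ : nsq _ _ _ = nsq mu Q (fun x => u x - s x))//.
by apply: eq_nsq => x Qx; rewrite uv.
Qed.

Lemma approx_box (al be : 'I_d -> R) :
  (forall i, - (L / 2) <= al i) -> (forall i, al i <= be i) -> (forall i, be i <= L / 2) ->
  apx (fun x => \1_(obox al be) x).
Proof.
move=> al0 ab be0.
pose f_ n := tens (fun i => mode_bump bc L (al i) (be i) n).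
have Sf n : trig_sums (f_ n) by apply: trig_sums_tens => i; exact: mode_bump_span.
have [] := @approx_dominated _ _ _ mu Q mD trig_sums sqi_trig_sums f_
    (fun x => \1_(obox al be) x) (fun=> 2 ^+ d) => //.
- by move=> n; exact: sqi_trig_sums.
- by move=> n; exact: approx_self.
- by apply: sqi_continuous; exact: cst_continuous.
- move=> n x _; rewrite /f_ /tens normr_prod.
  apply: (@le_trans _ _ (\prod_(i < d) (2 : R))); last by rewrite prodr_const card_ord.
  by rewrite ler_prod// => i _; rewrite normr_ge0 mode_bump_le.
- move=> x Qx.
  have -> : \1_(obox al be) x = \prod_i ((al i < x 0 i < be i)%R)%:R :> R.
    rewrite indicE; have [xb|nxb] := boolP (x \in obox al be).
      by rewrite big1// => i _; move/set_mem: xb => /(_ i) ->.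
    have [i Hi] : exists i, ~~ (al i < x 0 i < be i).
      apply: contrapT => H; move/negP: nxb; apply; apply/mem_set => i.
      by apply: contrapT => Hi; apply: H; exists i; apply/negP.
    by rewrite (bigD1 i)//= (negbTE Hi) mul0r.
  rewrite /f_ /tens; elim: (index_enum _) => [|i s IH].
    by under eq_fun do rewrite big_nil; rewrite big_nil; exact: cvg_cst.
  under eq_fun do rewrite big_cons; rewrite big_cons; apply: cvgM => //.
  by apply: mode_bump_cvg => //; exact: Qx.
Qed.

(** Orthants form a pi-system that generates the sigma-algebra, and inside the cube each of them is
    a box, to which products of one-dimensional bumps apply. *)
Definition corner (al : 'I_d -> R) : set V := [set x | forall i, al i < x 0 i].
Definition corners : set (set V) := [set corner al | al in setT].

Lemma measurable_corners : @measurable _ V = <<s corners >>.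
Proof.
have mcor al : measurable (corner al).
  rewrite (_ : corner al = \bigcap_(i in [set: 'I_d]) (rV_coord i @^-1` `]al i, +oo[)).
    apply: fin_bigcap_measurable => // i _.
    by rewrite -[X in measurable X]setTI; exact: measurable_coord.
  by apply/seteqP; split => x /= Bx i => [_|]; have := Bx i; rewrite /= in_itv/= andbT//; exact.
apply/seteqP; split; last first.
  by apply: smallest_sub; [exact: sigma_algebra_measurable|move=> _ [al _ <-]; exact: mcor].
apply: smallest_sub; first exact: smallest_sigma_algebra.
rewrite -bigcup_seq; apply: bigcup_sub => i _ B [C mC <-] /=.
rewrite setTI.
have mf : measurable_fun setT (rV_coord i : g_sigma_algebraType corners -> measurableTypeR R).
  apply: (measurability _ (measurable_realfun.RGenOInfty.measurableE R)).
  move=> _ [_ [a ->] <-]; rewrite setTI.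
  rewrite (_ : _ @^-1` _ = \bigcup_n corner (fun k => if k == i then a else - n%:R)).
    by apply: bigcupT_measurable => n; apply: sub_sigma_algebra; eexists.
  apply/seteqP; split => x /=; rewrite in_itv/= andbT.
    move=> ax; pose N := (\max_(k < d) (Num.truncn `|x 0%R k|).+1)%N.
    exists N => // k; case: eqP => [->//|_].
    rewrite ltrNl; apply: le_lt_trans (ler_norm _) _; rewrite normrN.
    apply: lt_le_trans (truncnS_gt _) _; rewrite ler_nat.
    exact: (@leq_bigmax _ (fun k => (Num.truncn `|x 0 k|).+1)).
  by move=> [n _ /(_ i)]; rewrite eqxx.
by have := mf measurableT C mC; rewrite setTI.
Qed.

Lemma sqi_indic (A : set V) : measurable A -> sqi mu Q (fun x => \1_A x).
Proof.
move=> mA; apply: (sqi_bounded mD cube_lty (M := 1)).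
  exact: measurable_indic.
by move=> x _; rewrite indicE; case: (_ \in _); rewrite ?normr1 ?normr0.
Qed.

Lemma approx_corner al : apx (fun x => \1_(corner al) x).
Proof.
pose al' i := Num.max (- (L / 2)) (Num.min (al i) (L / 2)).
have L0' := L0.
apply: (@eq_approx _ (fun x => \1_(obox al' (fun=> L / 2)) x)); last first.
  apply: approx_box => i //; rewrite /al'; first by rewrite le_max lexx.
  by rewrite ge_max ge_min lexx orbT andbT; lra.
move=> x Qx; rewrite !indicE; congr (nat_of_bool _)%:R; apply/idP/idP => /set_mem H; apply/mem_set => i.
  have /andP[] := H i; rewrite /al' gt_max gt_min => /andP[_ /orP[//|h1]] h2.
  by have := lt_trans h1 h2; rewrite ltxx.
by have /andP[q1 q2] := Qx i; rewrite /al' gt_max q1 gt_min q2 (H i).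
Qed.

Let apxD u v : sqi mu Q u -> sqi mu Q v -> apx u -> apx v -> apx (fun x => u x + v x).
Proof. exact: (approxD mD sqi_trig_sums trig_sumsD). Qed.

Let apxZ (c : R) u : sqi mu Q u -> apx u -> apx (fun x => c * u x).
Proof. exact: (approxZ mD sqi_trig_sums trig_sumsZ). Qed.

(** A Dynkin class argument: complements by linearity, disjoint unions by dominated convergence. *)
Lemma approx_indic (A : set V) : measurable A -> apx (fun x => \1_A x).
Proof.
rewrite measurable_corners => sA.
have one : apx (fun x => \1_setT x).
  have := approx_corner (fun=> - L); apply: eq_approx => x Qx.
  rewrite !indicE in_setT mem_set// => i; have /andP[q1 _] := Qx i.
  by apply: lt_trans q1; have := L0; lra.
apply: (dynkin_induction (P := fun A => apx (fun x => \1_A x)) measurable_corners _ one) sA.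
- move=> _ _ [al _ <-] [be _ <-]; exists (fun i => Num.max (al i) (be i)) => //.
  apply/seteqP; split => x /=.
    by move=> H; split => i; have := H i; rewrite gt_max => /andP[].
  by move=> [H1 H2] i; rewrite gt_max H1 H2.
- by move=> _ [al _ <-]; exact: approx_corner.
- move=> S mS aS; have E : (fun x => \1_(~` S) x) = fun x => \1_setT x + (-1) * \1_S x :> R.
    apply/funext => x; rewrite !indicE in_setT in_setC.
    by case: (_ \in S); rewrite ?mulr1 ?mulr0 ?subrr ?addr0.
  rewrite E; apply: apxD => //; [exact: sqi_indic|by apply: sqiZ; [exact: mD|exact: sqi_indic]|].
  by apply: apxZ => //; exact: sqi_indic.
move=> F mF tF aF.
pose f_ n x : R := \sum_(k < n) \1_(F k) x.
have fE n x : f_ n x = \1_(\bigcup_(k < n) F k) x.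
  have [[k kn Fkx]|nF] := pselect ((\bigcup_(k < n) F k) x); last first.
    rewrite indicE memNset// /f_ big1// => k _; rewrite indicE memNset// => Fkx.
    by apply: nF; exists k => //=.
  rewrite indicE mem_set; last by exists k.
  rewrite /f_ (bigD1 (Ordinal kn))//= indicE mem_set// big1 ?addr0// => j jk.
  rewrite indicE memNset// => Fjx; move/eqP: jk; apply; apply/val_inj => /=.
  by apply: (tF j k) => //; exists x.
have sf n : sqi mu Q (f_ n).
  by apply: sqi_sum => // k; exact: sqi_indic.
have [] := @approx_dominated _ _ _ mu Q mD trig_sums sqi_trig_sums f_
    (fun x => \1_(\bigcup_k F k) x) (fun=> 1) => //.
- move=> n; rewrite /f_; elim: n => [|n IH].
    under eq_fun do rewrite big_ord0.
    by apply: (@approx_self _ _ _ mu Q mD); eexists; exact: trig_sum0.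
  under eq_fun do rewrite big_ord_recr/=; apply: apxD => //; [exact: sf|exact: sqi_indic].
- by apply: sqi_continuous; exact: cst_continuous.
- by move=> n x _; rewrite fE indicE; case: (_ \in _); rewrite ?normr1 ?normr0.
move=> x _; have [[k _ Fkx]|nF] := pselect ((\bigcup_k F k) x); last first.
  have E0 n : f_ n x = 0.
    by rewrite fE indicE memNset// => -[k _ Fkx]; apply: nF; exists k.
  rewrite indicE memNset//; under eq_fun do rewrite E0.
  exact: cvg_cst.
apply: (@cvg_trans _ ((fun=> \1_(\bigcup_k F k) x : R) @ \oo)); last exact: cvg_cst.
apply: near_eq_cvg; exists k.+1 => // n /= kn; rewrite fE !indicE !mem_set//; last by exists k.
by exists k.
Qed.

Lemma trig_sums_dense u : sqi mu Q u -> apx u.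
Proof.
have pos (h : V -> R) : sqi mu Q h -> (forall x, 0 <= h x) -> apx h.
  move=> sf h0; have [mf _] := sf.
  have mEf : measurable_fun Q (EFin \o h) by exact/measurable_EFinP.
  have [g_ [ndg cg]] := approximation mD mEf (fun x _ => h0 x).
  have cg' x : Q x -> g_ ^~ x @ \oo --> h x by move=> /cg/fine_cvg.
  have [] // := @approx_dominated _ _ _ mu Q mD trig_sums sqi_trig_sums g_ h h => //.
  - move=> n; rewrite (_ : (g_ n : V -> R) = fun x => \sum_(y \in range (g_ n)) (y * \1_(g_ n @^-1` [set y]) x)).
      under eq_fun do rewrite fsbig_finite//=.
      by apply: sqi_sum => // y; apply: sqiZ => //; apply: sqi_indic.
    by apply/funext => x; exact: fimfunE.
  - move=> n; rewrite (_ : (g_ n : V -> R) = fun x => \sum_(y \in range (g_ n)) (y * \1_(g_ n @^-1` [set y]) x)).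
      under eq_fun do rewrite fsbig_finite//=.
      suff ap (s : seq R) : apx (fun x => \sum_(y <- s) (y * \1_(g_ n @^-1` [set y]) x)) by exact: ap.
      elim: s => [|y s IH].
        under eq_fun do rewrite big_nil.
        by apply: (@approx_self _ _ _ mu Q mD); eexists; exact: trig_sum0.
      under eq_fun do rewrite big_cons; apply: apxD => //.
      - by apply: sqiZ => //; exact: sqi_indic.
      - by apply: sqi_sum => // z; apply: sqiZ => //; exact: sqi_indic.
      - by apply: apxZ; [exact: sqi_indic|exact: approx_indic].
    by apply/funext => x; exact: fimfunE.
  - move=> n x Qx; rewrite ger0_norm//.
    rewrite -(cvg_lim _ (cg' x Qx))//; apply: nondecreasing_cvgn_le.
      by move=> k m km; exact: (lefP _ _ (ndg _ _ km)).
    by apply/cvg_ex; exists (h x); exact: cg'.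
move=> su; have E : u = fun x => Num.max (u x) 0 + (-1) * Num.max (- u x) 0.
  apply/funext => x; have [u0|u0] := leP 0 (u x).
    by rewrite max_r ?mulr0 ?addr0// oppr_le0.
  by rewrite max_l ?mulN1r ?opprK ?add0r// oppr_ge0 ltW.
have [mu' _] := su.
have s1 : sqi mu Q (fun x => Num.max (u x) 0).
  apply: sqi_le su => //; first by apply: measurable_maxr => //; exact: measurable_cst.
  move=> x _; have [u0|u0] := leP 0 (u x); first by [].
  by rewrite normr0.
have s2 : sqi mu Q (fun x => Num.max (- u x) 0).
  apply: sqi_le su => //.
    by apply: measurable_maxr; [exact: measurableT_comp|exact: measurable_cst].
  move=> x _; have [u0|u0] := leP 0 (- u x); first by rewrite normrN.
  by rewrite normr0.
rewrite E; apply: apxD => //; first exact: sqiZ.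
  by apply: pos => // x; rewrite le_max lexx orbT.
by apply: apxZ => //; apply: pos => // x; rewrite le_max lexx orbT.
Qed.

End trig_sums.
End tensors.

(** * The Laplacian on trigonometric sums *)

Section complex_parts.
Context {R : realType} {d : nat}.
Local Notation V := 'rV[R]_d.
Local Notation mu := (lebesgue_rV R d).
Implicit Types (u v f : V -> R[i]) (r : bool).

(** One boolean for both parts: the modes are real, so every [L^2] argument is made once, for a real
    component. *)
Definition part r (c : R[i]) : R := if r then complex.Im c else complex.Re c.
Definition realc (h : V -> R) : V -> R[i] := fun x => (h x)%:C%C.

Lemma partB r (c c' : R[i]) : part r (c - c') = part r c - part r c'.
Proof. by case: r c c' => -[a b] [a' b']. Qed.
Lemma partD r (c c' : R[i]) : part r (c + c') = part r c + part r c'.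
Proof. by case: r c c' => -[a b] [a' b']. Qed.
Lemma partM_real r (c : R[i]) (a : R) : part r (c * a%:C%C) = part r c * a.
Proof. by case: r c => -[x y] /=; rewrite mulr0 ?subr0 ?add0r. Qed.
Lemma part_realM r (c : R[i]) (a : R) : part r (a%:C%C * c) = a * part r c.
Proof. by rewrite mulrC partM_real mulrC. Qed.

Variable D : set V.
Hypothesis mD : measurable D.

Lemma normL2sq_split u : (forall r, measurable_fun D (fun x => part r (u x))) ->
  normL2sq D u = (\int[mu]_(x in D) (part false (u x) ^+ 2)%:E + \int[mu]_(x in D) (part true (u x) ^+ 2)%:E)%E.
Proof.
move=> mu'; rewrite /normL2sq; under eq_integral do rewrite EFinD.
rewrite ge0_integralD//.
- by move=> x _; rewrite lee_fin sqr_ge0.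
- by apply/measurable_EFinP; apply: measurable_funX; exact: (mu' false).
- by move=> x _; rewrite lee_fin sqr_ge0.
- by apply/measurable_EFinP; apply: measurable_funX; exact: (mu' true).
Qed.

Lemma L2_parts u : L2 D u <-> forall r, sqi mu D (fun x => part r (u x)).
Proof.
split=> [[mr mi uoo] r|sr].
  have mu' r' : measurable_fun D (fun x => part r' (u x)) by case: r'.
  apply/sqiP => //; split => //; apply: le_lt_trans uoo.
  rewrite normL2sq_split//; case: r; [apply: leeDr|apply: leeDl];
    by apply: integral_ge0 => x _; rewrite lee_fin sqr_ge0.
have mu' r : measurable_fun D (fun x => part r (u x)) by have [] := sr r.
split; [exact: (mu' false)|exact: (mu' true)|rewrite normL2sq_split//].
by apply: lte_add_pinfty; [have /sqiP[] := sr false|have /sqiP[] := sr true].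
Qed.

Lemma normL2sqE u : L2 D u ->
  normL2sq D u = (nsq mu D (fun x => part false (u x)) + nsq mu D (fun x => part true (u x)))%:E.
Proof.
move=> /L2_parts su; rewrite normL2sq_split; last by move=> r; have [] := su r.
have [_ i0] := su false; have [_ i1] := su true.
by rewrite EFinD /nsq /Rintegral !fineK//; exact: integrable_fin_num.
Qed.

Lemma part_cintegral r u : part r (cintegral D u) = \int[mu]_(x in D) part r (u x).
Proof. by case: r. Qed.

Lemma part_inner r u (h : V -> R) :
  part r (inner D u (realc h)) = ip mu D (fun x => part r (u x)) h.
Proof.
rewrite part_cintegral; apply: eq_Rintegral => x _.
by rewrite (_ : conjc _ = (h x)%:C%C) ?partM_real// /realc/= oppr0.
Qed.

Lemma Re_inner u v : L2 D u -> L2 D v -> complex.Re (inner D u v) =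
  ip mu D (fun x => part false (u x)) (fun x => part false (v x))
  + ip mu D (fun x => part true (u x)) (fun x => part true (v x)).
Proof.
move=> /L2_parts su /L2_parts sv; rewrite /ip -RintegralD//.
- by apply: eq_Rintegral => x _; case: (u x) (v x) => [a b] [a' b'] /=; rewrite mulrN opprK.
- by apply: sqi_int.
- by apply: sqi_int.
Qed.

Lemma part_partial r i f x : part r (partial i f x) = 'D_(unit_vec i) (fun y => part r (f y)) x.
Proof. by case: r. Qed.

Lemma partial_real i (h : V -> R) x : partial i (realc h) x = ('D_(unit_vec i) h x)%:C%C.
Proof.
rewrite /partial; congr Complex.
rewrite (_ : (fun y => complex.Im (realc h y)) = cst 0)//; exact: derive_cst.
Qed.

Lemma smooth_part r f k : smooth f -> Ck k (fun x => part r (f x)).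
Proof. by move=> /(_ k)[]; case: r. Qed.

Lemma smooth_realc (h : V -> R) : (forall k, Ck k h) -> smooth (realc h).
Proof.
move=> sh k; split; first exact: sh.
have -> : (fun x => complex.Im (realc h x)) = cst 0 by [].
elim: k => [|k IH] /=; first exact: cst_continuous.
move=> i; split; first by move=> x; exact: derivable_cst.
by rewrite (_ : (fun x => _) = cst 0)//; apply/funext => x; exact: derive_cst.
Qed.

Lemma Ck1_derive (h : V -> R) i : Ck 1 h ->
  (forall x, is_derive x (unit_vec i) h ('D_(unit_vec i) h x)) /\
  continuous (fun x => 'D_(unit_vec i) h x).
Proof. by move=> /(_ i)[dh ch]; split => // x; exact: derivableP. Qed.

End complex_parts.

(** * Modes in the form domain, and density in graph norm *)

Section form_domain_of_harmonics.
Context {R : realType} {d : nat}.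
Local Notation V := 'rV[R]_d.
Local Notation mu := (lebesgue_rV R d).
Variables (bc : boundary_condition) (L : R).
Hypothesis L0 : 0 < L.
Local Notation Q := (cube L : set V).
Local Notation IP := (ip mu Q).
Local Notation N2 := (nsq mu Q).
Implicit Types (w A B : 'I_d -> R) (r : bool).

Let mQ : measurable Q. Proof. exact: measurable_cube. Qed.
Let sqiC (h : V -> R) : continuous h -> sqi mu Q h. Proof. exact: sqi_continuous. Qed.

Lemma sqi_harmonic m w A B : sqi mu Q (harmonic_prod m w A B).
Proof. apply: sqiC; exact: continuous_harmonic. Qed.

Lemma harmonic_ibp m w A B i (a a1 : V -> R) : continuous a1 ->
  (forall x, is_derive x (unit_vec i) a (a1 x)) -> continuous a ->
  (forall x y : V, (forall j, j != i -> x 0 j = y 0 j /\ - (L / 2) < x 0 j < L / 2) ->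
    x 0 i = - (L / 2) -> y 0 i = L / 2 ->
    a x * harmonic_prod m w A B x = a y * harmonic_prod m w A B y) ->
  IP a1 (harmonic_prod m w A B) = - IP a (harmonic_prod (fun k => (k == i) + m k)%N w A B).
Proof.
move=> ca1 da ca face; set h := harmonic_prod m w A B; set h1 := harmonic_prod _ w A B.
have LL : - (L / 2) <= L / 2 by have := L0; lra.
have ch : continuous h by exact: continuous_harmonic.
have ch1 : continuous h1 by exact: continuous_harmonic.
have := @ftc_box R d i (fun=> - (L / 2)) (fun=> L / 2) (fun x => a x * h x) (fun x => a1 x * h x + a x * h1 x).
move=> /(_ _ _ _ face) H; apply/eqP; rewrite -addr_eq0; apply/eqP; rewrite -[RHS]H.
- rewrite -RintegralD//; first exact: sqi_int (sqiC ca1) (sqiC ch).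
  exact: sqi_int (sqiC ca) (sqiC ch1).
- exact: (fun=> LL).
- by apply: contD; exact: contM.
- move=> x; have dh := is_derive_harmonic m w A B i x.
  have := @is_deriveM _ _ a h x (unit_vec i) _ _ (da x) dh.
  by move=> HH; apply: is_derive_eq HH _; rewrite /GRing.scale/= addrC [h x * _]mulrC.
Qed.

Lemma test_function_boundary (th : V -> R[i]) (x : V) i : test_function Q th ->
  x 0 i = - (L / 2) \/ x 0 i = L / 2 -> th x = 0.
Proof.
move=> [_ _ sQ] xi; apply: contrapT => thx.
have /sQ /(_ i) : support_closure th x by apply: subset_closure; exact/eqP.
by case: xi => ->; rewrite ltxx ?andbF.
Qed.

Lemma test_function_ibp m w A B i r (th : V -> R[i]) : test_function Q th ->
  IP (fun x => part r (partial i th x)) (harmonic_prod m w A B)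
  = - IP (fun x => part r (th x)) (harmonic_prod (fun k => (k == i) + m k)%N w A B).
Proof.
move=> tth; have [sth _ _] := tth.
have [dh cd] := Ck1_derive i (smooth_part r 1 sth).
rewrite (_ : (fun x => part r (partial i th x)) = (fun x => 'D_(unit_vec i) (fun y => part r (th y)) x)); last first.
  by apply/funext => x; exact: part_partial.
apply: harmonic_ibp => //; first exact: (smooth_part r 0 sth).
have z0 (x : V) : x 0 i = - (L / 2) \/ x 0 i = L / 2 -> part r (th x) = 0.
  by move=> xi; rewrite (test_function_boundary tth xi); case: (r).
by move=> x y _ xi yi; rewrite !z0 ?mul0r//; [right|left].
Qed.

Lemma weak_partial_harmonic m w A B i :
  weak_partial Q i (realc (harmonic_prod m w A B))
    (realc (harmonic_prod (fun k => (k == i) + m k)%N w A B)).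
Proof.
move=> th tth.
have E r : part r (cintegral Q (fun x => realc (harmonic_prod m w A B) x * partial i th x)) =
   - part r (cintegral Q (fun x => realc (harmonic_prod (fun k => (k == i) + m k)%N w A B) x * th x)).
  rewrite !part_cintegral.
  under eq_Rintegral do rewrite part_realM mulrC; rewrite -/(IP _ _) (test_function_ibp m w A B i r tth).
  by congr (- _); apply: eq_Rintegral => x _; rewrite part_realM mulrC.
apply/eqP; rewrite eq_complex; apply/andP; split; apply/eqP; [exact: (E false)|exact: (E true)].
Qed.

Section cutoff_harmonic.
Variables (m : 'I_d -> nat) (w A B : 'I_d -> R).
Local Notation F k := (trigd (m k) (w k) (A k) (B k)).
Local Notation F1 k := (trigd (m k).+1 (w k) (A k) (B k)).

Definition cut_harmonic n : V -> R := tens (fun k t => wall_cut L n t * F k t).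
Definition cut_harmonic1 n i : V -> R := tens (fun k t =>
  if k == i then wall_cut1 L n t * F k t + wall_cut L n t * F1 k t else wall_cut L n t * F k t).

Lemma smooth1_cut_harmonic k n i : smooth1 k (fun t => wall_cut L n t * F i t).
Proof. by apply: smooth1M; [exact: smooth1_wall_cut|exact: smooth1_trigd]. Qed.

Lemma Ck_cut_harmonic k n : Ck k (cut_harmonic n).
Proof. by apply: Ck_tens => i; exact: smooth1_cut_harmonic. Qed.

Lemma is_derive_cut_harmonic n i x :
  is_derive x (unit_vec i) (cut_harmonic n) (cut_harmonic1 n i x).
Proof.
apply: is_derive_tens => [k /negbTE ->//|]; rewrite eqxx.
exact: is_derive1M (is_derive_wall_cut _ _ _) (is_derive_trigd _ _ _ _ _).
Qed.

(** The support lies where [n * wall_dist >= 1] in every coordinate, a closed set contained in the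
    open cube. *)
Lemma test_function_cut n : test_function Q (realc (cut_harmonic n)).
Proof.
pose K := [set x : V | forall k, 1 <= n%:R * wall_dist L (x 0 k)].
have cw : continuous (fun t : R => n%:R * wall_dist L t).
  apply: contM; first exact: cst_continuous.
  apply: contB; first exact: cst_continuous.
  by apply: contX; exact: cont_id.
have KQ : K `<=` Q.
  move=> x Kx k; have := Kx k; rewrite /wall_dist => H.
  have : 0 < (L / 2) ^+ 2 - x 0 k ^+ 2.
    by rewrite ltNge; apply/negP => h; have := mulr_ge0_le0 (ler0n R n) h; lra.
  rewrite subr_gt0 => h; have L2 : 0 <= L / 2 by have := L0; lra.
  by rewrite -ltr_norml -(@ltr_pXn2r _ 2)// ?nnegrE// real_normK ?num_real.
have cK : closed K.
  rewrite (_ : K = \bigcap_(k in [set: 'I_d]) ((fun x : V => n%:R * wall_dist L (x 0 k)) @^-1` `[1, +oo[)).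
    apply: closed_bigI => k _; apply: preimage_closed; last exact: rray_closed.
    have ck : continuous (fun x : V => n%:R * wall_dist L (x 0 k)).
      by apply: (@cont_comp1 _ _ (fun t : R => n%:R * wall_dist L t)) => //; exact: coord_continuous.
    by move=> y _; exact: ck.
  by apply/seteqP; split => x /= H k => [_|]; have := H k; rewrite /= in_itv/= andbT//; exact.
have sK : support_closure (realc (cut_harmonic n)) `<=` K.
  apply: (@subset_trans _ (closure K)); last by rewrite -((closure_id K).1 cK).
  apply: closure_subset => x /= /eqP nz k.
  rewrite leNgt; apply/negP => h; apply: nz.
  rewrite /realc /cut_harmonic /tens (bigD1 k)//=.
  by have [-> _] := wall_cut_eq0 (ltW h); rewrite !mul0r.
split; [by apply: smooth_realc => k; exact: Ck_cut_harmonic| |exact: subset_trans KQ].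
have cB : compact [set x : V | forall i, x ord0 i \in `[- (L / 2), L / 2]].
  apply: (@rV_compact _ d (fun i => `[- (L / 2), L / 2]%classic)) => i.
  exact: segment_compact.
apply: subclosed_compact cB _; first exact: closed_closure.
move=> x /sK /KQ Qx i; have /andP[? ?] := Qx i.
by rewrite in_itv/= !ltW.
Qed.

Let trigd_bound j (w' a b : R) : exists C : R, 0 <= C /\ forall t, `|trigd j w' a b t| <= C.
Proof.
elim: j a b => [|j IH] a b; last exact: IH.
by exists (`|a| + `|b|); split; [exact: addr_ge0|move=> t; exact: trig_le].
Qed.

Let trigd_bounds (m' : 'I_d -> nat) : exists2 C : 'I_d -> R, (forall k, 0 <= C k) &
  forall k t, `|trigd (m' k) (w k) (A k) (B k) t| <= C k.
Proof.
exists (fun k => projT1 (cid (trigd_bound (m' k) (w k) (A k) (B k)))) => k;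
  by have [] := projT2 (cid (trigd_bound (m' k) (w k) (A k) (B k))).
Qed.

Lemma sqi_cut_harmonic n : sqi mu Q (cut_harmonic n).
Proof. by apply: sqiC; exact: (Ck_cut_harmonic 0). Qed.

Lemma cut_harmonic_cvg eps : 0 < eps ->
  \forall n \near \oo, N2 (fun x => harmonic_prod m w A B x - cut_harmonic n x) < eps.
Proof.
have [C C0 FC] := trigd_bounds m.
have [] := @sqi_dominated _ _ _ mu Q mQ cut_harmonic (harmonic_prod m w A B) (fun=> \prod_k C k).
- by move=> n; have [] := sqi_cut_harmonic n.
- by apply: sqiC; exact: cst_continuous.
- move=> n x _; rewrite /cut_harmonic /tens normr_prod ler_prod// => k _.
  rewrite normr_ge0 normrM; have /andP[c0 c1] := wall_cut_itv L n (x 0 k).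
  by rewrite -[leRHS]mul1r ler_pM// ger0_norm.
- move=> x Qx; rewrite /cut_harmonic /harmonic_prod /tens; elim: (index_enum _) => [|k s IH].
    by under eq_fun do rewrite big_nil; rewrite big_nil; exact: cvg_cst.
  under eq_fun do rewrite big_cons; rewrite big_cons; apply: cvgM => //.
  rewrite -[X in _ --> X]mul1r; apply: cvgM; last exact: cvg_cst.
  by apply: wall_cut_cvg => //; exact: Qx.
by move=> _; exact.
Qed.

(** The derivative in direction [i] falls on one cutoff only, so only the factor of that coordinate
    has to vanish at its walls. *)
Lemma cut_harmonic1_cvg i (C' : R) eps : 0 <= C' ->
  (forall t, - (L / 2) <= t <= L / 2 -> `|F i t| <= C' * wall_dist L t) -> 0 < eps ->
  \forall n \near \oo, N2 (fun x => harmonic_prod (fun k => (k == i) + m k)%N w A B x - cut_harmonic1 n i x) < eps.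
Proof.
move=> C'0 FC'.
have [Ca a0 FC] := trigd_bounds m.
have [Cb b0 F1C] := trigd_bounds (fun k => (m k).+1).
pose C k := Ca k + Cb k + 3 * L * C'.
have L3 : 0 <= 3 * L * C' by rewrite mulr_ge0// mulr_ge0// ltW.
have cutF n (t g c : R) : `|g| <= c -> `|wall_cut L n t * g| <= c.
  move=> gc; have /andP[c0 c1] := wall_cut_itv L n t.
  by rewrite normrM ger0_norm// -[leRHS]mul1r ler_pM.
have dist0 (t : R) : - (L / 2) < t < L / 2 -> 0 < wall_dist L t by exact: wall_dist_gt0.
have cut1F n (t : R) : - (L / 2) < t < L / 2 -> `|wall_cut1 L n t * F i t| <= C' * (`|wall_cut1 L n t| * wall_dist L t).
  move=> tL; rewrite normrM mulrCA ler_wpM2l//; apply: FC'.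
  by have /andP[? ?] := tL; rewrite !ltW.
have [] := @sqi_dominated _ _ _ mu Q mQ (fun n => cut_harmonic1 n i)
   (harmonic_prod (fun k => (k == i) + m k)%N w A B) (fun=> \prod_k C k).
- move=> n; apply: measurable_funTS; apply: continuous_measurable_rV.
  have -> : cut_harmonic1 n i = fun x => 'D_(unit_vec i) (cut_harmonic n) x.
    by apply/funext => x; have [_ ->] := is_derive_cut_harmonic n i x.
  by have [_] := Ck_cut_harmonic 1 n i.
- by apply: sqiC; exact: cst_continuous.
- move=> n x Qx; rewrite /cut_harmonic1 /tens normr_prod ler_prod// => k _.
  rewrite normr_ge0 /C andTb; case: eqP => [->|_]; last first.
    by apply: (le_trans (cutF n (x 0 k) _ _ (FC k (x 0 k)))); have := b0 k; lra.
  apply: le_trans (ler_normD _ _) _.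
  have h1 := cut1F n _ (Qx i); have h2 := wall_cut1_le L0 n (Qx i).
  have h3 := cutF n (x 0 i) _ _ (F1C i (x 0 i)).
  have h4 := ler_wpM2l C'0 h2; have := a0 i; lra.
- move=> x Qx; rewrite /cut_harmonic1 /harmonic_prod /tens; elim: (index_enum _) => [|k s IH].
    by under eq_fun do rewrite big_nil; rewrite big_nil; exact: cvg_cst.
  under eq_fun do rewrite big_cons; rewrite big_cons; apply: cvgM => //.
  have cc : wall_cut L n (x 0 k) @[n --> \oo] --> (1 : R) by apply: wall_cut_cvg => //; exact: Qx.
  have [->|ki] := eqVneq k i; last first.
    by rewrite add0n -[X in _ --> X]mul1r; apply: cvgM => //; exact: cvg_cst.
  rewrite add1n -[X in _ --> X]add0r; apply: cvgD; last first.
    rewrite -[X in _ --> X]mul1r; apply: cvgM; last exact: cvg_cst.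
    by apply: wall_cut_cvg => //; exact: Qx.
  apply/norm_cvg0P.
  apply: (@squeeze_cvgr _ _ _ _ (cst 0) (fun n => C' * (`|wall_cut1 L n (x 0 i)| * wall_dist L (x 0 i)))).
  + by apply: nearW => n; rewrite /cst normr_ge0/=; exact: cut1F.
  + exact: cvg_cst.
  + rewrite -[X in _ --> X](mulr0 C'); apply: cvgM; first exact: cvg_cst.
    by apply: wall_cut1_cvg => //; exact: Qx.
by move=> _; exact.
Qed.

End cutoff_harmonic.

Lemma sqi_const0 : sqi mu Q (fun=> 0). Proof. by apply: sqiC; exact: cst_continuous. Qed.

Lemma L2_realc (h : V -> R) : sqi mu Q h -> L2 Q (realc h).
Proof. by move=> sh; apply/L2_parts => // -[]; [exact: sqi_const0|exact: sh]. Qed.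

Lemma nsq_const0 : N2 (fun=> 0) = 0.
Proof. by rewrite /nsq; under eq_Rintegral do rewrite expr0n/=; rewrite Rintegral_cst// mul0r. Qed.

Lemma normL2sq_realcB (h h' : V -> R) : sqi mu Q h -> sqi mu Q h' ->
  normL2sq Q (fun x => realc h x - realc h' x)%R = (N2 (fun x => h x - h' x))%:E.
Proof.
move=> sh sh'; have E : (fun x => realc h x - realc h' x)%R = realc (fun x => h x - h' x)%R.
  by apply/funext => x; rewrite /realc rmorphB.
rewrite E normL2sqE//; last by apply: L2_realc; exact: sqiB.
by rewrite (_ : N2 (fun x => part true _) = 0) ?addr0//; exact: nsq_const0.
Qed.

Definition harmonic_grad w A B i : V -> R := harmonic_prod (fun k => (k == i) + 0)%N w A B.

Lemma partial_harmonic0 w A B i : partial i (realc (harmonic0 w A B)) = realc (harmonic_grad w A B i).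
Proof.
apply/funext => x; rewrite partial_real /realc; congr (_%:C%C).
by have [_ ->] := is_derive_harmonic (fun=> 0%N) w A B i x.
Qed.

Lemma trigd_periodic m (w A B : R) : mode Periodic L w A B ->
  forall t, trigd m w A B (t + L) = trigd m w A B t.
Proof.
by elim: m A B => [|m IH] A B mo /=; [exact: mo|apply: IH; exact: mode_periodic_derive].
Qed.

Lemma harmonic_periodic m w A B i (x : V) : (forall k, mode Periodic L (w k) (A k) (B k)) ->
  harmonic_prod m w A B (x + L *: unit_vec i) = harmonic_prod m w A B x.
Proof.
move=> mo; apply: eq_bigr => k _; rewrite !mxE eqxx/=.
have [->|ki] := eqVneq k i; last by rewrite mulr0 addr0.
by rewrite mulr1 trigd_periodic.
Qed.

(** Dirichlet modes vanish linearly at the walls, which is what makes their truncations converge in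
    [H^1]; periodic modes are themselves admissible approximants. *)
Lemma form_domain_harmonic w A B : (forall i, mode bc L (w i) (A i) (B i)) ->
  form_domain bc L (realc (harmonic0 w A B)) (fun i => realc (harmonic_grad w A B i)).
Proof.
move=> mo; have s0 := sqi_harmonic (fun=> 0%N) w A B.
have s1 i : sqi mu Q (harmonic_grad w A B i) by exact: sqi_harmonic.
split.
  split; first exact: L2_realc.
  by move=> i; split; [exact: L2_realc|exact: weak_partial_harmonic].
case: (bc) mo => // mo eps eps0.
  pose eps' := eps / d.+2%:R.
  have e0 : 0 < eps' by rewrite divr_gt0.
  have wall i t : - (L / 2) <= t <= L / 2 ->
      `|trigd 0 (w i) (A i) (B i) t| <= (`|w i * B i| + `|- (w i * A i)|) * (2 / L) * wall_dist L t.
    have [fr fl] := mode_dirichlet (mo i).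
    by move=> tL; exact: (lipschitz_wall L0 (addr_ge0 (normr_ge0 _) (normr_ge0 _))
      (is_derive_trig (w i) (A i) (B i)) (trig_le (w i) (w i * B i) (- (w i * A i))) fr fl tL).
  have H1 := cut_harmonic_cvg (fun=> 0%N) w A B e0.
  have H2 : \forall n \near \oo, forall i, N2 (fun x => harmonic_grad w A B i x - cut_harmonic1 (fun=> 0%N) w A B n i x) < eps'.
    apply: filter_forall => i; apply: (cut_harmonic1_cvg _ (wall i) e0).
    by rewrite mulr_ge0 ?addr_ge0// divr_ge0// ltW.
  have [n [h1 h2]] := filter_ex (filterI H1 H2).
  exists (realc (cut_harmonic (fun=> 0%N) w A B n)); first exact: test_function_cut.
  have pE i : partial i (realc (cut_harmonic (fun=> 0%N) w A B n)) = realc (cut_harmonic1 (fun=> 0%N) w A B n i).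
    apply/funext => x; rewrite partial_real /realc; congr (_%:C%C).
    by have [_ ->] := is_derive_cut_harmonic (fun=> 0%N) w A B n i x.
  have sc1 i : sqi mu Q (cut_harmonic1 (fun=> 0%N) w A B n i).
    apply: sqiC; have -> : cut_harmonic1 (fun=> 0%N) w A B n i = fun x => 'D_(unit_vec i) (cut_harmonic (fun=> 0%N) w A B n) x.
      by apply/funext => x; have [_ ->] := is_derive_cut_harmonic (fun=> 0%N) w A B n i x.
    by have [_] := Ck_cut_harmonic (fun=> 0%N) w A B 1 n i.
  rewrite normL2sq_realcB//; last exact: sqi_cut_harmonic.
  under eq_bigr => i _ do rewrite pE normL2sq_realcB//.
  rewrite sumEFin -EFinD lte_fin.
  apply: (@lt_le_trans _ _ (eps' + \sum_(i < d) eps')).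
    apply: ltr_leD => //; apply: ler_sum => i _; exact/ltW/h2.
  rewrite sumr_const card_ord -mulrS -mulr_natr /eps' mulrAC ler_pdivrMr//.
  by rewrite ler_wpM2l ?(ltW eps0)// ler_nat.
exists (realc (harmonic0 w A B)).
  split; first by apply: smooth_realc => k; exact: Ck_harmonic.
  by move=> i x; rewrite /realc /harmonic0 harmonic_periodic.
rewrite normL2sq_realcB//.
under eq_bigr => i _ do rewrite partial_harmonic0 normL2sq_realcB//.
have z (h : V -> R) : N2 (fun x => h x - h x) = 0.
  by rewrite -nsq_const0; apply: eq_nsq => x _; rewrite subrr.
by rewrite z add0e big1 ?lte_fin// => i _; rewrite z.
Qed.

Lemma sqr_small (x C : R) : 0 <= C -> (forall e, 0 < e -> x ^+ 2 <= C * e) -> x = 0.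
Proof.
move=> C0 H; apply/eqP; rewrite -sqrf_eq0 -normr_le0; apply/ler_addgt0Pr => e e0.
rewrite add0r normrX real_normK ?num_real//.
have C1 : 0 < C + 1 by rewrite ltr_wpDl.
apply: le_trans (H (e / (C + 1)) _) _; first by rewrite divr_gt0.
rewrite mulrA ler_pdivrMr// mulrDr mulr1 mulrC; lra.
Qed.

Lemma nsq_part_lt (z : V -> R[i]) e r : L2 Q z -> (normL2sq Q z < e%:E)%E ->
  N2 (fun x => part r (z x)) < e.
Proof.
move=> Lz; rewrite normL2sqE// lte_fin; apply: le_lt_trans.
by case: r; rewrite ?lerDr ?lerDl nsq_ge0.
Qed.

Lemma normL2sq_ge0 (z : V -> R[i]) : (0 <= normL2sq Q z)%E.
Proof. by apply: integral_ge0 => x _; rewrite lee_fin addr_ge0 ?sqr_ge0. Qed.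

Let sqi_smooth (th : V -> R[i]) r : smooth th -> sqi mu Q (fun x => part r (th x)).
Proof. by move=> sth; apply: sqiC; exact: (smooth_part r 0 sth). Qed.

Let sqi_smooth1 (th : V -> R[i]) r i : smooth th -> sqi mu Q (fun x => part r (partial i th x)).
Proof.
move=> sth; apply: sqiC; have [_ cd] := Ck1_derive i (smooth_part r 1 sth).
by rewrite (_ : (fun x => _) = 'D_(unit_vec i) (fun y => part r (th y)))//; apply/funext => x; exact: part_partial.
Qed.

Lemma ip_sum_small (a b a' b' : V -> R) e : sqi mu Q a -> sqi mu Q b -> sqi mu Q a' -> sqi mu Q b' ->
  N2 a < e -> N2 b < e -> (IP a a' + IP b b') ^+ 2 <= 2 * (N2 a' + N2 b') * e.
Proof.
move=> sa sb sa' sb' ae be.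
have h1 := ip_CS mQ sa sa'; have h2 := ip_CS mQ sb sb'.
have h3 := ler_wpM2r (nsq_ge0 mu Q a') (ltW ae).
have h4 := ler_wpM2r (nsq_ge0 mu Q b') (ltW be).
have := sqr_ge0 (IP a a' - IP b b'); nra.
Qed.

(** The defect of the formula is continuous in the [H^1] norm and vanishes on [S]; Cauchy-Schwarz
    bounds its square by a multiple of every [e]. *)
Lemma closure_ibp S v h w A B r i : L2 Q v -> (forall i, L2 Q (h i)) ->
  H1_closure Q S v h -> (forall th, S th -> smooth th) ->
  (forall th, S th -> IP (fun x => part r (partial i th x)) (harmonic_grad w A B i) =
      - IP (fun x => part r (th x)) (harmonic_prod (fun k => (k == i) + ((k == i) + 0))%N w A B)) ->
  IP (fun x => part r (h i x)) (harmonic_grad w A B i) +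
  IP (fun x => part r (v x)) (harmonic_prod (fun k => (k == i) + ((k == i) + 0))%N w A B) = 0.
Proof.
move=> Lv Lh cl sS ibp; set g := harmonic_grad w A B i; set k := harmonic_prod _ w A B.
have sg : sqi mu Q g by exact: sqi_harmonic.
have sk : sqi mu Q k by exact: sqi_harmonic.
apply: (@sqr_small _ (2 * (N2 g + N2 k))) => [|e e0].
  by rewrite mulr_ge0// addr_ge0// nsq_ge0.
have [th Sth H] := cl e e0; have sth := sS _ Sth.
have svr := (L2_parts mQ v).1 Lv r; have sv := (L2_parts mQ v).1 Lv; have shi := (L2_parts mQ (h i)).1 (Lh i).
have sB1 r' : sqi mu Q (fun x => part r' (v x - th x)).
  under eq_fun do rewrite partB; apply: sqiB => //; exact: sqi_smooth.
have sB2 r' j : sqi mu Q (fun x => part r' (h j x - partial j th x)).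
  under eq_fun do rewrite partB; apply: sqiB => //; [exact: ((L2_parts mQ (h j)).1 (Lh j))|exact: sqi_smooth1].
have S0 : (0 <= \sum_(j < d) normL2sq Q (fun x => h j x - partial j th x)%R)%E.
  by apply: sume_ge0 => j _; exact: normL2sq_ge0.
have H1 : N2 (fun x => part r (v x - th x)) < e.
  apply: (@nsq_part_lt (fun x => v x - th x)).
    by apply/L2_parts => // r'; exact: sB1.
  by apply: le_lt_trans H; exact: leeDl.
have H2 : N2 (fun x => part r (h i x - partial i th x)) < e.
  apply: (@nsq_part_lt (fun x => h i x - partial i th x)).
    by apply/L2_parts => // r'; exact: sB2.
  apply: le_lt_trans H; rewrite (bigD1 i)//= addeCA; apply: leeDl.
  by apply: adde_ge0; [exact: normL2sq_ge0|apply: sume_ge0 => j _; exact: normL2sq_ge0].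
have := ip_sum_small (sB2 r i) (sB1 r) sg sk H2 H1.
have E1 : IP (fun x => part r (h i x - partial i th x)) g =
    IP (fun x => part r (h i x)) g - IP (fun x => part r (partial i th x)) g.
  rewrite -ipBl//; last exact: sqi_smooth1.
  by congr ip; apply/funext => x; rewrite partB.
have E2 : IP (fun x => part r (v x - th x)) k = IP (fun x => part r (v x)) k - IP (fun x => part r (th x)) k.
  rewrite -(ipBl mQ svr (sqi_smooth r sth) sk).
  by congr ip; apply/funext => x; rewrite partB.
rewrite E1 E2 ibp// opprK.
by rewrite (_ : _ + _ + (_ - _) = IP (fun x => part r (h i x)) g + IP (fun x => part r (v x)) k) //; ring.
Qed.

(** Green's formula against a mode, with a different reason for each condition: Dirichlet functions
    are limits of test functions, and in the periodic case opposite faces cancel. For Neumann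
    nothing is known of [v] at the walls, but the normal derivative of the mode vanishes there, so a
    cutoff turns that derivative into a test function for the weak gradient of [v]. *)
Lemma form_domain_ip v h w A B r i : (forall i, mode bc L (w i) (A i) (B i)) -> form_domain bc L v h ->
  IP (fun x => part r (h i x)) (harmonic_grad w A B i) =
  w i ^+ 2 * IP (fun x => part r (v x)) (harmonic0 w A B).
Proof.
move=> mo [[Lv Hh] cl].
set k := harmonic_prod (fun k => (k == i) + ((k == i) + 0))%N w A B.
have sv := (L2_parts mQ v).1 Lv; have sh := (L2_parts mQ (h i)).1 (Hh i).1.
have sk : sqi mu Q k by exact: sqi_harmonic.
have sg : sqi mu Q (harmonic_grad w A B i) by exact: sqi_harmonic.
suff X : IP (fun x => part r (h i x)) (harmonic_grad w A B i) + IP (fun x => part r (v x)) k = 0.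
  have E : IP (fun x => part r (v x)) k = - (w i ^+ 2 * IP (fun x => part r (v x)) (harmonic0 w A B)).
    rewrite -mulNr -ipZr//; last exact: sqi_harmonic.
    by congr ip; apply/funext => x; exact: harmonic_hess.
  by rewrite E in X; apply/eqP; rewrite -subr_eq0 X.
have Lh j : L2 Q (h j) by have [] := Hh j.
case bcE : bc mo cl => mo cl.
- apply: (closure_ibp Lv Lh cl); first by move=> th [].
  by move=> th tth; exact: test_function_ibp.
- have [fr fl] := mode_neumann (mo i).
  have wall t : - (L / 2) <= t <= L / 2 ->
      `|trigd ((i == i) + 0) (w i) (A i) (B i) t| <= (`|w i * - (w i * A i)| + `|- (w i * (w i * B i))|) * (2 / L) * wall_dist L t.
    rewrite eqxx /= => tL.
    exact: (lipschitz_wall L0 (addr_ge0 (normr_ge0 _) (normr_ge0 _)) (is_derive_trig (w i) (w i * B i) (- (w i * A i)))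
      (trig_le (w i) (w i * - (w i * A i)) (- (w i * (w i * B i)))) fr fl tL).
  apply: (@sqr_small _ (2 * (N2 (fun x => part r (h i x)) + N2 (fun x => part r (v x))))) => [|e e0].
    by rewrite mulr_ge0// addr_ge0// nsq_ge0.
  pose m := fun k => ((k == i) + 0)%N.
  have H1 := cut_harmonic_cvg m w A B e0.
  have H2 : \forall n \near \oo, N2 (fun x => k x - cut_harmonic1 m w A B n i x) < e.
    apply: (cut_harmonic1_cvg _ wall e0).
    by rewrite mulr_ge0 ?addr_ge0// divr_ge0// ltW.
  have [n [h1 h2]] := filter_ex (filterI H1 H2).
  have tth := test_function_cut m w A B n.
  have WP := (Hh i).2 _ tth.
  have sc : sqi mu Q (cut_harmonic m w A B n) by exact: sqi_cut_harmonic.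
  have cE : cut_harmonic1 m w A B n i = fun x => 'D_(unit_vec i) (cut_harmonic m w A B n) x.
    by apply/funext => x; have [_ ->] := is_derive_cut_harmonic m w A B n i x.
  have sc1 : sqi mu Q (cut_harmonic1 m w A B n i).
    by apply: sqiC; rewrite cE; have [_] := Ck_cut_harmonic m w A B 1 n i.
  have ibp : IP (fun x => part r (v x)) (cut_harmonic1 m w A B n i) = - IP (fun x => part r (h i x)) (cut_harmonic m w A B n).
    have := congr1 (part r) WP; rewrite (_ : part r (- _) = - part r (cintegral Q (fun x => h i x * realc (cut_harmonic m w A B n) x))); last first.
      by case: (r); case: (cintegral _ _).
    rewrite !part_cintegral.
    under eq_Rintegral do rewrite partial_real partM_real.
    under [in RHS]eq_Rintegral do rewrite partM_real.
    by rewrite -/(IP _ _) -/(IP _ _) cE.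
  have := ip_sum_small (sqiB mQ sg sc) (sqiB mQ sk sc1) (sh r) (sv r) h1 h2.
  rewrite !ipBl// (ipC _ _ (cut_harmonic1 _ _ _ _ _ _)) ibp opprK (ipC _ _ (cut_harmonic _ _ _ _ _)).
  rewrite (ipC _ _ (harmonic_grad _ _ _ _)) (ipC _ _ k).
  by rewrite (_ : _ - _ + (_ + _) = IP (fun x => part r (h i x)) (harmonic_grad w A B i) + IP (fun x => part r (v x)) k) //; ring.
- apply: (closure_ibp Lv Lh cl); first by move=> th [].
  move=> th [sth per]; have [dh cd] := Ck1_derive i (smooth_part r 1 sth).
  rewrite (_ : (fun x => part r (partial i th x)) = (fun x => 'D_(unit_vec i) (fun y => part r (th y)) x)); last first.
    by apply/funext => x; exact: part_partial.
  apply: harmonic_ibp => //; first exact: (smooth_part r 0 sth).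
  move=> x y xy xi yi.
  have -> : y = x + L *: unit_vec i.
    apply/rowP => j; rewrite !mxE eqxx/=; have [->|ji] := eqVneq j i.
      by rewrite mulr1 xi yi; field.
    by rewrite mulr0 addr0; have [->] := xy j ji.
  by rewrite per harmonic_periodic.
Qed.

(** Here [p] plays the gradient of [ui] and [li] its Laplacian. The clauses are Green's formula
    against the form domain, the weak equation tested with [ui], and Green's formula between two
    such triples; all survive the addition of a mode. *)
Let good (ui li : V -> R) (p : 'I_d -> V -> R) :=
  [/\ (forall i, sqi mu Q (p i)),
   forall v h, form_domain bc L v h -> forall r,
     \sum_i IP (fun x => part r (h i x)) (p i) = - IP (fun x => part r (v x)) li,
   forall f g, L2 Q f -> (forall i, L2 Q (g i)) -> (forall v h, form_domain bc L v h ->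
     \sum_(i < d) inner Q (g i) (h i) = inner Q f v) -> forall r,
     \sum_i IP (fun x => part r (g i x)) (p i) = IP (fun x => part r (f x)) ui &
   forall l' p', (forall i, sqi mu Q (p' i)) -> sqi mu Q l' -> (forall v h, form_domain bc L v h -> forall r,
     \sum_i IP (fun x => part r (h i x)) (p' i) = - IP (fun x => part r (v x)) l') ->
     \sum_i IP (p i) (p' i) = - IP ui l'].

Let ip0r (h : V -> R) : IP h (fun=> 0) = 0.
Proof. by rewrite /ip; under eq_Rintegral do rewrite mulr0; rewrite Rintegral_cst// mul0r. Qed.

Let trig_sum_good ui li : trig_sum bc L ui li -> exists p, good ui li p.
Proof.
elim=> [|c w A B v k mo Tv [p [sp p1 p2 p3]]].
  exists (fun _ _ => 0); split.
  - by move=> i; exact: sqi_const0.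
  - by move=> v h _ r; rewrite big1 ?ip0r ?oppr0.
  - by move=> f g _ _ _ r; rewrite big1 ?ip0r.
  - by move=> l' p' _ _ _; rewrite big1 => [|i _]; rewrite ipC ip0r ?oppr0.
have fd := form_domain_harmonic mo.
have se : sqi mu Q (harmonic0 w A B) by exact: sqi_harmonic.
have sg i : sqi mu Q (harmonic_grad w A B i) by exact: sqi_harmonic.
have sv : sqi mu Q v by apply: sqiC; exact: trig_sum_continuous Tv.
have sk : sqi mu Q k by apply: sqiC; exact: trig_sum_lap_continuous Tv.
exists (fun i x => c * harmonic_grad w A B i x + p i x); split.
- by move=> i; apply: sqiD => //; exact: sqiZ.
- move=> v' h fd' r; have [[Lv Hh] _] := fd'.
  have sv' := (L2_parts mQ v').1 Lv r.
  have sh i := (L2_parts mQ (h i)).1 (Hh i).1 r.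
  under eq_bigr => i _ do rewrite (ipDr mQ (sqiZ mQ c (sg i)) (sp i) (sh i)) (ipZr mQ c (sg i) (sh i)).
  have s2 := sqiZ mQ (- (\sum_i w i ^+ 2)) se.
  rewrite big_split/= (p1 _ _ fd') (ipDr mQ (sqiZ mQ c s2) sk sv').
  rewrite (ipZr mQ c s2 sv') (ipZr mQ _ se sv').
  rewrite -mulr_sumr; under eq_bigr => i _ do rewrite (form_domain_ip r i mo fd').
  by rewrite -mulr_suml; ring.
- move=> f g Lf Lg fg r; have sf := (L2_parts mQ f).1 Lf r.
  have sg' i := (L2_parts mQ (g i)).1 (Lg i) r.
  under eq_bigr => i _ do rewrite (ipDr mQ (sqiZ mQ c (sg i)) (sp i) (sg' i)) (ipZr mQ c (sg i) (sg' i)).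
  rewrite big_split/= (p2 f g)// ipDr//; last exact: sqiZ.
  rewrite ipZr// -mulr_sumr; congr (c * _ + _).
  have := congr1 (part r) (fg _ _ fd); rewrite part_inner//= => <-.
  rewrite (big_morph (part r) (id1 := 0) (op1 := +%R)); [|exact: partD|by case: (r)].
  by apply: eq_bigr => i _; rewrite part_inner.
- move=> l' p' sp' sl' H'.
  under eq_bigr => i _ do rewrite (ipDl mQ (sqiZ mQ c (sg i)) (sp i) (sp' i)) (ipZl mQ c (sg i) (sp' i)).
  rewrite big_split/= (p3 l' p')// ipDl//; last exact: sqiZ.
  rewrite ipZl// -mulr_sumr (H' _ _ fd false); ring.
Qed.

Let half_sum_ge (a b c : R) : 0 <= a - 2 * c + b -> c <= 2^-1 * a + 2^-1 * b.
Proof. lra. Qed.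

Let sum_le_l (a b c : R) : 0 <= b -> a + b <= c -> a <= c. Proof. lra. Qed.
Let sum_le_r (a b c : R) : 0 <= a -> a + b <= c -> b <= c. Proof. lra. Qed.

Let final_lt (e a eps : R) : 0 < eps -> e < eps / 8 -> a <= eps / 4 -> 2 * e + 2 * a < eps.
Proof. lra. Qed.

Let energy_le (d1 d0 g1 g0 e1 e0 i1 i0 eps : R) : 0 <= d1 -> 0 <= d0 -> 0 <= g1 -> 0 <= g0 ->
  i1 <= 2^-1 * e1 + 2^-1 * d1 -> i0 <= 2^-1 * e0 + 2^-1 * d0 ->
  e1 < eps / 8 -> e0 < eps / 8 -> d1 + g1 + (d0 + g0) = i1 + i0 -> d1 + d0 <= eps / 4.
Proof. lra. Qed.

(** Approximate [u + f] in [L^2] by a trigonometric sum [t] and solve [v - k = t], with [k] the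
    Laplacian of [v], mode by mode. Then [u - v] solves the same weak equation with a small right
    side, and the energy identity bounds it; the equation itself bounds [f + k]. *)
Lemma neg_laplacian_core u f eps : neg_laplacian bc L u f -> 0 < eps ->
  exists ui li : bool -> V -> R, forall r,
    [/\ trig_sum bc L (ui r) (li r), N2 (fun x => part r (u x) - ui r x) < eps &
        N2 (fun x => part r (f x) + li r x) < eps].
Proof.
move=> [Lf [g fdu fg]] eps0; have e4 : eps / 4 < eps by lra.
have [[Lu Hg] _] := fdu.
have su := (L2_parts mQ u).1 Lu; have sf := (L2_parts mQ f).1 Lf.
have Lg i : L2 Q (g i) by have [] := Hg i.
have sg i := (L2_parts mQ (g i)).1 (Lg i).
have ex r : exists t, exists ui li, [/\ trig_sum bc L ui li, (forall x, ui x - li x = t x), sqi mu Q t &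
    N2 (fun x => (part r (u x) + part r (f x)) - t x) < eps / 8].
  have e8 : 0 < eps / 8 by rewrite divr_gt0.
  have [t [l Tt] tH] := trig_sums_dense bc L0 (sqiD mQ (su r) (sf r)) e8.
  have [v [k [Tv vk]]] := trig_sum_resolvent Tt.
  exists t, v, k; split => //; apply: sqiC; exact: trig_sum_continuous Tt.
pose t r := projT1 (cid (ex r)); pose ui r := projT1 (cid (projT2 (cid (ex r)))).
pose li r := projT1 (cid (projT2 (cid (projT2 (cid (ex r)))))).
have H r : [/\ trig_sum bc L (ui r) (li r), (forall x, ui r x - li r x = t r x), sqi mu Q (t r) &
    N2 (fun x => (part r (u x) + part r (f x)) - t r x) < eps / 8].
  exact: (projT2 (cid (projT2 (cid (projT2 (cid (ex r))))))).
have su' r : sqi mu Q (ui r) by have [Tr _ _ _] := H r; apply: sqiC; exact: trig_sum_continuous Tr.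
have sl' r : sqi mu Q (li r) by have [Tr _ _ _] := H r; apply: sqiC; exact: trig_sum_lap_continuous Tr.
pose p r := projT1 (cid (trig_sum_good (let: And4 Tr _ _ _ := H r in Tr))).
have gp r : good (ui r) (li r) (p r) by exact: projT2 (cid (trig_sum_good _)).
pose Dr r x := part r (u x) - ui r x.
pose Er r x := (part r (u x) + part r (f x)) - t r x.
have sD r : sqi mu Q (Dr r) by exact: sqiB.
have sE r : sqi mu Q (Er r) by have [_ _ st _] := H r; apply: sqiB => //; exact: sqiD.
(* Summed over both parts, because the weak equation tested with [u] itself yields the energy only
   through the real part of the complex product. *)
have energy : \sum_(r : bool) (N2 (Dr r) + \sum_i N2 (fun x => part r (g i x) - p r i x)) =
    \sum_(r : bool) IP (Er r) (Dr r).
  have E1 r : \sum_i N2 (fun x => part r (g i x) - p r i x) =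
     \sum_i N2 (fun x => part r (g i x)) - IP (fun x => part r (f x)) (ui r) + IP (fun x => part r (u x)) (li r) - IP (ui r) (li r).
    have [sp p1 p2 p3] := gp r.
    under eq_bigr => i _ do rewrite nsqB// -(ip_nsq _ _ (p r i)).
    rewrite big_split sumrB/= (p3 (li r) (p r))// -mulr_sumr.
    have e1 := p1 _ _ fdu r; have e2 := p2 _ _ Lf Lg fg r.
    by rewrite mulr_natl mulr2n {1}e2 e1; ring.
  have E2 : \sum_(r : bool) \sum_i N2 (fun x => part r (g i x)) = \sum_(r : bool) IP (fun x => part r (f x)) (fun x => part r (u x)).
    have := congr1 (part false) (fg _ _ fdu); rewrite (big_morph (part false) (id1 := 0) (op1 := +%R)) //; last exact: partD.
    have -> : part false (inner Q f u) = complex.Re (inner Q f u) by [].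
    rewrite Re_inner// !big_bool /= => e; rewrite [RHS]addrC -e -big_split/=; apply: eq_bigr => i _.
    by rewrite -[RHS]/(complex.Re (inner Q (g i) (g i))) Re_inner// !ip_nsq addrC.
  rewrite big_split/= (eq_bigr _ (fun r _ => E1 r)) !big_split/= !sumrN E2 -!sumrN -!big_split/=.
  apply: eq_bigr => r _; have [_ uE _ _] := H r.
  have -> : Er r = fun x => Dr r x + (part r (f x) + li r x).
    by apply/funext => x; rewrite /Er /Dr -uE; ring.
  have sfl : sqi mu Q (fun x => part r (f x) + li r x) by exact: sqiD.
  rewrite ipDl// ip_nsq -!addrA; congr (_ + _).
  rewrite ipDl// /Dr !ipBr// (ipC _ _ (li r) (ui r)) (ipC _ _ (li r)); ring.
have bound r : IP (Er r) (Dr r) <= 2^-1 * N2 (Er r) + 2^-1 * N2 (Dr r).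
  have := nsq_ge0 mu Q (fun x => Er r x - Dr r x); rewrite (nsqB mQ (sE r) (sD r)).
  exact: half_sum_ge.
have N0 r : 0 <= N2 (Dr r) by exact: nsq_ge0.
have G0 r : 0 <= \sum_i N2 (fun x => part r (g i x) - p r i x).
  by apply: sumr_ge0 => i _; exact: nsq_ge0.
have Es r : N2 (Er r) < eps / 8 by have [_ _ _] := H r.
rewrite !big_bool in energy.
have tot : N2 (Dr true) + N2 (Dr false) <= eps / 4.
  exact: (energy_le (N0 true) (N0 false) (G0 true) (G0 false) (bound true) (bound false)
    (Es true) (Es false) energy).
have Ds r : N2 (Dr r) <= eps / 4.
  by case: r; [exact: (sum_le_l (N0 false) tot)|exact: (sum_le_r (N0 true) tot)].
exists ui, li => r; have [Tr uE _ _] := H r; split => //.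
  exact: le_lt_trans (Ds r) e4.
rewrite (_ : (fun x => part r (f x) + li r x) = fun x => Er r x - Dr r x); last first.
  by apply/funext => x; rewrite /Er /Dr -uE; ring.
apply: le_lt_trans (_ : 2 * N2 (Er r) + 2 * N2 (Dr r) < _).
  by have := nsqD_le mQ (sE r) (sqiN mQ (sD r)); rewrite nsqN.
exact: (final_lt eps0 (Es r) (Ds r)).
Qed.

End form_domain_of_harmonics.

(** * Spectral calculus for the form *)

Section real_inner_product.
Context {R : realType} {d : nat}.
Local Notation V := 'rV[R]_d.
Local Notation mu := (lebesgue_rV R d).
Variable D : set V.
Hypothesis mD : measurable D.
Implicit Types (u v w f : V -> R[i]) (r : bool).

(** The real part of the inner product: complex [L^2] is treated as a real Hilbert space, so that
    discriminants and Cauchy-Schwarz are taken over [R]. *)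
Definition cip u v : R := ip mu D (fun x => part false (u x)) (fun x => part false (v x))
  + ip mu D (fun x => part true (u x)) (fun x => part true (v x)).

Lemma cipE u v : L2 D u -> L2 D v -> complex.Re (inner D u v) = cip u v.
Proof. exact: Re_inner. Qed.

Lemma normL2sq_cip u : L2 D u -> normL2sq D u = (cip u u)%:E.
Proof. by move=> Lu; rewrite normL2sqE// /cip !ip_nsq. Qed.

Lemma cipC u v : cip u v = cip v u. Proof. by rewrite /cip ipC [in X in _ + X]ipC. Qed.

Lemma cip_ge0 u : 0 <= cip u u.
Proof. by rewrite /cip !ip_nsq addr_ge0 ?nsq_ge0. Qed.

Lemma L2_axpy (t : R) u v : L2 D u -> L2 D v -> L2 D (fun x => t%:C%C * u x + v x).
Proof.
move=> /(L2_parts mD) su /(L2_parts mD) sv; apply/(L2_parts mD) => r.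
rewrite (_ : (fun x => _) = fun x => t * part r (u x) + part r (v x)).
  by apply: sqiD => //; apply: sqiZ.
by apply/funext => x; rewrite partD part_realM.
Qed.

Lemma cip_axpy (t : R) u v w : L2 D u -> L2 D v -> L2 D w ->
  cip (fun x => t%:C%C * u x + v x) w = t * cip u w + cip v w.
Proof.
move=> /(L2_parts mD) su /(L2_parts mD) sv /(L2_parts mD) sw.
have E r : ip mu D (fun x => part r (t%:C%C * u x + v x)) (fun x => part r (w x)) =
   t * ip mu D (fun x => part r (u x)) (fun x => part r (w x)) + ip mu D (fun x => part r (v x)) (fun x => part r (w x)).
  rewrite (_ : (fun x => _) = fun x => t * part r (u x) + part r (v x)); last first.
    by apply/funext => x; rewrite partD part_realM.
  rewrite (ipDl mD _ (sv r) (sw r)); last exact: sqiZ.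
  by rewrite (ipZl mD _ (su r) (sw r)).
by rewrite /cip !E; ring.
Qed.

Lemma cip_axpyr (t : R) u v w : L2 D u -> L2 D v -> L2 D w ->
  cip w (fun x => t%:C%C * u x + v x) = t * cip w u + cip w v.
Proof. by move=> *; rewrite cipC cip_axpy// !(cipC w). Qed.

Lemma cip_axpy2 (t : R) u v : L2 D u -> L2 D v ->
  cip (fun x => t%:C%C * u x + v x) (fun x => t%:C%C * u x + v x)
  = t ^+ 2 * cip u u + 2 * t * cip u v + cip v v.
Proof.
move=> Lu Lv; have Luv := L2_axpy t Lu Lv.
by rewrite cip_axpy// !cip_axpyr// (cipC v u); ring.
Qed.

Lemma cip_eql u u' v : L2 D u -> L2 D u' -> L2 D v -> eqL2 D u u' -> cip u v = cip u' v.
Proof.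
move=> /(L2_parts mD) su /(L2_parts mD) su' /(L2_parts mD) sv uu.
have E r : ip mu D (fun x => part r (u x)) (fun x => part r (v x)) = ip mu D (fun x => part r (u' x)) (fun x => part r (v x)).
  rewrite /ip /Rintegral; congr fine; apply: ae_eq_integral => //.
  - by apply/measurable_EFinP; apply: measurable_funM; [have [] := su r|have [] := sv r].
  - by apply/measurable_EFinP; apply: measurable_funM; [have [] := su' r|have [] := sv r].
  by apply: filterS uu => x /= + Dx => /(_ Dx) ->.
by rewrite /cip !E.
Qed.

Lemma cip_eqr u u' v : L2 D u -> L2 D u' -> L2 D v -> eqL2 D u u' -> cip v u = cip v u'.
Proof. by move=> Lu Lu' Lv uu; rewrite !(cipC v); exact: cip_eql. Qed.

Lemma cip_eq2 u u' v v' : L2 D u -> L2 D u' -> L2 D v -> L2 D v' -> eqL2 D u u' -> eqL2 D v v' ->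
  cip u v = cip u' v'.
Proof. by move=> *; rewrite (@cip_eql u u')// (@cip_eqr v v'). Qed.

Lemma discriminant (a c m : R) : 0 <= a -> 0 <= c -> (forall t, 0 <= a + 2 * t * m + t ^+ 2 * c) ->
  m ^+ 2 <= a * c.
Proof.
move=> a0 c0 P; have [cp|] := ltP 0 c.
  have := P (- m / c).
  rewrite (_ : a + _ + _ = (a * c - m ^+ 2) / c); last by field; rewrite gt_eqF.
  by rewrite pmulr_lge0 ?invr_gt0// subr_ge0.
move=> c00; have c1 : c = 0 by apply/le_anti; rewrite c00.
have [->|fg0] := eqVneq m 0; first by rewrite expr0n/= c1 mulr0.
have := P (- (a + 1) / (2 * m)).
rewrite (_ : a + _ + _ = -1); first by rewrite lerNr oppr0 ler10.
by rewrite c1; field.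
Qed.

Lemma cip_CS u v : L2 D u -> L2 D v -> cip u v ^+ 2 <= cip u u * cip v v.
Proof.
move=> Lu Lv; rewrite mulrC; apply: discriminant => [||t]; try exact: cip_ge0.
by have := cip_ge0 (fun x => t%:C%C * u x + v x); rewrite cip_axpy2//; congr (_ <= _); ring.
Qed.

Lemma cip0 u v : L2 D u -> L2 D v -> cip u u = 0 -> cip u v = 0.
Proof.
move=> Lu Lv u0; apply/eqP; rewrite -sqrf_eq0; apply/eqP/le_anti; rewrite sqr_ge0 andbT.
by apply: le_trans (cip_CS Lu Lv) _; rewrite u0 mul0r.
Qed.

End real_inner_product.

(** * Moments of a finite measure carried by an interval *)

Section moments.
Context {R : realType}.
Local Notation RB := (measurableTypeR R).
Variable m : {measure set RB -> \bar R}.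
Variables (s a c : R).
Hypothesis mT : m setT = s%:E.
Hypothesis mac : m (~` `[a, c]%classic) = 0%E.

Let I : set RB := `[a, c]%classic.
Let mitv : measurable I. Proof. exact: measurable_itv. Qed.
Let s0 : 0 <= s. Proof. by rewrite -lee_fin -mT. Qed.
Let mI : m I = s%:E.
Proof.
rewrite -mT -(setUv I) measureU//; last by rewrite setICr.
  by rewrite [X in (_ + X)%E]mac adde0.
exact: measurableC.
Qed.

Let clip (x : R) : R := Num.max a (Num.min c x).
Let mclip : measurable_fun setT (clip : RB -> RB).
Proof. by apply: measurable_maxr => //; apply: measurable_minr. Qed.
Let clipE (x : R) : I x -> clip x = x.
Proof. by rewrite /I/= in_itv/= => /andP[ax xc]; rewrite /clip (min_idPr xc) (max_idPr ax). Qed.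
Let clip_ge x : a <= clip x. Proof. by rewrite /clip le_max lexx. Qed.
Let clip_le x : a <= c -> clip x <= c. Proof. by move=> ac; rewrite /clip ge_max ac ge_min lexx. Qed.
Let clip_abs x : `|clip x| <= `|a| + `|c|.
Proof.
rewrite /clip; case: (leP a) => [+|_]; last by rewrite lerDl.
case: (leP c) => [_ _|xc ax]; first by rewrite lerDr.
have := ler_norm c; have := ler_norm (- a); have := normr_ge0 a; have := normr_ge0 c.
by rewrite normrN ler_norml => ? ? ? ?; lra.
Qed.

Let ae_int (h g : RB -> R) : measurable_fun setT h -> measurable_fun setT g ->
  (forall x, I x -> h x = g x) -> (\int[m]_x (h x)%:E = \int[m]_x (g x)%:E)%E.
Proof.
move=> mh mg hg; apply: ae_eq_integral => //; [exact/measurable_EFinP|exact/measurable_EFinP|].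
exists (~` I); split => //; first exact: measurableC.
by move=> x /= /not_implyP[_ hx] xac; apply: hx; rewrite hg.
Qed.

Let int_bd (h : RB -> R) (A : R) : measurable_fun setT h -> (forall x, `|h x| <= A) ->
  m.-integrable setT (EFin \o h).
Proof.
move=> mh hA; apply/integrableP; split; first exact/measurable_EFinP.
apply: (@le_lt_trans _ _ (\int[m]_x (cst A%:E x))%E).
  apply: ge0_le_integral => //.
  - exact/measurableT_comp/measurable_EFinP.
  - by move=> x _; rewrite lee_fin; exact: hA.
by rewrite integral_cst// mT ltry.
Qed.

Lemma moment2 : (\int[m]_x (x ^+ 2)%:E < +oo)%E.
Proof.
have mh : measurable_fun setT ((fun x => x ^+ 2) : RB -> R) by exact: measurable_funX.
have mh2 : measurable_fun setT ((fun x => clip x ^+ 2) : RB -> R) by exact: measurable_funX.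
rewrite (ae_int mh mh2) => [|x /clipE ->//].
have /integrableP[_] : m.-integrable setT (EFin \o (fun x => clip x ^+ 2)).
  apply: (@int_bd _ ((`|a| + `|c|) ^+ 2)) => // x.
  by rewrite normrX ler_pXn2r ?nnegrE ?addr_ge0.
congr (_ < _)%E; apply: eq_integral => x _ /=.
by rewrite ger0_norm// sqr_ge0.
Qed.

Let int_clip : m.-integrable setT (EFin \o clip).
Proof. exact: int_bd mclip clip_abs. Qed.

Let moment1_clip : \int[m]_x x = \int[m]_x clip x.
Proof. by congr fine; apply: ae_int => // x /clipE ->. Qed.

(** On the support the positive part equals [x - a]. Expressing the first moment by a nonnegative
    integrand makes it additive when measures are added. *)
Lemma moment1E : [/\ (\int[m]_x (Num.max (x - a) 0)%:E < +oo)%E &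
  \int[m]_x x = fine (\int[m]_x (Num.max (x - a) 0)%:E)%E + a * s].
Proof.
have mx : measurable_fun setT ((fun x => Num.max (x - a) 0) : RB -> R).
  by apply: measurable_maxr => //; apply: measurable_funB.
have mx2 : measurable_fun setT ((fun x => clip x - a) : RB -> R) by exact: measurable_funB.
rewrite (ae_int mx mx2); last first.
  by move=> x Ix; rewrite (clipE Ix); apply/max_idPl; move: Ix; rewrite /I/= in_itv/= subr_ge0 => /andP[].
have ia : m.-integrable setT (EFin \o cst a) by exact: (int_bd (A := `|a|)).
have iB : m.-integrable setT (EFin \o (fun x => clip x - a)).
  by apply: eq_integrable (integrableB _ int_clip ia).
split.
  have /integrableP[_] := iB; congr (_ < _)%E; apply: eq_integral => x _ /=.
  by rewrite ger0_norm// subr_ge0.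
rewrite -[fine _]/(\int[m]_x (clip x - a)) RintegralB// moment1_clip.
by rewrite Rintegral_cst// mT /= mulrC subrK.
Qed.

Lemma moment1_ge : a * s <= \int[m]_x x.
Proof.
have [_ ->] := moment1E; rewrite lerDr fine_ge0//; apply: integral_ge0 => x _.
by rewrite lee_fin le_max lexx orbT.
Qed.

Lemma moment1_le : \int[m]_x x <= c * s.
Proof.
rewrite moment1_clip; have [ac|ca] := leP a c.
  have ic : m.-integrable setT (EFin \o cst c) by exact: (int_bd (A := `|c|)).
  apply: le_trans (le_Rintegral _ int_clip ic _) _ => //; first by move=> x _; exact: clip_le.
  by rewrite Rintegral_cst// mT.
have s00 : s = 0.
  by apply/EFin_inj; rewrite -mI /I set_itv_ge ?measure0// bnd_simp -ltNge.
have mT0 : m setT = 0%E by rewrite mT s00.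
rewrite s00 mulr0 /Rintegral (_ : (\int[m]_x _)%E = 0%E)//.
rewrite (negligible_integral measurableT measurableT)// ?setDv ?integral_set0//.
Qed.

End moments.

Lemma ge0_integral_add_measure {R : realType} {dT} {T : measurableType dT}
    (m m1 m2 : {measure set T -> \bar R}) (f : T -> \bar R) :
  (forall A, measurable A -> m A = m1 A + m2 A)%E -> (forall x, 0 <= f x)%E ->
  measurable_fun setT f -> (\int[m]_x f x = \int[m1]_x f x + \int[m2]_x f x)%E.
Proof.
move=> mE f0 mf; rewrite -ge0_integral_measure_add//.
apply: eq_measure_integral => A mA _; rewrite mE//; exact/esym/measure_addE.
Qed.

(** * Spectral subspaces of a symmetric operator bounded below *)

Section spectral_calculus.
Context {R : realType} {d : nat}.
Local Notation V := 'rV[R]_d.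
Variable D : set V.
Hypothesis mD : measurable D.
Local Notation RB := (measurableTypeR R).
Implicit Types (u v w f : V -> R[i]) (B C : set R).
Local Notation cip := (cip D).
Local Notation "u +[ t ] w" := (fun x => t%:C%C * w x + u x) (at level 50).
Variable A : (V -> R[i]) -> (V -> R[i]) -> Prop.
Variable E : set R -> (V -> R[i]) -> (V -> R[i]).
Hypothesis specE : spectral_measure D A E.
Variable K : R.
Hypothesis A_L2 : forall u f, A u f -> L2 D u /\ L2 D f.
Hypothesis A_sym : forall u f v g, A u f -> A v g -> cip f v = cip u g.
Hypothesis A_ge : forall u f, A u f -> - K * cip u u <= cip f u.
Local Notation nn u := (cip u u).

Lemma E_L2 B u : measurable (B : set RB) -> L2 D u -> L2 D (E B u).
Proof. by case: specE => P _ _ /P[H _ _ _]; exact: H. Qed.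

Lemma E_sym B u v : measurable (B : set RB) -> L2 D u -> L2 D v ->
  cip (E B u) v = cip u (E B v).
Proof.
move=> mB Lu Lv; case: specE => /(_ _ mB)[_ _ _ H] _ _.
by rewrite -!(cipE mD) ?H//; exact: E_L2.
Qed.

Lemma E_idem B u v : measurable (B : set RB) -> L2 D u -> L2 D v ->
  cip (E B (E B u)) v = cip (E B u) v.
Proof.
move=> mB Lu Lv; case: specE => /(_ _ mB)[_ _ H _] _ _.
by apply: cip_eql => //; [apply: E_L2 => //; apply: E_L2|exact: E_L2|exact: H].
Qed.

Lemma E_lin B t u v w : measurable (B : set RB) -> L2 D u -> L2 D v -> L2 D w ->
  cip (E B (u +[t] v)) w = t * cip (E B v) w + cip (E B u) w.
Proof.
move=> mB Lu Lv Lw; case: specE => /(_ _ mB)[_ H _ _] _ _.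
have L1 := E_L2 mB Lu; have L2' := E_L2 mB Lv.
rewrite -(cip_axpy mD)//; apply: cip_eql => //; last exact: H.
  by apply: E_L2 => //; exact: L2_axpy.
exact: L2_axpy.
Qed.

Lemma nnE B u : measurable (B : set RB) -> L2 D u -> nn (E B u) = cip (E B u) u.
Proof. by move=> mB Lu; rewrite -(E_sym mB) ?E_idem//; exact: E_L2. Qed.

Lemma E_measure u : L2 D u -> exists m : {measure set RB -> \bar R},
  [/\ forall B : set RB, measurable B -> m B = (nn (E B u))%:E, m setT = (nn u)%:E,
   (\int[m]_x (x ^+ 2)%:E < +oo)%E -> exists f, A u f &
   forall f, A u f -> cip f u = \int[m]_x x].
Proof.
move=> Lu; case: (specE) => _ ET /(_ u Lu)[m [mE dom mom]].
have mE' B : measurable (B : set RB) -> m B = (nn (E B u))%:E.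
  by move=> mB; rewrite mE// normL2sq_cip//; exact: E_L2.
exists m; split => //.
- rewrite mE'//; congr _%:E; apply: cip_eq2 => //; try exact: E_L2; exact: ET.
- by move=> /dom.
- by move=> f Af; rewrite -(cipE mD) ?mom//; have [] := A_L2 Af.
Qed.

Lemma nnE_sub B C u : measurable (B : set RB) -> measurable (C : set RB) -> B `<=` C ->
  L2 D u -> nn (E B u) <= nn (E C u).
Proof.
move=> mB mC BC Lu; have [m [mE mT _ _]] := E_measure Lu.
by rewrite -lee_fin -!mE// le_measure ?inE.
Qed.

(** Orthogonality of the projections follows from mass: by idempotence the spectral measure of
    [E B u] has its total mass on [B], so none is left for [C]. *)
Lemma nnE_cross B C u : measurable (B : set RB) -> measurable (C : set RB) -> B `&` C = set0 ->
  L2 D u -> nn (E C (E B u)) = 0.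
Proof.
move=> mB mC BC Lu; have LB := E_L2 mB Lu.
have [m [mE mT _ _]] := E_measure LB.
have : (m (B `|` C) <= m setT)%E by apply: le_measure; rewrite ?inE//; exact: measurableU.
have -> : m (B `|` C) = (m B + m C)%E by exact: measureU.
rewrite mT !mE// -EFinD lee_fin.
rewrite (_ : nn (E B (E B u)) = nn (E B u)); last by rewrite nnE// E_idem.
by rewrite gerDl => H; apply/le_anti; rewrite H cip_ge0.
Qed.

Lemma nnE_eq B u v : measurable (B : set RB) -> L2 D u -> L2 D v -> eqL2 D u v ->
  nn (E B u) = nn (E B v).
Proof.
move=> mB Lu Lv uv; have LB := E_L2 mB Lu; have LB' := E_L2 mB Lv.
by rewrite !nnE// (cip_eqr mD Lu Lv LB uv) E_sym// E_sym// (cip_eql mD Lu Lv LB' uv).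
Qed.

Lemma nnE_lin0 B t u v : measurable (B : set RB) -> L2 D u -> L2 D v ->
  nn (E B u) = 0 -> nn (E B v) = 0 -> nn (E B (u +[t] v)) = 0.
Proof.
move=> mB Lu Lv u0 v0; have Luv := L2_axpy mD t Lv Lu.
have LB := E_L2 mB Lu; have LB' := E_L2 mB Lv.
by rewrite nnE// E_lin// (cip0 mD LB Luv u0) (cip0 mD LB' Luv v0) mulr0 addr0.
Qed.

(* A vector spectrally supported in [-n, -K - 1/n] would violate the form bound. *)
Lemma E_below u : L2 D u -> nn (E `]-oo, - K[%classic u) = 0.
Proof.
move=> Lu; have [m [mE _ _ _]] := E_measure Lu.
pose B (n : nat) : set RB := `[- n%:R, - K - n.+1%:R^-1]%classic.
have mB n : measurable (B n) by exact: measurable_itv.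
have B0 n : nn (E (B n) u) = 0.
  have LB := E_L2 (mB n) Lu.
  have [m' [m'E m'T dom mom]] := E_measure LB.
  have m'B : m' (~` B n) = 0%E.
    have mBC : measurable (~` B n) by exact: measurableC.
    by rewrite m'E// nnE_cross ?setICr.
  have [f Af] := dom (moment2 m'T m'B).
  have := A_ge Af; rewrite (mom _ Af) => H1.
  have := le_trans H1 (moment1_le m'T m'B); rewrite mulrBl lerBrDr gerDl => H2.
  have := cip_ge0 D (E (B n) u); have : 0 < n.+1%:R^-1 :> R by [].
  by move=> n0 q0; apply/le_anti; rewrite q0 andbT -(@pmulr_rle0 _ n.+1%:R^-1).
apply: EFin_inj; rewrite -mE; last exact: measurable_itv.
have mI : measurable (`]-oo, - K[%classic : set RB) by exact: measurable_itv.
suff /negligibleP-/(_ mI) : m.-negligible (`]-oo, - K[%classic : set RB) by [].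
apply: (@negligibleS _ _ _ m (\bigcup_n B n)).
  move=> x /=; rewrite in_itv/= => xK.
  have KX : 0 < - K - x by rewrite subr_gt0.
  pose n := Num.trunc (Num.max (- x) ((- K - x)^-1)); exists n.+1 => //.
  have := truncnS_gt (Num.max (- x) ((- K - x)^-1)).
  rewrite -/n gt_max => /andP[h1 h2]; rewrite /B/= in_itv/=; apply/andP; split.
    by rewrite lerNl ltW.
  rewrite lerBrDl -lerBrDr; apply: le_trans (_ : n.+1%:R^-1 <= _).
    by rewrite lef_pV2 ?posrE ?ltr0n// ler_nat.
  by rewrite -[leRHS]invrK lef_pV2 ?posrE ?invr_gt0//; exact: ltW.
apply: negligible_bigcup => n; apply/negligibleP => //.
by apply: etrans (mE _ (mB n)) _; rewrite B0.
Qed.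

Variable b : R.
Let M := b + K.
Let Bc : set RB := `]b, +oo[%classic.
Let mBc : measurable Bc. Proof. exact: measurable_itv. Qed.
(** The spectral subspace is described by the vanishing of the complementary projection, a condition
    that passes to linear combinations and empties the spectral measure above [b]. *)
Definition low u := L2 D u /\ nn (E Bc u) = 0.

Lemma low_window u (m : {measure set RB -> \bar R}) : low u ->
  (forall B : set RB, measurable B -> m B = (nn (E B u))%:E) -> m (~` `[- K, b]%classic) = 0%E.
Proof.
move=> [Lu u0] mE; apply/negligibleP; first by apply: measurableC; exact: measurable_itv.
rewrite (_ : ~` _ = `]-oo, - K[%classic `|` Bc).
  apply: negligibleU; apply/negligibleP => //; try exact: measurable_itv.
    by apply: etrans (mE _ _) _; [exact: measurable_itv|rewrite E_below].
  by apply: etrans (mE _ mBc) _; rewrite u0.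
apply/seteqP; split => x /=; rewrite /Bc/= !in_itv/= ?andbT.
  by move/negP; rewrite negb_and -!ltNge => /orP[]; [left|right].
by move=> H; apply/negP; rewrite negb_and -!ltNge; apply/orP; case: H; [left|right].
Qed.

Lemma low_dom u : low u -> exists f, A u f.
Proof.
move=> lu; have [m [mE mT dom _]] := E_measure lu.1.
exact/dom/(moment2 mT)/(low_window lu mE).
Qed.

Lemma low_form u f : low u -> A u f ->
  - K * nn u <= cip f u /\ cip f u <= b * nn u.
Proof.
move=> lu Af; have [m [mE mT _ mom]] := E_measure lu.1.
have w := low_window lu mE; rewrite (mom _ Af); split.
  exact: moment1_ge mT w.
exact: moment1_le mT w.
Qed.

Lemma low_axpy t u v : low u -> low v -> low (u +[t] v).
Proof. by move=> [Lu u0] [Lv v0]; split; [exact: L2_axpy|exact: nnE_lin0]. Qed.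

(* The spectral measures of u and of w = E(]b, c]) f add up to that of u + w. *)
Lemma low_measureD u f c C (w := E `]b, c]%classic f) : low u -> L2 D f ->
  measurable (C : set RB) -> nn (E C (u +[1] w)) = nn (E C u) + nn (E C w).
Proof.
move=> [Lu u0] Lf mC; set B := `]b, c]%classic in w *.
have mB : measurable (B : set RB) by exact: measurable_itv.
have Lw : L2 D w by exact: E_L2.
have Luw := L2_axpy mD 1 Lw Lu.
have expand S : measurable (S : set RB) ->
  nn (E S (u +[1] w)) = nn (E S u) + nn (E S w) + 2 * cip (E S u) w.
  move=> mS; have LSu := E_L2 mS Lu; have LSw := E_L2 mS Lw.
  rewrite nnE// E_lin// !cip_axpyr// (nnE mS Lu) (nnE mS Lw) (E_sym mS Lw Lu) (cipC _ w); ring.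
suff cross : cip (E C u) w = 0 by rewrite expand// cross mulr0 addr0.
have mC1 : measurable (C `&` Bc : set RB) by exact: measurableI.
have mC2 : measurable (C `\` Bc : set RB) by exact: measurableD.
have [m1 [m1E _ _ _]] := E_measure Luw; have [m2 [m2E _ _ _]] := E_measure Lu.
have [m3 [m3E _ _ _]] := E_measure Lw.
have split_C v (m : {measure set RB -> \bar R}) :
    (forall S : set RB, measurable S -> m S = (nn (E S v))%:E) ->
    nn (E C v) = nn (E (C `&` Bc) v) + nn (E (C `\` Bc) v).
  move=> mE; apply: EFin_inj; rewrite [RHS]EFinD -(mE C mC) -(mE _ mC1) -(mE _ mC2).
  rewrite -[in LHS](setUIDK C Bc).
  have dis : (C `&` Bc) `&` (C `\` Bc) = set0 by rewrite setIDA setIAC -setIDA setDv setI0.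
  exact: measureU.
have s1 := split_C _ _ m1E; have s2 := split_C _ _ m2E; have s3 := split_C _ _ m3E.
have z1 : cip (E (C `&` Bc) u) w = 0.
  apply: (cip0 mD) => //; first exact: E_L2.
  by apply/le_anti; rewrite cip_ge0 andbT -u0; apply: nnE_sub => //; exact: subIsetr.
have z2 : cip (E (C `\` Bc) u) w = 0.
  rewrite E_sym// cipC; apply: (cip0 mD) => //; first exact: E_L2.
  apply: nnE_cross => //; apply/seteqP; split => x //= -[+ [_]].
  by rewrite /B /Bc /= !in_itv/= andbT => /andP[->].
have e0 := expand _ mC; have e1 := expand _ mC1; have e2 := expand _ mC2.
move: e1 e2; rewrite z1 z2 => e1 e2.
have : 2 * cip (E C u) w = 0 by lra.
by move/eqP; rewrite mulf_eq0 pnatr_eq0/= => /eqP.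
Qed.

(** For [w = E ]b, c] (A u)] the spectral measures of [u] and [w] add up to that of [u + w], so the
    quadratic form of [A] is additive on this sum and the cross term [2 * <A u, w>] vanishes. But
    [<A u, w>] is the squared norm of [w]; then let [c] grow. *)
Lemma low_image u f : low u -> A u f -> low f.
Proof.
move=> lu Af; have [Lu Lf] := A_L2 Af; split=> //.
have key c : b <= c -> nn (E `]b, c]%classic f) = 0.
  move=> bc; set B := `]b, c]%classic.
  have mB : measurable (B : set RB) by exact: measurable_itv.
  set w := E B f; have Lw : L2 D w by exact: E_L2.
  have Luw := L2_axpy mD 1 Lw Lu.
  have [m1 [m1E m1T dom1 mom1]] := E_measure Luw; have [m2 [m2E m2T _ mom2]] := E_measure Lu.
  have [m3 [m3E m3T dom3 mom3]] := E_measure Lw.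
  have madd (S : set RB) : measurable S -> m1 S = (m2 S + m3 S)%E.
    by move=> mS; rewrite m1E// m2E// m3E// -EFinD low_measureD.
  have mJ : measurable (`[- K, c]%classic : set RB) by exact: measurable_itv.
  have mJC : measurable (~` `[- K, c]%classic : set RB) by exact: measurableC.
  have j2 : m2 (~` `[- K, c]%classic) = 0%E.
    apply/eqP; rewrite eq_le measure_ge0 andbT -(low_window lu m2E); apply: le_measure; rewrite ?inE//.
      by apply: measurableC; exact: measurable_itv.
    apply: subsetC => x /=; rewrite !in_itv/= => /andP[-> /= xb]; exact: le_trans bc.
  have j3 : m3 (~` `[- K, c]%classic) = 0%E.
    have mS : measurable (`]c, +oo[%classic : set RB) by exact: measurable_itv.
    have mS' : measurable (`]-oo, - K[%classic : set RB) by exact: measurable_itv.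
    apply/negligibleP => //; rewrite (_ : ~` _ = `]-oo, - K[%classic `|` `]c, +oo[%classic).
      apply: negligibleU; apply/negligibleP => //.
        by apply: etrans (m3E _ mS') _; rewrite E_below.
      apply: etrans (m3E _ mS) _; rewrite nnE_cross//.
      apply/seteqP; split => x //=; rewrite !in_itv/= andbT => -[/andP[_ xc]].
      by rewrite bnd_simp in xc; rewrite ltNge xc.
    apply/seteqP; split => x /=; rewrite !in_itv/= ?andbT.
      by move/negP; rewrite negb_and -!ltNge => /orP[]; [left|right].
    by move=> H; apply/negP; rewrite negb_and -!ltNge; apply/orP; case: H; [left|right].
  have j1 : m1 (~` `[- K, c]%classic) = 0%E by rewrite madd// j2 j3 adde0.
  have [k Ak] := dom1 (moment2 m1T j1); have [g Ag] := dom3 (moment2 m3T j3).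
  have [_ Lk] := A_L2 Ak; have [_ Lg] := A_L2 Ag.
  have kE : cip k (u +[1] w) = cip f u + cip g w.
    rewrite (mom1 _ Ak) (mom2 _ Af) (mom3 _ Ag).
    have [f1 ->] := moment1E m1T j1; have [f2 ->] := moment1E m2T j2.
    have [f3 ->] := moment1E m3T j3.
    have ss : nn (u +[1] w) = nn u + nn w.
      by apply: EFin_inj; rewrite [RHS]EFinD -m1T -m2T -m3T madd.
    rewrite ss (@ge0_integral_add_measure _ _ _ m1 m2 m3)//.
    - by rewrite fineD ?ge0_fin_numE//; [ring|apply: integral_ge0 => x _; rewrite lee_fin le_max lexx orbT..].
    - by move=> x; rewrite lee_fin le_max lexx orbT.
    - by apply/measurable_EFinP; apply: measurable_maxr => //; exact: measurable_funB.
  have := kE; rewrite cip_axpyr// (A_sym Ak Ag) (A_sym Ak Af) !cip_axpy// (cipC _ w f).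
  rewrite -(A_sym Af Ag) (cipC _ u f) (cipC _ w g) => H.
  have : cip f w = 0 by lra.
  by rewrite /w cipC -nnE.
have [m [mE _ _ _]] := E_measure Lf.
apply: EFin_inj; rewrite -mE//.
suff /negligibleP-/(_ mBc) : m.-negligible Bc by [].
apply: (@negligibleS _ _ _ m (\bigcup_n `]b, b + n%:R]%classic)).
  move=> x /=; rewrite /Bc/= in_itv/= andbT => bx; exists (Num.trunc (x - b)).+1 => //=.
  by rewrite in_itv/= bx /= -lerBlDl; apply: ltW; exact: truncnS_gt.
apply: negligible_bigcup => n; have mB : measurable (`]b, b + n%:R]%classic : set RB) by exact: measurable_itv.
apply/negligibleP => //; apply: etrans (mE _ mB) _; rewrite key//.
by rewrite lerDl.
Qed.

(** Cauchy-Schwarz for the nonnegative form of [A + K] on the subspace, with [q = (A + K) u] and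
    [r = (A + K) q], gives [|q|^4 <= <q, u> * <r, q>]; the form bound gives [<q, u> <= M * |u|^2]
    and [<r, q> <= M * |q|^2]. *)
Lemma low_norm u f (q := fun x => K%:C%C * u x + f x) : low u -> A u f ->
  [/\ low q, 0 <= cip q u & nn q <= M ^+ 2 * nn u].
Proof.
move=> lu Af; have [Lu Lf] := A_L2 Af; have lf := low_image lu Af.
have lq : low q by exact: low_axpy.
have Lq := lq.1.
have qu : cip q u = K * nn u + cip f u by rewrite cip_axpy.
have [l1 l2] := low_form lu Af.
have qu0 : 0 <= cip q u by rewrite qu; lra.
have quM : cip q u <= M * nn u by rewrite qu /M; lra.
split => //.
have [g Ag] := low_dom lq; have [_ Lg] := A_L2 Ag.
set r := fun x => K%:C%C * q x + g x.
have Lr : L2 D r by exact: L2_axpy.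
have rq : cip r q = K * nn q + cip g q by rewrite cip_axpy.
have [l3 l4] := low_form lq Ag.
have CS : cip q q ^+ 2 <= cip q u * cip r q.
  apply: discriminant => [||t] //; first by rewrite rq; lra.
  have lt := low_axpy t lu lq; have [k Ak] := low_dom lt.
  have [_ Lk] := A_L2 Ak.
  have [kK _] := low_form lt Ak.
  have kE : cip k (u +[t] q) = t ^+ 2 * cip q g + t * cip u g + t * cip q f + cip u f.
    by rewrite cip_axpyr// (A_sym Ak Ag) (A_sym Ak Af) !cip_axpy//; ring.
  move: kK; rewrite kE (cip_axpy2 mD t Lq Lu) -(A_sym Af Ag) rq qu.
  have -> : nn q = cip f q + K * cip u q by rewrite {1}/q cip_axpy// addrC.
  rewrite (cipC _ q f) (cipC _ u f) (cipC _ q g) (cipC _ u q) qu.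
  rewrite -subr_ge0; congr (_ <= _); ring.
have M0 : 0 <= M * nn u by exact: le_trans qu0 quM.
have q0 := cip_ge0 D q.
have [->|qn0] := eqVneq (nn q) 0; first by rewrite mulr_ge0 ?sqr_ge0 ?cip_ge0.
have qp : 0 < nn q by rewrite lt_def qn0.
have rM : cip r q <= M * nn q by rewrite rq /M; lra.
have : nn q <= M * cip q u.
  rewrite -(ler_pM2r qp) -expr2; apply: le_trans CS _.
  by rewrite -mulrA mulrCA ler_wpM2l.
have [M00|M00] := leP 0 M.
  by move=> h; apply: le_trans h _; rewrite expr2 -mulrA ler_wpM2l.
move=> h; apply: le_trans h _; have : nn u <= 0 by rewrite -(nmulr_rge0 _ M00).
have := cip_ge0 D u => u0 u1; have u2 : nn u = 0 by apply/le_anti; rewrite u0 u1.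
by rewrite cipC (cip0 mD Lu Lq u2) u2 !mulr0.
Qed.

Lemma low_range v u : L2 D u -> L2 D v -> eqL2 D u (E `]-oo, b]%classic v) -> low u.
Proof.
move=> Lu Lv uE; split => //.
have mB : measurable (`]-oo, b]%classic : set RB) by exact: measurable_itv.
rewrite (nnE_eq mBc Lu (E_L2 mB Lv) uE) nnE_cross//.
by apply/seteqP; split => x //=; rewrite /Bc/= !in_itv/= andbT => -[xb]; rewrite ltNge xb.
Qed.

(* [u m] is (A + K)^m phi. *)
Lemma low_powers phi : low phi -> exists u f : nat -> V -> R[i],
  [/\ u 0%N = phi, forall m, A (u m) (f m) /\ u m.+1 = (fun x => K%:C%C * u m x + f m x),
    forall m, 0 <= cip (u m) phi & forall m, nn (u m) <= M ^+ (2 * m) * nn phi].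
Proof.
move=> lphi.
have /choice[T HT] u : exists f, low u -> A u f.
  by have [/low_dom[f Af]|nu] := pselect (low u); [exists f|exists u].
pose u m := iter m (fun u x => K%:C%C * u x + T u x) phi.
have lu m : low (u m).
  by elim: m => [//|m IH]; have [] := low_norm IH (HT _ IH).
exists u, (fun m => T (u m)); split => //.
- by move=> m; split => //; exact: HT.
(* Symmetry moves half of the powers to the other side: [<u m, phi>] becomes a squared norm for even
   [m] and a value of the nonnegative form for odd [m]. *)
- have sw j k : cip (u j.+1) (u k) = cip (u j) (u k.+1).
    have Aj := HT _ (lu j); have Ak := HT _ (lu k).
    have [Lj LTj] := A_L2 Aj; have [Lk LTk] := A_L2 Ak.
    by rewrite /= cip_axpy// cip_axpyr// (A_sym Aj Ak).
  have shift n j k : cip (u (n + j)%N) (u k) = cip (u j) (u (n + k)%N).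
    by elim: n j k => [//|n IH] j k; rewrite addSnnS IH sw.
  move=> m; rewrite -[phi]/(u 0%N) -(odd_double_half m) -addnn.
  have h := shift m./2 ; case: (odd m).
    by rewrite add1n -addnS h addn0; have [] := low_norm (lu m./2) (HT _ (lu m./2)).
  by rewrite add0n h addn0 cip_ge0.
- elim=> [|m IH]; first by rewrite muln0 mul1r.
  have [_ _ h] := low_norm (lu m) (HT _ (lu m)).
  by apply: le_trans h _; rewrite mulnS exprD -mulrA ler_wpM2l ?sqr_ge0.
Qed.
End spectral_calculus.

(** * Symmetry and lower bound of the Schrodinger operator *)

Section schrodinger_operator.
Context {R : realType} {d : nat}.
Local Notation V := 'rV[R]_d.
Local Notation mu := (lebesgue_rV R d).
Variables (bc : boundary_condition) (L : R).
Local Notation Q := (cube L : set V).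
Let mQ : measurable Q. Proof. exact: measurable_cube. Qed.
Local Notation cip := (cip Q).
Implicit Types u v f w k : V -> R[i].

Lemma Re_sum I (s : seq I) (F : I -> R[i]) :
  complex.Re (\sum_(i <- s) F i) = \sum_(i <- s) complex.Re (F i).
Proof. elim: s => [|i s IH]; first by rewrite !big_nil.
by rewrite !big_cons -IH; case: (F i) (\sum_(j <- s) _) => [? ?] []. Qed.

Lemma neg_laplacian_form u w v k : neg_laplacian bc L u w -> neg_laplacian bc L v k ->
  exists g h : 'I_d -> V -> R[i],
    [/\ forall i, L2 Q (g i) /\ L2 Q (h i), cip w v = \sum_i cip (g i) (h i) &
      cip u k = \sum_i cip (g i) (h i)].
Proof.
move=> [Lw [g gu gP]] [Lk [h hv hP]]; exists g, h.
have [[Lu gg] _] := gu; have [[Lv hh] _] := hv.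
have Lg i : L2 Q (g i) by have [] := gg i.
have Lh i : L2 Q (h i) by have [] := hh i.
split=> //.
- rewrite -(cipE mQ)// -(gP _ _ hv) Re_sum; apply: eq_bigr => i _; exact: (cipE mQ).
- rewrite cipC -(cipE mQ)// -(hP _ _ gu) Re_sum; apply: eq_bigr => i _.
  by rewrite cipC; exact: (cipE mQ).
Qed.

Variables (pot W : V -> R) (K : R).
Hypothesis mW : measurable_fun setT W.
Hypothesis WK : forall x, `|W x| <= K.
Hypothesis potW : pot = W %[ae mu].

Lemma L2_potential u : L2 Q u -> L2 Q (fun x => (W x)%:C%C * u x).
Proof.
move=> /(L2_parts mQ) su; apply/(L2_parts mQ) => r.
have mWr : measurable_fun Q (fun x => W x * part r (u x)).
  apply: measurable_funM; last by have [] := su r.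
  by apply: measurable_funS mW.
rewrite (_ : (fun x => _) = fun x => W x * part r (u x)); last by apply/funext => x; rewrite part_realM.
apply: (sqi_le mQ mWr _ (sqiZ mQ K (su r))) => x _.
by rewrite !normrM ler_wpM2r// (le_trans (WK x))// ler_norm.
Qed.

Lemma cip_potential u v : cip (fun x => (W x)%:C%C * u x) v = cip u (fun x => (W x)%:C%C * v x).
Proof.
have E r : ip mu Q (fun x => part r ((W x)%:C%C * u x)) (fun x => part r (v x))
  = ip mu Q (fun x => part r (u x)) (fun x => part r ((W x)%:C%C * v x)).
  by apply: eq_Rintegral => x _; rewrite !part_realM; ring.
by rewrite /cip !E.
Qed.

Lemma cip_potential_ge u : L2 Q u -> - K * cip u u <= cip (fun x => (W x)%:C%C * u x) u.
Proof.
move=> Lu; have LWu := L2_potential Lu.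
have /(L2_parts mQ) su := Lu; have /(L2_parts mQ) sWu := LWu.
have E r : - K * ip mu Q (fun x => part r (u x)) (fun x => part r (u x)) <=
   ip mu Q (fun x => part r ((W x)%:C%C * u x)) (fun x => part r (u x)).
  rewrite -(ipZl mQ _ (su r) (su r)); apply: le_Rintegral => //.
  - exact: sqi_int (sqiZ mQ _ (su r)) (su r).
  - exact: sqi_int (sWu r) (su r).
  move=> x _; rewrite part_realM -!mulrA -expr2 ler_wpM2r ?sqr_ge0//.
  by have := WK x; rewrite ler_norml => /andP[].
by rewrite /cip mulrDr lerD.
Qed.

Lemma schrodinger_split u f : schrodinger bc L pot u f ->
  [/\ L2 Q u, L2 Q f & exists w, [/\ neg_laplacian bc L u w, L2 Q w &
    eqL2 Q f (fun x => 1%:C%C * w x + (W x)%:C%C * u x)]].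
Proof.
move=> [Lf [w uw fw]]; have [Lw [g [[Lu _] _] _]] := uw; split=> //; exists w; split=> //.
apply: filterS2 fw potW => x /= fx Wx Qx.
by rewrite fx// Wx// rmorph1 mul1r.
Qed.

Lemma schrodinger_L2 u f : schrodinger bc L pot u f -> L2 Q u /\ L2 Q f.
Proof. by case/schrodinger_split. Qed.

Lemma schrodinger_cip u f v w : L2 Q u -> L2 Q f -> L2 Q v -> L2 Q w ->
  eqL2 Q f (fun x => 1%:C%C * w x + (W x)%:C%C * u x) ->
  cip f v = cip w v + cip (fun x => (W x)%:C%C * u x) v.
Proof.
move=> Lu Lf Lv Lw fE; have LWu := L2_potential Lu.
by rewrite (cip_eql mQ Lf _ Lv fE) ?cip_axpy ?mul1r//; exact: L2_axpy.
Qed.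

Lemma schrodinger_sym u f v g : schrodinger bc L pot u f -> schrodinger bc L pot v g ->
  cip f v = cip u g.
Proof.
move=> /schrodinger_split[Lu Lf [w [uw Lw fE]]] /schrodinger_split[Lv Lg [k [vk Lk gE]]].
have [g0 [h0 [_ E1 E2]]] := neg_laplacian_form uw vk.
rewrite (schrodinger_cip Lu Lf Lv Lw fE) (cipC _ u) (schrodinger_cip Lv Lg Lu Lk gE).
by rewrite E1 (cipC _ k) E2 cip_potential (cipC _ u).
Qed.

Lemma schrodinger_ge u f : schrodinger bc L pot u f -> - K * cip u u <= cip f u.
Proof.
move=> /schrodinger_split[Lu Lf [w [uw Lw fE]]].
have [g [h [_ _ _]]] := neg_laplacian_form uw uw.
rewrite (schrodinger_cip Lu Lf Lu Lw fE); apply: le_trans (cip_potential_ge Lu) _.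
rewrite lerDr; have [_ [g' gu gP]] := uw.
have [[_ Lg] _] := gu.
rewrite -(cipE mQ)// -(gP _ _ gu) Re_sum; apply: sumr_ge0 => i _.
by have [Li _] := Lg i; rewrite (cipE mQ)// cip_ge0.
Qed.

End schrodinger_operator.

Section low_energy_states.
Context {R : realType} {d : nat}.
Local Notation V := 'rV[R]_d.
Local Notation mu := (lebesgue_rV R d).

(** A Borel representative clipped at plus and minus the essential supremum changes only on a null
    set, and its bound holds at every point. *)
Lemma sup_norm_truncation (L : R) (pot : V -> R) : 0 < L -> lebesgue_measurable pot ->
  (exists M : R, forall x, `|pot x| <= M) ->
  0 <= sup_norm pot /\ exists W : V -> R, [/\ measurable_fun setT W,
    forall x, `|W x| <= sup_norm pot & pot = W %[ae mu]].
Proof.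
move=> L0 [W0 mW0 potW0] [M potM]; set K := sup_norm pot.
(* The [L^oo] norm is an essential supremum provided that the whole space has positive measure. *)
have muT : (0 < mu setT)%E.
  apply: (@lt_le_trans _ _ (mu (cube L))); last by apply: le_measure; rewrite ?inE//; exact: measurable_cube.
  rewrite /cube lebesgue_rV_box => [|i]; last by lra.
  by rewrite lte_fin; apply: prodr_gt0 => i _; lra.
pose N := ess_sup mu (abse \o (EFin \o pot)).
have NE : K = fine N by rewrite /K /sup_norm unlock /= muT.
have N0 : (0 <= N)%E by apply: ess_sup_gee => //; apply/nearW => x /=; rewrite lee_fin.
have NM : (N <= M%:E)%E by apply/ess_supP/nearW => x /=; rewrite lee_fin.
have NK : N = K%:E by rewrite NE fineK// ge0_fin_numE// (le_lt_trans NM)// ltry.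
have K0 : 0 <= K by rewrite -lee_fin -NK.
split => //; exists (fun x => Num.max (- K) (Num.min K (W0 x))); split.
- by apply: measurable_maxr => //; apply: measurable_minr.
- by move=> x; rewrite ler_norml le_max lexx/= ge_max ge_min lexx /= andbT; lra.
- apply: filterS2 potW0 (ess_sup_ge mu (abse \o (EFin \o pot))) => x /= Wx.
  rewrite -/N NK lee_fin ler_norml => /andP[h1 h2] xT.
  by rewrite -Wx// (min_idPr h2) (max_idPr h1).
Qed.

(** Since the operator is a relation up to null sets, the recursion between the powers is expressed
    by the vanishing of an [L^2] norm. *)
Lemma low_energy_powers bc (L b : R) (pot : V -> R) phi : 0 < L ->
  lebesgue_measurable pot -> (exists M : R, forall x, `|pot x| <= M) ->
  ran_spectral_projector (cube L) (schrodinger bc L pot) `]-oo, b] phi ->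
  let K := sup_norm pot in let Q := cube L : set V in
  [/\ 0 <= K, L2 Q phi & exists (W : V -> R) (u w : nat -> V -> R[i]),
    [/\ measurable_fun setT W, forall x, `|W x| <= K, u 0%N = phi &
     forall m, [/\ L2 Q (u m), neg_laplacian bc L (u m) (w m),
       forall r, nsq mu Q (fun x => part r (u m.+1 x) - (part r (w m x) + (W x + K) * part r (u m x))) = 0,
       0 <= cip Q (u m) phi &
       cip Q (u m) (u m) <= (b + K) ^+ (2 * m) * cip Q phi phi]]].
Proof.
move=> L0 mpot bpot [Lphi [E [specE [v Lv phiE]]]] K Q.
have mQ : measurable Q by exact: measurable_cube.
have [K0 [W [mW WK potW]]] := sup_norm_truncation L0 mpot bpot.
have A_L2 := @schrodinger_L2 _ _ bc L pot W potW.
have A_sym := @schrodinger_sym _ _ bc L pot W K mW WK potW.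
have A_ge := @schrodinger_ge _ _ bc L pot W K mW WK potW.
have lphi := low_range mQ specE A_L2 Lphi Lv phiE.
have [u [f [u0 uS pos nrm]]] := low_powers mQ specE A_L2 A_sym A_ge lphi.
split=> //.
have /choice[w wP] m : exists w, [/\ neg_laplacian bc L (u m) w, L2 Q w &
    eqL2 Q (f m) (fun x => 1%:C%C * w x + (W x)%:C%C * u m x)].
  by have [/(schrodinger_split potW)[_ _ [w wP]] _] := uS m; exists w.
exists W, u, w; split=> // m; have [Afm uSm] := uS m; have [wm Lw fE] := wP m.
have [Lu Lf] := A_L2 _ _ Afm.
split=> // r; rewrite -[RHS](_ : nsq mu Q (fun=> 0) = 0); last first.
  by rewrite /nsq /Rintegral; under eq_integral do rewrite expr0n/=; rewrite integral0.
have su := (L2_parts mQ (u m)).1 Lu r.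
have sw := (L2_parts mQ (w m)).1 Lw r.
have sS : sqi mu Q (fun x => part r (u m.+1 x)).
  by apply: ((L2_parts mQ (u m.+1)).1 _ r); rewrite uSm; exact: L2_axpy.
rewrite /nsq /Rintegral; congr fine; apply: ae_eq_integral => //.
  apply/measurable_EFinP; apply: measurable_funX; apply: measurable_funB; first by have [] := sS.
  apply: measurable_funD; first by have [] := sw.
  apply: measurable_funM; last by have [] := su.
  by apply: measurable_funD => //; exact: measurable_funS mW.
apply: filterS fE => x /= fx Qx; rewrite uSm partD fx// partD !part_realM.
by congr (_ ^+ 2)%:E; ring.
Qed.
End low_energy_states.

(** * Periodic covering of the cube by unit cells *)

Section one_dimensional_covering.
Context {R : realType}.
Local Notation RB := (measurableTypeR R).
Local Notation mu1 := (@lebesgue_measure R).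
Implicit Types (s c t : R) (f : R -> \bar R).

Lemma ge0_integral_isometry s c (f : RB -> \bar R) : s = 1 \/ s = -1 ->
  measurable_fun setT f -> (forall t, 0 <= f t)%E ->
  (\int[mu1]_t f (s * t + c)%R = \int[mu1]_t f t)%E.
Proof.
move=> s1 mf f0; pose g : RB -> RB := fun t => s * t + c.
have mg : measurable_fun setT g by apply: measurable_funD => //; exact: measurable_funM.
rewrite -[LHS](ge0_integral_pushforward mg mu1 measurableT)//.
apply: esym; apply: eq_measure_integral => A mA _.
apply: (@lebesgue_measure_unique _ (pushforward mu1 g)) => // _ [[a b] _ <-].
rewrite /=; case: s1 => s1.
- rewrite (_ : pushforward _ _ _ = mu1 `]a - c, b - c]%classic); last first.
    congr (mu1 _); apply/seteqP; split => t; rewrite /= !in_itv/= /g s1 mul1r => /andP[h1 h2]; apply/andP; split; lra.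
  rewrite !lebesgue_measure_itv/= !lte_fin; congr (if _ then _ else _); first by rewrite ltrD2r.
  by rewrite -!EFinB; congr EFin; ring.
- rewrite (_ : pushforward _ _ _ = mu1 `[c - b, c - a[%classic); last first.
    congr (mu1 _); apply/seteqP; split => t; rewrite /= !in_itv/= /g s1 mulN1r => /andP[h1 h2]; apply/andP; split; lra.
  rewrite !lebesgue_measure_itv/= !lte_fin; congr (if _ then _ else _).
    by rewrite ltrD2l ltrN2.
  by rewrite -!EFinB; congr EFin; ring.
Qed.

(** The maps [t -> s * t + c] that generate the symmetries attached to the boundary condition: the
    reflections in the two walls, or the translation by [L]. *)
Definition wall_move bc L s c := match bc with
  | Periodic => s = 1 /\ c = L
  | _ => s = -1 /\ (c = L \/ c = - L)
  end.

Lemma wall_move_sign bc L s c : wall_move bc L s c -> s = 1 \/ s = -1.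
Proof. by case: bc => -[-> _]; [right|right|left]. Qed.

Lemma wall_moves bc L : bc = Periodic \/ (wall_move bc L (-1) L /\ wall_move bc L (-1) (- L)).
Proof.
by case: bc; [right|right|left]; rewrite /wall_move; split; split; auto.
Qed.

Variables (bc : boundary_condition) (L : R).
Hypothesis L0 : 0 < L.
Variable f : RB -> \bar R.
Hypothesis mf : measurable_fun setT f.
Hypothesis f0 : forall t, (0 <= f t)%E.
Hypothesis fsym : forall s c t, wall_move bc L s c -> f (s * t + c) = f t.

Definition tile (q : int) : set RB := `[q%:~R * L - L / 2, q%:~R * L + L / 2]%classic.
Let tile_int q : \bar R := (\int[mu1]_t ((\1_(tile q) t)%:E * f t))%E.

Let mtile q : measurable_fun setT (fun t : RB => ((\1_(tile q) t)%:E * f t)%E).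
Proof.
by apply: emeasurable_funM => //; apply/measurable_EFinP/measurable_indic; exact: measurable_itv.
Qed.

Let tile_move s c p q : wall_move bc L s c ->
  (forall t, tile p (s * t + c) <-> tile q t) -> tile_int p = tile_int q.
Proof.
move=> mv pq; rewrite /tile_int -(ge0_integral_isometry c (wall_move_sign mv))//.
  apply: eq_integral => t _; rewrite (fsym _ mv); congr (_ * _)%E; congr EFin.
  rewrite !indicE; congr (nat_of_bool _)%:R.
  by apply/idP/idP => /set_mem h; apply/mem_set/pq.
by move=> t; rewrite mule_ge0// lee_fin.
Qed.

Let tile_shift (p q : int) s c t : s = 1 -> c = (p - q)%:~R * L -> tile p (s * t + c) <-> tile q t.
Proof.
move=> -> ->; rewrite /tile/= !in_itv/= mul1r intrD intrN.
by split=> /andP[h1 h2]; apply/andP; split; lra.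
Qed.

Let tile_flip (p q : int) s c t : s = -1 -> c = (p + q)%:~R * L -> tile p (s * t + c) <-> tile q t.
Proof.
move=> -> ->; rewrite /tile/= !in_itv/= mulN1r intrD.
by split=> /andP[h1 h2]; apply/andP; split; lra.
Qed.

(** A reflection carries tile [n + 1] to tile [- n], so both signs go through the induction
    together. *)
Let tile_nat (n : nat) : tile_int n%:Z = tile_int 0 /\ tile_int (- n%:Z) = tile_int 0.
Proof.
elim: n => [|n [IH1 IH2]]; first by rewrite oppr0.
have [bcP|[mv1 mv2]] := wall_moves bc L.
  have mv : wall_move bc L 1 L by rewrite bcP.
  split.
    rewrite -IH1; apply: (tile_move mv) => t; apply: tile_shift => //.
    by rewrite -addn1 PoszD addrC addKr mul1r.
  rewrite -IH2; apply: esym; apply: (tile_move mv) => t; apply: tile_shift => //.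
  by rewrite opprK -addn1 PoszD addKr mul1r.
split.
  rewrite -IH2; apply: (tile_move mv1) => t; apply: tile_flip => //.
  by rewrite -addn1 PoszD addrAC subrr add0r mul1r.
rewrite -IH1; apply: (tile_move mv2) => t; apply: tile_flip => //.
by rewrite -addn1 PoszD opprD addrAC addNr add0r mulN1r.
Qed.

Let tileE q : tile_int q = tile_int 0.
Proof.
by case: q => n; [exact: (tile_nat n).1|rewrite NegzE; exact: (tile_nat n.+1).2].
Qed.

(** An interval of length [L] is covered by two consecutive tiles, each with the integral of the
    central one. *)
Lemma window_integral (x : R) :
  (\int[mu1]_t ((\1_`[x, x + L[%classic t)%:E * f t) <= 2%:E * tile_int 0)%E.
Proof.
pose q := Num.floor ((x + L / 2) / L).
have /andP[q1 q2] : q%:~R <= (x + L / 2) / L < (q + 1)%:~R.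
  by rewrite ge_floor/= -floor_lt_int// ltzD1 lexx.
move: q1 q2; rewrite ler_pdivlMr// ltr_pdivrMr// intrD mulrDl mul1r => q1 q2.
have -> : (2%:E * tile_int 0 = tile_int q + tile_int (q + 1)%R)%E.
  by rewrite !tileE mule_natl mule2n.
have z p t : (0 <= (\1_(tile p) t)%:E * f t)%E by rewrite mule_ge0// lee_fin.
rewrite -ge0_integralD//; apply: ge0_le_integral => //.
- by move=> t _; rewrite mule_ge0// lee_fin.
- by apply: emeasurable_funM => //; apply/measurable_EFinP/measurable_indic; exact: measurable_itv.
- exact: emeasurable_funD.
move=> t _; rewrite -ge0_muleDl ?lee_fin//; apply: lee_wpmul2r => //.
rewrite -EFinD lee_fin !indicE; case: (boolP (t \in _)) => [/set_mem|_]; last first.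
  by rewrite addr_ge0.
rewrite /= in_itv/= => /andP[h1 h2].
have [h3|h3] := leP t (q%:~R * L + L / 2).
  rewrite (_ : t \in tile q) ?lerDl//; apply/mem_set; rewrite /tile/= in_itv/=; apply/andP; split => //; lra.
rewrite (_ : t \in tile (q + 1)) ?lerDr//; apply/mem_set; rewrite /tile/= in_itv/= intrD mulrDl mul1r.
by apply/andP; split; lra.
Qed.

Lemma tile0_integral :
  tile_int 0 = (\int[mu1]_t ((\1_`]- (L / 2), L / 2[%classic t)%:E * f t))%E.
Proof.
have conv (b0 b1 : bool) : (\int[mu1]_t ((\1_[set` Interval (BSide b0 (- (L / 2))%R) (BSide b1 (L / 2))%R] t)%:E * f t)
    = \int[mu1]_(t in `](- (L / 2))%R, (L / 2)%R[) f t)%E.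
  rewrite -(@integral_itv_bndoo _ _ _ _ b0 b1); last exact: measurable_funS mf.
  rewrite [RHS]integral_mkcond; apply: eq_integral => t _; rewrite patchE indicE.
  by case: ifPn => _; rewrite ?mul1e ?mul0e.
by rewrite /tile_int /tile mul0r sub0r add0r !conv.
Qed.

Section grid_windows.
Variable l : nat.
Hypothesis Ll : L = l%:R.
(** The centres of the [l] unit cells of the interval: integers for odd [l], half-integers for even
    [l]. *)
Definition grid (k : nat) : R := k%:R - (l%:R - 1) / 2.
Definition windows (r : nat) (t : R) : R := \sum_(k < l) \1_(`]grid k - r%:R, grid k + r%:R[%classic : set RB) t.

Lemma sum_unit_windows (n : nat) (x t : R) :
  \sum_(k < n) \1_(`[x + k%:R, x + k%:R + 1[%classic : set RB) t = \1_(`[x, x + n%:R[%classic : set RB) t :> R.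
Proof.
elim: n => [|n IH]; first by rewrite big_ord0 addr0 set_itv_ge ?indicE ?in_set0// bnd_simp ltxx.
rewrite big_ord_recr/= IH -natr1 !indicE !mem_setE !in_itv/=.
have [h1|h1] := leP x t; last first.
  by rewrite /= (_ : (x + n%:R <= t) = false) ?addr0//; apply/negbTE; rewrite -ltNge (lt_le_trans h1)// lerDl.
rewrite /= addrA; have [h2|h2] := ltP t (x + n%:R).
  by rewrite (_ : t < _) ?addr0// (lt_le_trans h2)// lerDl.
by rewrite add0r /=.
Qed.

(** The [l] windows of length [2 r], cut into unit pieces, regroup into [2 r] windows of length
    [l]. *)
Lemma windows_le r t :
  windows r t <= \sum_(j < 2 * r) \1_(`[grid 0 - r%:R + j%:R, grid 0 - r%:R + j%:R + L[%classic : set RB) t.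
Proof.
rewrite Ll; under [leRHS]eq_bigr => j _ do rewrite -sum_unit_windows.
rewrite exchange_big/=; apply: ler_sum => k _.
have := sum_unit_windows (2 * r) (grid k - r%:R) t.
rewrite (_ : \sum_(_ < _) _ = \sum_(j < 2 * r) \1_(`[grid 0 - r%:R + j%:R + k%:R, grid 0 - r%:R + j%:R + k%:R + 1[%classic : set RB) t); last first.
  apply: eq_bigr => j _; rewrite (_ : grid 0 - r%:R + j%:R + k%:R = grid k - r%:R + j%:R)//.
  by rewrite /grid; ring.
move=> H; rewrite [leRHS]H natrM !indicE !mem_setE !in_itv/= ler_nat.
rewrite (_ : grid k - r%:R + 2 * r%:R = grid k + r%:R); last by ring.
by case: (boolP (_ < t < _)) => [/andP[/ltW -> ->]|_].
Qed.

Lemma windows_ge0 r t : 0 <= windows r t.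
Proof. exact: sumr_ge0. Qed.

Lemma windows_bound r t : windows r t <= (2 * r)%:R.
Proof.
apply: le_trans (windows_le _ _) _; apply: (@le_trans _ _ (\sum_(j < 2 * r) 1)); last by rewrite sumr_const card_ord.
by apply: ler_sum => j _; rewrite indicE; case: (_ \in _).
Qed.

Lemma measurable_windows r : measurable_fun setT (windows r : RB -> RB).
Proof. by apply: measurable_sum => k; apply: measurable_indic; exact: measurable_itv. Qed.

Lemma windows_integral r :
  (\int[mu1]_t ((windows r t)%:E * f t) <= (4 * r)%:R%:E *
    \int[mu1]_t ((\1_`]- (L / 2), L / 2[%classic t)%:E * f t))%E.
Proof.
pose g j t : \bar R := ((\1_(`[grid 0 - r%:R + j%:R, (grid 0 - r%:R + j%:R + L)%R[%classic : set RB) t)%:E * f t)%E.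
have mg j : measurable_fun setT (g j : RB -> \bar R).
  by apply: emeasurable_funM => //; apply/measurable_EFinP/measurable_indic; exact: measurable_itv.
have g0 j t : (0 <= g j t)%E by rewrite /g mule_ge0// lee_fin.
apply: (@le_trans _ _ (\int[mu1]_t (\sum_(j < 2 * r) g j t))%E).
  apply: ge0_le_integral => //.
  - by move=> t _; rewrite mule_ge0// lee_fin windows_ge0.
  - by apply: emeasurable_funM => //; apply/measurable_EFinP; exact: measurable_windows.
  - exact: emeasurable_sum.
  move=> t _; rewrite -ge0_sume_distrl => [|j _]; last by rewrite lee_fin.
  by apply: lee_wpmul2r => //; rewrite sumEFin lee_fin windows_le.
rewrite ge0_integral_sum//.
apply: (@le_trans _ _ (\sum_(j < 2 * r) (2%:E * tile_int 0))%E).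
  by apply: lee_sum => j _; exact: window_integral.
have sum_cst n (x : \bar R) : (0 <= x)%E -> (\sum_(j < n) x = n%:R%:E * x)%E.
  move=> x0; elim: n => [|n IH]; first by rewrite big_ord0 mul0e.
  by rewrite big_ord_recr/= IH -natr1 EFinD ge0_muleDl ?mul1e// lee_fin.
have I0 : (0 <= tile_int 0)%E by apply: integral_ge0 => t _; rewrite mule_ge0// lee_fin.
rewrite sum_cst ?mule_ge0// muleA -EFinM -natrM tile0_integral.
by rewrite mulnC mulnA.
Qed.
End grid_windows.
End one_dimensional_covering.

Section covering.
Context {R : realType}.
Local Notation RB := (measurableTypeR R).
Local Notation mu1 := (@lebesgue_measure R).

Definition rV_upd {n} (x : 'rV[R]_n) (i : 'I_n) (y : R) : 'rV[R]_n :=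
  \row_j (if j == i then y else x 0 j).

Lemma rV_upd0 n t (x : 'rV[R]_n) y : rV_upd (rV_cons (t, x)) ord0 y = rV_cons (y, x).
Proof.
apply/rowP => j; rewrite mxE; case: (unliftP ord0 j) => [k|] ->; first by rewrite !rV_consS.
by rewrite eqxx rV_cons0.
Qed.

Lemma rV_updS n t (x : 'rV[R]_n) i y :
  rV_upd (rV_cons (t, x)) (lift ord0 i) y = rV_cons (t, rV_upd x i y).
Proof.
apply/rowP => j; rewrite mxE; case: (unliftP ord0 j) => [k|] ->; last by rewrite !rV_cons0.
by rewrite !rV_consS mxE (inj_eq lift_inj).
Qed.

(** Invariance without sign, in each coordinate. It is applied to squares, where the sign of the
    Dirichlet reflection disappears. *)
Definition even_at bc (L : R) {n T} (f : 'rV[R]_n -> T) := forall i s c x, wall_move bc L s c ->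
  f (rV_upd x i (s * x 0 i + c)) = f x.

Lemma even_at_cons bc (L : R) {n T} (f : 'rV[R]_n.+1 -> T) t : even_at bc L f ->
  even_at bc L (fun x => f (rV_cons (t, x))).
Proof. by move=> ef i s c x /(ef (lift ord0 i) _ _ (rV_cons (t, x))) <-; rewrite rV_updS rV_consS. Qed.

Definition prod_weight (w : R -> R) {n} (x : 'rV[R]_n) : R := \prod_i w (x 0 i).

Definition prod_weight2 (v w : R -> R) {n} (x : 'rV[R]_n.+1) : R :=
  v (x 0 ord0) * \prod_i w (x 0 (lift ord0 i)).

Lemma prod_weight2E w n (x : 'rV[R]_n.+1) : prod_weight w x = prod_weight2 w w x.
Proof. by rewrite /prod_weight big_ord_recl. Qed.

Lemma prod_weight2_cons v w n t (x : 'rV[R]_n) : prod_weight2 v w (rV_cons (t, x)) = v t * prod_weight w x.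
Proof.
rewrite /prod_weight2 rV_cons0; congr (_ * _).
by apply: eq_bigr => i _; rewrite rV_consS.
Qed.

Lemma prod_weight_ge0 w n (x : 'rV[R]_n) : (forall t, 0 <= w t) -> 0 <= prod_weight w x.
Proof. by move=> w0; apply: prodr_ge0. Qed.

Lemma measurable_prod_weight (w : R -> R) n : measurable_fun setT (w : RB -> RB) ->
  measurable_fun setT (prod_weight w : 'rV[R]_n -> R).
Proof.
move=> mw; rewrite /prod_weight; elim: (index_enum _) => [|i s IH].
  by under eq_fun do rewrite big_nil; exact: measurable_cst.
under eq_fun do rewrite big_cons; apply: measurable_funM => //.
by apply: (measurableT_comp mw); exact: measurable_coord.
Qed.

Lemma measurable_prod_weight2 (v w : R -> R) n : measurable_fun setT (v : RB -> RB) ->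
  measurable_fun setT (w : RB -> RB) -> measurable_fun setT (prod_weight2 v w : 'rV[R]_n.+1 -> R).
Proof.
move=> mv mw; apply: measurable_funM; first by apply: (measurableT_comp mv); exact: measurable_coord.
elim: (index_enum _) => [|i s IH].
  by under eq_fun do rewrite big_nil; exact: measurable_cst.
under eq_fun do rewrite big_cons; apply: measurable_funM => //.
by apply: (measurableT_comp mw); exact: measurable_coord.
Qed.

(** Tonelli for product weights. The first coordinate has its own weight: the time interval of a
    tube, or one more spatial window in the induction on the dimension. *)
Lemma integral_prod_weight2 (v w : R -> R) n (f : 'rV[R]_n.+1 -> \bar R) :
  measurable_fun setT (v : RB -> RB) -> (forall t, 0 <= v t) ->
  measurable_fun setT (w : RB -> RB) -> (forall t, 0 <= w t) ->
  measurable_fun setT f -> (forall x, 0 <= f x)%E ->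
  let F t := (\int[lebesgue_rV R n]_x ((prod_weight w x)%:E * f (rV_cons (t, x))))%E in
  measurable_fun setT (F : RB -> \bar R) /\
  (\int[lebesgue_rV R n.+1]_x ((prod_weight2 v w x)%:E * f x) = \int[mu1]_t ((v t)%:E * F t))%E.
Proof.
move=> mv v0 mw w0 mf f0 F.
have W0 m (x : 'rV[R]_m) : 0 <= prod_weight w x by exact: prod_weight_ge0.
pose g (p : RB * 'rV[R]_n) : \bar R := ((prod_weight w p.2)%:E * f (rV_cons p))%E.
have mg : measurable_fun setT g.
  apply: emeasurable_funM; last by apply: measurableT_comp => //; exact: measurable_rV_cons.
  apply/measurable_EFinP.
  have h : measurable_fun setT (prod_weight w \o snd : RB * 'rV[R]_n -> R) by apply: measurableT_comp; [exact: measurable_prod_weight|exact: measurable_snd].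
  exact: h.
have g0 p : (0 <= g p)%E by rewrite /g mule_ge0// lee_fin.
have mF : measurable_fun setT (F : RB -> \bar R).
  exact: (measurable_fun_fubini_tonelli_F (m2 := lebesgue_rV R n) g mg g0).
split => //.
have mwf : measurable_fun setT (fun x : 'rV[R]_n.+1 => ((prod_weight2 v w x)%:E * f x)%E).
  by apply: emeasurable_funM => //; apply/measurable_EFinP; exact: measurable_prod_weight2.
have W2 (x : 'rV[R]_n.+1) : 0 <= prod_weight2 v w x by rewrite mulr_ge0// prodr_ge0.
rewrite ge0_integral_lebesgue_cons//; last by move=> x; rewrite mule_ge0// lee_fin.
rewrite fubini_tonelli1//=.
- apply: eq_integral => t _; rewrite -ge0_integralZl//.
  + by apply: eq_integral => x _; rewrite prod_weight2_cons EFinM muleA.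
  + apply: emeasurable_funM; first by apply/measurable_EFinP; exact: measurable_prod_weight.
    by apply: measurableT_comp => //; exact: measurable_rV_cons2.
  + by move=> x _; rewrite mule_ge0// lee_fin.
  + by rewrite lee_fin.
- by apply: (measurableT_comp mwf); exact: measurable_rV_cons.
- by move=> p; rewrite mule_ge0// lee_fin.
Qed.

Variables (bc : boundary_condition) (l r : nat).
Local Notation L := (l%:R : R).
Hypothesis L0 : 0 < L.
Local Notation inside := (\1_(`]- (L / 2), L / 2[%classic : set RB) : R -> R).

Lemma windows_integral_rV n (f : 'rV[R]_n -> \bar R) :
  measurable_fun setT f -> (forall x, 0 <= f x)%E -> even_at bc L f ->
  (\int[lebesgue_rV R n]_x ((prod_weight (windows l r) x)%:E * f x) <=
   ((4 * r) ^ n)%:R%:E * \int[lebesgue_rV R n]_x ((prod_weight inside x)%:E * f x))%E.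
Proof.
have mw : measurable_fun setT (windows l r : RB -> RB) by exact: measurable_windows.
have w0 t : 0 <= windows l r t :> R by exact: windows_ge0.
have mi : measurable_fun setT (inside : RB -> RB) by apply: measurable_indic; exact: measurable_itv.
have i0 t : 0 <= inside t by [].
elim: n f => [|n IH] f mf f0 ef.
  rewrite expn0 mul1e; apply: ge0_le_integral => //.
  - by move=> x _; rewrite mule_ge0// lee_fin prod_weight_ge0.
  - by apply: emeasurable_funM => //; apply/measurable_EFinP; exact: measurable_prod_weight.
  - by apply: emeasurable_funM => //; apply/measurable_EFinP; exact: measurable_prod_weight.
  - by move=> x _; rewrite /prod_weight !big_ord0.
have E2 w : @prod_weight w n.+1 = prod_weight2 w w by apply/funext => x; exact: prod_weight2E.
rewrite !E2.
have [mF ->] := integral_prod_weight2 mw w0 mw w0 mf f0.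
have [mG ->] := integral_prod_weight2 mi i0 mi i0 mf f0.
set F := (fun t => _) in mF *; set G := (fun t => _) in mG *.
have F0 t : (0 <= F t)%E by apply: integral_ge0 => x _; rewrite mule_ge0// lee_fin prod_weight_ge0.
have G0 t : (0 <= G t)%E by apply: integral_ge0 => x _; rewrite mule_ge0// lee_fin prod_weight_ge0.
have FG t : (F t <= ((4 * r) ^ n)%:R%:E * G t)%E.
  apply: IH => //; last exact: even_at_cons.
  by apply: measurableT_comp => //; exact: measurable_rV_cons2.
have eG s c t : wall_move bc L s c -> G (s * t + c) = G t.
  move=> mv; apply: eq_integral => x _; congr (_ * _)%E.
  by have := ef ord0 _ _ (rV_cons (t, x)) mv; rewrite rV_upd0 rV_cons0.
have mwG : measurable_fun setT (fun t : RB => ((windows l r t)%:E * G t)%E).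
  by apply: emeasurable_funM => //; exact/measurable_EFinP.
apply: (@le_trans _ _ (((4 * r) ^ n)%:R%:E * \int[mu1]_t ((windows l r t)%:E * G t))%E).
  rewrite -ge0_integralZl//; last by move=> t _; rewrite mule_ge0// lee_fin.
  apply: ge0_le_integral => //.
  - by move=> t _; apply: mule_ge0; [rewrite lee_fin|exact: F0].
  - by apply: emeasurable_funM => //; exact/measurable_EFinP.
  - exact: measurable_funeM.
  - by move=> t _; rewrite muleCA; apply: lee_wpmul2l; [rewrite lee_fin|exact: FG].
rewrite expnSr natrM EFinM -muleA; apply: lee_wpmul2l; first by rewrite lee_fin.
exact: (windows_integral L0 mG G0 eG).
Qed.
End covering.

Lemma sum_integral_indic {R : realType} {dT} {T : measurableType dT} (I : finType)
    (mu : {measure set T -> \bar R}) (S : I -> set T) (g : T -> \bar R) :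
  (forall i, measurable (S i)) -> measurable_fun setT g -> (forall x, 0 <= g x)%E ->
  (\sum_i \int[mu]_(x in S i) g x = \int[mu]_x ((\sum_i (\1_(S i) x : R))%:E * g x))%E.
Proof.
move=> mS mg g0.
transitivity (\int[mu]_x (\sum_i ((\1_(S i) x : R)%:E * g x))%E)%E; last first.
  by apply: eq_integral => x _; rewrite -ge0_sume_distrl ?sumEFin// => i _; rewrite lee_fin.
rewrite ge0_integral_sum//.
- apply: eq_bigr => i _; rewrite integral_mkcond; apply: eq_integral => x _.
  by rewrite patchE indicE; case: ifPn => _; rewrite ?mul1e ?mul0e.
- by move=> i; apply: emeasurable_funM => //; apply/measurable_EFinP/measurable_indic.
- by move=> i x _; rewrite mule_ge0// lee_fin.
Qed.

Section grid_covering.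
Context {R : realType} {d : nat}.
Local Notation n := d.+1.
Local Notation RB := (measurableTypeR R).
Variables (bc : boundary_condition) (l : nat).
Local Notation L := (l%:R : R).
Hypothesis l0 : (0 < l)%N.
Hypothesis d_gt0 : (0 < d)%N.
Variables (delta : R) (z : 'rV[int]_d -> 'rV[R]_d).
Hypothesis delta0 : 0 < delta.
Hypothesis delta2 : delta < 2^-1.
Hypothesis eqz : equidistributed 1 delta z.
Implicit Types kk : {ffun 'I_d -> 'I_l}.

(** Lattice cells are centred at integers, so for even [l] they do not tile the interval and the
    walls cut cells in half. The integer next to the grid point on the side of the centre has its
    whole cell inside, at the price of a displacement by 1/2. *)
Lemma admissible_lattice (k : nat) : (k < l)%N -> exists j : int,
  [/\ - (L / 2) <= j%:~R - 2^-1, j%:~R + 2^-1 <= L / 2 & `|j%:~R - grid l k| <= 2^-1 :> R].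
Proof.
move=> kl.
have kl' : k%:R + 1 <= L by rewrite natr1 ler_nat.
have k0 : 0 <= k%:R :> R by [].
have lE : L = (odd l)%:R + 2 * l./2%:R by rewrite -[in LHS](odd_double_half l) natrD -mul2n natrM.
have bd (x y : R) : x - y <= 2^-1 -> y - x <= 2^-1 -> `|x - y| <= 2^-1.
  by move=> h1 h2; rewrite ler_norml h1 andbT lerNl opprB.
have [ol|el] := boolP (odd l).
  exists (k%:Z - l./2%:Z); rewrite intrD intrN -!pmulrn.
  have {}lE : L = 1 + 2 * l./2%:R by rewrite lE ol.
  by split; last apply: bd; rewrite /grid; lra.
move: lE; rewrite (negbTE el) add0r => lE.
have [h|h] := ltnP k l./2.
  have h' : k%:R + 1 <= l./2%:R :> R by rewrite natr1 ler_nat.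
  exists (k%:Z - l./2%:Z + 1); rewrite !intrD intrN -!pmulrn.
  by split; last apply: bd; rewrite /grid; lra.
have h' : l./2%:R <= k%:R :> R by rewrite ler_nat.
exists (k%:Z - l./2%:Z); rewrite intrD intrN -!pmulrn.
by split; last apply: bd; rewrite /grid; lra.
Qed.

Lemma euclid_ball_center : forall c : 'rV[R]_d, euclid_ball c delta c.
Proof.
by move=> c; rewrite /euclid_ball/= big1 ?sqrtr0// => i _; rewrite subrr expr0n.
Qed.

Lemma euclid_ball_coord (c x : 'rV[R]_d) i : euclid_ball c delta x -> `|x 0 i - c 0 i| < 2^-1.
Proof.
move=> /(euclid_ballP _ delta0) h; apply: lt_trans delta2.
rewrite -(@ltr_pXn2r _ 2)// ?nnegrE ?ltW// real_normK ?num_real//.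
apply: le_lt_trans h; rewrite (bigD1 i)//= lerDl; apply: sumr_ge0 => j _; exact: sqr_ge0.
Qed.

Lemma admissible_ball : exists zc : {ffun 'I_d -> 'I_l} -> 'rV[R]_d, forall kk,
  [/\ forall i, `|zc kk 0 i - grid l (kk i)| <= 1 &
    euclid_ball (zc kk) delta `<=` equi_set delta z L].
Proof.
have /choice[j jP] (kk : {ffun 'I_d -> 'I_l}) : exists j : 'rV[int]_d, forall i,
    [/\ - (L / 2) <= (j 0 i)%:~R - 2^-1, (j 0 i)%:~R + 2^-1 <= L / 2 & `|(j 0 i)%:~R - grid l (kk i)| <= 2^-1 :> R].
  have /choice[f fP] i := admissible_lattice (ltn_ord (kk i)).
  by exists (\row_i f i) => i; rewrite mxE.
exists (fun kk => z (j kk)) => kk.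
have cell x i : euclid_ball (z (j kk)) delta x -> (j kk 0 i)%:~R - 2^-1 < x 0 i < (j kk 0 i)%:~R + 2^-1.
  move=> /(eqz (k := j kk)) /= /(_ i); rewrite !mxE !mul1r => /andP[h1 h2]; apply/andP; split; lra.
split=> [i|x Bx].
  have [_ _ ] := jP kk i; have /andP[h1 h2] := cell _ i (euclid_ball_center (z (j kk))).
  by rewrite !ler_norml => /andP[h3 h4]; apply/andP; split; lra.
split; first by exists (j kk).
move=> i; have [h1 h2 _] := jP kk i; have /andP[h3 h4] := cell _ i Bx.
by apply/andP; split; lra.
Qed.

Lemma measurable_equi_set : measurable (equi_set delta z L).
Proof.
apply: measurableI; last exact: measurable_cube.
by apply: countable_bigcupT_measurable => // k; exact: measurable_euclid_ball.
Qed.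

Lemma sum_windows (r : nat) (x : 'I_d -> R) :
  \sum_(kk : {ffun 'I_d -> 'I_l}) \prod_i \1_(`]grid l (kk i) - r%:R, grid l (kk i) + r%:R[%classic : set RB) (x i)
  = \prod_i windows l r (x i) :> R.
Proof. by rewrite /windows bigA_distr_bigA. Qed.

Variable zc : {ffun 'I_d -> 'I_l} -> 'rV[R]_d.
Hypothesis zcP : forall kk, [/\ forall i, `|zc kk 0 i - grid l (kk i)| <= 1 &
    euclid_ball (zc kk) delta `<=` equi_set delta z L].

Definition tube_lo : 'I_n -> R := fun i => rV_cons (0, const_mx (- (L / 2)) : 'rV[R]_d) 0 i.
Definition tube_hi (t : R) : 'I_n -> R := fun i => rV_cons (t, const_mx (L / 2) : 'rV[R]_d) 0 i.

Lemma obox_tube t (x : 'rV[R]_n) : obox tube_lo (tube_hi t) x <->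
  0 < x 0 ord0 < t /\ forall i, - (L / 2) < x 0 (lift ord0 i) < L / 2.
Proof.
split=> [h|[h1 h2] i].
  split; first by have := h ord0; rewrite /tube_lo /tube_hi !rV_cons0.
  by move=> i; have := h (lift ord0 i); rewrite /tube_lo /tube_hi !rV_consS !mxE.
by case: (unliftP ord0 i) => [j|] ->; rewrite /tube_lo /tube_hi ?rV_consS ?rV_cons0 ?mxE.
Qed.

Lemma obox_slab y (x : 'rV[R]_n) : obox (slab_lo y) (slab_hi y) x <->
  0 < x 0 ord0 < 4 * d%:R + 1 /\ forall i, y 0 i - 4 * d%:R < x 0 (lift ord0 i) < y 0 i + 4 * d%:R.
Proof.
split=> [h|[h1 h2] i].
  split; first by have := h ord0; rewrite slab_lo0 slab_hi0.
  by move=> i; have := h (lift ord0 i); rewrite slab_loS slab_hiS.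
by case: (unliftP ord0 i) => [j|] ->; rewrite ?slab_loS ?slab_hiS ?slab_lo0 ?slab_hi0.
Qed.

Local Notation r := (4 * d).+1.
Local Notation inside := (\1_(`]- (L / 2), L / 2[%classic : set RB) : R -> R).
Local Notation T := (4 * d%:R + 1 : R).
Local Notation mul_d := ((4 * r) ^ d)%N.

Lemma tube_integral t (g : 'rV[R]_n -> R) :
  (\int[lebesgue_rV R n]_(x in obox tube_lo (tube_hi t)) (g x)%:E
    = \int[lebesgue_rV R n]_x ((prod_weight2 (\1_(`]0%R, t[%classic : set RB) : R -> R) inside x)%:E * (g x)%:E))%E.
Proof.
pose v : R -> R := \1_(`]0%R, t[%classic : set RB).
rewrite -/v integral_mkcond.
apply: eq_integral => x _; rewrite patchE.
case: ifPn => [/set_mem/obox_tube[h1 h2]|/negP h].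
  rewrite /prod_weight2 /v indicE mem_set /= ?in_itv// mul1r big1 ?mul1e// => i _.
  by rewrite indicE mem_set//= in_itv/=.
suff -> : prod_weight2 v inside x = 0 by rewrite mul0e.
apply/eqP/contraT => nz; exfalso; apply: h; apply/mem_set/obox_tube.
move: nz; rewrite /prod_weight2 mulf_eq0 negb_or /v indicE mem_setE pnatr_eq0 eqb0 negbK in_itv/= => /andP[-> nz].
split => // i; move/prodf_neq0: nz => /(_ i isT).
by rewrite indicE mem_setE pnatr_eq0 eqb0 negbK in_itv.
Qed.

Let near kk i : grid l (kk i) - 1 <= zc kk 0 i <= grid l (kk i) + 1.
Proof. by have [/(_ i)] := zcP kk; rewrite ler_distl. Qed.

(** Slabs reach beyond the cube, and the symmetry of [g] folds them back. The window radius
    [4 d + 1] is the half-width of a slab plus the displacement of its centre from the grid. *)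
Lemma slab_covering (g : 'rV[R]_n -> R) : continuous g -> (forall x, 0 <= g x) ->
  (forall t, even_at bc L (fun x => g (rV_cons (t, x)))) ->
  \sum_(kk : {ffun 'I_d -> 'I_l}) bint (slab_lo (zc kk)) (slab_hi (zc kk)) g <= mul_d%:R * bint tube_lo (tube_hi T) g.
Proof.
move=> cg g0 eg.
have bg a b : bmf (obox a b) g by exact: bmf_continuous.
have mg : measurable_fun setT (EFin \o g) by apply/measurable_EFinP; exact: continuous_measurable_rV.
have Eg0 x : (0 <= (EFin \o g) x)%E by rewrite lee_fin.
have L0 : 0 < L by rewrite ltr0n.
rewrite -lee_fin EFinM -sumEFin; under eq_bigr do rewrite bint_EFin//.
rewrite bint_EFin// sum_integral_indic//; last by move=> kk; exact: measurable_obox.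
pose v : R -> R := \1_(`]0, T[%classic : set RB).
have mv : measurable_fun setT (v : RB -> RB) by apply: measurable_indic; exact: measurable_itv.
have v0 t : 0 <= v t by [].
have mw : measurable_fun setT (windows l r : RB -> RB) by exact: measurable_windows.
have w0 t : 0 <= windows l r t :> R by exact: windows_ge0.
have mi : measurable_fun setT (inside : RB -> RB) by apply: measurable_indic; exact: measurable_itv.
have i0 t : 0 <= inside t by [].
apply: (@le_trans _ _ (\int[lebesgue_rV R n]_x ((prod_weight2 v (windows l r) x)%:E * (g x)%:E))%E).
  apply: ge0_le_integral => //.
  - by move=> x _; apply: mule_ge0 => //; rewrite lee_fin ?g0//; apply: sumr_ge0 => kk _.
  - apply: emeasurable_funM => //; apply/measurable_EFinP; apply: measurable_sum => kk.
    by apply: measurable_indic; exact: measurable_obox.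
  - by apply: emeasurable_funM => //; apply/measurable_EFinP; exact: measurable_prod_weight2.
  move=> x _; apply: lee_wpmul2r; rewrite lee_fin//.
  rewrite /prod_weight2 -sum_windows mulr_sumr; apply: ler_sum => kk _.
  rewrite indicE; case: (boolP (x \in _)) => [/set_mem/obox_slab[h1 h2]|_]; last first.
    by rewrite mulr_ge0// prodr_ge0.
  rewrite /v indicE mem_set /= ?in_itv// mul1r big1// => i _.
  rewrite indicE mem_set//= in_itv/=; have /andP[h3 h4] := near kk i; have /andP[h5 h6] := h2 i.
  by rewrite -addn1 natrD natrM; apply/andP; split; lra.
have [mF ->] := integral_prod_weight2 mv v0 mw w0 mg Eg0.
rewrite tube_integral.
have [mG ->] := integral_prod_weight2 mv v0 mi i0 mg Eg0.
rewrite -ge0_integralZl//; last 2 first.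
- by apply: emeasurable_funM => //; exact/measurable_EFinP.
- move=> t _; apply: mule_ge0; first by rewrite lee_fin.
  by apply: integral_ge0 => x _; rewrite mule_ge0// lee_fin prod_weight_ge0.
apply: ge0_le_integral => //.
- move=> t _; apply: mule_ge0; first by rewrite lee_fin.
  by apply: integral_ge0 => x _; rewrite mule_ge0// lee_fin prod_weight_ge0.
- by apply: emeasurable_funM => //; exact/measurable_EFinP.
- by apply: measurable_funeM; apply: emeasurable_funM => //; exact/measurable_EFinP.
move=> t _; rewrite muleCA; apply: lee_wpmul2l; first by rewrite lee_fin.
apply: (windows_integral_rV r (bc := bc) L0).
- by apply: (measurableT_comp mg); exact: measurable_rV_cons2.
- by move=> x; rewrite lee_fin.
- by move=> i s c x mvs; congr EFin; exact: eg.
Qed.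

Lemma bint_indic_EFin m (a b : 'I_m -> R) S (g : 'rV[R]_m -> R) : measurable S -> continuous g ->
  ((bint a b (fun x => \1_S x * g x))%:E = \int[lebesgue_rV R m]_(x in obox a b `&` S) (g x)%:E)%E.
Proof.
move=> mS cg; rewrite bint_EFin; last first.
  by apply: bmfM; [exact: bmf_indic|exact: bmf_continuous].
rewrite integral_mkcond [RHS]integral_mkcond; apply: eq_integral => x _; rewrite !patchE in_setI.
by case: ifPn => //= _; rewrite indicE; case: ifPn => _; rewrite ?mul1r ?mul0r.
Qed.

(** Each coordinate of a point of the cube is within 1/2 of a grid point, and the chosen centre
    within 1 of that; hence the half-width 3/2 of the cells. *)
Lemma cell_covering (g : 'rV[R]_n -> R) : continuous g -> (forall x, 0 <= g x) ->
  bint tube_lo (tube_hi 1) g <=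
  \sum_(kk : {ffun 'I_d -> 'I_l}) bint (slab_lo (zc kk)) (slab_hi (zc kk)) (fun x => \1_(cell (zc kk)) x * g x).
Proof.
move=> cg g0.
have mg : measurable_fun setT (EFin \o g) by apply/measurable_EFinP; exact: continuous_measurable_rV.
have L0 : 0 < L by rewrite ltr0n.
have mS kk : measurable (obox (slab_lo (zc kk)) (slab_hi (zc kk)) `&` cell (zc kk)).
  by apply: measurableI; [exact: measurable_obox|exact: measurable_cell].
rewrite -lee_fin bint_EFin; last exact: bmf_continuous.
rewrite -sumEFin; under eq_bigr => kk _ do rewrite (bint_indic_EFin _ _ (measurable_cell (zc kk)) cg).
rewrite sum_integral_indic//.
rewrite (integral_mkcond (obox tube_lo _)); apply: ge0_le_integral => //.
- by move=> x _; rewrite patchE; case: ifP => // _; rewrite lee_fin.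
- by apply/(measurable_restrictT _ _).1; [exact: measurable_obox|exact: measurable_funS mg].
- apply: emeasurable_funM => //; apply/measurable_EFinP; apply: measurable_sum => kk.
  by apply: measurable_indic.
move=> x _; rewrite patchE; case: ifPn => [/set_mem/obox_tube[/andP[x0 x1] xi]|_]; last first.
  by apply: mule_ge0; rewrite lee_fin ?g0//; apply: sumr_ge0.
have /choice[k kP] (i : 'I_d) : exists k : 'I_l, `|x 0 (lift ord0 i) - grid l k| <= 2^-1.
  have /andP[h1 h2] := xi i; set y := x 0 _ in h1 h2 *.
  have y0 : 0 <= y + L / 2 by lra.
  have /andP[h3 h4] := truncn_itv y0; set k := Num.truncn _ in h3 h4.
  have kl : (k < l)%N by rewrite -(ltr_nat R); lra.
  exists (Ordinal kl); move: h4; rewrite -(@natr1 _ k) => h4.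
  by rewrite ler_norml /grid /=; apply/andP; split; lra.
have kd : x \in obox (slab_lo (zc (finfun k))) (slab_hi (zc (finfun k))) `&` cell (zc (finfun k)).
  apply/mem_set; split.
    apply/obox_slab; split; first by rewrite x0/=; have := ler0n R d; lra.
    move=> i; have := kP i; have := near (finfun k) i; rewrite ffunE ler_norml.
    have d1 : 1 <= d%:R :> R by rewrite ler1n.
    move=> /andP[h1 h2] /andP[h3 h4]; apply/andP; split; lra.
  split; first exact: ltW.
  move=> i; have := kP i; have := near (finfun k) i; rewrite ffunE !ler_norml.
  move=> /andP[h1 h2] /andP[h3 h4]; apply/andP; split; lra.
rewrite -[leLHS]mul1e; apply: lee_wpmul2r; first by rewrite lee_fin.
by rewrite lee_fin (bigD1 (finfun k))//= indicE kd lerDl; apply: sumr_ge0.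
Qed.

(** Several grid points may select the same ball. In each coordinate at most 4 grid points lie
    within distance 2 of a given point, whence the multiplicity [4 ^ d]. *)
Lemma ball_covering (h : 'rV[R]_d -> R) : continuous h -> (forall x, 0 <= h x) ->
  \sum_(kk : {ffun 'I_d -> 'I_l}) bint (fun i => slab_lo (zc kk) (lift ord0 i)) (fun i => slab_hi (zc kk) (lift ord0 i))
     (fun x => \1_(euclid_ball (zc kk) delta) x * h x)
  <= (4 ^ d)%:R * bint (fun=> - (L / 2)) (fun=> L / 2) (fun x => \1_(equi_set delta z L) x * h x).
Proof.
move=> ch h0.
have mh : measurable_fun setT (EFin \o h) by apply/measurable_EFinP; exact: continuous_measurable_rV.
have mB kk : measurable (euclid_ball (zc kk) delta) by exact: measurable_euclid_ball.
have mW := measurable_equi_set.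
rewrite -lee_fin EFinM -sumEFin; under eq_bigr => kk _ do rewrite (bint_indic_EFin _ _ (mB kk) ch).
rewrite (bint_indic_EFin _ _ mW ch) sum_integral_indic//; last first.
  by move=> kk; apply: measurableI => //; exact: measurable_obox.
rewrite (_ : obox _ _ `&` _ = equi_set delta z L); last by rewrite setIC -setIA -cubeE setIid.
rewrite (integral_mkcond (equi_set _ _ _)) -ge0_integralZl//; first last.
- by move=> x _; rewrite patchE; case: ifP => // _; rewrite lee_fin.
- by apply/(measurable_restrictT _ _).1 => //; exact: measurable_funS mh.
apply: ge0_le_integral => //.
- by move=> x _; apply: mule_ge0; rewrite lee_fin ?h0//; apply: sumr_ge0.
- apply: emeasurable_funM => //; apply/measurable_EFinP; apply: measurable_sum => kk.
  by apply: measurable_indic; apply: measurableI => //; exact: measurable_obox.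
- by apply: measurable_funeM; apply/(measurable_restrictT _ _).1 => //; exact: measurable_funS mh.
move=> x _; rewrite patchE; case: ifPn => [_|/negP nW].
  rewrite -EFinM lee_fin; apply: ler_wpM2r => //.
  apply: (@le_trans _ _ (\prod_i windows l 2 (x 0 i))).
    rewrite -sum_windows; apply: ler_sum => kk _.
    rewrite indicE; case: (boolP (x \in _)) => [/set_mem[_ Bx]|_]; last by apply: prodr_ge0.
    rewrite /= big1// => i _; rewrite indicE mem_set//= in_itv/=.
    have := euclid_ball_coord i Bx; have := near kk i; rewrite ltr_norml.
    by move=> /andP[h1 h2] /andP[h3 h4]; apply/andP; split; lra.
  rewrite natrX -[d in leRHS]card_ord -prodr_const; apply: ler_prod => i _.
  by rewrite windows_ge0 /=; exact: (@windows_bound _ L l erefl 2).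
rewrite (_ : (point : \bar R) = 0%E)// mule0 big1 ?mul0e// => kk _; rewrite indicE; case: (boolP (x \in _)) => // /set_mem[_ Bx].
by exfalso; apply: nW; apply/mem_set; have [_] := zcP kk; exact.
Qed.

Section global_estimate.
Variables (F : 'rV[R]_n -> R) (G : 'I_n -> 'rV[R]_n -> R) (H : 'I_n -> 'I_n -> 'rV[R]_n -> R).
Hypothesis C2F : C2 F G H.
Hypothesis F0 : forall x, F (rV_cons (0, x)) = 0.
Variables (ka : R) (e : 'rV[R]_n -> R).
Hypothesis ka0 : 0 <= ka.
Hypothesis ce : continuous e.
Hypothesis e0 : forall x, 0 <= e x.
Hypothesis Fe : forall x, `|lapl H x| <= ka * `|F x| + e x.
Hypothesis evenF : forall t, even_at bc L (fun x => F (rV_cons (t, x)) ^+ 2).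
Hypothesis evene : forall t, even_at bc L (fun x => e (rV_cons (t, x)) ^+ 2).
Local Notation M := (36 * 37 * 36 * 10 ^+ 2 : R).

Lemma global_estimate al : 3 <= al -> 12 * (16 * d%:R) ^+ 2 * ka ^+ 2 <= al ^+ 3 ->
  bint tube_lo (tube_hi 1) (fun x => F x ^+ 2) <=
   50 * two_step_cst (d := d) M ^+ 2 *
    (expR (1000 * (ln (512 * d%:R) + 1) * (al * - ln delta)) *
       (mul_d%:R * bint tube_lo (tube_hi T) (fun x => e x ^+ 2)
        + (4 ^ d)%:R * bint (fun=> - (L / 2)) (fun=> L / 2)
            (fun x => \1_(equi_set delta z L) x * G ord0 (rV_cons (0, x)) ^+ 2))
     + expR (- (al / 4)) * (mul_d%:R * bint tube_lo (tube_hi T) (fun x => F x ^+ 2))).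
Proof.
move=> al3 alka; set k := two_step_cst M.
have k1 : 1 <= k.
  have d1 : 1 <= d%:R :> R by rewrite ler1n.
  have M1 : 1 <= M ^+ 2 by apply: exprn_ege1; lra.
  rewrite /k /two_step_cst; have h1 : 1 <= (2600 ^+ 2 * d%:R ^+ 2 : R).
    by rewrite -exprMn; apply: exprn_ege1; lra.
  have h2 : 0 <= 3 * (4 + 2 * n%:R) ^+ 2 :> R by rewrite mulr_ge0// sqr_ge0.
  by rewrite -[leLHS]mulr1; apply: ler_pM => //; rewrite -[leLHS]addr0; apply: lerD.
have [[cF _ _] CG _] := C2F; have cG : continuous (G ord0) by have [] := CG ord0.
have cF2 : continuous (fun x => F x ^+ 2) by exact: contX.
have ce2 : continuous (fun x => e x ^+ 2) by exact: contX.
have cG2 : continuous (fun x => G ord0 (rV_cons (0, x)) ^+ 2).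
  by apply: contX; exact: cont_slice2.
have C1 := cell_covering cF2 (fun x => sqr_ge0 _).
have C2 := slab_covering cF2 (fun x => sqr_ge0 _) evenF.
have C3 := slab_covering ce2 (fun x => sqr_ge0 _) evene.
have C4 := ball_covering cG2 (fun x => sqr_ge0 _).
apply: le_trans C1 _.
have step kk := @two_steps R d d_gt0 (zc kk) delta delta0 delta2 F G H C2F F0 ka e ka0 ce e0 Fe M erefl al al3 alka k1.
apply: le_trans (ler_sum _ (fun kk _ => step kk)) _.
rewrite -mulr_sumr; apply: ler_wpM2l; first by rewrite mulr_ge0// sqr_ge0.
rewrite big_split/= -!mulr_sumr; apply: lerD; last by apply: ler_wpM2l => //; exact: expR_ge0.
apply: ler_wpM2l; first exact: expR_ge0.
by rewrite big_split/=; apply: lerD.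
Qed.

End global_estimate.
End grid_covering.

(** * Ghost dimension *)

Section power_weights.
Context {R : realType}.
Implicit Types t y : R.

Definition tpow (n : nat) t : R := t ^+ n / n`!%:R.
Definition tpow' (n : nat) t : R := if n is n'.+1 then tpow n' t else 0.

Lemma tpow_ge0 n t : 0 <= t -> 0 <= tpow n t.
Proof. by move=> t0; rewrite /tpow divr_ge0// exprn_ge0. Qed.

Lemma is_derive_tpow n t : is_derive t (1 : R) (tpow n) (tpow' n t).
Proof.
case: n => [|n] /=.
  rewrite (_ : tpow 0 = cst 1); first exact: is_derive_cst.
  by apply/funext => s; rewrite /tpow expr0 fact0 divr1.
have H := is_derive1Z (n.+1`!%:R^-1) (is_derive1X n t).
rewrite (_ : tpow n.+1 = fun x => n.+1`!%:R^-1 * x ^+ n.+1); last by apply/funext => s; rewrite /tpow mulrC.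
apply: is_derive_eq H _; rewrite /tpow factS natrM; field.
by rewrite nat1r !pnatr_eq0 -lt0n fact_gt0.
Qed.

Lemma continuous_tpow n : continuous (tpow n).
Proof. exact: is_derive_continuous (is_derive_tpow n). Qed.

Lemma continuous_tpow' n : continuous (tpow' n).
Proof. by case: n => [|n] /=; [exact: cst_continuous|exact: continuous_tpow]. Qed.

Lemma tpow_le_exp n t T N : 0 <= t <= T -> (n <= N)%N -> tpow n t <= (1 + T) ^+ N.
Proof.
move=> /andP[t0 tT] nN; apply: (@le_trans _ _ (t ^+ n)).
  by rewrite ler_piMr ?exprn_ge0// invf_le1 ?ltr0n ?fact_gt0// ler1n fact_gt0.
apply: (@le_trans _ _ ((1 + T) ^+ n)).
  by apply: lerXn2r; rewrite ?nnegrE; lra.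
by apply: ler_weXn2l => //; lra.
Qed.

Lemma sum_tpow_le y N : 0 <= y -> \sum_(k < N) tpow k y <= expR y.
Proof.
move=> y0; have -> : \sum_(k < N) tpow k y = series (exp_coeff y) N.
  by rewrite /series /= big_mkord.
apply: nondecreasing_cvgn_le; last exact: is_cvg_series_exp_coeff.
by apply: nondecreasing_series => k _ _; exact: exp_coeff_ge0.
Qed.

(** A truncation of [sinh (t * s) / s], in a form that includes [s = 0]. *)
Lemma sum_tpow_odd_le t s N : 0 <= t -> 0 <= s ->
  \sum_(m < N) tpow (2 * m).+1 t * (s ^+ 2) ^+ m <= t * expR (t * s).
Proof.
move=> t0 s0; apply: (@le_trans _ _ (t * \sum_(k < 2 * N) tpow k (t * s))); last first.
  by apply: ler_wpM2l => //; apply: sum_tpow_le; exact: mulr_ge0.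
elim: N => [|N IH]; first by rewrite muln0 !big_ord0 mulr0.
have E k : tpow k.+1 t * s ^+ k = t * tpow k (t * s) / k.+1%:R.
  rewrite /tpow exprMn exprS factS natrM; field.
  by rewrite nat1r !pnatr_eq0 /= -lt0n fact_gt0.
rewrite mulnS !big_ord_recr/= !mulrDr -addrA; apply: lerD => //.
have P k : 0 <= t * tpow k (t * s) by rewrite mulr_ge0// tpow_ge0// mulr_ge0.
rewrite -exprM E -[leLHS]addr0; apply: lerD; last exact: P.
by rewrite ler_piMr// invf_le1 ?ltr0n// ler1n.
Qed.

(** Bounds the one term by which the truncated series fails the equation, by comparison with the
    exponential series at [(1 + T)^2 * M]. *)
Lemma tpow_tail (T M : R) : 0 <= T -> 0 <= M -> forall eps, 0 < eps -> exists2 N : nat, (0 < N)%N &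
  tpow (2 * N).-1 T * M ^+ N < eps.
Proof.
move=> T0 M0 eps e0; set S := (1 + T) ^+ 2 * M.
have S0 : 0 <= S by rewrite mulr_ge0// sqr_ge0.
have /cvgrPdist_lt/(_ _ e0) := cvg_series_cvg_0 (@is_cvg_series_exp_coeff R S).
move=> [N _ /(_ N.+1 (leqnSn N))]; rewrite sub0r normrN ger0_norm ?exp_coeff_ge0// => H.
exists N.+1 => //; apply: le_lt_trans H; rewrite [X in _ <= X](_ : _ = S ^+ N.+1 / N.+1`!%:R)//.
rewrite /tpow /S exprMn -exprM [leRHS]mulrAC; apply: ler_wpM2r; first exact: exprn_ge0.
have F m : 0 < m`!%:R :> R by rewrite ltr0n fact_gt0.
apply: ler_pM; [exact: exprn_ge0|by rewrite invr_ge0| |]; last first.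
  rewrite lef_pV2 ?posrE// ler_nat (_ : (2 * N.+1).-1 = N.+1 + N)%N; last lia.
  suff le_fact (a c : nat) : (a`! <= (a + c)`!)%N by exact: le_fact.
  by elim: c => [|c IH]; rewrite ?addn0// addnS factS (leq_trans IH)// leq_pmull.
apply: (@le_trans _ _ ((1 + T) ^+ (2 * N.+1).-1)).
  by apply: lerXn2r; rewrite ?nnegrE; lra.
by apply: ler_weXn2l; [lra|lia].
Qed.

End power_weights.

Section time_extension.
Context {R : realType} {d : nat}.
Local Notation n := d.+1.

Definition rV_tail (x : 'rV[R]_n) : 'rV[R]_d := \row_j x 0 (lift ord0 j).

Lemma rV_tail_cons t x : rV_tail (rV_cons (t, x)) = x.
Proof. by apply/rowP => j; rewrite mxE rV_consS. Qed.

Lemma continuous_rV_tail : continuous rV_tail.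
Proof.
by apply: continuous_rV => i; under eq_fun do rewrite mxE; exact: coord_continuous.
Qed.

Definition lifted (G : 'I_d -> 'rV[R]_d -> R) (i : 'I_n) (x : 'rV[R]_n) : R :=
  if unlift ord0 i is Some j then G j (rV_tail x) else 0.

Lemma C1_tail u G : C1 u G -> C1 (fun x => u (rV_tail x)) (lifted G).
Proof.
move=> [cu cG du]; split.
- by move=> x; apply: continuous_comp; [exact: continuous_rV_tail|exact: cu].
- move=> i; rewrite /lifted; case: (unlift ord0 i) => [j|]; last exact: cst_continuous.
  by move=> x; apply: continuous_comp; [exact: continuous_rV_tail|exact: cG].
move=> i x; rewrite /lifted; case: unliftP => [j|] ->.
  have Hl (h : R) : u (h *: unit_vec j + rV_tail x) = u (rV_tail (h *: unit_vec (lift ord0 j) + x)).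
    by congr u; apply/rowP => k; rewrite !mxE (inj_eq lift_inj).
  exact: (is_derive_line Hl (du j (rV_tail x))).
have Hl (h : R) : cst (u (rV_tail x)) (h *: unit_vec ord0 + x) = u (rV_tail (h *: unit_vec ord0 + x)).
  by congr u; apply/rowP => k; rewrite !mxE [lift _ _ == _]eq_sym (negbTE (neq_lift _ _)) andbF mulr0 add0r.
exact: (is_derive_line Hl (is_derive_cst (u (rV_tail x)) x (unit_vec ord0))).
Qed.

Lemma C2_tail u G H : C2 u G H ->
  C2 (fun x => u (rV_tail x)) (lifted G) (fun i j => lifted (fun k => if unlift ord0 i is Some i' then H i' k else cst 0) j).
Proof.
move=> [C1u C1G sH]; split; first exact: C1_tail.
- move=> i; rewrite {1}/lifted; case: (unlift ord0 i) => [j|]; first exact: C1_tail.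
  by apply: C1_eq (C1_cst 0) _ _ => [x|j x]//; rewrite /lifted; case: unlift.
move=> i j x; rewrite /lifted; case: (unlift ord0 i) => [i'|]; case: (unlift ord0 j) => [j'|] //.
Qed.

Lemma lapl_tail (H : 'I_d -> 'I_d -> 'rV[R]_d -> R) x :
  lapl (fun i j => lifted (fun k => if unlift ord0 i is Some i' then H i' k else cst 0) j) x
  = \sum_i H i i (rV_tail x).
Proof.
rewrite /lapl big_ord_recl /lifted unlift_none add0r.
by apply: eq_bigr => i _; rewrite liftK.
Qed.

Lemma C2_time_product (g g1 g2 : R -> R) u G H : continuous g2 ->
  (forall t : R, is_derive t (1 : R) g (g1 t)) -> (forall t : R, is_derive t (1 : R) g1 (g2 t)) ->
  C2 u G H -> exists G' H', [/\ C2 (fun x : 'rV[R]_n => g (x 0 ord0) * u (rV_tail x)) G' H',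
    forall x, lapl H' x = g2 (x 0 ord0) * u (rV_tail x) + g (x 0 ord0) * \sum_i H i i (rV_tail x) &
    forall x, G' ord0 x = g1 (x 0 ord0) * u (rV_tail x)].
Proof.
move=> cg2 dg dg1 C2u.
have Cc : C2 (fun x : 'rV[R]_n => x 0 ord0) (fun i _ => (i == ord0)%:R) (fun _ _ _ => 0).
  by apply: C2_eq (C2_coord 0 ord0) _ _ _ => // x; rewrite subr0.
have Ct := C2_comp cg2 dg dg1 Cc.
have CP := C2M Ct (C2_tail C2u).
eexists; eexists; split; first exact: CP.
- move=> x; rewrite -lapl_tail /lapl !big_ord_recl; cbn beta; rewrite /lifted unlift_none eqxx.
  rewrite !mulr1 !mulr0 !addr0 mulrDr mulr_sumr addrA; congr (_ + _).
    ring.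
  apply: eq_bigr => i _; have z : (lift ord0 i == ord0)%:R = 0 :> R by rewrite eq_sym (negbTE (neq_lift _ _)).
  rewrite z; ring.
- by move=> x; rewrite /lifted unlift_none eqxx mulr0 addr0 mulr1.
Qed.

Lemma C2_time_sum N (g g1 g2 : nat -> R -> R) (u l : nat -> 'rV[R]_d -> R) :
  (forall m, continuous (g2 m)) ->
  (forall m (t : R), is_derive t (1 : R) (g m) (g1 m t)) ->
  (forall m (t : R), is_derive t (1 : R) (g1 m) (g2 m t)) ->
  (forall m, exists G H, C2 (u m) G H /\ forall x, \sum_i H i i x = l m x) ->
  exists G H, [/\ C2 (fun x : 'rV[R]_n => \sum_(m < N) g m (x 0 ord0) * u m (rV_tail x)) G H,
    forall x, lapl H x = \sum_(m < N) (g2 m (x 0 ord0) * u m (rV_tail x) + g m (x 0 ord0) * l m (rV_tail x)) &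
    forall x, G ord0 x = \sum_(m < N) g1 m (x 0 ord0) * u m (rV_tail x)].
Proof.
move=> cg2 dg dg1 Cu; elim: N => [|N [G [H [IH IHl IHg]]]].
  exists (fun _ _ => 0), (fun _ _ _ => 0); split.
  - by apply: C2_eq (C2_cst 0) _ _ _ => // x; rewrite big_ord0.
  - by move=> x; rewrite big_ord0 /lapl big1.
  - by move=> x; rewrite big_ord0.
have [G1 [H1 [C lE]]] := Cu N.
have [G' [H' [C' lE' gE']]] := C2_time_product (cg2 N) (dg N) (dg1 N) C.
have CD := C2D IH C'; eexists; eexists; split.
- by apply: C2_eq CD _ _ _ => //= x; rewrite big_ord_recr.
- move=> x; rewrite big_ord_recr /= -IHl -lE -lE' /lapl -big_split; apply: eq_bigr => i _ //.
- by move=> x; rewrite big_ord_recr /= -IHg -gE'.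
Qed.
End time_extension.

Section trig_sum_parity.
Context {R : realType} {d : nat}.
Local Notation V := 'rV[R]_d.
Variables (bc : boundary_condition) (L : R).
Definition wall_sign : R := if bc is Dirichlet then -1 else 1.

Lemma mode_move (w A B s c y : R) : mode bc L w A B -> wall_move bc L s c ->
  trig w A B (s * y + c) = wall_sign * trig w A B y.
Proof.
rewrite /mode /wall_symmetric /wall_move /wall_sign; case: bc.
- move=> /(_ y)[m1 m2] [-> [->|->]]; by rewrite !mulN1r addrC ?m1 ?m2.
- move=> /(_ y)[m1 m2] [-> [->|->]]; by rewrite mulN1r mul1r addrC ?m1 ?m2.
- by move=> /(_ y) m1 [-> ->]; rewrite !mul1r.
Qed.

Lemma trig_sum_parity u l : trig_sum bc L u l -> forall i s c (x : V), wall_move bc L s c ->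
  u (rV_upd x i (s * x 0 i + c)) = wall_sign * u x /\
  l (rV_upd x i (s * x 0 i + c)) = wall_sign * l x.
Proof.
move=> Tu i s c x mv; elim: Tu => [|k w A B u' l' mo _ [IHu IHl]]; first by rewrite mulr0.
have hE : harmonic0 w A B (rV_upd x i (s * x 0 i + c)) = wall_sign * harmonic0 w A B x.
  rewrite /harmonic0 /harmonic_prod /tens (bigD1 i)//= [in RHS](bigD1 i)//= mulrA; congr (_ * _).
    by rewrite mxE eqxx; apply: mode_move.
  by apply: eq_bigr => j /negbTE ji; rewrite mxE ji.
by rewrite IHu IHl hE; split; ring.
Qed.

Lemma wall_sign2 : wall_sign ^+ 2 = 1.
Proof. by rewrite /wall_sign; case: bc; ring. Qed.
End trig_sum_parity.

(** The crude factor [2 ^+ N] is harmless, because [N] is fixed before the accuracy of the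
    approximation is chosen. *)
Lemma nsq_sum_le {R : realType} {dT} {T : measurableType dT} (mu : {measure set T -> \bar R})
    (D : set T) (mD : measurable D) (f : nat -> T -> R) N : (forall m, sqi mu D (f m)) ->
  sqi mu D (fun x => \sum_(m < N) f m x) /\
  nsq mu D (fun x => \sum_(m < N) f m x) <= 2 ^+ N * \sum_(m < N) nsq mu D (f m).
Proof.
move=> sf; elim: N => [|N [IH1 IH2]].
  under eq_fun do rewrite big_ord0; split; first exact: sqi0.
  rewrite big_ord0 mulr0 /nsq; under eq_Rintegral do rewrite expr0n/=.
  by rewrite /Rintegral integral0.
under eq_fun do rewrite big_ord_recr/=; split; first exact: sqiD.
apply: le_trans (nsqD_le mD IH1 (sf N)) _; rewrite big_ord_recr/= exprS mulrDr.
have h0 := nsq_ge0 mu D (f N); have h1 : 1 <= 2 ^+ N :> R by apply: exprn_ege1; lra.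
apply: lerD; first by rewrite -mulrA; apply: ler_wpM2l => //; lra.
by rewrite -mulrA ler_wpM2l// ler_peMl.
Qed.

Section approximate_extension.
Context {R : realType} {d : nat}.
Local Notation V := 'rV[R]_d.
Local Notation mu := (lebesgue_rV R d).
Variables (bc : boundary_condition) (L : R).
Hypothesis L0 : 0 < L.
Local Notation Q := (cube L : set V).
Local Notation N2 := (nsq mu Q).
Let mQ : measurable Q. Proof. exact: measurable_cube. Qed.
Variables (W : V -> R) (u w : nat -> V -> R[i]) (K M : R).
Hypothesis mW : measurable_fun setT W.
Hypothesis WK : forall x, `|W x| <= K.
Hypothesis K0 : 0 <= K.
Hypothesis M0 : 0 <= M.
Hypothesis Lu : forall m, L2 Q (u m).
Hypothesis uw : forall m, neg_laplacian bc L (u m) (w m).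
Hypothesis uS : forall m r,
  N2 (fun x => part r (u m.+1 x) - (part r (w m x) + (W x + K) * part r (u m x))) = 0.
Hypothesis pos : forall m, 0 <= cip Q (u m) (u 0%N).
Hypothesis nrm : forall m, cip Q (u m) (u m) <= M ^+ (2 * m) * cip Q (u 0%N) (u 0%N).
Local Notation nn0 := (cip Q (u 0%N) (u 0%N)).
Implicit Types (r : bool) (t : R).
Local Notation ga m := (tpow (2 * m).+1).

Definition ext N r t (x : V) : R := \sum_(m < N) ga m t * part r (u m x).

Lemma sqi_part r m : sqi mu Q (fun x => part r (u m x)).
Proof. exact: (L2_parts mQ (u m)).1 (Lu m) r. Qed.

Lemma ext_sqi N r t : sqi mu Q (ext N r t).
Proof.
apply: (nsq_sum_le mQ (f := fun m x => ga m t * part r (u m x)) N _).1 => m.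
by apply: sqiZ => //; exact: sqi_part.
Qed.

Definition extc N t : V -> R[i] := fun x => Complex (ext N false t x) (ext N true t x).

Lemma extcS N t : extc N.+1 t = fun x => (ga N t)%:C%C * u N x + extc N t x.
Proof.
apply/funext => x; rewrite /extc /ext !big_ord_recr /=; case: (u N x) => a b /=.
by congr Complex; ring.
Qed.

Lemma L2_extc N t : L2 Q (extc N t).
Proof. by apply/(L2_parts mQ) => -[]; exact: ext_sqi. Qed.

Lemma cip_extc N t v : L2 Q v -> cip Q (extc N t) v = \sum_(m < N) ga m t * cip Q (u m) v.
Proof.
move=> Lv; elim: N => [|N IH].
  rewrite big_ord0 /cip /ip; under eq_Rintegral do rewrite /= /ext big_ord0 mul0r.
  by under [X in _ + X]eq_Rintegral do rewrite /= /ext big_ord0 mul0r; rewrite /Rintegral !integral0/= addr0.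
by rewrite extcS cip_axpy//; [rewrite IH big_ord_recr/= addrC|exact: L2_extc].
Qed.

Lemma cip_u_le m m' : `|cip Q (u m) (u m')| <= M ^+ m * M ^+ m' * nn0.
Proof.
have n0 := cip_ge0 Q (u 0%N).
rewrite -(@ler_pXn2r _ 2)// ?nnegrE ?mulr_ge0 ?exprn_ge0//.
rewrite real_normK ?num_real//; apply: le_trans (cip_CS mQ (Lu m) (Lu m')) _.
apply: le_trans (ler_pM (cip_ge0 _ _) (cip_ge0 _ _) (nrm m) (nrm m')) _.
by rewrite !mul2n -!addnn !exprD le_eqVlt; apply/orP; left; apply/eqP; ring.
Qed.

(** The Gram matrix of the powers is dominated by the rank-one matrix [M ^+ m * M ^+ m'], so the
    double sum is at most the square of a scalar series. *)
Lemma extc_le N t : 0 <= t -> cip Q (extc N t) (extc N t) <= (t * expR (t * Num.sqrt M)) ^+ 2 * nn0.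
Proof.
move=> t0; have n0 := cip_ge0 Q (u 0%N).
set S := \sum_(m < N) ga m t * M ^+ m.
have S0 : 0 <= S by apply: sumr_ge0 => m _; rewrite mulr_ge0 ?exprn_ge0// tpow_ge0.
have SE : S <= t * expR (t * Num.sqrt M).
  by rewrite /S -{1}(sqr_sqrtr M0); apply: sum_tpow_odd_le; rewrite ?sqrtr_ge0.
apply: (@le_trans _ _ (S ^+ 2 * nn0)); last first.
  by apply: ler_wpM2r => //; rewrite lerXn2r ?nnegrE// mulr_ge0// expR_ge0.
have g0 m : 0 <= ga m t by exact: tpow_ge0.
rewrite cip_extc; last exact: L2_extc.
apply: (@le_trans _ _ (\sum_(m < N) ga m t * (\sum_(m' < N) ga m' t * (M ^+ m * M ^+ m' * nn0)))).
  apply: ler_sum => m _; apply: ler_wpM2l => //; rewrite cipC cip_extc//.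
  apply: ler_sum => m' _; apply: ler_wpM2l => //; rewrite [M ^+ m * _]mulrC.
  exact: le_trans (ler_norm _) (cip_u_le m' m).
rewrite le_eqVlt; apply/orP; left; apply/eqP; rewrite expr2 -mulrA {1}/S mulr_suml.
apply: eq_bigr => m _; rewrite -mulrA; congr (_ * _); rewrite /S mulr_suml mulr_sumr.
by apply: eq_bigr => m' _; ring.
Qed.

(** Every term pairs nonnegatively with [u 0], so the pairing is at least that of the first term;
    Cauchy-Schwarz turns it into a norm. *)
Lemma extc_ge N t : (0 < N)%N -> 0 <= t -> t ^+ 2 * nn0 <= cip Q (extc N t) (extc N t).
Proof.
move=> N0 t0; have n0 := cip_ge0 Q (u 0%N); have e0 := cip_ge0 Q (extc N t).
have h : t * nn0 <= cip Q (extc N t) (u 0%N).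
  rewrite cip_extc//; case: N N0 e0 => // N _ _; rewrite big_ord_recl /= {1}/tpow expr1 (_ : 1`! = 1%N)// divr1.
  by rewrite lerDl; apply: sumr_ge0 => m _; rewrite mulr_ge0// tpow_ge0.
have := cip_CS mQ (L2_extc N t) (Lu 0%N).
have [n1|n1] := eqVneq nn0 0; first by move=> _; rewrite n1 mulr0.
have np : 0 < nn0 by rewrite lt_def n1.
move=> CS; rewrite -(ler_pM2r np); apply: le_trans CS.
rewrite -mulrA -expr2 -exprMn; apply: lerXn2r; rewrite ?nnegrE ?mulr_ge0//.
by apply: le_trans h; rewrite mulr_ge0.
Qed.

Variables (ui li : nat -> bool -> V -> R) (eps : R).
Hypothesis trig_ui : forall m r, trig_sum bc L (ui m r) (li m r).
Hypothesis ui_u : forall m r, N2 (fun x => part r (u m x) - ui m r x) <= eps.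
Hypothesis li_w : forall m r, N2 (fun x => part r (w m x) + li m r x) <= eps.

Definition appF N r t (x : V) : R := \sum_(m < N) ga m t * ui m r x.
Definition appL N r t (x : V) : R := \sum_(m < N) (tpow' (2 * m) t * ui m r x + ga m t * li m r x).

Let sui m r : sqi mu Q (ui m r). Proof. exact: sqi_continuous (trig_sum_continuous (trig_ui m r)). Qed.
Let sli m r : sqi mu Q (li m r). Proof. exact: sqi_continuous (trig_sum_lap_continuous (trig_ui m r)). Qed.
Let sw m r : sqi mu Q (fun x => part r (w m x)).
Proof. by have [/(L2_parts mQ)/(_ r)] := uw m. Qed.

Let sqi_mult (c h : V -> R) (C : R) : measurable_fun setT c -> (forall x, `|c x| <= C) -> sqi mu Q h ->
  sqi mu Q (fun x => c x * h x) /\ N2 (fun x => c x * h x) <= C ^+ 2 * N2 h.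
Proof.
move=> mc cC sh; have C0 : 0 <= C by exact: le_trans (cC 0).
have mch : measurable_fun Q (fun x => c x * h x).
  by apply: measurable_funM; [exact: measurable_funTS|have [] := sh].
have le x : `|c x * h x| <= `|C * h x| by rewrite !normrM ler_wpM2r// (ger0_norm C0).
have s : sqi mu Q (fun x => c x * h x) by exact: (sqi_le mQ mch (fun x _ => le x) (sqiZ mQ C sh)).
split => //; rewrite -(nsqZ mQ)//; apply: (le_nsq mQ s (sqiZ mQ C sh)) => x _; exact: le.
Qed.

Let ga_le N m t T : 0 <= t <= T -> (m < N)%N -> 0 <= ga m t <= (1 + T) ^+ (2 * N).
Proof.
move=> tT mN; apply/andP; split; first by apply: tpow_ge0; case/andP: tT.
apply: tpow_le_exp => //; lia.
Qed.

Let tpow'_le N m t T : 0 <= t <= T -> (m <= N)%N -> 0 <= tpow' (2 * m) t <= (1 + T) ^+ (2 * N).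
Proof.
move=> tT mN; have /andP[t0 t1] := tT.
case: (2 * m)%N (leq_mul2l 2 m N) => [|k] /= H; first by rewrite lexx exprn_ge0//; lra.
by rewrite tpow_ge0// tpow_le_exp//; lia.
Qed.

Let nsq_scaled (h : V -> R) (c C e : R) : sqi mu Q h -> 0 <= c <= C -> N2 h <= e ->
  N2 (fun x => c * h x) <= C ^+ 2 * e.
Proof.
move=> sh /andP[c0 cC] he; rewrite (nsqZ mQ)//; apply: ler_pM; rewrite ?sqr_ge0 ?nsq_ge0//.
by apply: lerXn2r; rewrite ?nnegrE//; exact: le_trans cC.
Qed.

Lemma appF_ext N r t T : 0 <= t <= T -> 0 <= eps ->
  [/\ sqi mu Q (appF N r t) &
   N2 (fun x => ext N r t x - appF N r t x) <= 2 ^+ N * (N%:R * (((1 + T) ^+ (2 * N)) ^+ 2 * eps))].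
Proof.
move=> tT e0; split.
  by apply: (nsq_sum_le mQ (f := fun m x => ga m t * ui m r x) N _).1 => m; apply: sqiZ.
pose f m x := if (m < N)%N then ga m t * (part r (u m x) - ui m r x) else 0.
have sd m : sqi mu Q (fun x => part r (u m x) - ui m r x) by apply: sqiB => //; exact: sqi_part.
have sf m : sqi mu Q (f m).
  by case mN: (m < N)%N; rewrite /f mN; [apply: sqiZ|exact: sqi0].
rewrite (_ : (fun x => _) = fun x => \sum_(m < N) f m x); last first.
  by apply/funext => x; rewrite /ext /appF -sumrB; apply: eq_bigr => m _; rewrite /f ltn_ord mulrBr.
apply: le_trans (nsq_sum_le mQ N sf).2 _; apply: ler_wpM2l; first exact: exprn_ge0.
rewrite -[N in N%:R]card_ord mulr_natl -sumr_const; apply: ler_sum => m _.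
rewrite (_ : f m = fun x => ga m t * (part r (u m x) - ui m r x)); last by apply/funext => x; rewrite /f ltn_ord.
exact: nsq_scaled (sd m) (ga_le tT (ltn_ord m)) (ui_u m r).
Qed.

Let sqiW h : sqi mu Q h -> sqi mu Q (fun x => (W x + K) * h x).
Proof.
move=> sh; have [] // := @sqi_mult (fun x => W x + K) h (2 * K) _ _ sh; first exact: measurable_funD.
by move=> x; rewrite (le_trans (ler_normD _ _))// (ger0_norm K0); have := WK x; lra.
Qed.

Lemma appL_error N r t T : 0 <= t <= T -> 0 <= eps -> (0 < N)%N ->
  [/\ sqi mu Q (appL N r t) &
   N2 (fun x => appL N r t x - (W x + K) * appF N r t x) <=
    2 * (2 ^+ N * (N%:R * ((2 * (1 + 2 * K) ^+ 2 + 4) * (((1 + T) ^+ (2 * N)) ^+ 2 * eps))))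
    + 2 * ((tpow (2 * N).-1 T * M ^+ N) ^+ 2 * nn0)].
Proof.
move=> tT e0 N0; have /andP[t0 t1] := tT; set Ga := (1 + T) ^+ (2 * N).
have Ga0 : 0 <= Ga by rewrite exprn_ge0//; lra.
split.
  apply: (nsq_sum_le mQ (f := fun m x => tpow' (2 * m) t * ui m r x + ga m t * li m r x) N _).1 => m.
  by apply: sqiD => //; apply: sqiZ.
pose v m x := part r (u m.+1 x) - (part r (w m x) + (W x + K) * part r (u m x)).
have su m : sqi mu Q (fun x => part r (u m x)) by exact: sqi_part.
have sv m : sqi mu Q (v m).
  by apply: sqiB => //; apply: sqiD => //; exact: sqiW.
pose a m x := (tpow' (2 * m) t - ga m t * (W x + K)) * (part r (u m x) - ui m r x).
pose f m x := if (m < N)%N then ga m t * (part r (w m x) + li m r x) + ga m t * v m x - a m x else 0.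
(* Two time derivatives shift the series by one index and meet the recursion of [u]; the sum
   telescopes, and truncation leaves the term of index [N]. *)
have fE x : appL N r t x - (W x + K) * appF N r t x = \sum_(m < N) f m x - tpow' (2 * N) t * part r (u N x).
  rewrite (eq_bigr (fun m : 'I_N => ga m t * (part r (w m x) + li m r x) + ga m t * v m x - a m x)); last first.
    by move=> m _; rewrite /f ltn_ord.
  rewrite /appL /appF /v /a; elim: (N) => [|k IH]; first by rewrite !big_ord0 /=; ring.
  have -> : tpow' (2 * k.+1) t = ga k t by rewrite mulnS.
  rewrite !big_ord_recr/= mulrDr opprD addrACA IH.
  by ring.
have Dl m : sqi mu Q (fun x => part r (u m x) - ui m r x) by apply: sqiB.
have El m : sqi mu Q (fun x => part r (w m x) + li m r x) by apply: sqiD.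
have aP m : (m < N)%N -> sqi mu Q (a m) /\ N2 (a m) <= (Ga * (1 + 2 * K)) ^+ 2 * N2 (fun x => part r (u m x) - ui m r x).
  move=> mN; apply: sqi_mult => //.
    by apply: measurable_funB => //; apply: measurable_funM => //; exact: measurable_funD.
  move=> x; have /andP[g0 g1] := ga_le tT mN; have /andP[p0 p1] := tpow'_le tT (ltnW mN).
  apply: le_trans (ler_normB _ _) _; rewrite normrM (ger0_norm p0) (ger0_norm g0) mulrDr mulr1; apply: lerD => //.
  apply: ler_pM => //; apply: le_trans (ler_normD _ _) _; rewrite (ger0_norm K0); have := WK x; lra.
have sf m : sqi mu Q (f m).
  case mN: (m < N)%N; rewrite /f mN; last exact: sqi0.
  by apply: sqiB => //; [apply: sqiD => //; apply: sqiZ|have [] := aP m mN].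
have sS := nsq_sum_le mQ N sf.
have h1 : N2 (fun x => \sum_(m < N) f m x) <= 2 ^+ N * (N%:R * ((2 * (1 + 2 * K) ^+ 2 + 4) * (Ga ^+ 2 * eps))).
  apply: le_trans sS.2 _; apply: ler_wpM2l; first exact: exprn_ge0.
  rewrite -[N in N%:R]card_ord mulr_natl -sumr_const; apply: ler_sum => m _.
  have mN := ltn_ord m; have [sa aN] := aP m mN.
  rewrite (_ : f m = fun x => (ga m t * (part r (w m x) + li m r x) + ga m t * v m x) - a m x); last first.
    by apply/funext => x; rewrite /f mN.
  pose z (x : V) : R := 0.
  have b1 := nsq_scaled (El m) (ga_le tT mN) (li_w m r).
  have b2 : N2 (fun x => ga m t * v m x) <= 0.
    by rewrite (nsqZ mQ)// (_ : N2 (v m) = 0) ?mulr0//; exact: uS.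
  have sg1 : sqi mu Q (fun x => ga m t * (part r (w m x) + li m r x)) by apply: sqiZ.
  have sg2 : sqi mu Q (fun x => ga m t * v m x) by apply: sqiZ.
  have b3 := nsqD_le mQ sg1 sg2.
  have b4 := nsqD_le mQ (sqiD mQ sg1 sg2) (sqiN mQ sa).
  rewrite nsqN in b4.
  have b5 : N2 (a m) <= (Ga * (1 + 2 * K)) ^+ 2 * eps.
    by apply: le_trans aN _; apply: ler_wpM2l; [exact: sqr_ge0|exact: ui_u].
  apply: le_trans b4 _; rewrite exprMn in b5; set X := Ga ^+ 2 * eps in b1 *.
  rewrite (_ : _ * eps = (1 + 2 * K) ^+ 2 * X) in b5; last by rewrite /X; ring.
  rewrite mulrDl; lra.
have h2 : N2 (fun x => tpow' (2 * N) t * part r (u N x)) <= (tpow (2 * N).-1 T * M ^+ N) ^+ 2 * nn0.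
  rewrite (nsqZ mQ)// exprMn -[leRHS]mulrA.
  have tp : 0 <= tpow' (2 * N) t <= tpow (2 * N).-1 T.
    case: N N0 @Ga {Ga0 f fE aP sf sS h1} => // k _ _; rewrite mulnS /= tpow_ge0//= /tpow.
    by apply: ler_wpM2r; [rewrite invr_ge0|apply: lerXn2r; rewrite ?nnegrE; lra].
  have /andP[tp0 tp1] := tp.
  apply: ler_pM; rewrite ?sqr_ge0 ?nsq_ge0//; first by apply: lerXn2r; rewrite ?nnegrE//; exact: le_trans tp1.
  rewrite -exprM mulnC; apply: le_trans (nrm N); rewrite /cip !ip_nsq.
  by case: (r); [rewrite lerDr|rewrite lerDl]; exact: nsq_ge0.
have sT : sqi mu Q (fun x => tpow' (2 * N) t * part r (u N x)) by apply: sqiZ.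
rewrite (_ : (fun x => _) = fun x => \sum_(m < N) f m x + - (tpow' (2 * N) t * part r (u N x))); last first.
  by apply/funext => x; rewrite fE.
apply: le_trans (nsqD_le mQ sS.1 (sqiN mQ sT)) _; rewrite nsqN.
by apply: lerD; apply: ler_wpM2l.
Qed.
End approximate_extension.

(** * The spectral inequality *)

Section approximation.
Context {R : realType} {d : nat}.
Local Notation V := 'rV[R]_d.
Local Notation mu := (lebesgue_rV R d).
Variables (bc : boundary_condition) (L : R).
Hypothesis L0 : 0 < L.
Local Notation Q := (cube L : set V).
Local Notation N2 := (nsq mu Q).
Variables (W : V -> R) (u w : nat -> V -> R[i]) (K M : R).
Hypothesis mW : measurable_fun setT W.
Hypothesis WK : forall x, `|W x| <= K.
Hypothesis K0 : 0 <= K.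
Hypothesis M0 : 0 <= M.
Hypothesis Lu : forall m, L2 Q (u m).
Hypothesis uw : forall m, neg_laplacian bc L (u m) (w m).
Hypothesis uS : forall m r,
  N2 (fun x => part r (u m.+1 x) - (part r (w m x) + (W x + K) * part r (u m x))) = 0.
Hypothesis nrm : forall m, cip Q (u m) (u m) <= M ^+ (2 * m) * cip Q (u 0%N) (u 0%N).

Lemma approximate_extension T eta : 0 <= T -> 0 < eta ->
  exists N (ui li : nat -> bool -> V -> R),
  [/\ (0 < N)%N, forall m r, trig_sum bc L (ui m r) (li m r),
   forall r t, 0 <= t <= T ->
     [/\ sqi mu Q (appF ui N r t), sqi mu Q (appL ui li N r t),
       N2 (fun x => ext u N r t x - appF ui N r t x) <= eta &
       N2 (fun x => appL ui li N r t x - (W x + K) * appF ui N r t x) <= eta] &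
   forall r, N2 (fun x => part r (u 0%N x) - ui 0%N r x) <= eta].
Proof.
move=> T0 eta0; set nn0 := cip Q (u 0%N) (u 0%N).
have n0 : 0 <= nn0 by exact: cip_ge0.
pose ep := Num.min 1 (eta / (4 * (nn0 + 1))).
have ep0 : 0 < ep by rewrite /ep lt_min ltr01/= divr_gt0// mulr_gt0//; lra.
have [N N0 tail] := tpow_tail T0 M0 ep0.
have tail2 : 2 * ((tpow (2 * N).-1 T * M ^+ N) ^+ 2 * nn0) <= eta / 2.
  set y := tpow _ _ * _ in tail *.
  have y0 : 0 <= y by rewrite mulr_ge0 ?exprn_ge0// tpow_ge0.
  have y1 : y <= 1 by apply: le_trans (ltW tail) _; rewrite ge_min lexx.
  have y2 : y * (4 * (nn0 + 1)) <= eta.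
    rewrite -ler_pdivlMr; last by lra.
    by apply: le_trans (ltW tail) _; rewrite ge_min lexx orbT.
  have y3 : y ^+ 2 <= y by rewrite expr2 ler_piMl.
  have y4 : y ^+ 2 * nn0 <= y * nn0 by exact: ler_wpM2r.
  nra.
set Ga := ((1 + T) ^+ (2 * N)) ^+ 2.
have Ga0 : 0 <= Ga by exact: sqr_ge0.
pose C0 := 2 ^+ N * (N%:R * ((2 * (1 + 2 * K) ^+ 2 + 4) * Ga)).
have q0 : 0 <= 2 * (1 + 2 * K) ^+ 2 + 4 by rewrite addr_ge0// mulr_ge0// sqr_ge0.
have C00 : 0 <= C0 by apply: mulr_ge0; [exact: exprn_ge0|apply: mulr_ge0 => //; exact: mulr_ge0].
(* The tail has already fixed [N], so [C0], which grows with [N], is a constant when the accuracy is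
   chosen. *)
pose eps := Num.min eta (eta / (4 * (C0 + 1))).
have eps0 : 0 < eps by rewrite /eps lt_min eta0/= divr_gt0// mulr_gt0//; lra.
have epsC : 2 * (C0 * eps) <= eta / 2.
  have : eps * (4 * (C0 + 1)) <= eta.
    by rewrite -ler_pdivlMr; [rewrite ge_min lexx orbT|lra].
  nra.
have /choice[ui] m := neg_laplacian_core L0 (uw m) eps0.
move=> /choice[li core].
have trig m r : trig_sum bc L (ui m r) (li m r) by have [] := core m r.
have uiu m r : N2 (fun x => part r (u m x) - ui m r x) <= eps by have [_ /ltW] := core m r.
have liw m r : N2 (fun x => part r (w m x) + li m r x) <= eps by have [_ _ /ltW] := core m r.
exists N, ui, li; split=> // [r t tT|r]; last first.
  by apply: le_trans (uiu 0%N r) _; rewrite ge_min lexx.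
have [s1 e1] := appF_ext L0 K0 M0 Lu trig uiu N r tT (ltW eps0).
have [s2 e2] := appL_error L0 mW WK K0 M0 Lu uw uS nrm trig uiu liw r tT (ltW eps0) N0.
split=> //.
  apply: le_trans e1 _; apply: (@le_trans _ _ (C0 * eps)); last first.
    have : 0 <= C0 * eps by rewrite mulr_ge0// ltW.
    by move: epsC; lra.
  rewrite /C0 -!mulrA; apply: ler_wpM2l; first exact: exprn_ge0.
  apply: ler_wpM2l => //; rewrite -/Ga mulrA ler_peMl//; first by rewrite mulr_ge0// ltW.
  have := sqr_ge0 (1 + 2 * K); lra.
apply: le_trans e2 _.
rewrite (_ : 2 ^+ N * _ = C0 * eps); last by rewrite /C0 -/Ga; ring.
by move: epsC tail2; rewrite -/nn0; lra.
Qed.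
End approximation.

(** * Tube integrals and their time slices *)

Section tube_slices.
Context {R : realType} {d : nat}.
Local Notation n := d.+1.
Local Notation RB := (measurableTypeR R).
Local Notation mu1 := (@lebesgue_measure R).
Variable l : nat.
Local Notation L := (l%:R : R).
Local Notation slice g t := (bint (fun=> - (L / 2)) (fun=> L / 2) (fun x : 'rV[R]_d => g (rV_cons (t, x)))).
Implicit Types g : 'rV[R]_n -> R.

Lemma tube_slices t1 g : continuous g -> (forall x, 0 <= g x) ->
  measurable_fun setT (fun t : RB => (slice g t)%:E) /\
  ((bint (tube_lo l) (tube_hi l t1) g)%:E =
   \int[mu1]_t ((\1_(`]0%R, t1[%classic : set RB) t)%:E * (slice g t)%:E))%E.
Proof.
move=> cg g0.
have mg : measurable_fun setT (EFin \o g) by apply/measurable_EFinP; exact: continuous_measurable_rV.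
pose ins : R -> R := \1_(`]- (L / 2), L / 2[%classic : set RB).
have mi : measurable_fun setT (ins : RB -> RB) by apply: measurable_indic; exact: measurable_itv.
have mv : measurable_fun setT ((\1_(`]0, t1[%classic : set RB) : R -> R) : RB -> RB).
  by apply: measurable_indic; exact: measurable_itv.
have [] := integral_prod_weight2 mv (fun=> _) mi (fun=> _) mg (fun=> _) => // mF E.
have sE t : (slice g t)%:E = (\int[lebesgue_rV R d]_x ((prod_weight ins x)%:E * (EFin \o g) (rV_cons (t, x))))%E.
  rewrite bint_EFin; last by apply: bmf_continuous; exact: cont_slice2.
  rewrite integral_mkcond; apply: eq_integral => x _; rewrite patchE.
  case: ifPn => [/set_mem h|/negP h].
    rewrite /prod_weight big1 ?mul1e// => i _.
    by rewrite /ins indicE mem_set//= in_itv/=; exact: h.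
  suff -> : prod_weight ins x = 0 by rewrite mul0e.
  apply/eqP/contraT => nz; exfalso; apply: h; apply/mem_set => i.
  move/prodf_neq0: nz => /(_ i isT).
  by rewrite /ins indicE mem_setE pnatr_eq0 eqb0 negbK in_itv.
split; first by under eq_fun do rewrite sE.
rewrite bint_EFin; last exact: bmf_continuous.
by rewrite tube_integral E; apply: eq_integral => t _; rewrite sE.
Qed.

Let indic_itv (c x y : R) : 0 <= c -> x <= y ->
  (\int[mu1]_t (c%:E * (\1_(`]x, y[%classic : set RB) t)%:E) = (c * (y - x))%:E)%E.
Proof.
move=> c0 xy; rewrite ge0_integralZl//; last by apply/measurable_EFinP/measurable_indic; exact: measurable_itv.
rewrite integral_indic// ?setIT.
transitivity (c%:E * @lebesgue_measure R (`]x, y[%classic : set RB))%E; first by [].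
rewrite lebesgue_measure_itv/= lte_fin EFinM; congr (_ * _)%E.
by case: ltgtP xy => // ->; rewrite subrr.
Qed.

Lemma tube_le t1 c g : 0 <= t1 -> 0 <= c -> continuous g -> (forall x, 0 <= g x) ->
  (forall t, 0 < t < t1 -> slice g t <= c) -> bint (tube_lo l) (tube_hi l t1) g <= t1 * c.
Proof.
move=> t10 c0 cg g0 gc; have [mS E] := tube_slices t1 cg g0.
have s0 t : 0 <= slice g t by exact: bint_ge0.
rewrite -lee_fin E.
apply: (@le_trans _ _ (\int[mu1]_t (c%:E * (\1_(`]0%R, t1[%classic : set RB) t)%:E))%E).
  apply: ge0_le_integral => //.
  - by move=> t _; rewrite mule_ge0// lee_fin.
  - by apply: emeasurable_funM => //; apply/measurable_EFinP/measurable_indic; exact: measurable_itv.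
  - by apply: measurable_funeM; apply/measurable_EFinP/measurable_indic; exact: measurable_itv.
  move=> t _; rewrite -!EFinM lee_fin indicE mem_setE in_itv/=.
  by case: (boolP (_ < t < _)) => [/gc h|_]; rewrite ?mul0r ?mulr0// mul1r mulr1.
by rewrite indic_itv// subr0 mulrC.
Qed.

Lemma tube_ge a c g : 0 <= a -> 0 <= c -> continuous g -> (forall x, 0 <= g x) ->
  (forall t, 0 < t < 1 -> a * t ^+ 2 - c <= slice g t) ->
  a / 8 - c <= bint (tube_lo l) (tube_hi l 1) g.
Proof.
move=> a0 c0 cg g0 gc; have [mS E] := tube_slices 1 cg g0.
have s0 t : 0 <= slice g t by exact: bint_ge0.
have mi (x y : R) : measurable_fun setT (fun t : RB => (\1_(`]x, y[%classic : set RB) t : R)%:E).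
  by apply/measurable_EFinP/measurable_indic; exact: measurable_itv.
rewrite lerBlDr -lee_fin EFinD E.
have -> : (c%:E = \int[mu1]_t (c%:E * (\1_(`]0%R, 1%R[%classic : set RB) t)%:E))%E.
  by rewrite indic_itv// subr0 mulr1.
rewrite -ge0_integralD//; last 4 first.
- by move=> t _; rewrite mule_ge0// lee_fin.
- exact: emeasurable_funM.
- by move=> t _; rewrite mule_ge0// lee_fin.
- exact: measurable_funeM.
(* On the upper half of the unit interval [t^2 >= 1 / 4], which gives the factor 1/8. *)
have -> : ((a / 8)%:E = \int[mu1]_t ((a / 4)%:E * (\1_(`]2^-1%R, 1%R[%classic : set RB) t)%:E))%E.
  rewrite indic_itv ?divr_ge0//; last by lra.
  by congr EFin; field.
apply: ge0_le_integral => //.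
- by move=> t _; rewrite mule_ge0// lee_fin divr_ge0.
- exact: measurable_funeM.
- by apply: emeasurable_funD; [exact: emeasurable_funM|exact: measurable_funeM].
move=> t _; rewrite -!EFinM -EFinD lee_fin !indicE !mem_setE !in_itv/=.
case: (boolP (2^-1 < t < 1)) => [/andP[t2 t1]|_]; last first.
  by rewrite mulr0 addr_ge0 ?mulr_ge0.
have t01 : 0 < t < 1 by lra.
have := gc t t01; rewrite t01 !mul1r !mulr1 => h.
have t4 : 4^-1 <= t ^+ 2 by nra.
have := ler_wpM2l a0 t4; lra.
Qed.
End tube_slices.

(** * The estimate for a fixed Carleman parameter *)

Section core_inequality.
Context {R : realType} {d : nat}.
Local Notation V := 'rV[R]_d.
Local Notation n := d.+1.
Local Notation mu := (lebesgue_rV R d).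
Hypothesis d_gt0 : (0 < d)%N.
Variables (bc : boundary_condition) (l : nat).
Hypothesis l0 : (0 < l)%N.
Local Notation L := (l%:R : R).
Local Notation Q := (cube L : set V).
Local Notation N2 := (nsq mu Q).
Variables (delta : R) (z : 'rV[int]_d -> V).
Hypothesis delta0 : 0 < delta.
Hypothesis delta2 : delta < 2^-1.
Hypothesis eqz : equidistributed 1 delta z.
Variables (W : V -> R) (u w : nat -> V -> R[i]) (K M : R).
Hypothesis mW : measurable_fun setT W.
Hypothesis WK : forall x, `|W x| <= K.
Hypothesis K0 : 0 <= K.
Hypothesis M0 : 0 <= M.
Hypothesis Lu : forall m, L2 Q (u m).
Hypothesis uw : forall m, neg_laplacian bc L (u m) (w m).
Hypothesis uS : forall m r,
  N2 (fun x => part r (u m.+1 x) - (part r (w m x) + (W x + K) * part r (u m x))) = 0.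
Hypothesis pos : forall m, 0 <= cip Q (u m) (u 0%N).
Hypothesis nrm : forall m, cip Q (u m) (u m) <= M ^+ (2 * m) * cip Q (u 0%N) (u 0%N).
Local Notation nn0 := (cip Q (u 0%N) (u 0%N)).
Local Notation Om := (equi_set delta z L).
Local Notation nnW := (cip Om (u 0%N) (u 0%N)).
Local Notation T := (4 * d%:R + 1 : R).
Local Notation mul_d := ((4 * (4 * d).+1) ^ d)%N.
Local Notation cst := (50 * two_step_cst (d := d) (36 * 37 * 36 * 10 ^+ 2 : R) ^+ 2).

Let L0 : 0 < L. Proof. by rewrite ltr0n. Qed.
Let mQ : measurable Q. Proof. exact: measurable_cube. Qed.
Let T0 : 0 <= T. Proof. by have := ler0n R d; lra. Qed.

Section one_part.
Variables (ui li : nat -> bool -> V -> R) (N : nat) (eta : R) (r : bool).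
Hypothesis N0 : (0 < N)%N.
Hypothesis trig : forall m r, trig_sum bc L (ui m r) (li m r).
Hypothesis approx : forall r t, 0 <= t <= T ->
     [/\ sqi mu Q (appF ui N r t), sqi mu Q (appL ui li N r t),
       N2 (fun x => ext u N r t x - appF ui N r t x) <= eta &
       N2 (fun x => appL ui li N r t x - (W x + K) * appF ui N r t x) <= eta].
Hypothesis approx0 : forall r, N2 (fun x => part r (u 0%N x) - ui 0%N r x) <= eta.

Definition extension (x : 'rV[R]_n) : R := appF ui N r (x 0 ord0) (rV_tail x).

Lemma extension_cons t x : extension (rV_cons (t, x)) = appF ui N r t x.
Proof. by rewrite /extension rV_cons0 rV_tail_cons. Qed.

Lemma extension_C2 : exists G H, [/\ C2 extension G H,
  forall x, lapl H x = appL ui li N r (x 0 ord0) (rV_tail x) &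
  forall x, G ord0 (rV_cons (0, x)) = ui 0%N r x].
Proof.
have [G [H [C lE gE]]] := @C2_time_sum R d N (fun m => tpow (2 * m).+1) (fun m => tpow (2 * m))
  (fun m => tpow' (2 * m)) (fun m => ui m r) (fun m => li m r) (fun m => @continuous_tpow' R (2 * m))
  (fun m t => is_derive_tpow (2 * m).+1 t) (fun m t => is_derive_tpow (2 * m) t)
  (fun m => trig_sum_C2 (trig m r)).
exists G, H; split=> // x; rewrite gE rV_cons0 rV_tail_cons.
case: N N0 => // k _; rewrite big_ord_recl big1 ?addr0.
  by rewrite /tpow muln0 expr0 (_ : 0`! = 1%N)// divr1 mul1r.
by move=> i _; rewrite /tpow expr0n/= !mul0r.
Qed.

Lemma appF_parity i s c t x : wall_move bc L s c ->
  appF ui N r t (rV_upd x i (s * x 0 i + c)) = wall_sign bc * appF ui N r t x /\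
  appL ui li N r t (rV_upd x i (s * x 0 i + c)) = wall_sign bc * appL ui li N r t x.
Proof.
move=> mv; rewrite /appF /appL !mulr_sumr; split; apply: eq_bigr => m _;
  have [e1 e2] := trig_sum_parity (trig m r) i x mv; rewrite ?e1 ?e2; ring.
Qed.

Let half_le (a y : R) : 0 <= y -> a <= y -> (a + `|a|) / 2 <= y.
Proof. by have [a0|a0] := ger0P a; lra. Qed.
Let half_ge (a : R) : a <= (a + `|a|) / 2 /\ 0 <= (a + `|a|) / 2.
Proof. by have [a0|a0] := ger0P a; split; lra. Qed.

Lemma part_estimate al : 3 <= al -> 12 * (16 * d%:R) ^+ 2 * (2 * K) ^+ 2 <= al ^+ 3 ->
  bint (tube_lo l) (tube_hi l 1) (fun x => extension x ^+ 2) <=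
   cst * (expR (1000 * (ln (512 * d%:R) + 1) * (al * - ln delta)) *
       (mul_d%:R * (T * eta) + (4 ^ d)%:R *
          (2 * nsq mu Om (fun x => part r (u 0%N x)) + 2 * eta))
     + expR (- (al / 4)) * (mul_d%:R * bint (tube_lo l) (tube_hi l T) (fun x => extension x ^+ 2))).
Proof.
move=> al3 alK; have [zc zcP] := admissible_ball l delta0 eqz.
have [G [H [CE lE gE]]] := extension_C2.
have [[cF _ _] CG _] := CE.
have cl : continuous (lapl H).
  by apply: cont_sum => i; have [_ cH _] := CG i; exact: cH.
pose a x := `|lapl H x| - 2 * K * `|extension x|.
(* The source must be continuous while [W] is only measurable. The positive part of
   [|lapl| - 2 * K * |F|] is continuous, and dominated by the true error since
   [|W + K| <= 2 * K]. *)
pose e x := (a x + `|a x|) / 2.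
have ca : continuous a.
  by apply: contB; [exact: cont_norm|apply: contM; [exact: cst_continuous|exact: cont_norm]].
have ce : continuous e.
  by apply: contM; [apply: contD => //; exact: cont_norm|exact: cst_continuous].
have e0 x : 0 <= e x := (half_ge (a x)).2.
have K20 : 0 <= 2 * K by have := K0; lra.
have Fe x : `|lapl H x| <= 2 * K * `|extension x| + e x.
  by have := (half_ge (a x)).1; rewrite -/(e x) /a; lra.
have F0 x : extension (rV_cons (0, x)) = 0.
  by rewrite extension_cons /appF big1// => m _; rewrite /tpow expr0n/= !mul0r.
have ws := wall_sign2 (R := R) bc.
have abs_ws (y : R) : `|wall_sign bc * y| = `|y|.
  by rewrite normrM (_ : `|wall_sign bc| = 1) ?mul1r// /wall_sign; case: (bc); rewrite ?normrN normr1.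
have evF t : even_at bc L (fun x => extension (rV_cons (t, x)) ^+ 2).
  move=> i s c x mv; rewrite !extension_cons (appF_parity i t x mv).1.
  by rewrite exprMn ws mul1r.
have eve t : even_at bc L (fun x => e (rV_cons (t, x)) ^+ 2).
  move=> i s c x mv; rewrite /e /a !lE !extension_cons !rV_cons0 !rV_tail_cons.
  by rewrite (appF_parity i t x mv).1 (appF_parity i t x mv).2 !abs_ws.
have := global_estimate l0 d_gt0 delta0 delta2 zcP CE F0 K20 ce e0 Fe evF eve al3 alK.
move=> h; apply: le_trans h _.
have k0 : 0 <= cst by rewrite mulr_ge0// sqr_ge0.
apply: ler_wpM2l => //; rewrite lerD2r; apply: ler_wpM2l; first exact: expR_ge0.
apply: lerD.
  apply: ler_wpM2l => //; apply: tube_le => //.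
  - apply: le_trans (approx0 r); exact: nsq_ge0.
  - exact: contX.
  - by move=> x; exact: sqr_ge0.
  move=> t /andP[t0 t1]; have tT : 0 <= t <= T by rewrite !ltW.
  have [sF sL _ h] := approx r tT; apply: le_trans h.
  have se : sqi mu Q (fun x => e (rV_cons (t, x))) by apply: sqi_continuous; exact: cont_slice2.
  have sd : sqi mu Q (fun x => appL ui li N r t x - (W x + K) * appF ui N r t x).
    apply: sqiB => //.
    have mWF : measurable_fun Q (fun x => (W x + K) * appF ui N r t x).
      apply: measurable_funM; last by have [] := sF.
      by apply: measurable_funD => //; exact: measurable_funTS.
    apply: (sqi_le mQ mWF _ (sqiZ mQ (2 * K) sF)) => x _.
    rewrite (normrM (W x + K)) (normrM (2 * K)) ler_wpM2r// (ger0_norm K20); apply: le_trans (ler_normD _ _) _.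
    by rewrite (ger0_norm K0); have := WK x; lra.
  apply: (le_nsq mQ se sd) => x _; rewrite (ger0_norm (e0 _)).
  apply: half_le => //; rewrite /a lE extension_cons rV_cons0 rV_tail_cons.
  set y := appL _ _ _ _ _ _; set f := appF _ _ _ _ _.
  have h1 : `|y| <= `|y - (W x + K) * f| + `|(W x + K) * f|.
    by rewrite -[X in `|X| <= _](subrK ((W x + K) * f)); exact: ler_normD.
  have h2 : `|(W x + K) * f| <= 2 * K * `|f|.
    rewrite normrM ler_wpM2r//; apply: le_trans (ler_normD _ _) _.
    by rewrite (ger0_norm K0); have := WK x; lra.
  lra.
apply: ler_wpM2l => //.
have mOm : measurable Om by exact: measurable_equi_set.
have OmQ : Om `<=` Q by move=> x [].
have restrict h : sqi mu Q h -> sqi mu Om h /\ nsq mu Om h <= N2 h.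
  move=> [mh ih]; have ih' := integrableS mQ mOm OmQ ih.
  split; first by split => //; exact: measurable_funS mh.
  rewrite /nsq /Rintegral fine_le//.
  - exact: integrable_fin_num.
  - exact: integrable_fin_num.
  by apply: ge0_subset_integral => //; [exact: measurable_int ih|move=> x _; rewrite lee_fin sqr_ge0].
have cu : continuous (ui 0%N r) := trig_sum_continuous (trig 0 r).
have sui : sqi mu Q (ui 0%N r) by exact: sqi_continuous.
have su : sqi mu Q (fun x => part r (u 0%N x)) := (L2_parts mQ (u 0%N)).1 (Lu 0) r.
have -> : bint (fun=> - (L / 2)) (fun=> L / 2) (fun x => \1_Om x * G ord0 (rV_cons (0, x)) ^+ 2) = nsq mu Om (ui 0%N r).
  apply: EFin_inj; rewrite (bint_indic_EFin _ _ mOm); last by apply: contX; apply: cont_slice2; have [] := CG ord0.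
  rewrite (_ : obox _ _ `&` _ = Om); last by apply/seteqP; split => [x []|x Omx]//; split => //; exact: OmQ.
  rewrite /nsq /Rintegral fineK; last by apply: integrable_fin_num => //; have [[]] := restrict _ sui.
  by apply: eq_integral => x _; rewrite gE.
have [s1 _] := restrict _ su; have [s2 _] := restrict _ sui.
have [s3 n3] := restrict _ (sqiB mQ su sui).
rewrite [X in nsq mu Om X <= _](_ : _ = fun x => part r (u 0%N x) + - (part r (u 0%N x) - ui 0%N r x)); last first.
  by apply/funext => x; ring.
apply: le_trans (nsqD_le mOm s1 (sqiN mOm s3)) _; rewrite nsqN lerD2l.
by apply: ler_wpM2l => //; exact: le_trans n3 (approx0 r).
Qed.

End one_part.

Let core_arith (a0 a1 b0 b1 x0 x1 y nn c E m t q ep eta : R) :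
  nn / 16 - 2 * eta <= a0 + a1 -> b0 + b1 <= t * (y + 4 * eta) ->
  0 <= c -> 0 <= ep -> 0 <= m ->
  a0 <= c * (E * (m * (t * eta) + q * (2 * x0 + 2 * eta)) + ep * (m * b0)) ->
  a1 <= c * (E * (m * (t * eta) + q * (2 * x1 + 2 * eta)) + ep * (m * b1)) ->
  nn / 16 - 2 * eta <= c * (E * (m * (t * (2 * eta)) + q * (2 * (x0 + x1) + 4 * eta)) + ep * (m * (t * (y + 4 * eta)))).
Proof.
move=> h1 h2 c0 e0 m0 h3 h4; apply: le_trans h1 (le_trans (lerD h3 h4) _).
rewrite -mulrDr; apply: ler_wpM2l => //.
have h5 : ep * (m * (b0 + b1)) <= ep * (m * (t * (y + 4 * eta))).
  by apply: ler_wpM2l => //; exact: ler_wpM2l.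
apply: le_trans (_ : _ <= E * (m * (t * (2 * eta)) + q * (2 * (x0 + x1) + 4 * eta)) + ep * (m * (b0 + b1))) _; last by rewrite lerD2l.
by rewrite le_eqVlt; apply/orP; left; apply/eqP; ring.
Qed.

(** The lower bound [t^2 * nn0] loses a factor 2 in the approximation by trigonometric sums and 8 in
    the time integral, whence 16. Both parts are added because the growth bounds concern the complex
    function. *)
Lemma core_estimate al eta : 3 <= al -> 12 * (16 * d%:R) ^+ 2 * (2 * K) ^+ 2 <= al ^+ 3 -> 0 < eta ->
  nn0 / 16 - 2 * eta <=
   cst * (expR (1000 * (ln (512 * d%:R) + 1) * (al * - ln delta)) *
       (mul_d%:R * (T * (2 * eta)) + (4 ^ d)%:R * (2 * nnW + 4 * eta))
     + expR (- (al / 4)) * (mul_d%:R * (T * (2 * ((T * expR (T * Num.sqrt M)) ^+ 2 * nn0) + 4 * eta)))).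
Proof.
move=> al3 alK eta0.
have [N [ui [li [N0 trig approx approx0]]]] := approximate_extension L0 mW WK K0 M0 Lu uw uS nrm T0 eta0.
have est r := part_estimate r N0 trig approx approx0 al3 alK.
have -> : nnW = nsq mu Om (fun x => part false (u 0%N x)) + nsq mu Om (fun x => part true (u 0%N x)).
  by rewrite /cip !ip_nsq.
have n0 : 0 <= nn0 by exact: cip_ge0.
have cE r : continuous (extension ui N r).
  by have [G [H [[[]]]]] := extension_C2 r N0 trig.
have cE2 r : continuous (fun x => extension ui N r x ^+ 2) by exact: contX.
pose g x := extension ui N false x ^+ 2 + extension ui N true x ^+ 2.
have cg : continuous g by exact: contD.
have g0 x : 0 <= g x by rewrite addr_ge0 ?sqr_ge0.
have bE r a c : bmf (obox a c) (fun x => extension ui N r x ^+ 2) by exact: bmf_continuous.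
have slice t : bint (fun=> - (L / 2)) (fun=> L / 2) (fun x => g (rV_cons (t, x)))
   = N2 (appF ui N false t) + N2 (appF ui N true t).
  rewrite bintD; try (by apply: bmf_continuous; exact: (cont_slice2 (f := fun x => extension ui N _ x ^+ 2))).
  by congr (_ + _); apply: eq_nsq => x _; rewrite extension_cons.
have nnE t : cip Q (extc u N t) (extc u N t) = N2 (ext u N false t) + N2 (ext u N true t).
  by rewrite /cip !ip_nsq.
have se r t : sqi mu Q (ext u N r t) by exact: ext_sqi.
apply: (core_arith _ _ _ _ _ (est false) (est true)).
- rewrite -bintD// (_ : nn0 / 16 = (nn0 / 2) / 8); last by field.
  apply: (tube_ge _ _ cg g0); [by rewrite divr_ge0|by rewrite mulr_ge0// ltW|].
  move=> t /andP[t0 t1]; rewrite slice.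
  have tT : 0 <= t <= T by rewrite ltW//=; have := ler0n R d; move: (ltW t1); lra.
  have := extc_ge Lu pos N0 (ltW t0); rewrite nnE => h.
  have le r : N2 (ext u N r t) <= 2 * N2 (appF ui N r t) + 2 * eta.
    have [sF _ e _] := approx r t tT.
    rewrite (_ : N2 (ext u N r t) = N2 (fun x => appF ui N r t x + (ext u N r t x - appF ui N r t x))); last first.
      by apply: eq_nsq => x _; ring.
    apply: le_trans (nsqD_le mQ sF (sqiB mQ (se r t) sF)) _; rewrite lerD2l.
    exact: ler_wpM2l.
  have := le false; have := le true; move: h; set p := N2 _; set q := N2 _; set p' := N2 _; set q' := N2 _.
  set y := t ^+ 2 * nn0; rewrite (_ : nn0 / 2 * t ^+ 2 = y / 2); last by rewrite /y; field.
  lra.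
- rewrite -bintD//; apply: (tube_le T0 _ cg g0).
    by rewrite addr_ge0 ?mulr_ge0 ?sqr_ge0// ltW.
  move=> t /andP[t0 t1]; rewrite slice; have tT : 0 <= t <= T by rewrite !ltW.
  have le r : N2 (appF ui N r t) <= 2 * N2 (ext u N r t) + 2 * eta.
    have [sF _ e _] := approx r t tT.
    rewrite (_ : N2 (appF ui N r t) = N2 (fun x => ext u N r t x + - (ext u N r t x - appF ui N r t x))); last first.
      by apply: eq_nsq => x _; ring.
    apply: le_trans (nsqD_le mQ (se r t) (sqiN mQ (sqiB mQ (se r t) sF))) _; rewrite lerD2l nsqN.
    exact: ler_wpM2l.
  have h := extc_le M0 Lu nrm N (ltW t0); rewrite nnE in h.
  have mono : (t * expR (t * Num.sqrt M)) ^+ 2 * nn0 <= (T * expR (T * Num.sqrt M)) ^+ 2 * nn0.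
    apply: ler_wpM2r => //; apply: lerXn2r; rewrite ?nnegrE ?mulr_ge0 ?expR_ge0 ?(ltW t0)//.
    by apply: ler_pM; rewrite ?expR_ge0 ?(ltW t0) ?(ltW t1)// ler_expR ler_wpM2r ?sqrtr_ge0// ltW.
  have := le false; have := le true; have := le_trans h mono; set p := N2 _; set q := N2 _; set p' := N2 _; set q' := N2 _.
  set y := _ * nn0; lra.
- by rewrite mulr_ge0// sqr_ge0.
- exact: expR_ge0.
- exact: ler0n.
Qed.

End core_inequality.

(** * Passage to the limit and choice of the constants *)

Section constants.
Context {R : realType}.

(** The difference of the two sides is affine in [eta] with slope [k]; a positive gap is refuted at
    half of the gap divided by [k]. *)
Lemma limit_arith (a c E m t q ep x y : R) : 0 <= c -> 0 <= E -> 0 <= m -> 0 <= t -> 0 <= q -> 0 <= ep ->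
  (forall eta, 0 < eta -> a - 2 * eta <= c * (E * (m * (t * (2 * eta)) + q * (2 * x + 4 * eta)) + ep * (m * (t * (y + 4 * eta))))) ->
  a <= c * (E * (q * (2 * x)) + ep * (m * (t * y))).
Proof.
move=> c0 E0 m0 t0 q0 ep0 H; set r := c * _.
pose k := 2 + c * (E * (m * (t * 2) + q * 4) + ep * (m * (t * 4))).
have k0 : 0 <= c * (E * (m * (t * 2) + q * 4) + ep * (m * (t * 4))).
  by rewrite !mulr_ge0 ?addr_ge0 ?mulr_ge0// addr_ge0 ?mulr_ge0.
rewrite leNgt; apply/negP => ra.
have kp : 0 < k by rewrite /k; lra.
have e0 : 0 < (a - r) / (2 * k) by rewrite divr_gt0 ?subr_gt0// mulr_gt0.
have := H _ e0; set eta := _ / _ in e0 *.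
rewrite (_ : c * _ = r + (k - 2) * eta); last by rewrite /r /k; ring.
have : k * eta = (a - r) / 2 by rewrite /eta; field; rewrite gt_eqF.
by rewrite mulrBl => h1 h2; lra.
Qed.

Lemma powR23_cube (K : R) : 0 <= K -> (K `^ (2 / 3)) ^+ 3 = K ^+ 2.
Proof.
move=> K0; rewrite -powR_mulrn ?powR_ge0// -powRrM -[RHS]powR_mulrn//; congr (_ `^ _).
by field.
Qed.

(** With [y = K^(2/3)] one has [K^2 = y^3 <= (1 + y)^4], so [K <= (1 + y)^2]: the shift by [K] costs
    nothing beyond the scale already present. *)
Lemma sqrt_le_scale (K b : R) : 0 <= K -> 0 <= b ->
  Num.sqrt (b + K) <= 1 + K `^ (2 / 3) + Num.sqrt b.
Proof.
move=> K0 b0; set y := K `^ (2 / 3); have y0 : 0 <= y by exact: powR_ge0.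
have y3 : y ^+ 3 = K ^+ 2 by exact: powR23_cube.
have s0 := sqrtr_ge0 b; have sb := sqr_sqrtr b0.
have Ky : K <= (1 + y) ^+ 2.
  rewrite -(@ler_pXn2r _ 2) ?nnegrE ?sqr_ge0// -y3 -exprM.
  apply: (@le_trans _ _ ((1 + y) ^+ 3)); first by apply: lerXn2r; rewrite ?nnegrE; lra.
  by apply: ler_weXn2l => //; lra.
have h : b + K <= (1 + y + Num.sqrt b) ^+ 2.
  have : 0 <= (1 + y) * Num.sqrt b by rewrite mulr_ge0//; lra.
  by rewrite -{1}sb; nra.
apply: le_trans (_ : Num.sqrt ((1 + y + Num.sqrt b) ^+ 2) <= _); first exact: ler_wsqrtr.
by rewrite sqrtr_sqr ger0_norm//; lra.
Qed.
End constants.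

Section final_constants.
Context {R : realType}.
Variables (d : nat) (carleman_cst : R).
Hypothesis d_gt0 : (0 < d)%N.
Hypothesis carleman_ge0 : 0 <= carleman_cst.
Local Notation T := (4 * d%:R + 1 : R).
Local Notation mul_d := ((4 * (4 * d).+1) ^ d)%N.

Definition rate_cst : R := 1000 * (ln (512 * d%:R) + 1).
Definition leak_cst : R := carleman_cst * (mul_d%:R * (T * (2 * T ^+ 2))).
(** At the damping rate 1/4, the term [8 * T] compensates the squared growth [expR (2 * T * sM)] of
    the extension and the logarithm brings the leak down to 1/32; the 3 secures [al >= 3]. *)
Definition scale_cst : R := 8 * T + 4 * ln (32 * leak_cst + 1) + 3.
Definition prefactor : R := 64 * (carleman_cst * (4 ^ d)%:R) + 1.
(** As [- ln delta >= ln 2], a constant prefactor is at most the power [ln prefactor / ln 2] of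
    [1 / delta]. *)
Definition sfuc_exponent : R := rate_cst * scale_cst + ln prefactor / ln 2.

Let D1 : 1 <= d%:R :> R. Proof. by rewrite ler1n. Qed.
Let T0 : 0 <= T. Proof. by apply: addr_ge0 => //; exact: mulr_ge0. Qed.
Let leak_ge0 : 0 <= leak_cst.
Proof.
have cc := carleman_ge0; have t0 := T0; apply: mulr_ge0 => //; apply: mulr_ge0 => //; apply: mulr_ge0 => //.
Qed.
Let ln_leak : 0 <= ln (32 * leak_cst + 1).
Proof. by have := leak_ge0 => h; apply: ln_ge0; lra. Qed.

Lemma scale_cst_ge : 8 * T + 3 <= scale_cst.
Proof. by have := ln_leak; rewrite /scale_cst; lra. Qed.

(* The tuning of the Carleman parameter: [al = C S] makes the leak term small
   in comparison with the growth [exp (2 T sqrt M)] of the extension. *)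
Lemma leak_small (S sM : R) : 1 <= S -> sM <= S ->
  leak_cst * (expR (- (scale_cst * S / 4)) * expR (T * sM) ^+ 2) <= 32^-1.
Proof.
move=> S1 sS; have D := D1; have ll := ln_leak; have lk := leak_ge0.
rewrite -expRM_natr -expRD; set ex := (_ + _).
have exle : ex <= - ln (32 * leak_cst + 1).
  rewrite /ex; have h1 : T * sM <= T * S by apply: ler_wpM2l => //; lra.
  have h2 : ln (32 * leak_cst + 1) * 1 <= ln (32 * leak_cst + 1) * S by exact: ler_wpM2l.
  rewrite /scale_cst; set X := ln _ in h2 ll *; set Y := T * S in h1.
  have -> : (8 * T + 4 * X + 3) * S / 4 = 2 * Y + X * S + 3 / 4 * S by rewrite /Y; field.
  by move: h1; set Z := T * sM => h1; lra.
have p1 : 0 < 32 * leak_cst + 1 by lra.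
apply: (@le_trans _ _ (leak_cst * (32 * leak_cst + 1)^-1)).
  by apply: ler_wpM2l => //; apply: le_trans (_ : expR (- ln (32 * leak_cst + 1)) <= _); rewrite ?ler_expR// expRN lnK.
by rewrite ler_pdivrMr//; lra.
Qed.

(** The constant is [12 * (32 d)^2 <= (32 d)^3], and [32 d <= 8 * T <= scale_cst]; the cube of
    [K^(2/3)] accounts for [K^2]. *)
Lemma scale_condition (K S : R) : 0 <= K -> 1 + K `^ (2 / 3) <= S ->
  12 * (16 * d%:R) ^+ 2 * (2 * K) ^+ 2 <= (scale_cst * S) ^+ 3.
Proof.
move=> K0 KS; have D := D1; have y3 := powR23_cube K0; have y0 := powR_ge0 K (2 / 3).
have sc := scale_cst_ge.
rewrite [leRHS]exprMn.
have S3 : K ^+ 2 <= S ^+ 3 by rewrite -y3; apply: lerXn2r; rewrite ?nnegrE; lra.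
have C3 : 12 * (16 * d%:R) ^+ 2 * 4 <= scale_cst ^+ 3.
  apply: (@le_trans _ _ ((32 * d%:R) ^+ 3)); last by apply: lerXn2r; rewrite ?nnegrE; lra.
  rewrite (_ : _ * 4 = 12 * (32 * d%:R) ^+ 2); last by ring.
  by rewrite [leRHS]exprS; apply: ler_wpM2r; [exact: sqr_ge0|lra].
rewrite (_ : _ * (2 * K) ^+ 2 = 12 * (16 * d%:R) ^+ 2 * 4 * K ^+ 2); last by ring.
apply: ler_pM; [|exact: sqr_ge0|exact: C3|exact: S3].
apply: mulr_ge0; [apply: mulr_ge0; [exact: ler0n|exact: sqr_ge0]|exact: ler0n].
Qed.

(** Half of [nn / 16] absorbs the leak; multiplying the rest by 32 gives 64. *)
Let absorb (nn X E nW : R) : nn / 16 <= 2 * X * E * nW + 32^-1 * nn -> 0 <= E * nW ->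
  nn <= (64 * X + 1) * E * nW.
Proof.
have -> : 2 * X * E * nW = 2 * (X * (E * nW)) by ring.
have -> : (64 * X + 1) * E * nW = 64 * (X * (E * nW)) + E * nW by ring.
set q := E * nW; set p := X * q => h1 h2; lra.
Qed.

Let exponent_le (p r c S lam m : R) : 0 <= p -> 0 < m -> 1 <= S -> m <= lam ->
  p + r * (c * S * lam) <= (r * c + p / m) * S * lam.
Proof.
move=> p0 m0 S1 ml.
have -> : (r * c + p / m) * S * lam = p * (S * (lam / m)) + r * (c * S * lam).
  by field; rewrite gt_eqF.
rewrite lerD2r ler_peMr// -[leLHS]mulr1; apply: ler_pM => //.
by rewrite ler_pdivlMr// mul1r.
Qed.

Lemma final_arith (S sM lam nn nW : R) : 0 <= nn -> 0 <= nW -> 1 <= S -> sM <= S -> ln 2 <= lam ->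
  nn / 16 <= carleman_cst * (expR (rate_cst * (scale_cst * S * lam)) * ((4 ^ d)%:R * (2 * nW))
     + expR (- (scale_cst * S / 4)) * (mul_d%:R * (T * (2 * ((T * expR (T * sM)) ^+ 2 * nn))))) ->
  expR (sfuc_exponent * S * - lam) * nn <= nW.
Proof.
move=> nn0 nW0 S1 sS l2 H.
have ln20 : 0 < ln (2 : R) by apply: ln_gt0; lra.
have sm := leak_small S1 sS; set E := expR (rate_cst * _) in H.
have E0 : 0 < E by exact: expR_gt0.
have H1 : nn / 16 <= 2 * (carleman_cst * (4 ^ d)%:R) * E * nW + 32^-1 * nn.
  apply: le_trans H _; rewrite mulrDr; apply: lerD.
    by rewrite le_eqVlt; apply/orP; left; apply/eqP; ring.
  apply: le_trans (ler_wpM2r nn0 sm).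
  by rewrite le_eqVlt; apply/orP; left; apply/eqP; rewrite /leak_cst exprMn; ring.
have P0 : 1 <= prefactor.
  by rewrite /prefactor lerDr; apply: mulr_ge0 => //; exact: mulr_ge0.
have H2 : nn <= prefactor * E * nW.
  by apply: absorb => //; rewrite mulr_ge0// ltW.
have lP : 0 <= ln prefactor by exact: ln_ge0.
have PE : prefactor * E <= expR (sfuc_exponent * S * lam).
  rewrite -[prefactor]lnK; last by rewrite posrE; apply: lt_le_trans P0.
  by rewrite -expRD ler_expR; exact: exponent_le.
rewrite mulrN expRN mulrC ler_pdivrMr ?expR_gt0// mulrC.
apply: le_trans H2 _; exact: ler_wpM2r.
Qed.
End final_constants.

Theorem theorem2p2 (R : realType) (d : nat) (d_gt0 : (0 < d)%N) :
  exists N : R,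
  forall (bc : boundary_condition) (delta : R), 0 < delta < 1 / 2 ->
  forall z : 'rV[int]_d -> 'rV[R]_d, equidistributed 1 delta z ->
  forall V : 'rV[R]_d -> R,
    lebesgue_measurable V -> (exists M : R, forall x, `|V x| <= M) ->
  forall L : nat, (0 < L)%N ->
  forall b : R, 0 <= b ->
  forall phi : 'rV[R]_d -> R[i],
    ran_spectral_projector (cube L%:R) (schrodinger bc L%:R V) `]-oo, b] phi ->
  ((C_sfuc N delta b (sup_norm V))%:E * normL2sq (cube L%:R) phi
     <= normL2sq (equi_set delta z L%:R) phi)%E.
Proof.
pose cc : R := 50 * two_step_cst (d := d) (36 * 37 * 36 * 10 ^+ 2 : R) ^+ 2.
have cc0 : 0 <= cc by rewrite mulr_ge0// sqr_ge0.
exists (sfuc_exponent d cc) => bc delta /andP[delta0 delta1] z eqz V mV bV L Lpos b b0 phi ranphi.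
have L0 : 0 < L%:R :> R by rewrite ltr0n.
have delta2 : delta < 2^-1 by lra.
have [K0 Lphi [W [u [w [mW WK u0 um]]]]] := low_energy_powers L0 mV bV ranphi.
set K := sup_norm V in K0 WK um *.
have Lu m : L2 (cube L%:R) (u m) by have [] := um m.
have uw m : neg_laplacian bc L%:R (u m) (w m) by have [] := um m.
have uS m r : nsq (lebesgue_rV R d) (cube L%:R)
    (fun x => part r (u m.+1 x) - (part r (w m x) + (W x + K) * part r (u m x))) = 0.
  by have [] := um m.
have pos m : 0 <= cip (cube L%:R) (u m) (u 0%N) by have [] := um m; rewrite u0.
have nrm m : cip (cube L%:R) (u m) (u m) <= (b + K) ^+ (2 * m) * cip (cube L%:R) (u 0%N) (u 0%N).
  by have [] := um m; rewrite u0.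
have M0 : 0 <= b + K by exact: addr_ge0.
set S := 1 + K `^ (2 / 3) + Num.sqrt b.
have y0 : 0 <= K `^ (2 / 3) by exact: powR_ge0.
have s0 := sqrtr_ge0 b.
have S1 : 1 <= S by rewrite /S; lra.
have sS : Num.sqrt (b + K) <= S by exact: sqrt_le_scale.
have D1 : 1 <= d%:R :> R by rewrite ler1n.
have sc := scale_cst_ge d cc0.
have C3 : 3 <= scale_cst d cc * S.
  by apply: le_trans (ler_pM _ _ _ S1 : 3 * 1 <= _); rewrite ?mulr1//; lra.
have CK : 12 * (16 * d%:R) ^+ 2 * (2 * K) ^+ 2 <= (scale_cst d cc * S) ^+ 3.
  by apply: (scale_condition d_gt0 cc0) => //; rewrite /S; lra.
have core eta eta0 := @core_estimate R d d_gt0 bc L Lpos delta z delta0 delta2 eqz W u w K (b + K)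
  mW WK K0 M0 Lu uw uS pos nrm (scale_cst d cc * S) eta C3 CK eta0.
have mW' : measurable (equi_set delta z L%:R) by exact: measurable_equi_set.
have lam2 : ln 2 <= - ln delta.
  rewrite -lnV ?posrE// ler_ln ?posrE ?invr_gt0//.
  by rewrite -[leLHS]invrK lef_pV2 ?posrE ?invr_gt0// ltW.
have T0 : 0 <= 4 * d%:R + 1 :> R by lra.
have LW : L2 (equi_set delta z L%:R) phi.
  have mQ : measurable (cube L%:R : set 'rV[R]_d) by exact: measurable_cube.
  apply/(L2_parts mW') => r; have [mp ip] := (L2_parts mQ phi).1 Lphi r.
  have sub : equi_set delta z L%:R `<=` cube L%:R by move=> x [].
  by split; [exact: measurable_funS mp|exact: integrableS ip].
rewrite (normL2sq_cip _ Lphi) ?(normL2sq_cip mW' LW); last exact: measurable_cube.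
rewrite -EFinM lee_fin /C_sfuc /powR gt_eqF// -/S.
rewrite -[ln delta]opprK; apply: (final_arith d_gt0 cc0 _ _ S1 sS lam2); rewrite ?cip_ge0//.
rewrite -u0; exact: (limit_arith cc0 (expR_ge0 _) (ler0n _ _) T0 (ler0n _ _) (expR_ge0 _) core).
Qed.
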